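(* Let $B=(B_{ij})_{i,j=0}^2$ be polynomial parameters of a 011-PI operator $\mathcal B=\mathcal P[B]:\mathbb R^{4n_1+16n_2}\times L_2^{2n_1+4n_2}[a,b]\times L_2^{2n_1+4n_2}[c,d]\to\mathbb R^{n_1+4n_2}\times L_2^{n_1+2n_2}[a,b]\times L_2^{n_1+2n_2}[c,d]$, where $B_{11}=\{B_{11}^0,B_{11}^1,B_{11}^1\}$ and $B_{22}=\{B_{22}^0,B_{22}^1,B_{22}^1\}$ are separable, and such that $\mathcal B$ defines a set of well-posed boundary conditions $\mathcal B\Lambda_{\mathrm{bf}}u=0$, i.e. $\mathcal B\mathcal H_1$ is invertible with inverse a 011-PI operator $\mathcal P[\hat E]$. Let $\mathcal T=\mathcal P[T]$ be the 2D-PI operator with the explicit parameters $T$ given in the context. Then for any $u\in X(\mathcal B)$ and any $\hat u\in L_2^{n_0+n_1+n_2}([a,b]\times[c,d])$, $$u=\mathcal T\mathcal Du\qquad\text{and}\qquad\hat u=\mathcal D\mathcal T\hat u.$$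
   Context: $a<b$, $c<d$; $L_2,H_k$ are over $[a,b]\times[c,d]$ with $H_k^m=\{u:\partial_x^{\alpha_1}\partial_y^{\alpha_2}u\in L_2^m\ \forall\,\max(\alpha_1,\alpha_2)\le k\}$ (weak derivatives, boundary values as traces). $\mathcal D(u_0,u_1,u_2)=(u_0,\partial_x\partial_yu_1,\partial_x^2\partial_y^2u_2)$. 011-PI operators: $\mathcal P[B]$ with separable $B_{11},B_{22}$ maps $(w_0,w_1,w_2)$ to $\big(B_{00}w_0+\int_a^bB_{01}(x)w_1(x)dx+\int_c^dB_{02}(y)w_2(y)dy$, $\ B_{10}(x)w_0+B_{11}^0(x)w_1(x)+\int_a^bB_{11}^1(x,\theta)w_1(\theta)d\theta+\int_c^dB_{12}(x,y)w_2(y)dy$, $\ B_{20}(y)w_0+\int_a^bB_{21}(x,y)w_1(x)dx+B_{22}^0(y)w_2(y)+\int_c^dB_{22}^1(y,\nu)w_2(\nu)d\nu\big)$. Boundary values: for $u=(u_0,u_1,u_2)$, with $\Lambda_1f=(f(a,c),f(b,c),f(a,d),f(b,d))$, $(\Lambda_2f)(x)=(f(x,c),f(x,d))$, $(\Lambda_3f)(y)=(f(a,y),f(b,y))$, $\Lambda_{\mathrm{bf}}u=\big((\Lambda_1u_1,\Lambda_1u_2,\Lambda_1\partial_xu_2,\Lambda_1\partial_yu_2,\Lambda_1\partial_x\partial_yu_2),\ (\Lambda_2\partial_xu_1,\Lambda_2\partial_x^2u_2,\Lambda_2\partial_x^2\partial_yu_2),\ (\Lambda_3\partial_yu_1,\Lambda_3\partial_y^2u_2,\Lambda_3\partial_x\partial_y^2u_2)\big)$.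 $X(\mathcal B)=\{u\in L_2^{n_0}\times H_1^{n_1}\times H_2^{n_2}:\mathcal B\Lambda_{\mathrm{bf}}u=0\}$. Matrices $H$: column-vector entries in the first block row are read as (vector)$\otimes I_{n_1}$, in the other block rows as (vector)$\otimes I_{n_2}$. With $e=(1,1,1,1)^T$, $p=(0,b-a,0,b-a)^T$, $g'=(0,0,d-c,d-c)^T$, $m=(0,0,0,(d-c)(b-a))^T$, $f=(0,1,0,1)^T$, $f_d=(0,0,0,d-c)^T$, $g=(0,0,1,1)^T$, $g_b=(0,0,0,b-a)^T$, $h=(0,0,0,1)^T$, $s=(1,1)^T$, $t=(0,1)^T$: $$H_{00}=\begin{bmatrix}e&0&0&0&0\\0&e&p&g'&m\\0&0&e&0&g'\\0&0&0&e&p\\0&0&0&0&e\end{bmatrix},\ H_{01}(x)=\begin{bmatrix}f&0&0\\0&(b-x)f&(b-x)f_d\\0&f&f_d\\0&0&(b-x)f\\0&0&f\end{bmatrix},\ H_{02}(y)=\begin{bmatrix}g&0&0\\0&(d-y)g&(d-y)g_b\\0&0&(d-y)g\\0&g&g_b\\0&0&g\end{bmatrix},$$ $$H_{03}(x,y)=\begin{bmatrix}0&h&0\\0&0&(d-y)(b-x)h\\0&0&(d-y)h\\0&0&(b-x)h\\0&0&h\end{bmatrix},\quad H_{11}=\begin{bmatrix}s&0&0\\0&s&(d-c)t\\0&0&s\end{bmatrix},\quad H_{22}=\begin{bmatrix}s&0&0\\0&s&(b-a)t\\0&0&s\end{bmatrix},$$ $$H_{13}(y)=\begin{bmatrix}0&t&0\\0&0&(d-y)t\\0&0&t\end{bmatrix},\quad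 H_{23}(x)=\begin{bmatrix}0&t&0\\0&0&(b-x)t\\0&0&t\end{bmatrix}.$$ Column block widths: $n_1,n_2,n_2,n_2,n_2$ for $H_{00}$; $n_1,n_2,n_2$ for $H_{01},H_{02},H_{11},H_{22}$; $n_0,n_1,n_2$ for $H_{03},H_{13},H_{23}$. $\mathcal H_1$ is the operator $\mathcal H_1(v_0,v_1,v_2)=(H_{00}v_0+\int_a^bH_{01}v_1dx+\int_c^dH_{02}v_2dy,\ H_{11}v_1,\ H_{22}v_2)$ on $\mathbb R^{n_1+4n_2}\times L_2^{n_1+2n_2}[a,b]\times L_2^{n_1+2n_2}[c,d]$. Matrices $K$ (block rows of sizes $n_0,n_1,n_2$; scalars in the last row multiply $I_{n_2}$): $$K_{30}=\begin{bmatrix}0&0&0&0&0\\ I_{n_1}&0&0&0&0\\0&I_{n_2}&(x-a)&(y-c)&(y-c)(x-a)\end{bmatrix},\quad K_{31}(x,y,\theta)=\begin{bmatrix}0&0&0\\ I_{n_1}&0&0\\0&(x-\theta)&(y-c)(x-\theta)\end{bmatrix},$$ $$K_{32}(x,y,\nu)=\begin{bmatrix}0&0&0\\ I_{n_1}&0&0\\0&(y-\nu)&(x-a)(y-\nu)\end{bmatrix},\quad K_{33}(x,y,\theta,\nu)=\begin{bmatrix}0&0&0\\0&I_{n_1}&0\\0&0&(x-\theta)(y-\nu)\end{bmatrix}.$$ Parameters $E$ of $\mathcal B\mathcal H_1=\mathcal P[E]$: $E_{00}=B_{00}H_{00}$; $E_{01}(x)=B_{00}H_{01}(x)+B_{01}(x)H_{11}$;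 $E_{02}(y)=B_{00}H_{02}(y)+B_{02}(y)H_{22}$; $E_{10}(x)=B_{10}(x)H_{00}$; $E_{20}(y)=B_{20}(y)H_{00}$; $E_{11}^0=B_{11}^0H_{11}$; $E_{22}^0=B_{22}^0H_{22}$; $E_{11}^1(x,\theta)=B_{10}(x)H_{01}(\theta)+B_{11}^1(x,\theta)H_{11}$; $E_{22}^1(y,\nu)=B_{20}(y)H_{02}(\nu)+B_{22}^1(y,\nu)H_{22}$; $E_{12}(x,y)=B_{10}(x)H_{02}(y)+B_{12}(x,y)H_{22}$; $E_{21}(x,y)=B_{20}(y)H_{01}(x)+B_{21}(x,y)H_{11}$. $\hat E$ (with $\hat E_{11}=\{\hat E_{11}^0,\hat E_{11}^1,\hat E_{11}^1\}$, $\hat E_{22}=\{\hat E_{22}^0,\hat E_{22}^1,\hat E_{22}^1\}$, square-integrable entries) are the parameters with $\mathcal P[\hat E]=\mathcal P[E]^{-1}$. Parameters $F$: $F_0(x,y)=B_{00}H_{03}(x,y)+B_{01}(x)H_{13}(y)+B_{02}(y)H_{23}(x)$; $F_1^0(x,y)=B_{11}^0(x)H_{13}(y)$; $F_1^1(x,y,\theta)=B_{10}(x)H_{03}(\theta,y)+B_{11}^1(x,\theta)H_{13}(y)+B_{12}(x,y)H_{23}(\theta)$; $F_2^0(x,y)=B_{22}^0(y)H_{23}(x)$; $F_2^1(x,y,\nu)=B_{20}(y)H_{03}(x,\nu)+B_{22}^1(y,\nu)H_{23}(x)+B_{21}(x,y)H_{13}(\nu)$. Parameters $G$: $G_0(x,y)=\hat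 E_{00}F_0(x,y)+\hat E_{01}(x)F_1^0(x,y)+\int_a^b\hat E_{01}(\theta)F_1^1(\theta,y,x)d\theta+\hat E_{02}(y)F_2^0(x,y)+\int_c^d\hat E_{02}(\nu)F_2^1(x,\nu,y)d\nu$; $G_1^0(x,y)=\hat E_{11}^0(x)F_1^0(x,y)$, $G_2^0(x,y)=\hat E_{22}^0(y)F_2^0(x,y)$; $G_1^1(x,y,\theta)=\hat E_{10}(x)F_0(\theta,y)+\hat E_{11}^0(x)F_1^1(x,y,\theta)+\hat E_{11}^1(x,\theta)F_1^0(\theta,y)+\int_a^b\hat E_{11}^1(x,\eta)F_1^1(\eta,y,\theta)d\eta+\hat E_{12}(x,y)F_2^0(\theta,y)+\int_c^d\hat E_{12}(x,\nu)F_2^1(\theta,\nu,y)d\nu$; $G_2^1(x,y,\nu)=\hat E_{20}(y)F_0(x,\nu)+\hat E_{22}^0(y)F_2^1(x,y,\nu)+\hat E_{22}^1(y,\nu)F_2^0(x,\nu)+\int_c^d\hat E_{22}^1(y,\mu)F_2^1(x,\mu,\nu)d\mu+\hat E_{21}(x,y)F_1^0(x,\nu)+\int_a^b\hat E_{21}(\theta,y)F_1^1(\theta,\nu,x)d\theta$. Parameters $T$: $T_{00}=\mathrm{diag}(I_{n_0},0_{n_1},0_{n_2})$, $T_{22}(x,y,\theta,\nu)=-K_{30}(x,y)G_0(\theta,\nu)-\int_a^xK_{31}(x,y,\eta)G_1^1(\eta,\nu,\theta)d\eta-\int_c^yK_{32}(x,y,\mu)G_2^1(\theta,\mu,\nu)d\mu$,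 $T_{12}(x,y,\theta,\nu)=-K_{31}(x,y,\theta)G_1^0(\theta,\nu)+T_{22}(x,y,\theta,\nu)$, $T_{21}(x,y,\theta,\nu)=-K_{32}(x,y,\nu)G_2^0(\theta,\nu)+T_{22}(x,y,\theta,\nu)$, $T_{11}=K_{33}+T_{21}+T_{12}-T_{22}$, and $$(\mathcal T\hat u)(x,y)=T_{00}\hat u(x,y)+\int_a^x\!\!\int_c^yT_{11}\hat u\,d\nu d\theta+\int_x^b\!\!\int_c^yT_{21}\hat u\,d\nu d\theta+\int_a^x\!\!\int_y^dT_{12}\hat u\,d\nu d\theta+\int_x^b\!\!\int_y^dT_{22}\hat u\,d\nu d\theta,$$ where $T_{ij}=T_{ij}(x,y,\theta,\nu)$ and $\hat u=\hat u(\theta,\nu)$ in the integrals. *)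

(* Defs.v *)
From HB Require Import structures.
From mathcomp Require Export all_boot all_order all_algebra.
From mathcomp Require Export all_classical all_reals all_analysis.
Set Implicit Arguments.
Unset Strict Implicit.
Unset Printing Implicit Defensive.
Import Order.TTheory GRing.Theory Num.Theory.
Import numFieldNormedType.Exports.

Local Open Scope classical_set_scope.
Local Open Scope ring_scope.

(* Elements of L_2 are represented by (Borel) measurable functions; equality of
   L_2 elements is always rendered by equality almost everywhere. *)
Section L2.
Context d (T : measurableType d) (R : realType).
Variable mu : {measure set T -> \bar R}.

Definition L2 (D : set T) (f : T -> R) : Prop :=
  measurable_fun D f /\ mu.-integrable D (fun t => ((f t) ^+ 2)%:E).

Definition L2mx p q (D : set T) (F : T -> 'M[R]_(p, q)) : Prop :=
  forall i j, L2 D (fun t => F t i j).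

Definition mxint p q (D : set T) (F : T -> 'M[R]_(p, q)) : 'M[R]_(p, q) :=
  \matrix_(i, j) \int[mu]_(t in D) F t i j.
End L2.

Notation mu1 R := (@lebesgue_measure R).
Notation mu2 R := (@lebesgue_measure R \x @lebesgue_measure R)%E.

Notation "'\mint_' ( t 'in' D ) F" := (mxint (mu1 _) D (fun t => F))
  (at level 36, t name, D at level 50, F at level 36,
   format "'\mint_' ( t  'in'  D )  F") : ring_scope.

Section Sobolev.
Variables (R : realType) (a b c d : R).

Definition rect : set (R * R) := `[a, b] `*` `[c, d].

Definition pdx (phi : R * R -> R) : R * R -> R :=
  fun z => derive1 (fun t : R => phi (t, z.2)) z.1.
Definition pdy (phi : R * R -> R) : R * R -> R :=
  fun z => derive1 (fun t : R => phi (z.1, t)) z.2.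

(* C^oo: partial derivatives of all orders, taken in any order, exist and are
   continuous. *)
Definition smooth (phi : R * R -> R) : Prop :=
  forall s : seq bool,
    let psi := foldr (fun e : bool => if e then pdx else pdy) phi s in
    continuous psi /\
    forall x y : R, derivable (fun t : R => psi (t, y)) x 1 /\
                    derivable (fun t : R => psi (x, t)) y 1.

(* The closure of a bounded set is compact, so these are the C^oo functions
   with compact support in the open rectangle. *)
Definition test_function (phi : R * R -> R) : Prop :=
  smooth phi /\ closure [set z | phi z != 0] `<=` `]a, b[ `*` `]c, d[.

Definition is_weak_derivative (i j : nat) (f g : R * R -> R) : Prop :=
  forall phi, test_function phi ->
    \int[mu2 R]_(z in rect) (f z * iter i pdx (iter j pdy phi) z) =
    (-1) ^+ (i + j) * \int[mu2 R]_(z in rect) (g z * phi z).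

Definition has_wderiv (i j : nat) (f : R * R -> R) : Prop :=
  exists g, L2 (mu2 R) rect g /\ is_weak_derivative i j f g.

(* The weak derivative, unique almost everywhere when it exists in L_2
   (0 by convention otherwise). *)
Definition wderiv0 (i j : nat) (f : R * R -> R) : R * R -> R :=
  xget (fun=> 0) [set g | L2 (mu2 R) rect g /\ is_weak_derivative i j f g].

Definition wderiv (i j n : nat) (f : R * R -> 'cV[R]_n) : R * R -> 'cV[R]_n :=
  fun z => \col_k wderiv0 i j (fun z => f z k 0) z.

Definition in_L2 n (f : R * R -> 'cV[R]_n) : Prop := L2mx (mu2 R) rect f.

Definition in_H (k n : nat) (f : R * R -> 'cV[R]_n) : Prop :=
  in_L2 f /\
  forall i j, (maxn i j <= k)%N -> forall l, has_wderiv i j (fun z => f z l 0).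

(* Traces. On a side of the rectangle, the trace h of f is the L_2 function for
   which the mean of |f - h|^2 over the strip of width e along that side tends
   to 0 with e; at a corner it is the number v for which the mean of |f - v|^2
   over the square of width e at that corner tends to 0. They do not depend on
   the representative of f, are unique (almost everywhere on sides), and are the
   restrictions of f when f is continuous on the closed rectangle. Side traces
   exist when f and its weak derivative transversal to the side are in L_2,
   corner traces when f is in H_1. *)
Definition is_trace_y (y0 : R) (f : R * R -> R) (h : R -> R) : Prop :=
  L2 (mu1 R) `[a, b] h /\
  (fun e : R => e^-1 *
     \int[mu2 R]_(z in rect `&` [set z | `|z.2 - y0| <= e]) (f z - h z.1) ^+ 2)
    @ 0^'+ --> (0 : R).

Definition is_trace_x (x0 : R) (f : R * R -> R) (h : R -> R) : Prop :=
  L2 (mu1 R) `[c, d] h /\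
  (fun e : R => e^-1 *
     \int[mu2 R]_(z in rect `&` [set z | `|z.1 - x0| <= e]) (f z - h z.2) ^+ 2)
    @ 0^'+ --> (0 : R).

Definition is_trace_xy (x0 y0 : R) (f : R * R -> R) (v : R) : Prop :=
  (fun e : R => e ^- 2 *
     \int[mu2 R]_(z in rect `&` [set z | `|z.1 - x0| <= e /\ `|z.2 - y0| <= e])
       (f z - v) ^+ 2)
    @ 0^'+ --> (0 : R).

Definition trace_y n (y0 : R) (f : R * R -> 'cV[R]_n) : R -> 'cV[R]_n :=
  fun x => \col_k xget (fun=> 0) (is_trace_y y0 (fun z => f z k 0)) x.
Definition trace_x n (x0 : R) (f : R * R -> 'cV[R]_n) : R -> 'cV[R]_n :=
  fun y => \col_k xget (fun=> 0) (is_trace_x x0 (fun z => f z k 0)) y.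
Definition trace_xy n (x0 y0 : R) (f : R * R -> 'cV[R]_n) : 'cV[R]_n :=
  \col_k xget 0 (is_trace_xy x0 y0 (fun z => f z k 0)).

End Sobolev.

Section Blocks.
Variable R : realType.

Definition col2 p1 p2 q (A1 : 'M[R]_(p1, q)) (A2 : 'M[R]_(p2, q)) :=
  col_mx A1 A2.
Definition col3 p1 p2 p3 q (A1 : 'M[R]_(p1, q)) (A2 : 'M[R]_(p2, q))
    (A3 : 'M[R]_(p3, q)) := col_mx A1 (col2 A2 A3).
Definition col4 p1 p2 p3 p4 q (A1 : 'M[R]_(p1, q)) (A2 : 'M[R]_(p2, q))
    (A3 : 'M[R]_(p3, q)) (A4 : 'M[R]_(p4, q)) := col_mx A1 (col3 A2 A3 A4).
Definition col5 p1 p2 p3 p4 p5 q (A1 : 'M[R]_(p1, q)) (A2 : 'M[R]_(p2, q))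
    (A3 : 'M[R]_(p3, q)) (A4 : 'M[R]_(p4, q)) (A5 : 'M[R]_(p5, q)) :=
  col_mx A1 (col4 A2 A3 A4 A5).
Definition row3 p q1 q2 q3 (A1 : 'M[R]_(p, q1)) (A2 : 'M[R]_(p, q2))
    (A3 : 'M[R]_(p, q3)) := row_mx A1 (row_mx A2 A3).
Definition row5 p q1 q2 q3 q4 q5 (A1 : 'M[R]_(p, q1)) (A2 : 'M[R]_(p, q2))
    (A3 : 'M[R]_(p, q3)) (A4 : 'M[R]_(p, q4)) (A5 : 'M[R]_(p, q5)) :=
  row_mx A1 (row_mx A2 (row3 A3 A4 A5)).

(* (k1, k2)^T \otimes I_n and (k1, k2, k3, k4)^T \otimes I_n *)
Definition kron2 n (k1 k2 : R) : 'M[R]_(n + n, n) := col2 k1%:M k2%:M.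
Definition kron4 n (k1 k2 k3 k4 : R) : 'M[R]_(n + (n + (n + n)), n) :=
  col4 k1%:M k2%:M k3%:M k4%:M.
End Blocks.

Notation quad n := (n + (n + (n + n)))%N.

(* Full boundary values, sizes 4 n1 + 16 n2 and 2 n1 + 4 n2. *)
Notation bf0 n1 n2 := (quad n1 + (quad n2 + (quad n2 + (quad n2 + quad n2))))%N.
Notation bf1 n1 n2 := ((n1 + n1) + ((n2 + n2) + (n2 + n2)))%N.
(* Core boundary values, sizes n1 + 4 n2 and n1 + 2 n2. *)
Notation bc0 n1 n2 := (n1 + (n2 + (n2 + (n2 + n2))))%N.
Notation bc1 n1 n2 := (n1 + (n2 + n2))%N.
Notation nst n0 n1 n2 := (n0 + (n1 + n2))%N (only parsing).

(* Parameters of a 011-PI operator with separable 11- and 22-blocks, i.e.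
   B_11 = {B11_0, B11_1, B11_1} and B_22 = {B22_0, B22_1, B22_1}. Kernels are
   written in the order of arguments B12 x y, B21 x y, B11_1 x theta,
   B22_1 y nu. *)
Record PI011 (R : realType) (m0 m1 m2 p0 p1 p2 : nat) := MkPI011 {
  P00   : 'M[R]_(p0, m0);
  P01   : R -> 'M[R]_(p0, m1);
  P02   : R -> 'M[R]_(p0, m2);
  P10   : R -> 'M[R]_(p1, m0);
  P11_0 : R -> 'M[R]_(p1, m1);
  P11_1 : R -> R -> 'M[R]_(p1, m1);
  P12   : R -> R -> 'M[R]_(p1, m2);
  P20   : R -> 'M[R]_(p2, m0);
  P21   : R -> R -> 'M[R]_(p2, m1);
  P22_0 : R -> 'M[R]_(p2, m2);
  P22_1 : R -> R -> 'M[R]_(p2, m2) }.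

(* R^m0 x L_2^m1[a,b] x L_2^m2[c,d] *)
Notation rl2 R m0 m1 m2 :=
  ('cV[R]_m0 * (R -> 'cV[R]_m1) * (R -> 'cV[R]_m2))%type.

Section PI.
Variables (R : realType) (a b c d : R).

Definition in_rl2 m0 m1 m2 (w : rl2 R m0 m1 m2) : Prop :=
  L2mx (mu1 R) `[a, b] w.1.2 /\ L2mx (mu1 R) `[c, d] w.2.

Definition rl2_eq m0 m1 m2 (v w : rl2 R m0 m1 m2) : Prop :=
  [/\ v.1.1 = w.1.1,
      v.1.2 = w.1.2 %[ae mu1 R in `[a, b]%classic] &
      v.2 = w.2 %[ae mu1 R in `[c, d]%classic]].

Definition rl2_zero m0 m1 m2 : rl2 R m0 m1 m2 := (0, fun=> 0, fun=> 0).

Section Operator.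
Variables (m0 m1 m2 p0 p1 p2 : nat) (B : PI011 R m0 m1 m2 p0 p1 p2).

Definition pi011 (w : rl2 R m0 m1 m2) : rl2 R p0 p1 p2 :=
  let: (w0, w1, w2) := w in
  ( P00 B *m w0 + \mint_(x in `[a, b]) (P01 B x *m w1 x)
      + \mint_(y in `[c, d]) (P02 B y *m w2 y),
    fun x => P10 B x *m w0 + P11_0 B x *m w1 x
      + \mint_(t in `[a, b]) (P11_1 B x t *m w1 t)
      + \mint_(y in `[c, d]) (P12 B x y *m w2 y),
    fun y => P20 B y *m w0 + \mint_(x in `[a, b]) (P21 B x y *m w1 x)
      + P22_0 B y *m w2 y
      + \mint_(v in `[c, d]) (P22_1 B y v *m w2 v) ).

Definition polymx1 p q (M : R -> 'M[R]_(p, q)) : Prop :=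
  exists P : 'M[{poly R}]_(p, q), forall x, M x = \matrix_(i, j) (P i j).[x].
Definition polymx2 p q (M : R -> R -> 'M[R]_(p, q)) : Prop :=
  exists P : 'M[{poly {poly R}}]_(p, q),
    forall x y, M x y = \matrix_(i, j) (P i j).[x, y].

Definition polynomial_parameters : Prop :=
  [/\ [/\ polymx1 (P01 B), polymx1 (P02 B), polymx1 (P10 B) &
          polymx1 (P20 B)],
      [/\ polymx1 (P11_0 B), polymx1 (P22_0 B), polymx2 (P11_1 B) &
          polymx2 (P22_1 B)] &
      polymx2 (P12 B) /\ polymx2 (P21 B)].

Definition square_integrable_parameters : Prop :=
  [/\ [/\ L2mx (mu1 R) `[a, b] (P01 B), L2mx (mu1 R) `[c, d] (P02 B),
          L2mx (mu1 R) `[a, b] (P10 B) & L2mx (mu1 R) `[c, d] (P20 B)],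
      [/\ L2mx (mu1 R) `[a, b] (P11_0 B), L2mx (mu1 R) `[c, d] (P22_0 B),
          L2mx (mu2 R) (`[a, b] `*` `[a, b]) (fun z => P11_1 B z.1 z.2) &
          L2mx (mu2 R) (`[c, d] `*` `[c, d]) (fun z => P22_1 B z.1 z.2)] &
      L2mx (mu2 R) (`[a, b] `*` `[c, d]) (fun z => P12 B z.1 z.2) /\
      L2mx (mu2 R) (`[a, b] `*` `[c, d]) (fun z => P21 B z.1 z.2)].

End Operator.

(* A and A' map L_2 to L_2 and are mutually inverse there. *)
Definition mutually_inverse m0 m1 m2 p0 p1 p2
    (A : rl2 R m0 m1 m2 -> rl2 R p0 p1 p2)
    (A' : rl2 R p0 p1 p2 -> rl2 R m0 m1 m2) : Prop :=
  [/\ forall v, in_rl2 v -> in_rl2 (A v),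
      forall w, in_rl2 w -> in_rl2 (A' w),
      forall v, in_rl2 v -> rl2_eq (A' (A v)) v &
      forall w, in_rl2 w -> rl2_eq (A (A' w)) w].

End PI.

Section BoundaryValues.
Variables (R : realType) (a b c d : R) (n0 n1 n2 : nat).

Definition Lambda1 n (f : R * R -> 'cV[R]_n) : 'cV[R]_(quad n) :=
  col4 (trace_xy a b c d a c f) (trace_xy a b c d b c f)
       (trace_xy a b c d a d f) (trace_xy a b c d b d f).
Definition Lambda2 n (f : R * R -> 'cV[R]_n) : R -> 'cV[R]_(n + n) :=
  fun x => col2 (trace_y a b c d c f x) (trace_y a b c d d f x).
Definition Lambda3 n (f : R * R -> 'cV[R]_n) : R -> 'cV[R]_(n + n) :=
  fun y => col2 (trace_x a b c d a f y) (trace_x a b c d b f y).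

Local Notation state := (R * R -> 'cV[R]_(nst n0 n1 n2)).

Definition comp0 (u : state) : R * R -> 'cV[R]_n0 := fun z => usubmx (u z).
Definition comp1 (u : state) : R * R -> 'cV[R]_n1 :=
  fun z => usubmx (dsubmx (u z)).
Definition comp2 (u : state) : R * R -> 'cV[R]_n2 :=
  fun z => dsubmx (dsubmx (u z)).

Local Notation "'\wd_' ( i , j ) f" := (wderiv a b c d i j f)
  (at level 9, f at level 9).

Definition Lambda_bf (u : state) : rl2 R (bf0 n1 n2) (bf1 n1 n2) (bf1 n1 n2) :=
  let u1 := comp1 u in let u2 := comp2 u in
  ( col5 (Lambda1 u1) (Lambda1 u2) (Lambda1 \wd_(1, 0) u2)
         (Lambda1 \wd_(0, 1) u2) (Lambda1 \wd_(1, 1) u2),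
    fun x => col3 (Lambda2 \wd_(1, 0) u1 x) (Lambda2 \wd_(2, 0) u2 x)
                  (Lambda2 \wd_(2, 1) u2 x),
    fun y => col3 (Lambda3 \wd_(0, 1) u1 y) (Lambda3 \wd_(0, 2) u2 y)
                  (Lambda3 \wd_(1, 2) u2 y) ).

(* L_2^n0 x H_1^n1 x H_2^n2, the domain of the differential operator Dop. *)
Definition in_L2H1H2 (u : state) : Prop :=
  [/\ in_L2 a b c d (comp0 u), in_H a b c d 1 (comp1 u) &
      in_H a b c d 2 (comp2 u)].

Definition Dop (u : state) : state :=
  fun z => col3 (comp0 u z) (\wd_(1, 1) (comp1 u) z) (\wd_(2, 2) (comp2 u) z).

Definition in_X (B : PI011 R (bf0 n1 n2) (bf1 n1 n2) (bf1 n1 n2)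
                             (bc0 n1 n2) (bc1 n1 n2) (bc1 n1 n2))
    (u : state) : Prop :=
  in_L2H1H2 u /\
  rl2_eq a b c d (pi011 a b c d B (Lambda_bf u)) (rl2_zero R _ _ _).

End BoundaryValues.

Section MatricesHK.
Variables (R : realType) (a b c d : R) (n0 n1 n2 : nat).

Let e n : 'M[R]_(quad n, n) := kron4 n 1 1 1 1.
Let p n : 'M[R]_(quad n, n) := kron4 n 0 (b - a) 0 (b - a).
Let g' n : 'M[R]_(quad n, n) := kron4 n 0 0 (d - c) (d - c).
Let m n : 'M[R]_(quad n, n) := kron4 n 0 0 0 ((d - c) * (b - a)).
Let f n : 'M[R]_(quad n, n) := kron4 n 0 1 0 1.
Let f_d n : 'M[R]_(quad n, n) := kron4 n 0 0 0 (d - c).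
Let g n : 'M[R]_(quad n, n) := kron4 n 0 0 1 1.
Let g_b n : 'M[R]_(quad n, n) := kron4 n 0 0 0 (b - a).
Let h n : 'M[R]_(quad n, n) := kron4 n 0 0 0 1.
Let s n : 'M[R]_(n + n, n) := kron2 n 1 1.
Let t n : 'M[R]_(n + n, n) := kron2 n 0 1.

Definition H00 : 'M[R]_(bf0 n1 n2, bc0 n1 n2) :=
  col5 (row5 (e n1) 0      0      0       0)
       (row5 0      (e n2) (p n2) (g' n2) (m n2))
       (row5 0      0      (e n2) 0       (g' n2))
       (row5 0      0      0      (e n2)  (p n2))
       (row5 0      0      0      0       (e n2)).

Definition H01 (x : R) : 'M[R]_(bf0 n1 n2, bc1 n1 n2) :=
  col5 (row3 (f n1) 0                   0)
       (row3 0      ((b - x) *: f n2)   ((b - x) *: f_d n2))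
       (row3 0      (f n2)              (f_d n2))
       (row3 0      0                   ((b - x) *: f n2))
       (row3 0      0                   (f n2)).

Definition H02 (y : R) : 'M[R]_(bf0 n1 n2, bc1 n1 n2) :=
  col5 (row3 (g n1) 0                   0)
       (row3 0      ((d - y) *: g n2)   ((d - y) *: g_b n2))
       (row3 0      0                   ((d - y) *: g n2))
       (row3 0      (g n2)              (g_b n2))
       (row3 0      0                   (g n2)).

Definition H03 (x y : R) : 'M[R]_(bf0 n1 n2, nst n0 n1 n2) :=
  col5 (row3 0      (h n1) 0)
       (row3 0      0      (((d - y) * (b - x)) *: h n2))
       (row3 0      0      ((d - y) *: h n2))
       (row3 0      0      ((b - x) *: h n2))
       (row3 0      0      (h n2)).

Definition H11 : 'M[R]_(bf1 n1 n2, bc1 n1 n2) :=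
  col3 (row3 (s n1) 0      0)
       (row3 0      (s n2) ((d - c) *: t n2))
       (row3 0      0      (s n2)).

Definition H22 : 'M[R]_(bf1 n1 n2, bc1 n1 n2) :=
  col3 (row3 (s n1) 0      0)
       (row3 0      (s n2) ((b - a) *: t n2))
       (row3 0      0      (s n2)).

Definition H13 (y : R) : 'M[R]_(bf1 n1 n2, nst n0 n1 n2) :=
  col3 (row3 0      (t n1) 0)
       (row3 0      0      ((d - y) *: t n2))
       (row3 0      0      (t n2)).

Definition H23 (x : R) : 'M[R]_(bf1 n1 n2, nst n0 n1 n2) :=
  col3 (row3 0      (t n1) 0)
       (row3 0      0      ((b - x) *: t n2))
       (row3 0      0      (t n2)).

Definition H1op (v : rl2 R (bc0 n1 n2) (bc1 n1 n2) (bc1 n1 n2)) :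
    rl2 R (bf0 n1 n2) (bf1 n1 n2) (bf1 n1 n2) :=
  let: (v0, v1, v2) := v in
  ( H00 *m v0 + \mint_(x in `[a, b]) (H01 x *m v1 x)
      + \mint_(y in `[c, d]) (H02 y *m v2 y),
    fun x => H11 *m v1 x,
    fun y => H22 *m v2 y ).

Definition K30 (x y : R) : 'M[R]_(nst n0 n1 n2, bc0 n1 n2) :=
  col3 (row5 0    0    0          0          0)
       (row5 1%:M 0    0          0          0)
       (row5 0    1%:M (x - a)%:M (y - c)%:M ((y - c) * (x - a))%:M).

Definition K31 (x y theta : R) : 'M[R]_(nst n0 n1 n2, bc1 n1 n2) :=
  col3 (row3 0    0              0)
       (row3 1%:M 0              0)
       (row3 0    (x - theta)%:M ((y - c) * (x - theta))%:M).

Definition K32 (x y nu : R) : 'M[R]_(nst n0 n1 n2, bc1 n1 n2) :=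
  col3 (row3 0    0           0)
       (row3 1%:M 0           0)
       (row3 0    (y - nu)%:M ((x - a) * (y - nu))%:M).

Definition K33 (x y theta nu : R) : 'M[R]_(nst n0 n1 n2) :=
  col3 (row3 0 0    0)
       (row3 0 1%:M 0)
       (row3 0 0    ((x - theta) * (y - nu))%:M).

End MatricesHK.

Section ParametersT.
Variables (R : realType) (a b c d : R) (n0 n1 n2 : nat).
Variable B : PI011 R (bf0 n1 n2) (bf1 n1 n2) (bf1 n1 n2)
                     (bc0 n1 n2) (bc1 n1 n2) (bc1 n1 n2).
Variable Eh : PI011 R (bc0 n1 n2) (bc1 n1 n2) (bc1 n1 n2)
                      (bc0 n1 n2) (bc1 n1 n2) (bc1 n1 n2).

Local Notation h03 := (H03 b d n0 n1 n2).
Local Notation h13 := (H13 d n0 n1 n2).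
Local Notation h23 := (H23 b n0 n1 n2).
Local Notation k30 := (K30 a c n0 n1 n2).
Local Notation k31 := (K31 c n0 n1 n2).
Local Notation k32 := (K32 a n0 n1 n2).
Local Notation k33 := (K33 n0 n1 n2).

(* The boundary conditions B Lambda_bf u = 0 are well-posed, and Eh are the
   parameters of the inverse of B H_1. *)
Definition well_posed_with_inverse : Prop :=
  square_integrable_parameters a b c d Eh /\
  mutually_inverse a b c d
    (fun v => pi011 a b c d B (H1op a b c d v)) (pi011 a b c d Eh).

Definition F0 (x y : R) : 'M[R]_(bc0 n1 n2, nst n0 n1 n2) :=
  P00 B *m h03 x y + P01 B x *m h13 y + P02 B y *m h23 x.
Definition F1_0 (x y : R) : 'M[R]_(bc1 n1 n2, nst n0 n1 n2) :=
  P11_0 B x *m h13 y.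
Definition F1_1 (x y theta : R) : 'M[R]_(bc1 n1 n2, nst n0 n1 n2) :=
  P10 B x *m h03 theta y + P11_1 B x theta *m h13 y + P12 B x y *m h23 theta.
Definition F2_0 (x y : R) : 'M[R]_(bc1 n1 n2, nst n0 n1 n2) :=
  P22_0 B y *m h23 x.
Definition F2_1 (x y nu : R) : 'M[R]_(bc1 n1 n2, nst n0 n1 n2) :=
  P20 B y *m h03 x nu + P22_1 B y nu *m h23 x + P21 B x y *m h13 nu.

Definition G0 (x y : R) : 'M[R]_(bc0 n1 n2, nst n0 n1 n2) :=
  P00 Eh *m F0 x y + P01 Eh x *m F1_0 x y
  + \mint_(theta in `[a, b]) (P01 Eh theta *m F1_1 theta y x)
  + P02 Eh y *m F2_0 x y
  + \mint_(nu in `[c, d]) (P02 Eh nu *m F2_1 x nu y).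
Definition G1_0 (x y : R) : 'M[R]_(bc1 n1 n2, nst n0 n1 n2) :=
  P11_0 Eh x *m F1_0 x y.
Definition G2_0 (x y : R) : 'M[R]_(bc1 n1 n2, nst n0 n1 n2) :=
  P22_0 Eh y *m F2_0 x y.
Definition G1_1 (x y theta : R) : 'M[R]_(bc1 n1 n2, nst n0 n1 n2) :=
  P10 Eh x *m F0 theta y + P11_0 Eh x *m F1_1 x y theta
  + P11_1 Eh x theta *m F1_0 theta y
  + \mint_(eta in `[a, b]) (P11_1 Eh x eta *m F1_1 eta y theta)
  + P12 Eh x y *m F2_0 theta y
  + \mint_(nu in `[c, d]) (P12 Eh x nu *m F2_1 theta nu y).
Definition G2_1 (x y nu : R) : 'M[R]_(bc1 n1 n2, nst n0 n1 n2) :=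
  P20 Eh y *m F0 x nu + P22_0 Eh y *m F2_1 x y nu
  + P22_1 Eh y nu *m F2_0 x nu
  + \mint_(mu in `[c, d]) (P22_1 Eh y mu *m F2_1 x mu nu)
  + P21 Eh x y *m F1_0 x nu
  + \mint_(theta in `[a, b]) (P21 Eh theta y *m F1_1 theta nu x).

Definition T00 : 'M[R]_(nst n0 n1 n2) :=
  col3 (row3 1%:M 0 0) (row3 0 0 0) (row3 0 0 0).
Definition T22 (x y theta nu : R) : 'M[R]_(nst n0 n1 n2) :=
  - (k30 x y *m G0 theta nu)
  - \mint_(eta in `[a, x]) (k31 x y eta *m G1_1 eta nu theta)
  - \mint_(mu in `[c, y]) (k32 x y mu *m G2_1 theta mu nu).
Definition T12 (x y theta nu : R) : 'M[R]_(nst n0 n1 n2) :=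
  - (k31 x y theta *m G1_0 theta nu) + T22 x y theta nu.
Definition T21 (x y theta nu : R) : 'M[R]_(nst n0 n1 n2) :=
  - (k32 x y nu *m G2_0 theta nu) + T22 x y theta nu.
Definition T11 (x y theta nu : R) : 'M[R]_(nst n0 n1 n2) :=
  k33 x y theta nu + T21 x y theta nu + T12 x y theta nu - T22 x y theta nu.

Definition Top (u : R * R -> 'cV[R]_(nst n0 n1 n2)) :
    R * R -> 'cV[R]_(nst n0 n1 n2) :=
  fun z => let: (x, y) := z in
    T00 *m u (x, y)
    + \mint_(theta in `[a, x]) \mint_(nu in `[c, y])
        (T11 x y theta nu *m u (theta, nu))
    + \mint_(theta in `[x, b]) \mint_(nu in `[c, y])
        (T21 x y theta nu *m u (theta, nu))
    + \mint_(theta in `[a, x]) \mint_(nu in `[y, d])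
        (T12 x y theta nu *m u (theta, nu))
    + \mint_(theta in `[x, b]) \mint_(nu in `[y, d])
        (T22 x y theta nu *m u (theta, nu)).

End ParametersT.

(* Main.v *)
Require Import Defs.
From HB Require Import structures.
From mathcomp Require Import all_boot all_order all_algebra.
From mathcomp Require Import all_classical all_reals all_analysis.
From mathcomp Require Import measurable_realfun.
From mathcomp Require Import ring lra.
Set Implicit Arguments.
Unset Strict Implicit.
Unset Printing Implicit Defensive.
Import Order.TTheory GRing.Theory Num.Theory.
Import numFieldNormedType.Exports.
Local Open Scope classical_set_scope.
Local Open Scope ring_scope.

(* Du Bois-Reymond's lemma makes every u in L_2 x H_1 x H_2 almost everywhere an
   iterated primitive: writing U = D u, u = K_30 v_0 + int K_31 v_1 + int K_32 v_2
   + iint K_33 U, where v collects the values of the derivatives of u at (a, c)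
   and along the sides y = c and x = a. Taking traces of this expansion gives
   Lambda_bf u = H_1 v + h U, where h is the integral operator with kernels H_03,
   H_13 and H_23, so that B Lambda_bf u = 0 reads P[E] v = - B h U = - P[F] U.
   Applying P[E]^-1, v = - P[E^] P[F] U = - P[G] U, and Fubini turns the expansion
   with this v into T U. Conversely, T u^ is the expansion with v = - P[G] u^ and
   U = u^, and an iterated primitive has the expected weak derivatives. *)

(** * Integrable and square-integrable functions *)

(** The parameters of [P[E^]] are only square integrable: G can be neither evaluated nor bounded
    pointwise, and multiplication by the diagonal part of [P[E^]] in general sends L_2 only into
    L_1. Two facts compensate. The parameters of B are polynomials, so F is bounded, and every
    composition has a square-integrable outer factor and a bounded inner one. And [P[E^]] preserves
    L_2 by hypothesis, which makes [P[G] U] square integrable although its kernels do not show it.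
    In T this function occurs only under integrals with the bounded weights K, so T U is the
    expansion at every point. Traces are limits of mean squares over thin strips and small squares:
    their existence rests on the bound of Hölder type that Cauchy-Schwarz gives for primitives,
    their uniqueness on strips of width comparable to the parameter. In the expansion of a function
    of H_1 or H_2, the function of one variable left over by an integration is a priori only in L_2;
    averaging over the other variable shows that it is itself a primitive. Arguments are given in y
    and carried over to x by exchanging the coordinates. *)

Definition L1 d (T : measurableType d) (R : realType)
    (mu : {measure set T -> \bar R}) (D : set T) (f : T -> R) : Prop :=
  mu.-integrable D (EFin \o f).

Lemma aeS d (T : measurableType d) (R : realType) (mu : {measure set T -> \bar R})
    (P Q : T -> Prop) : (forall x, P x -> Q x) ->
  (\forall x \ae mu, P x) -> \forall x \ae mu, Q x.
Proof. by move=> PQ; apply: filterS. Qed.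

Lemma aeS2 d (T : measurableType d) (R : realType) (mu : {measure set T -> \bar R})
    (P Q S : T -> Prop) : (forall x, P x -> Q x -> S x) ->
  (\forall x \ae mu, P x) -> (\forall x \ae mu, Q x) -> \forall x \ae mu, S x.
Proof. by move=> PQ; apply: filterS2. Qed.

Section integrable_functions.
Context d (T : measurableType d) (R : realType).
Variable mu : {measure set T -> \bar R}.
Variable D : set T.
Hypothesis mD : measurable D.
Implicit Types f g : T -> R.

Lemma L1_measurable f : L1 mu D f -> measurable_fun D f.
Proof. by move=> /measurable_int/measurable_EFinP. Qed.

Lemma L1_le f g : measurable_fun D f -> L1 mu D g ->
  (forall x, D x -> `|f x| <= g x) -> L1 mu D f.
Proof.
move=> mf ig fg; apply: le_integrable ig => //; first exact/measurable_EFinP.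
by move=> x Dx /=; rewrite lee_fin (le_trans (fg _ Dx))// ler_norm.
Qed.

Lemma eq_L1 f g : (forall x, D x -> f x = g x) -> L1 mu D f -> L1 mu D g.
Proof.
by move=> fg; apply: eq_integrable => // x /set_mem Dx; rewrite /= fg.
Qed.

Lemma L1D f g : L1 mu D f -> L1 mu D g -> L1 mu D (fun x => f x + g x).
Proof. by move=> fi gi; exact: (integrableD mD fi gi). Qed.

Lemma L1Z k f : L1 mu D f -> L1 mu D (fun x => k * f x).
Proof. by move=> fi; exact: (integrableZl mD k fi). Qed.

Lemma L1N f : L1 mu D f -> L1 mu D (fun x => - f x).
Proof. by move=> /(L1Z (-1)); apply: eq_L1 => x _; rewrite mulN1r. Qed.

Lemma L1B f g : L1 mu D f -> L1 mu D g -> L1 mu D (fun x => f x - g x).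
Proof. by move=> fi gi; apply: L1D => //; exact: L1N. Qed.

Lemma L1_0 : L1 mu D (fun=> 0).
Proof. exact: integrable0. Qed.

Lemma L1_sum I (s : seq I) (P : pred I) (F : I -> T -> R) :
  (forall i, P i -> L1 mu D (F i)) -> L1 mu D (fun x => \sum_(i <- s | P i) F i x).
Proof.
move=> FI; elim: s => [|i s ih].
  by apply: eq_L1 L1_0 => x _; rewrite big_nil.
case Pi : (P i).
  by apply: eq_L1 (L1D (FI _ Pi) ih) => x _; rewrite big_cons Pi.
by apply: eq_L1 ih => x _; rewrite big_cons Pi.
Qed.

Lemma L1_norm f : L1 mu D f -> L1 mu D (fun x => `|f x|).
Proof. exact: integrable_norm. Qed.

Lemma L1_subset (E : set T) f : measurable E -> E `<=` D -> L1 mu D f -> L1 mu E f.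
Proof. by move=> mE ED; apply: integrableS. Qed.

Lemma Rintegral_sum I (s : seq I) (F : I -> T -> R) :
  (forall i, L1 mu D (F i)) ->
  \int[mu]_(x in D) (\sum_(i <- s) F i x) = \sum_(i <- s) \int[mu]_(x in D) F i x.
Proof.
move=> FI; elim: s => [|i s ih].
  rewrite big_nil -[RHS](mul0r (fine (mu D))) -(Rintegral_cst mu mD 0).
  by apply: eq_Rintegral => x _; rewrite big_nil.
rewrite big_cons -ih -RintegralD//; [|exact: FI|exact: L1_sum].
by apply: eq_Rintegral => x _; rewrite big_cons.
Qed.

Lemma ae_eq_Rintegral f g : measurable_fun D f -> measurable_fun D g ->
  f = g %[ae mu in D] -> \int[mu]_(x in D) f x = \int[mu]_(x in D) g x.
Proof.
move=> mf mg fg; congr fine; apply: ae_eq_integral => //.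
- exact/measurable_EFinP.
- exact/measurable_EFinP.
- by apply: filterS fg => x /= h Dx; rewrite h.
Qed.

Lemma ae_eq_L1 f g : measurable_fun D g ->
  f = g %[ae mu in D] -> L1 mu D f -> L1 mu D g.
Proof.
move=> mg fg fi; apply/integrableP; split; first exact/measurable_EFinP.
have /integrableP[mf] := fi; apply: le_lt_trans.
rewrite le_eqVlt; apply/orP; left; apply/eqP.
apply: ae_eq_integral => //.
- by apply: measurableT_comp => //; exact/measurable_EFinP.
- by apply: measurableT_comp.
- by apply: filterS fg => x /= h Dx; rewrite h.
Qed.

Lemma Rintegral_eq0_ae f : L1 mu D f -> (forall x, D x -> 0 <= f x) ->
  \int[mu]_(x in D) f x = 0 -> f = (fun=> 0) %[ae mu in D].
Proof.
move=> fi f0 if0.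
have mf := L1_measurable fi.
have h : (\int[mu]_(x in D) `|(f x)%:E| = 0)%E.
  rewrite -[RHS]/(0%:E) -if0 fineK; last exact: integrable_fin_num.
  by apply: eq_integral => x /set_mem Dx; rewrite /= ger0_norm// f0.
have /(ae_eq_integral_abs mu mD) : measurable_fun D (EFin \o f).
  exact/measurable_EFinP.
by move=> [/(_ h) + _]; apply: filterS => x /= + Dx => /(_ Dx) [].
Qed.

End integrable_functions.

Section L2_functions.
Context d (T : measurableType d) (R : realType).
Variable mu : {measure set T -> \bar R}.
Variable D : set T.
Hypothesis mD : measurable D.
Implicit Types f g : T -> R.

Lemma L2P f : L2 mu D f <-> measurable_fun D f /\ L1 mu D (fun x => f x ^+ 2).
Proof. by []. Qed.

Lemma L2_sqr f : L2 mu D f -> L1 mu D (fun x => f x ^+ 2).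
Proof. by case. Qed.

Lemma L2_le f g : measurable_fun D f -> L2 mu D g ->
  (forall x, D x -> `|f x| <= `|g x|) -> L2 mu D f.
Proof.
move=> mf [mg ig] fg; apply/L2P; split=> //; apply: (L1_le mD _ (f := _) (g := fun x => g x ^+ 2)) => //.
  exact: measurable_funX.
by move=> x Dx; rewrite normrX -[leRHS]ger0_norm ?sqr_ge0// normrX lerXn2r ?nnegrE ?fg.
Qed.

Lemma eq_L2 f g : (forall x, D x -> f x = g x) -> L2 mu D f -> L2 mu D g.
Proof.
move=> fg /L2P[mf fi]; apply/L2P; split.
  by apply: eq_measurable_fun mf => x /set_mem /fg.
by apply: (eq_L1 mD _ fi) => x Dx; rewrite fg.
Qed.

Lemma L2_mul f g : L2 mu D f -> L2 mu D g -> L1 mu D (fun x => f x * g x).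
Proof.
move=> [mf fi] [mg gi]; apply: (L1_le mD _ (L1D mD fi gi)).
  exact: measurable_funM.
move=> x _; rewrite ler_norml; apply/andP; split.
  by have := sqr_ge0 (f x + g x); have := sqr_ge0 (f x); have := sqr_ge0 (g x); nra.
by have := sqr_ge0 (f x - g x); have := sqr_ge0 (f x); have := sqr_ge0 (g x); nra.
Qed.

Lemma L2Z k f : L2 mu D f -> L2 mu D (fun x => k * f x).
Proof.
move=> /L2P[mf fi]; apply/L2P; split; first exact: measurable_funM.
by apply: (eq_L1 mD _ (L1Z mD (k ^+ 2) fi)) => x _; rewrite exprMn.
Qed.

Lemma L2D f g : L2 mu D f -> L2 mu D g -> L2 mu D (fun x => f x + g x).
Proof.
move=> [mf fi] [mg gi]; apply/L2P; split; first exact: measurable_funD.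
apply: (L1_le mD _ (L1Z mD 2 (L1D mD fi gi))).
  by apply: measurable_funX; exact: measurable_funD.
move=> x _; rewrite ger0_norm ?sqr_ge0//.
by have := sqr_ge0 (f x - g x); nra.
Qed.

Lemma L2N f : L2 mu D f -> L2 mu D (fun x => - f x).
Proof. by move=> /(L2Z (-1)); apply: eq_L2 => x _; rewrite mulN1r. Qed.

Lemma L2B f g : L2 mu D f -> L2 mu D g -> L2 mu D (fun x => f x - g x).
Proof. by move=> fi gi; apply: L2D => //; exact: L2N. Qed.

Lemma L2_0 : L2 mu D (fun=> 0).
Proof.
apply/L2P; split; first exact: measurable_cst.
by have := L1_0 mu D; apply: eq_L1 => // x _; rewrite expr0n.
Qed.

Lemma L2_sum I (s : seq I) (F : I -> T -> R) :
  (forall i, L2 mu D (F i)) -> L2 mu D (fun x => \sum_(i <- s) F i x).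
Proof.
move=> FI; elim: s => [|i s ih].
  by apply: eq_L2 L2_0 => x _; rewrite big_nil.
by apply: eq_L2 (L2D (FI i) ih) => x _; rewrite big_cons.
Qed.

Lemma L2_subset (E : set T) f : measurable E -> E `<=` D -> L2 mu D f -> L2 mu E f.
Proof.
move=> mE ED [mf fi]; split; first exact: measurable_funS mf.
exact: (L1_subset mD mE ED fi).
Qed.

Lemma L2_bounded_mul f g (C : R) : measurable_fun D f ->
  (forall x, D x -> `|f x| <= C) -> L2 mu D g -> L2 mu D (fun x => f x * g x).
Proof.
move=> mf fC g2; apply: (L2_le _ (L2Z C g2)).
  by apply: measurable_funM => //; case: g2.
move=> x Dx; rewrite !normrM ler_wpM2r//.
by rewrite (le_trans (fC _ Dx))// ler_norm.
Qed.

Lemma ae_eq_L2 f g : measurable_fun D g ->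
  f = g %[ae mu in D] -> L2 mu D f -> L2 mu D g.
Proof.
move=> mg fg [mf fi]; split=> //; apply: ae_eq_L1 (fi) => //.
  exact: measurable_funX.
by apply: filterS fg => x h Dx; rewrite h.
Qed.

(** The quadratic polynomial [\int (f + t g)^2] in [t] is nonnegative; its value at the minimum
    [t = - B / C] gives the inequality. *)
Lemma cauchy_schwarz f g : L2 mu D f -> L2 mu D g ->
  (\int[mu]_(x in D) (f x * g x)) ^+ 2 <=
  \int[mu]_(x in D) (f x ^+ 2) * \int[mu]_(x in D) (g x ^+ 2).
Proof.
move=> f2 g2; have fg := L2_mul f2 g2.
have fi := L2_sqr f2; have gi := L2_sqr g2.
set A := \int[mu]_(x in D) (f x ^+ 2); set C := \int[mu]_(x in D) (g x ^+ 2).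
set B := \int[mu]_(x in D) (f x * g x).
have q t : 0 <= A + t * (2 * B) + t ^+ 2 * C.
  have fg2 := L1Z mD t (L1Z mD 2 fg); have gt := L1Z mD (t ^+ 2) gi.
  have -> : A + t * (2 * B) + t ^+ 2 * C =
      \int[mu]_(x in D) (f x ^+ 2 + t * (2 * (f x * g x)) + t ^+ 2 * g x ^+ 2).
    rewrite RintegralD//; last exact: (L1D mD fi fg2).
    rewrite RintegralD// !RintegralZl//; exact: (L1Z mD 2 fg).
  by apply: Rintegral_ge0 => x _; have := sqr_ge0 (f x + t * g x); nra.
have C0 : 0 <= C by apply: Rintegral_ge0 => x _; exact: sqr_ge0.
have A0 : 0 <= A by apply: Rintegral_ge0 => x _; exact: sqr_ge0.
have [C00|Cn0] := eqVneq C 0.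
  have [->|Bn0] := eqVneq B 0; first by rewrite expr0n mulr_ge0.
  (* With [C = 0] the polynomial is affine in [t], and this [t] would give it the value -1. *)
  have := q (- (A + 1) / (2 * B)); rewrite C00.
  by rewrite mulfVK ?mulf_neq0// mulr0 addr0 opprD addrA subrr sub0r oppr_ge0 ler10.
have := q (- B / C).
have -> : A + - B / C * (2 * B) + (- B / C) ^+ 2 * C = (A * C - B ^+ 2) / C by field.
by rewrite pmulr_lge0 ?invr_gt0 ?lt0r ?Cn0// subr_ge0.
Qed.

Hypothesis fD : (mu D < +oo)%E.

Lemma L1_cst k : L1 mu D (fun=> k).
Proof. apply: measurable_bounded_integrable => //.
by exists `|k|; split; [exact: num_real|move=> M kM x _; exact: ltW]. Qed.

Lemma bounded_L1 f (C : R) : measurable_fun D f ->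
  (forall x, D x -> `|f x| <= C) -> L1 mu D f.
Proof. by move=> mf fC; apply: L1_le (L1_cst C) _. Qed.

Lemma L2_cst k : L2 mu D (fun=> k).
Proof. by split; [exact: measurable_cst|exact: L1_cst]. Qed.

Lemma bounded_L2 f (C : R) : measurable_fun D f ->
  (forall x, D x -> `|f x| <= C) -> L2 mu D f.
Proof.
move=> mf fC; apply: L2_le (L2_cst C) _ => // x Dx.
by rewrite (le_trans (fC _ Dx))// ler_norm.
Qed.

Lemma L2_L1 f : L2 mu D f -> L1 mu D f.
Proof.
move=> f2; apply: (eq_L1 mD _ (L2_mul f2 (L2_cst 1))) => x _.
by rewrite mulr1.
Qed.

Lemma sqr_Rintegral_le f : L2 mu D f ->
  (\int[mu]_(x in D) f x) ^+ 2 <= fine (mu D) * \int[mu]_(x in D) (f x ^+ 2).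
Proof.
move=> f2; have := cauchy_schwarz f2 (L2_cst 1).
under eq_Rintegral do rewrite mulr1.
under [X in _ <= _ * X]eq_Rintegral do rewrite expr1n.
by rewrite Rintegral_cst// mul1r mulrC.
Qed.

End L2_functions.

(** * Fubini and Tonelli for real integrals over a product of sets *)

Section product_integrals.
Context d1 d2 (T1 : measurableType d1) (T2 : measurableType d2) (R : realType).
Variable m1 : {sigma_finite_measure set T1 -> \bar R}.
Variable m2 : {sigma_finite_measure set T2 -> \bar R}.
Variables (A : set T1) (B : set T2).
Hypotheses (mA : measurable A) (mB : measurable B).
Implicit Type f : T1 * T2 -> R.

Let mAB : measurable (A `*` B).
Proof. exact: measurableX. Qed.

(** Extension by zero, through which the theorems on the whole product are transported to [A] times
    [B]. *)
Let g f : T1 * T2 -> \bar R := EFin \o (f \_ (A `*` B)).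

Let g1 f x : A x -> (fun y => g f (x, y)) = (EFin \o (fun y => f (x, y))) \_ B.
Proof.
move=> Ax; apply/funext => y; rewrite /g /= !patchE.
case: ifPn => [/set_mem[_ By]|h]; first by rewrite mem_set.
rewrite ifN//; apply: contra h => /set_mem By.
by rewrite mem_set.
Qed.

Let g1N f x : ~ A x -> (fun y => g f (x, y)) = cst 0%E.
Proof.
move=> Ax; apply/funext => y; rewrite /g /= !patchE.
by case: ifPn => [/set_mem[]|].
Qed.

Let g2 f y : B y -> (fun x => g f (x, y)) = (EFin \o (fun x => f (x, y))) \_ A.
Proof.
move=> By; apply/funext => x; rewrite /g /= !patchE.
case: ifPn => [/set_mem[Ax _]|h]; first by rewrite mem_set.
rewrite ifN//; apply: contra h => /set_mem Ax.
by rewrite mem_set.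
Qed.

Let L1_g f : L1 (m1 \x m2)%E (A `*` B) f -> (m1 \x m2)%E.-integrable setT (g f).
Proof.
by move=> fi; rewrite /g -restrict_EFin; apply: (integrable_mkcond _ mAB).1.
Qed.

Let measurable_g f : measurable_fun (A `*` B) f -> measurable_fun setT (g f).
Proof.
move=> mf; rewrite /g; apply/measurable_EFinP.
by apply/(measurable_restrictT f mAB).
Qed.

Lemma L1_section1 f : L1 (m1 \x m2)%E (A `*` B) f ->
  \forall x \ae m1, A x -> L1 m2 B (fun y => f (x, y)).
Proof.
move=> /L1_g/ae_integrable1; apply: filterS => x /= + Ax.
by rewrite g1// => /(integrable_mkcond _ mB).2.
Qed.

Lemma L1_section2 f : L1 (m1 \x m2)%E (A `*` B) f ->
  \forall y \ae m2, B y -> L1 m1 A (fun x => f (x, y)).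
Proof.
move=> /L1_g/ae_integrable2; apply: filterS => y /= + By.
by rewrite g2// => /(integrable_mkcond _ mA).2.
Qed.

Let fubini1E f x : A x -> fubini_F m2 (g f) x = (\int[m2]_(y in B) (f (x, y))%:E)%E.
Proof. by move=> Ax; rewrite /fubini_F g1// [RHS]integral_mkcond. Qed.

Let fubini2E f y : B y -> fubini_G m1 (g f) y = (\int[m1]_(x in A) (f (x, y))%:E)%E.
Proof. by move=> By; rewrite /fubini_G g2// [RHS]integral_mkcond. Qed.

Let measurable_fubini1 f : L1 (m1 \x m2)%E (A `*` B) f ->
  measurable_fun A (fun x => \int[m2]_(y in B) f (x, y)).
Proof.
move=> fi; apply: (@eq_measurable_fun _ _ _ _ _ (fine \o fubini_F m2 (g f))).
  by move=> x /set_mem Ax; rewrite /= fubini1E.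
apply: measurableT_comp => //; apply: measurable_funTS.
exact: measurable_fubini_F (L1_g fi).
Qed.

Let measurable_fubini2 f : L1 (m1 \x m2)%E (A `*` B) f ->
  measurable_fun B (fun y => \int[m1]_(x in A) f (x, y)).
Proof.
move=> fi; apply: (@eq_measurable_fun _ _ _ _ _ (fine \o fubini_G m1 (g f))).
  by move=> x /set_mem Ax; rewrite /= fubini2E.
apply: measurableT_comp => //; apply: measurable_funTS.
exact: measurable_fubini_G (L1_g fi).
Qed.

Let L1_gG f : L1 (m1 \x m2)%E (A `*` B) f -> m2.-integrable setT (fubini_G m1 (g f)).
Proof.
move=> /L1_g gi; have mg := measurable_int _ gi.
apply/integrableP; split; first exact: measurable_fubini_G gi.
have := (integrable21ltyP m1 m2 mg).1 gi; apply: le_lt_trans.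
apply: ge0_le_integral => //.
- by apply: measurableT_comp => //; exact: measurable_fubini_G gi.
- apply: (measurable_fun_fubini_tonelli_G (abse \o g f)) => //=.
  exact: measurableT_comp.
- move=> y _; apply: le_abse_integral => //.
  exact: measurableT_comp.
Qed.

Lemma L1_fubini1 f : L1 (m1 \x m2)%E (A `*` B) f ->
  L1 m1 A (fun x => \int[m2]_(y in B) f (x, y)).
Proof.
move=> fi; have Fi := integrable_fubini_F (L1_g fi).
have : m1.-integrable A (fubini_F m2 (g f)) by exact: integrableS Fi.
apply: le_integrable => //; first exact/measurable_EFinP/measurable_fubini1.
move=> x Ax /=; rewrite fubini1E// /Rintegral.
(* Where the inner integral is infinite its [fine] is 0, so the real integral is dominated by the
   extended one in all cases. *)
by case: (\int[m2]_(y in B) _)%E => [r| |] //=; rewrite ?normr0 ?leey.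
Qed.

Lemma L1_fubini2 f : L1 (m1 \x m2)%E (A `*` B) f ->
  L1 m2 B (fun y => \int[m1]_(x in A) f (x, y)).
Proof.
move=> fi; have Fi := L1_gG fi.
have : m2.-integrable B (fubini_G m1 (g f)) by exact: integrableS Fi.
apply: le_integrable => //; first exact/measurable_EFinP/measurable_fubini2.
move=> x Ax /=; rewrite fubini2E// /Rintegral.
by case: (\int[m1]_(y in A) _)%E => [r| |] //=; rewrite ?normr0 ?leey.
Qed.

Lemma Rfubini1 f : L1 (m1 \x m2)%E (A `*` B) f ->
  \int[(m1 \x m2)%E]_(z in A `*` B) f z = \int[m1]_(x in A) \int[m2]_(y in B) f (x, y).
Proof.
move=> fi; congr fine; rewrite integral_mkcond restrict_EFin.
rewrite -(integral12_prod_meas1 (L1_g fi)).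
transitivity (\int[m1]_(x in A) fubini_F m2 (g f) x)%E.
  rewrite [RHS]integral_mkcond; apply: eq_integral => x _.
  rewrite patchE; case: ifPn => // xA; rewrite /fubini_F g1N ?integral0//.
  by move=> Ax; move/negP: xA; apply; exact: mem_set.
apply: ae_eq_integral => //.
- by apply: measurable_funTS; exact: measurable_fubini_F (L1_g fi).
- exact/measurable_EFinP/measurable_fubini1.
- apply: filterS (L1_section1 fi) => x /= + Ax => /(_ Ax) fx.
  by rewrite fubini1E// /Rintegral fineK//; exact: integrable_fin_num.
Qed.

Lemma Rfubini2 f : L1 (m1 \x m2)%E (A `*` B) f ->
  \int[(m1 \x m2)%E]_(z in A `*` B) f z = \int[m2]_(y in B) \int[m1]_(x in A) f (x, y).
Proof.
move=> fi; congr fine; rewrite integral_mkcond restrict_EFin.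
rewrite -(integral21_prod_meas1 (L1_g fi)).
transitivity (\int[m2]_(y in B) fubini_G m1 (g f) y)%E.
  rewrite [RHS]integral_mkcond; apply: eq_integral => y _.
  rewrite patchE; case: ifPn => // yB; rewrite /fubini_G.
  rewrite (_ : (fun x => _) = cst 0%E) ?integral0//.
  apply/funext => x; rewrite /g /= patchE ifN//.
  by apply: contra yB => /set_mem[_ By]; exact: mem_set.
apply: ae_eq_integral => //.
- by apply: measurable_funTS; exact: measurable_fubini_G (L1_g fi).
- exact/measurable_EFinP/measurable_fubini2.
- apply: filterS (L1_section2 fi) => x /= + Ax => /(_ Ax) fx.
  by rewrite fubini2E// /Rintegral fineK//; exact: integrable_fin_num.
Qed.

(** Integrability on every section makes the inner integral of [|f|] finite, so the real iterated
    integral carries the same information as the extended one in Tonelli's criterion. *)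
Lemma L1_tonelli f : measurable_fun (A `*` B) f ->
  (forall x, A x -> L1 m2 B (fun y => f (x, y))) ->
  L1 m1 A (fun x => \int[m2]_(y in B) `|f (x, y)|) ->
  L1 (m1 \x m2)%E (A `*` B) f.
Proof.
move=> mf fB fA; apply/integrable_mkcond => //; rewrite restrict_EFin.
apply/integrable12ltyP; first exact: measurable_g.
have /integrableP[_] := fA; apply: le_lt_trans.
rewrite [leRHS]integral_mkcond le_eqVlt; apply/orP; left; apply/eqP.
apply: eq_integral => x _; rewrite patchE; case: ifPn => [/set_mem Ax|nA].
  rewrite /= ger0_norm ?Rintegral_ge0// /Rintegral fineK; last first.
    by apply: integrable_fin_num => //; exact: integrable_norm (fB _ Ax).
  rewrite [RHS]integral_mkcond; apply: eq_integral => y _.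
  have /(congr1 (fun h => `|h y|%E)) := g1 f Ax; rewrite /g /= => ->.
  by rewrite !patchE; case: ifPn => //= _; rewrite normr0.
apply: integral0_eq => y _; rewrite /= patchE ifN ?normr0//=.
by apply: contra nA => /set_mem[Ax _]; exact: mem_set.
Qed.

Lemma L1_section f x : A x -> measurable_fun (A `*` B) f ->
  measurable_fun B (fun y => f (x, y)).
Proof.
move=> Ax mf.
apply: (measurable_comp mAB _ mf); last exact: measurable_funTS.
by move=> _ [y By <-].
Qed.

End product_integrals.

Lemma L1_patchP d (T : measurableType d) (R : realType)
    (mu : {measure set T -> \bar R}) (D : set T) (f : T -> R) : measurable D ->
  L1 mu D f <-> mu.-integrable setT (EFin \o (f \_ D)).
Proof. by move=> mD; rewrite -restrict_EFin; exact: integrable_mkcond. Qed.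

(* The library's sigma-finite structure on [m1 \x m2] is shadowed by the one for
   probabilities, hence this alias. *)
Section sigma_finite_product.
Context d1 d2 (T1 : measurableType d1) (T2 : measurableType d2) (R : realType).
Variable m1 : {sigma_finite_measure set T1 -> \bar R}.
Variable m2 : {sigma_finite_measure set T2 -> \bar R}.

Definition sfprod : set (T1 * T2) -> \bar R := (m1 \x m2)%E.

HB.instance Definition _ := Measure.copy sfprod (m1 \x m2)%E.

Let sfprod_sigma_finite : sigma_finite setT sfprod.
Proof.
have /sigma_finiteP[F [TF ndF Foo]] := sigma_finiteT m1.
have /sigma_finiteP[G [TG ndG Goo]] := sigma_finiteT m2.
exists (fun n => F n `*` G n).
  rewrite -setXTT TF TG predeqE => -[x y]; split.
    move=> [/= [n _ Fnx] [k _ Gky]]; exists (maxn n k) => //; split.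
    - by move: x Fnx; exact/subsetPset/ndF/leq_maxl.
    - by move: y Gky; exact/subsetPset/ndG/leq_maxr.
  by move=> [n _ []/= ? ?]; split; exists n.
move=> k; have [? ?] := Foo k; have [? ?] := Goo k.
split; first exact: measurableX.
by rewrite /sfprod product_measure1E// lte_mul_pinfty// ge0_fin_numE.
Qed.

HB.instance Definition _ := Measure_isSigmaFinite.Build _ _ _ sfprod
  sfprod_sigma_finite.

End sigma_finite_product.

(** * Integrability under projections and rearrangements of the variables *)

Section pullback.
Context d1 d2 d3 (T1 : measurableType d1) (T2 : measurableType d2)
  (T3 : measurableType d3) (R : realType).
Variable m1 : {sigma_finite_measure set T1 -> \bar R}.
Variable m2 : {sigma_finite_measure set T2 -> \bar R}.
Variable m3 : {sigma_finite_measure set T3 -> \bar R}.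
Variables (A : set T1) (B : set T2) (C : set T3).
Hypotheses (mA : measurable A) (mB : measurable B) (mC : measurable C).

Lemma L1_fst f : (m2 B < +oo)%E -> L1 m1 A f ->
  L1 (m1 \x m2)%E (A `*` B) (fun z => f z.1).
Proof.
move=> Boo fi; apply: L1_tonelli => //.
- have mAB := measurableX mA mB.
  apply: (measurable_comp mA _ (L1_measurable fi)); last exact: measurable_funTS.
  by move=> _ [z [Az _] <-].
- by move=> x Ax /=; exact: L1_cst.
- have := L1Z mA (fine (m2 B)) (L1_norm fi).
  by apply: eq_L1 => // x Ax /=; rewrite Rintegral_cst// mulrC.
Qed.

Lemma L1_swap f : L1 (m1 \x m2)%E (A `*` B) f ->
  L1 (m2 \x m1)%E (B `*` A) (fun z => f (z.2, z.1)).
Proof.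
move=> fi; have mAB := measurableX mA mB; have mBA := measurableX mB mA.
have mf : measurable_fun (B `*` A) (fun z => f (z.2, z.1)).
  apply: (measurable_comp mAB _ (L1_measurable fi)); last first.
    by apply: measurable_funTS; apply: measurable_fun_pair.
  by move=> _ [z [Az Bz] <-].
apply/(L1_patchP _ _ mBA)/integrable12ltyP.
  by apply/measurable_EFinP/(measurable_restrictT _ mBA).
move: fi => /(L1_patchP _ _ mAB) fi.
have := (integrable21ltyP m1 m2 (measurable_int _ fi)).1 fi.
apply: le_lt_trans; rewrite le_eqVlt; apply/orP; left; apply/eqP.
apply: eq_integral => y _; apply: eq_integral => x _ /=.
rewrite !patchE; congr (`|(if _ then _ else _)%:E|)%E.
by apply/idP/idP => /set_mem [? ?]; apply/mem_set.
Qed.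

(** A variable in [C] on which the function does not depend only multiplies the iterated integral of
    [|f|] by [m3 C]. This lets a kernel in two variables be multiplied by functions of a third
    one. *)
Lemma L1_mid f : (m3 C < +oo)%E -> L1 (m1 \x m2)%E (A `*` B) f ->
  L1 (sfprod m1 m3 \x m2)%E ((A `*` C) `*` B) (fun z => f (z.1.1, z.2)).
Proof.
move=> Coo fi; have mAB := measurableX mA mB.
have mACB := measurableX (measurableX mA mC) mB.
have mf : measurable_fun ((A `*` C) `*` B) (fun z => f (z.1.1, z.2)).
  apply: (measurable_comp mAB _ (L1_measurable fi)).
    by move=> _ [z [[Az Cz] Bz] <-].
  apply: measurable_funTS; apply: measurable_fun_pair => //.
  exact: (measurableT_comp measurable_fst measurable_fst).
apply/(L1_patchP _ _ mACB)/integrable12ltyP.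
  by apply/measurable_EFinP/(measurable_restrictT _ mACB).
move: fi => /(L1_patchP _ _ mAB) fi; have mfi := measurable_int _ fi.
pose Psi x := (\int[m2]_y `|(EFin \o (f \_ (A `*` B))) (x, y)|)%E.
have mPsi : measurable_fun setT Psi.
  apply: (measurable_fun_fubini_tonelli_F (abse \o (EFin \o (f \_ (A `*` B))))) => //=.
  exact: measurableT_comp.
have Psioo : (\int[m1]_x Psi x < +oo)%E by exact: (integrable12ltyP m1 m2 mfi).1 fi.
have Psi0 x : (0 <= Psi x)%E by exact: integral_ge0.
have E (z : T1 * T3) : (\int[m2]_y
    `|(EFin \o ((fun z => f (z.1.1, z.2)) \_ (A `*` C `*` B))) (z, y)|)%E
    = (Psi z.1 * (\1_C z.2)%:E)%E.
  rewrite /Psi -ge0_integralZr//; last first.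
    apply: measurableT_comp => //; apply: (measurableT_comp mfi).
    exact: measurable_pair1.
  apply: eq_integral => y _; rewrite /= !patchE indicE.
  have [zC|zC] := boolP (z.2 \in C).
    rewrite mule1; congr (`|(if _ then _ else _)%:E|)%E.
    apply/idP/idP => /set_mem; first by move=> [[? ?] ?]; apply/mem_set.
    by move=> [? ?]; apply/mem_set; split => //; split=> //; exact/set_mem.
  rewrite mule0 ifN ?normr0//; apply: contra zC => /set_mem [[_ ?] _].
  exact/mem_set.
under eq_integral do rewrite E.
pose Phi z := (Psi z.1 * (\1_C z.2)%:E)%E.
rewrite (@fubini_tonelli1 _ _ _ _ _ m1 m3 Phi); last 2 first.
- apply: emeasurable_funM; first exact: measurableT_comp.
  by apply/measurable_EFinP; apply: measurableT_comp => //; exact: measurable_indic.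
- by move=> z; rewrite mule_ge0// lee_fin.
rewrite (_ : (\int[m1]_x _ = \int[m1]_x (Psi x * m3 C))%E); last first.
  apply: eq_integral => x _; rewrite /fubini_F /Phi /= ge0_integralZl//.
  - by rewrite integral_indic// setIT.
  - by apply/measurable_EFinP; exact: measurable_indic.
rewrite ge0_integralZr//; apply: lte_mul_pinfty => //.
  exact: integral_ge0.
by rewrite ge0_fin_numE//; exact: integral_ge0.
Qed.

(** Tonelli yields the same threefold iterated integral of [|f|] on both sides; the two product
    measures themselves are never compared. *)
Lemma L1_assoc f : L1 (sfprod m1 m2 \x m3)%E ((A `*` B) `*` C) f ->
  L1 (m1 \x sfprod m2 m3)%E (A `*` (B `*` C)) (fun z => f ((z.1, z.2.1), z.2.2)).
Proof.
move=> fi; have mAB := measurableX (measurableX mA mB) mC.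
have mD := measurableX mA (measurableX mB mC).
pose pi (z : T1 * (T2 * T3)) := ((z.1, z.2.1), z.2.2).
have mpi : measurable_fun setT pi.
  apply: measurable_fun_pair; last exact: (measurableT_comp measurable_snd measurable_snd).
  apply: measurable_fun_pair => //.
  exact: (measurableT_comp measurable_fst measurable_snd).
have mf : measurable_fun (A `*` (B `*` C)) (fun z => f ((z.1, z.2.1), z.2.2)).
  apply: (measurable_comp mAB _ (L1_measurable fi)).
    by move=> _ [z [Az [Bz Cz]] <-].
  exact: measurable_funTS.
apply/(L1_patchP _ _ mD)/integrable12ltyP.
  by apply/measurable_EFinP/(measurable_restrictT _ mD).
move: fi => /(L1_patchP _ _ mAB) fi; have mfi := measurable_int _ fi.
have := (integrable12ltyP (sfprod m1 m2) m3 mfi).1 fi.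
pose h : (T1 * T2) * T3 -> \bar R := abse \o (EFin \o f \_ (A `*` B `*` C)).
have mh : measurable_fun setT h by exact: measurableT_comp.
have h0 z : (0 <= h z)%E by exact: abse_ge0.
have -> : (\int[sfprod m1 m2]_x \int[m3]_y `|(EFin \o f \_ (A `*` B `*` C)) (x, y)| =
    \int[(m1 \x m2)]_x \int[m3]_y h (x, y))%E by [].
rewrite (fubini_tonelli1 (fubini_F m3 h)); last 2 first.
- exact: measurable_fun_fubini_tonelli_F.
- by move=> z; exact: integral_ge0.
apply: le_lt_trans; rewrite le_eqVlt; apply/orP; left; apply/eqP.
apply: eq_integral => x _.
pose hx : T2 * T3 -> \bar R := fun w => h (pi (x, w)).
have mhx : measurable_fun setT hx.
  apply: (measurableT_comp mh); apply: (measurableT_comp mpi).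
  exact: measurable_pair1.
have -> : (\int[sfprod m2 m3]_y `|(EFin \o (fun z => f ((z.1, z.2.1), z.2.2)) \_ (A `*` (B `*` C))) (x, y)|
  = \int[(m2 \x m3)]_y hx y)%E.
  apply: eq_integral => w _; rewrite /hx /h /= !patchE.
  congr (`|(if _ then _ else _)%:E|)%E.
  by apply/idP/idP => /set_mem; [move=> [? [? ?]]|move=> [[? ?] ?]]; apply/mem_set.
by rewrite (fubini_tonelli1 hx)// => w; exact: h0.
Qed.

End pullback.

Section L2_product.
Context d1 d2 (T1 : measurableType d1) (T2 : measurableType d2) (R : realType).
Variable m1 : {sigma_finite_measure set T1 -> \bar R}.
Variable m2 : {sigma_finite_measure set T2 -> \bar R}.
Variables (A : set T1) (B : set T2).
Hypotheses (mA : measurable A) (mB : measurable B).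
Hypotheses (fA : (m1 A < +oo)%E) (fB : (m2 B < +oo)%E).
Implicit Type f : T1 * T2 -> R.

Let mAB : measurable (A `*` B).
Proof. exact: measurableX. Qed.

Lemma finite_measureX : ((m1 \x m2)%E (A `*` B) < +oo)%E.
Proof. by rewrite product_measure1E// lte_mul_pinfty// ge0_fin_numE. Qed.
Let fAB := finite_measureX.

Lemma L2_fst (f : T1 -> R) : L2 m1 A f -> L2 (m1 \x m2)%E (A `*` B) (fun z => f z.1).
Proof.
move=> f2; apply/L2P; split.
  exact: L1_measurable (L1_fst mA mB fB (L2_L1 mA fA f2)).
exact: (L1_fst mA mB fB (L2_sqr f2)).
Qed.

Lemma L2_swap f : L2 (m1 \x m2)%E (A `*` B) f ->
  L2 (m2 \x m1)%E (B `*` A) (fun z => f (z.2, z.1)).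
Proof.
move=> f2; apply/L2P; split.
  exact: L1_measurable (L1_swap mA mB (L2_L1 mAB fAB f2)).
exact: (L1_swap mA mB (L2_sqr f2)).
Qed.

Lemma L2_measurable_section f x : A x -> L2 (m1 \x m2)%E (A `*` B) f ->
  measurable_fun B (fun y => f (x, y)).
Proof. by move=> Ax [mf _]; exact: (L1_section mA mB Ax mf). Qed.

Lemma L2_section1 f : L2 (m1 \x m2)%E (A `*` B) f ->
  \forall x \ae m1, A x -> L2 m2 B (fun y => f (x, y)).
Proof.
move=> f2; have := L1_section1 mA mB (L2_sqr f2).
apply: filterS => x h Ax; apply/L2P; split; last exact: h.
exact: (L2_measurable_section Ax f2).
Qed.

End L2_product.

Section L2_product_operations.
Context d1 d2 (T1 : measurableType d1) (T2 : measurableType d2) (R : realType).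
Variable m1 : {sigma_finite_measure set T1 -> \bar R}.
Variable m2 : {sigma_finite_measure set T2 -> \bar R}.
Variables (A : set T1) (B : set T2).
Hypotheses (mA : measurable A) (mB : measurable B).
Hypotheses (fA : (m1 A < +oo)%E) (fB : (m2 B < +oo)%E).
Implicit Type f : T1 * T2 -> R.

Let mAB : measurable (A `*` B).
Proof. exact: measurableX. Qed.
Let fAB := finite_measureX mA mB fA fB.

Lemma L2_snd (f : T2 -> R) : L2 m2 B f -> L2 (m1 \x m2)%E (A `*` B) (fun z => f z.2).
Proof. by move=> f2; exact: (L2_swap mB mA fB fA (L2_fst mB mA fB fA f2)). Qed.

Lemma L1_le_ae (f g : T1 -> R) : measurable_fun A f -> L1 m1 A g ->
  (\forall x \ae m1, A x -> `|f x| <= g x) -> L1 m1 A f.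
Proof.
move=> mf ig fg; apply/integrableP; split; first exact/measurable_EFinP.
have /integrableP[mg] := ig; apply: le_lt_trans.
apply: ae_ge0_le_integral => //.
- by apply: measurableT_comp => //; exact/measurable_EFinP.
- exact: measurableT_comp.
- apply: filterS fg => x h Ax /=; rewrite lee_fin (le_trans (h Ax))//.
  exact: ler_norm.
Qed.

Lemma L2_mul_snd f w : L2 (m1 \x m2)%E (A `*` B) f -> L2 m2 B w ->
  L1 (m1 \x m2)%E (A `*` B) (fun z => f z * w z.2).
Proof. by move=> f2 w2; exact: (L2_mul mAB f2 (L2_snd w2)). Qed.

(** On almost every section Cauchy-Schwarz bounds the squared integral by [W] times
    [\int f(x, y)^2 dy], which is integrable in [x] by Fubini. *)
Lemma L2_hilbert_schmidt f w : L2 (m1 \x m2)%E (A `*` B) f -> L2 m2 B w ->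
  L2 m1 A (fun x => \int[m2]_(y in B) (f (x, y) * w y)).
Proof.
move=> f2 w2; have fw := L2_mul_snd f2 w2.
have mI := L1_measurable (L1_fubini1 mA mB fw).
apply/L2P; split => //; set W := \int[m2]_(y in B) (w y ^+ 2).
apply: (@L1_le_ae _ (fun x => W * \int[m2]_(y in B) (f (x, y) ^+ 2))).
- exact: measurable_funX.
- exact: (L1Z mA _ (L1_fubini1 mA mB (L2_sqr f2))).
apply: filterS (L2_section1 mA mB f2) => x h Ax.
rewrite ger0_norm ?sqr_ge0// mulrC.
exact: (cauchy_schwarz mB (h Ax) w2).
Qed.

Lemma L2_Rintegral f : L2 (m1 \x m2)%E (A `*` B) f ->
  L2 m1 A (fun x => \int[m2]_(y in B) f (x, y)).
Proof.
move=> f2; have := L2_hilbert_schmidt f2 (L2_cst mB fB 1).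
by apply: eq_L2 => // x Ax; apply: eq_Rintegral => y _; rewrite mulr1.
Qed.

Context d3 (T3 : measurableType d3).
Variable m3 : {sigma_finite_measure set T3 -> \bar R}.
Variable C : set T3.
Hypotheses (mC : measurable C) (fC : (m3 C < +oo)%E).

Lemma L2_mid f : L2 (m1 \x m2)%E (A `*` B) f ->
  L2 (sfprod m1 m3 \x m2)%E ((A `*` C) `*` B) (fun z => f (z.1.1, z.2)).
Proof.
move=> f2; apply/L2P; split.
  exact: L1_measurable (L1_mid mA mB mC fC (L2_L1 mAB fAB f2)).
exact: (L1_mid mA mB mC fC (L2_sqr f2)).
Qed.

Lemma L2_assoc (f : T1 * T2 * T3 -> R) :
  L2 (sfprod m1 m2 \x m3)%E ((A `*` B) `*` C) f ->
  L2 (m1 \x sfprod m2 m3)%E (A `*` (B `*` C)) (fun z => f ((z.1, z.2.1), z.2.2)).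
Proof.
move=> f2; have fABC := finite_measureX (m1 := sfprod m1 m2) mAB mC fAB fC.
apply/L2P; split.
  exact: L1_measurable (L1_assoc mA mB mC (L2_L1 (measurableX mAB mC) fABC f2)).
exact: (L1_assoc mA mB mC (L2_sqr f2)).
Qed.

End L2_product_operations.

Section weighted_fubini.
Context d1 d2 (T1 : measurableType d1) (T2 : measurableType d2) (R : realType).
Variable m1 : {sigma_finite_measure set T1 -> \bar R}.
Variable m2 : {sigma_finite_measure set T2 -> \bar R}.
Variables (A : set T1) (B : set T2).
Hypotheses (mA : measurable A) (mB : measurable B).

(** Multipliers that preserve both [L1] and [L2]. On bounded domains polynomials, test functions,
    indicators and primitives are of this kind. *)
Definition bmeas d (T : measurableType d) (D : set T) (f : T -> R) :=
  measurable_fun D f /\ exists C : R, forall x, D x -> `|f x| <= C.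

Lemma L1_bmeas d (T : measurableType d) (mu : {measure set T -> \bar R})
    (D : set T) (f g : T -> R) : measurable D ->
  L1 mu D f -> bmeas D g -> L1 mu D (fun x => f x * g x).
Proof.
move=> mD fi [mg [C gC]]; apply: (@L1_le _ _ _ mu D mD _ (fun x => C * `|f x|)).
- by apply: measurable_funM => //; exact: L1_measurable fi.
- exact: (L1Z mD _ (L1_norm fi)).
- by move=> x Dx; rewrite normrM mulrC ler_wpM2r// gC.
Qed.

Lemma L2_bmeas d (T : measurableType d) (mu : {measure set T -> \bar R})
    (D : set T) (f g : T -> R) : measurable D ->
  L2 mu D f -> bmeas D g -> L2 mu D (fun x => f x * g x).
Proof.
move=> mD f2 [mg [C gC]].
by apply: eq_L2 (L2_bounded_mul mD mg gC f2) => // x _; rewrite mulrC.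
Qed.

Lemma bmeasM d (T : measurableType d) (D : set T) (f g : T -> R) :
  bmeas D f -> bmeas D g -> bmeas D (fun x => f x * g x).
Proof.
move=> [mf [C fC]] [mg [C' gC]]; split; first exact: measurable_funM.
by exists (C * C') => x Dx; rewrite normrM ler_pM ?fC ?gC.
Qed.

Lemma bmeasD d (T : measurableType d) (D : set T) (f g : T -> R) :
  bmeas D f -> bmeas D g -> bmeas D (fun x => f x + g x).
Proof.
move=> [mf [C fC]] [mg [C' gC]]; split; first exact: measurable_funD.
by exists (C + C') => x Dx; rewrite (le_trans (ler_normD _ _))// lerD ?fC ?gC.
Qed.

Lemma bmeas_cst d (T : measurableType d) (D : set T) k : bmeas D (fun=> k).
Proof. by split; [exact: measurable_cst|exists `|k|]. Qed.

Lemma bmeas_sum d (T : measurableType d) (D : set T) I (s : seq I) (F : I -> T -> R) :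
  (forall i, bmeas D (F i)) -> bmeas D (fun x => \sum_(i <- s) F i x).
Proof.
move=> FI; elim: s => [|i s ih].
  rewrite (_ : (fun x => _) = fun=> 0); first exact: bmeas_cst.
  by apply/funext => x; rewrite big_nil.
rewrite (_ : (fun x => _) = fun x => F i x + \sum_(j <- s) F j x).
  exact: bmeasD.
by apply/funext => x; rewrite big_cons.
Qed.

Lemma bmeas_indic d (T : measurableType d) (D E : set T) : measurable E ->
  bmeas D (\1_E : T -> R).
Proof.
move=> mE; split; first exact: measurable_indic.
by exists 1 => x _; rewrite indicE; case: (_ \in _); rewrite ?normr0 ?normr1.
Qed.

Lemma bmeas_fst f : bmeas A f -> bmeas (A `*` B) (fun z : T1 * T2 => f z.1).
Proof.
move=> [mf [C fC]]; split; last by exists C => z [Az _]; exact: fC.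
apply: (measurable_comp mA _ mf); last exact: measurable_funTS.
by move=> _ [z [Az _] <-].
Qed.

Lemma bmeas_snd f : bmeas B f -> bmeas (A `*` B) (fun z : T1 * T2 => f z.2).
Proof.
move=> [mf [C fC]]; split; last by exists C => z [_ Bz]; exact: fC.
apply: (measurable_comp mB _ mf); last exact: measurable_funTS.
by move=> _ [z [_ Bz] <-].
Qed.

Variable h : T1 * T2 -> R.
Hypothesis hi : L1 (m1 \x m2)%E (A `*` B) h.
Variables (u : T1 -> R) (v : T2 -> R).

Let mAB : measurable (A `*` B).
Proof. exact: measurableX. Qed.

Lemma L1_weighted_fubini1 : bmeas B v ->
  L1 m1 A (fun x => \int[m2]_(y in B) (h (x, y) * v y)).
Proof. by move=> bv; have := L1_fubini1 mA mB (L1_bmeas mAB hi (bmeas_snd bv)). Qed.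

Lemma L1_weighted_fubini2 : bmeas A u ->
  L1 m2 B (fun y => \int[m1]_(x in A) (h (x, y) * u x)).
Proof. by move=> bu; have := L1_fubini2 mA mB (L1_bmeas mAB hi (bmeas_fst bu)). Qed.

(** On almost every section [u x] is a constant factor, so testing with a product amounts to testing
    in [y] and then pairing the resulting function of [x] with [u]. This reduces two-dimensional
    tests to one-dimensional ones. *)
Lemma Rweighted_fubini1 : bmeas A u -> bmeas B v ->
  \int[(m1 \x m2)%E]_(z in A `*` B) (h z * (u z.1 * v z.2)) =
  \int[m1]_(x in A) (\int[m2]_(y in B) (h (x, y) * v y) * u x).
Proof.
move=> bu bv; have uv := bmeasM (bmeas_fst bu) (bmeas_snd bv).
have hv := L1_bmeas mAB hi (bmeas_snd bv).
rewrite (Rfubini1 mA mB (L1_bmeas mAB hi uv)).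
apply: ae_eq_Rintegral => //.
- exact: L1_measurable (L1_fubini1 mA mB (L1_bmeas mAB hi uv)).
- apply: measurable_funM; last by case: bu.
  exact: L1_measurable (L1_fubini1 mA mB hv).
- apply: filterS (L1_section1 mA mB hv) => x /= hx Ax.
  rewrite -RintegralZr//; last exact: hx.
  by apply: eq_Rintegral => y _; rewrite mulrA mulrAC.
Qed.

Lemma Rweighted_fubini2 : bmeas A u -> bmeas B v ->
  \int[(m1 \x m2)%E]_(z in A `*` B) (h z * (u z.1 * v z.2)) =
  \int[m2]_(y in B) (\int[m1]_(x in A) (h (x, y) * u x) * v y).
Proof.
move=> bu bv; have uv := bmeasM (bmeas_fst bu) (bmeas_snd bv).
have hv := L1_bmeas mAB hi (bmeas_fst bu).
rewrite (Rfubini2 mA mB (L1_bmeas mAB hi uv)).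
apply: ae_eq_Rintegral => //.
- exact: L1_measurable (L1_fubini2 mA mB (L1_bmeas mAB hi uv)).
- apply: measurable_funM; last by case: bv.
  exact: L1_measurable (L1_fubini2 mA mB hv).
- apply: filterS (L1_section2 mA mB hv) => y /= hy By.
  rewrite -RintegralZr//; last exact: hy.
  by apply: eq_Rintegral => x _; rewrite mulrA.
Qed.

End weighted_fubini.

(** * Test functions and the fundamental lemma *)

Section smooth_functions.
Variable R : realType.
Implicit Types f g : R -> R.

(** Continuity of the last derivative is not asked for: in [smooth1] the next order supplies it. *)
Fixpoint Cn (n : nat) f : Prop :=
  if n is m.+1 then
    exists g, (forall x : R, is_derive x 1 f (g x)) /\ Cn m g
  else True.

Definition smooth1 f := forall n, Cn n f.

Lemma CnW n f : Cn n.+1 f -> Cn n f.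
Proof. by elim: n f => // n ih f [g [fg /ih gn]]; exists g. Qed.

Lemma CnD n f g : Cn n f -> Cn n g -> Cn n (fun x => f x + g x).
Proof.
elim: n f g => // n ih f g [f' [df Cf']] [g' [dg Cg']].
by exists (fun x => f' x + g' x); split; [move=> x; exact: is_deriveD|exact: ih].
Qed.

Lemma CnZ n k f : Cn n f -> Cn n (fun x => k * f x).
Proof.
elim: n f => // n ih f [f' [df Cf']].
by exists (fun x => k * f' x); split; [move=> x; exact: is_deriveZ|exact: ih].
Qed.

Lemma CnM n f g : Cn n f -> Cn n g -> Cn n (fun x => f x * g x).
Proof.
elim: n f g => // n ih f g [f' [df Cf']] [g' [dg Cg']].
exists (fun x => f x * g' x + g x * f' x); split.
  by move=> x; exact: (is_deriveM (df x) (dg x)).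
by apply: CnD; apply: ih => //; apply: CnW; [exists f'|exists g'].
Qed.

Lemma Cn_affine n f (k l : R) : Cn n f -> Cn n (fun x => f (k * x + l)).
Proof.
elim: n f => // n ih f [f' [df Cf']].
exists (fun x => k * f' (k * x + l)); split; last by apply: CnZ; exact: ih.
move=> x; rewrite mulrC; apply: is_derive1_comp => //.
have -> : (fun x : R => k * x + l) = (fun x => k * x + cst l x) by [].
have h : is_derive x 1 (fun x : R => k * x) k.
  have := is_deriveZ k (is_derive_id x 1).
  by rewrite /GRing.scale /= mulr1.
by rewrite -[X in is_derive _ _ _ X]addr0; exact: is_deriveD.
Qed.

Lemma is_derive_derive1 f g : (forall x : R, is_derive x 1 f (g x)) -> (derive1 f) = g.
Proof.
by move=> fg; apply/funext => x; rewrite derive1E; case: (fg x) => _ <-.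
Qed.

Lemma smooth1_derive f : smooth1 f -> smooth1 (derive1 f).
Proof.
move=> fs n; have [g [fg Cg]] := fs n.+1.
by rewrite (is_derive_derive1 fg).
Qed.

Lemma smooth1_is_derive f (x : R) : smooth1 f -> is_derive x 1 f ((derive1 f) x).
Proof. by move=> fs; have [g [fg _]] := fs 1%N; rewrite (is_derive_derive1 fg). Qed.

Lemma smooth1_derivable f (x : R) : smooth1 f -> derivable f x 1.
Proof. by move=> /(smooth1_is_derive x)[]. Qed.

Lemma smooth1_continuous f : smooth1 f -> continuous f.
Proof.
move=> fs x; apply: differentiable_continuous; apply/derivable1_diffP.
exact: smooth1_derivable.
Qed.

Lemma smooth1M f g : smooth1 f -> smooth1 g -> smooth1 (fun x => f x * g x).
Proof. by move=> fs gs n; exact: CnM. Qed.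

Lemma smooth1D f g : smooth1 f -> smooth1 g -> smooth1 (fun x => f x + g x).
Proof. by move=> fs gs n; exact: CnD. Qed.

Lemma smooth1Z k f : smooth1 f -> smooth1 (fun x => k * f x).
Proof. by move=> fs n; exact: CnZ. Qed.

Lemma smooth1_affine k l f : smooth1 f -> smooth1 (fun x => f (k * x + l)).
Proof. by move=> fs n; exact: Cn_affine. Qed.

(** The flat function [t^-k e^(-1/t)], extended by 0. The powers [t^-k] are included because the
    derivatives of [e^(-1/t)] are linear combinations of these functions, so that smoothness follows
    by one induction over the family. *)
Definition psi (k : nat) (t : R) : R :=
  if 0 < t then (t^-1) ^+ k * expR (- t^-1) else 0.

Lemma psi_ge0 k t : 0 <= psi k t.
Proof.
rewrite /psi; case: ifPn => // t0.
by rewrite mulr_ge0 ?expR_ge0// exprn_ge0// invr_ge0 ltW.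
Qed.

Lemma psi0_le1 t : psi 0 t <= 1.
Proof.
rewrite /psi; case: ifPn => // t0; rewrite mul1r expR_le1.
by rewrite oppr_le0 invr_ge0 ltW.
Qed.

(** The term of degree [k + 2] of the exponential series gives [s^(k+2) / (k+2)! <= e^s] at
    [s = 1/t]. Two spare powers of [t] are kept so that the difference quotient at 0 tends to 0. *)
Lemma psi_bound k t : `|psi k t| <= (k.+2)`!%:R * t ^+ 2.
Proof.
rewrite ger0_norm ?psi_ge0// /psi; case: ifPn => t0; last first.
  by rewrite mulr_ge0// sqr_ge0.
have ti : 0 <= t^-1 by rewrite invr_ge0 ltW.
have := expR_ge1Dxn k.+1 ti => h.
have {}h : t^-1 ^+ k.+2 / (k.+2)`!%:R <= expR t^-1.
  by apply: le_trans h; rewrite lerDr.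
rewrite expRN ler_pdivrMr ?expR_gt0//.
rewrite ler_pdivrMr ?ltr0n ?fact_gt0// in h.
rewrite -(ler_pM2l (x := t^-1 ^+ 2)) ?exprn_gt0 ?invr_gt0//.
rewrite -exprD (_ : (2 + k = k.+2)%N)//; apply: (le_trans h).
rewrite le_eqVlt; apply/orP; left; apply/eqP.
by rewrite exprVn; field; rewrite gt_eqF.
Qed.

Lemma is_derive_psi k (t : R) : is_derive t 1 (psi k) (psi k.+2 t - k%:R * psi k.+1 t).
Proof.
have [t0|t0|->] := ltrgt0P t.
- have dinv : is_derive t 1 (fun t : R => t^-1) (- (t ^- 2)).
    have := is_deriveV (f := id) (lt0r_neq0 t0) (is_derive_id t 1).
    by rewrite /GRing.scale/= mulr1.
  have dexp : is_derive t 1 (fun t => expR (- t^-1)) (expR (- t^-1) * t ^- 2).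
    apply: (is_derive1_comp (f := expR)).
    by rewrite -[X in is_derive _ _ _ X]opprK; exact: is_deriveN.
  have dX : is_derive t 1 (fun t => (t^-1) ^+ k) (- k%:R * (t^-1) ^+ k.+1).
    have -> : (fun t : R => (t^-1) ^+ k) = (fun t : R => t^-1) ^+ k.
      by apply/funext => s; rewrite exprfctE.
    apply: (is_derive_eq (is_deriveX k dinv)).
    rewrite /GRing.scale /=; case: k => [|k]; first by rewrite !mul0r oppr0 mul0r.
    by rewrite /= -exprVn !exprS expr0; ring.
  have := is_deriveM dX dexp => h.
  apply: is_derive_eq.
    apply: near_eq_is_derive h; near=> s; rewrite /psi ifT//.
    by near: s; exact: lt_nbhsr.
  rewrite /psi t0 /GRing.scale /= -!exprVn !exprS expr0.
  by ring.
- rewrite /psi !ifF ?mulr0 ?subr0; [|by apply/negP => /(lt_trans t0); rewrite ltxx..].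
  have h : is_derive t 1 (cst (0 : R)) 0 by exact: is_derive_cst.
  apply: near_eq_is_derive h; near=> s; rewrite /psi ifF//; apply/negbTE; rewrite -leNgt ltW//.
  by near: s; exact: lt_nbhsl.
- rewrite /psi ltxx mulr0 subr0.
  (* By [psi_bound] the difference quotient at 0 is at most [(k+2)! |h|] in absolute value. *)
  have cv : (fun h : R => h^-1 *: ((psi k \o shift 0) (h *: 1) - psi k 0)) @ 0^' --> (0 : R).
    apply/cvgr0Pnorm_le => e e0.
    near=> h.
    have h0 : h != 0 by near: h; exact: nbhs_dnbhs_neq.
    rewrite /= /GRing.scale /= mulr1 addr0 [X in _ - X]/psi ltxx subr0 normrM normfV.
    rewrite ler_pdivrMl ?normr_gt0//; apply: (le_trans (psi_bound k h)).
    rewrite -real_normK ?num_real// expr2 mulrA mulrC ler_wpM2l//.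
    rewrite -ler_pdivlMl ?ltr0n ?fact_gt0//.
    near: h; apply: nbhs_dnbhs.
    apply: (@nbhs0_le _ R^o); rewrite mulr_gt0// invr_gt0 ltr0n fact_gt0//.
  apply: DeriveDef; first by apply/cvg_ex; exists 0.
  by apply/cvg_lim => //; exact: Rhausdorff.
Unshelve. all: by end_near. Qed.

Lemma smooth1_psi k : smooth1 (psi k).
Proof.
move=> n; elim: n k => // n ih k.
exists (fun t => psi k.+2 t + (- k%:R) * psi k.+1 t); split.
  by move=> t; rewrite mulNr; exact: is_derive_psi.
by apply: CnD => //; exact: CnZ.
Qed.

End smooth_functions.

Lemma Rdominated_convergence d (T : measurableType d) (R : realType)
    (mu : {measure set T -> \bar R}) (D : set T) (f_ : nat -> T -> R) (f g : T -> R) :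
  measurable D -> (forall n, measurable_fun D (f_ n)) -> measurable_fun D f ->
  (forall x, D x -> f_ ^~ x @ \oo --> f x) -> L1 mu D g ->
  (forall n x, D x -> `|f_ n x| <= g x) ->
  (fun n => \int[mu]_(x in D) f_ n x) @ \oo --> \int[mu]_(x in D) f x.
Proof.
move=> mD mf_ mf cf gi fg.
have := @dominated_convergence _ _ _ mu D mD (fun n => EFin \o f_ n) (EFin \o f)
  (EFin \o g).
case.
- by move=> n; exact/measurable_EFinP.
- exact/measurable_EFinP.
- by apply: aeW => x Dx; apply: cvg_EFin; [exact: nearW|exact: cf].
- by [].
- by apply: aeW => x n Dx; rewrite lee_fin fg.
move=> fi _ cv; apply: fine_cvg.
by rewrite fineK; [exact: cv|exact: integrable_fin_num].
Qed.

Section test_functions.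
Variable R : realType.
Implicit Types (a b c d p q : R) (f alpha beta : R -> R).

(** The support lies in a closed segment inside the open interval, the one-dimensional form of the
    closure condition in [test_function]. *)
Definition test1 a b alpha := smooth1 alpha /\
  exists p q, [/\ a < p, q < b & forall x, alpha x != 0 -> p <= x <= q].

Definition tensor alpha beta : R * R -> R := fun z => alpha z.1 * beta z.2.

Lemma pdx_tensor alpha beta : smooth1 alpha ->
  pdx (tensor alpha beta) = tensor (derive1 alpha) beta.
Proof.
move=> sa; apply/funext => -[x y]; rewrite /pdx /tensor /=.
have h : forall x : R, is_derive x 1 (fun t => alpha t * beta y) (derive1 alpha x * beta y).
  move=> t; rewrite mulrC (_ : (fun t => _) = (fun t => beta y * alpha t)); last first.
    by apply/funext => s; rewrite mulrC.
  exact: is_deriveZ (smooth1_is_derive _ sa).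
by rewrite (is_derive_derive1 h).
Qed.

Lemma pdy_tensor alpha beta : smooth1 beta ->
  pdy (tensor alpha beta) = tensor alpha (derive1 beta).
Proof.
move=> sb; apply/funext => -[x y]; rewrite /pdy /tensor /=.
have h : forall y : R, is_derive y 1 (fun t => alpha x * beta t) (alpha x * derive1 beta y).
  by move=> t; exact: is_deriveZ (smooth1_is_derive _ sb).
by rewrite (is_derive_derive1 h).
Qed.

(** Any word of partial derivations sends a tensor product of smooth functions to another one, so
    the induction never leaves this class. *)
Lemma smooth_tensor alpha beta : smooth1 alpha -> smooth1 beta ->
  smooth (tensor alpha beta).
Proof.
move=> sa sb s /=.
have : exists alpha' beta', [/\ smooth1 alpha', smooth1 beta' &
    foldr (fun e : bool => if e then (@pdx R) else (@pdy R)) (tensor alpha beta) s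
    = tensor alpha' beta'].
  elim: s => [|e s /= [al [be [sal sbe ->]]]]; first by exists alpha, beta.
  case: e.
    by exists (derive1 al), be; split => //; [exact: smooth1_derive|rewrite pdx_tensor].
  by exists al, (derive1 be); split => //; [exact: smooth1_derive|rewrite pdy_tensor].
move=> [al [be [sal sbe ->]]]; split.
  move=> z; apply: cvgM.
    by apply: continuous_comp; [exact: cvg_fst|exact: smooth1_continuous].
  by apply: continuous_comp; [exact: cvg_snd|exact: smooth1_continuous].
move=> x y; rewrite /tensor /=; split.
  rewrite (_ : (fun t => _) = (fun t => be y * al t)); last first.
    by apply/funext => t; rewrite mulrC.
  exact/smooth1_derivable/smooth1Z.
exact/smooth1_derivable/smooth1Z.
Qed.

Lemma test_tensor a b c d alpha beta : test1 a b alpha -> test1 c d beta ->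
  test_function a b c d (tensor alpha beta).
Proof.
move=> [sa [p [q [ap qb apq]]]] [sb [r [s [cr sd brs]]]].
split; first exact: smooth_tensor.
have cl : closed (`[p, q] `*` `[r, s] : set (R * R)).
  rewrite (_ : _ `*` _ = (fst @^-1` `[p, q]) `&` (snd @^-1` `[r, s])); last first.
    by apply/seteqP; split => z [].
  apply: closedI; apply: preimage_closed; try exact: itv_closed.
      by move=> z _; exact: cvg_fst.
    by move=> z _; exact: cvg_snd.
apply: subset_trans.
  apply: (@closure_subset _ _ (`[p, q] `*` `[r, s])).
  move=> z /=; rewrite /tensor mulf_eq0 negb_or => /andP[az bz].
  by split; rewrite /= in_itv/= ?apq ?brs.
rewrite -((closure_id _).1 cl) => z /= [+ +]; rewrite !in_itv/= => /andP[h1 h2] /andP[h3 h4].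
split.
  by rewrite (lt_le_trans ap h1) (le_lt_trans h2 qb).
by rewrite (lt_le_trans cr h3) (le_lt_trans h4 sd).
Qed.

(** The factor [n + 1] keeps the support at distance [1/(n+1)] from [p] and [q] and at the same time
    drives the exponents to 0, so these functions tend to the indicator of []p, q[]. *)
Definition bump p q (n : nat) (x : R) : R :=
  psi 0 (n.+1%:R * (x - p) - 1) * psi 0 (n.+1%:R * (q - x) - 1).

Lemma bump_ge0 p q n x : 0 <= bump p q n x.
Proof. by rewrite mulr_ge0// psi_ge0. Qed.

Lemma bump_le1 p q n x : bump p q n x <= 1.
Proof. by rewrite mulr_ile1 ?psi_ge0 ?psi0_le1. Qed.

Lemma smooth1_bump p q n : smooth1 (bump p q n).
Proof.
apply: smooth1M.
  have := smooth1_affine n.+1%:R (- n.+1%:R * p - 1) (@smooth1_psi R 0).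
  by congr smooth1; apply/funext => x; congr psi; ring.
have := smooth1_affine (- n.+1%:R) (n.+1%:R * q - 1) (@smooth1_psi R 0).
by congr smooth1; apply/funext => x; congr psi; ring.
Qed.

Lemma bump_neq0 p q n x : bump p q n x != 0 -> p + n.+1%:R^-1 <= x <= q - n.+1%:R^-1.
Proof.
rewrite /bump mulf_eq0 negb_or /psi; case: ifPn; last by rewrite eqxx.
case: ifPn; last by rewrite eqxx andbF.
move=> h1 h2 _; rewrite subr_gt0 mulrC -ltr_pdivrMr ?ltr0n// div1r in h1.
rewrite subr_gt0 mulrC -ltr_pdivrMr ?ltr0n// div1r in h2.
by move: h1 h2; set e := n.+1%:R^-1 => h1 h2; apply/andP; split; lra.
Qed.

Lemma test1_bump a b p q n : a <= p -> q <= b -> test1 a b (bump p q n).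
Proof.
move=> ap qb; split; first exact: smooth1_bump.
have n0 : 0 < n.+1%:R^-1 :> R by rewrite invr_gt0 ltr0n.
exists (p + n.+1%:R^-1), (q - n.+1%:R^-1); split; last exact: bump_neq0.
  by move: n0; set e := n.+1%:R^-1 => n0; lra.
by move: n0; set e := n.+1%:R^-1 => n0; lra.
Qed.

Lemma cvg_psi0 (t : R) : 0 < t -> (fun n => psi 0 (n.+1%:R * t - 1)) @ \oo --> (1 : R).
Proof.
move=> t0.
have cs : (fun n : nat => n.+1%:R * t - 1) @ \oo --> +oo.
  apply/cvgryPge => A; near=> n.
  rewrite lerBrDr -ler_pdivrMr//.
  apply: (@le_trans _ _ n%:R); last by rewrite ler_nat.
  by near: n; exact: nbhs_infty_ger.
have cs0 : \forall n \near \oo, 0 < n.+1%:R * t - 1 by move/cvgryPgt : cs; exact.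
have cv : (fun n : nat => (n.+1%:R * t - 1)^-1) @ \oo --> (0 : R).
  apply/gtr0_cvgV0 => //.
rewrite -[X in _ --> X]expR0 -[X in expR X]oppr0.
have : (fun n : nat => expR (- (n.+1%:R * t - 1)^-1)) @ \oo --> expR (- 0 : R).
  by apply: continuous_cvg; [exact: continuous_expR|exact: cvgN].
apply: cvg_trans; apply: near_eq_cvg; near=> n.
rewrite /psi ifT ?mul1r//.
by near: n; exact: cs0.
Unshelve. all: by end_near. Qed.

Lemma cvg_bump p q x : (fun n => bump p q n x) @ \oo --> (\1_(`]p, q[) x : R).
Proof.
rewrite indicE; have [/set_mem/=|xpq] := boolP (x \in _).
  rewrite in_itv/= => /andP[px xq]; rewrite -[X in _ --> X]mulr1.
  by apply: cvgM; apply: cvg_psi0; rewrite subr_gt0.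
rewrite (_ : (fun n => _) = fun=> 0); first exact: cvg_cst.
apply/funext => n; apply/eqP; apply: contraNT xpq => /bump_neq0/andP[h1 h2].
apply/mem_set; rewrite /= in_itv/=.
have n0 : 0 < n.+1%:R^-1 :> R by rewrite invr_gt0 ltr0n.
by move: n0 h1 h2; set e := n.+1%:R^-1 => n0 h1 h2; apply/andP; split; lra.
Qed.

Lemma measurable_smooth1 (D : set R) f : smooth1 f -> measurable_fun D f.
Proof.
by move=> /smooth1_continuous/continuous_measurable_fun; exact: measurable_funTS.
Qed.

Lemma smooth1_bounded a b f : smooth1 f -> exists C : R, forall x, `[a, b]%classic x -> `|f x| <= C.
Proof.
move=> /smooth1_continuous cf.
have : compact (f @` `[a, b]).
  by apply: continuous_compact; [exact: continuous_subspaceT|exact: segment_compact].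
move=> /compact_bounded [M [_ HM]]; exists (M + 1) => x xab.
by apply: (HM (M + 1)); [rewrite ltrDl|exists x].
Qed.

End test_functions.

(** * The fundamental lemma of the calculus of variations *)

Section fundamental_lemma.
Variable R : realType.
Local Notation mu := (@lebesgue_measure R).
Implicit Types (a b c d : R).

Lemma measurable_segment a b : measurable (`[a, b]%classic : set (measurableTypeR R)).
Proof. exact: measurable_itv. Qed.

Lemma segment_lty a b : (mu `[a, b]%classic < +oo)%E.
Proof. by rewrite lebesgue_measure_itv/=; case: ifPn => // _; rewrite -EFinB ltry. Qed.

Lemma L1_mul_smooth1 a b (f alpha : R -> R) : L1 mu `[a, b] f -> smooth1 alpha ->
  L1 mu `[a, b] (fun x => f x * alpha x).
Proof.
move=> fi sa; have [C hC] := smooth1_bounded a b sa.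
have mab := measurable_segment a b.
apply: (L1_le mab (g := fun x => C * `|f x|)).
- apply: measurable_funM; first exact: L1_measurable fi.
  exact: measurable_smooth1.
- exact: (L1Z mab _ (L1_norm fi)).
- by move=> x xab; rewrite normrM mulrC ler_wpM2r// hC.
Qed.

(** By Lebesgue differentiation the extension of [f] by zero is almost everywhere the derivative of
    its primitive from -oo, which is constantly 0. *)
Lemma L1_eq0_primitive a b (f : R -> R) : L1 mu `[a, b] f ->
  (forall q, a <= q <= b -> \int[mu]_(x in `[a, q]) f x = 0) ->
  f = (fun=> 0) %[ae mu in `[a, b]%classic].
Proof.
move=> fi f0; have mab := measurable_segment a b.
have gi : L1 mu setT (f \_ `[a, b]).
  exact: ((L1_patchP mu f mab).1 fi).
have F0 y : \int[mu]_(t in `]-oo, y]) (f \_ `[a, b]) t = 0.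
  rewrite -Rintegral_mkcondr; have [yb|by_] := leP y b.
    rewrite (_ : _ `&` _ = `[a, y]%classic); last first.
      by apply/seteqP; split => x /=; rewrite !in_itv/=; lra.
    have [ay|ya] := leP a y; first by apply: f0; rewrite ay.
    by rewrite set_itv_ge ?Rintegral_set0// bnd_simp -ltNge.
  rewrite (_ : _ `&` _ = `[a, b]%classic); last first.
    by apply/seteqP; split => x /=; rewrite !in_itv/=; lra.
  have [ab|ba] := leP a b; first by apply: f0; rewrite ab lexx.
  by rewrite set_itv_ge ?Rintegral_set0// bnd_simp -ltNge.
have gl : locally_integrable [set: R] (f \_ `[a, b]).
  split; [exact: L1_measurable gi|exact: openT|].
  move=> K _ cK; have /integrableP[_] : L1 mu K (f \_ `[a, b]).
    by apply: L1_subset gi => //; exact: compact_measurable.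
  by [].
have gy y : mu.-integrable `]-oo, y] (EFin \o (f \_ `[a, b])).
  apply: (@L1_subset _ _ _ mu _ measurableT _ _ _ _ gi) => //.
have := FTC1Ny gy gl.
apply: filterS; first exact: (ae_filter_ringOfSetsType mu).
move=> x /= [_ +] xab.
rewrite (_ : (fun x => _) = cst 0) ?derive1_cst; last by apply/funext => y; rewrite F0.
by rewrite patchE mem_set.
Qed.

(** The bumps on []a, q[] tend to its indicator under the bound [|f|], so dominated convergence
    makes every integral of [f] over [[a, q]] vanish. *)
Lemma fundamental_lemma1 a b (f : R -> R) : L1 mu `[a, b] f ->
  (forall alpha, test1 a b alpha -> \int[mu]_(x in `[a, b]) (f x * alpha x) = 0) ->
  f = (fun=> 0) %[ae mu in `[a, b]%classic].
Proof.
move=> fi f0; apply: L1_eq0_primitive => // q /andP[aq qb].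
have mab := measurable_segment a b.
have cv : (fun n => \int[mu]_(x in `[a, b]) (f x * bump a q n x)) @ \oo -->
    \int[mu]_(x in `[a, b]) (f x * \1_(`]a, q[) x).
  apply: (@Rdominated_convergence _ _ _ mu _ (fun n x => f x * bump a q n x)
    (fun x => f x * \1_(`]a, q[) x) (fun x => `|f x|) mab).
  - by move=> n; apply: L1_measurable (L1_mul_smooth1 fi (smooth1_bump _ _ _)).
  - apply: measurable_funM; first exact: L1_measurable fi.
    exact: measurable_indic.
  - by move=> x _; apply: cvgMr; exact: cvg_bump.
  - exact: L1_norm.
  - move=> n x _; rewrite normrM ler_piMr// ger0_norm ?bump_ge0//.
    exact: bump_le1.
have /(cvg_unique (@Rhausdorff R)) := cv => /(_ 0) h.
have {h} : \int[mu]_(x in `[a, b]) (f x * \1_(`]a, q[) x) = 0.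
  apply: h; rewrite (_ : (fun n => _) = fun=> 0); first exact: cvg_cst.
  by apply/funext => n; apply: f0; exact: test1_bump.
rewrite (_ : (fun x => _) = f \_ `]a, q[); last first.
  by apply/funext => x; rewrite patchE indicE; case: ifPn; rewrite ?mulr1 ?mulr0.
rewrite -Rintegral_mkcondr (_ : _ `&` _ = `]a, q[%classic); last first.
  by apply/seteqP; split => x /=; rewrite !in_itv/=; lra.
rewrite Rintegral_itv_bndo_bndc; last first.
  apply: L1_subset fi => // x /=; rewrite !in_itv/=; lra.
rewrite Rintegral_itv_obnd_cbnd//.
by apply: L1_subset fi => // x /=; rewrite !in_itv/=; lra.
Qed.

Variables a b c d : R.
Local Notation Q := (rect a b c d).

Lemma measurable_rect : measurable (Q : set (measurableTypeR R * measurableTypeR R)).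
Proof. by apply: measurableX; exact: measurable_segment. Qed.

Lemma rect_lty : (mu2 R Q < +oo)%E.
Proof.
apply: finite_measureX; by [exact: measurable_segment|exact: segment_lty].
Qed.

Lemma bmeas_smooth1 p q alpha : smooth1 alpha ->
  bmeas (`[p, q]%classic : set (measurableTypeR R)) alpha.
Proof.
by move=> sa; split; [exact: measurable_smooth1|exact: smooth1_bounded].
Qed.

(** The null set off which [\int h(x, y) beta(y) dy] vanishes depends on [beta], so sections cannot
    be treated one by one. Instead the two one-dimensional lemmas are chained through integrals:
    [alpha] is replaced by an indicator [\1_E], then [beta] by [\1_F]. A Dynkin argument passes from
    the products of [E] and [F] to all measurable sets. *)
Lemma fundamental_lemma2 (h : R * R -> R) : L1 (mu2 R) Q h ->
  (forall alpha beta, test1 a b alpha -> test1 c d beta ->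
     \int[mu2 R]_(z in Q) (h z * tensor alpha beta z) = 0) ->
  h = (fun=> 0) %[ae mu2 R in Q].
Proof.
move=> hi h0.
have mab := measurable_segment a b; have mcd := measurable_segment c d.
have mQ := measurable_rect.
have Hb beta : test1 c d beta ->
    (fun x => \int[mu]_(y in `[c, d]) (h (x, y) * beta y)) = (fun=> 0) %[ae mu in `[a, b]%classic].
  move=> tb; have bb := bmeas_smooth1 c d tb.1.
  apply: fundamental_lemma1; first exact: (L1_weighted_fubini1 mab mcd hi bb).
  move=> alpha ta; have ba := bmeas_smooth1 a b ta.1.
  by rewrite -(Rweighted_fubini1 mab mcd hi ba bb); exact: h0.
have KE (E : set (measurableTypeR R)) : measurable E ->
    (fun y => \int[mu]_(x in `[a, b]) (h (x, y) * \1_E x)) = (fun=> 0) %[ae mu in `[c, d]%classic].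
  move=> mE; have bE := bmeas_indic R `[a, b]%classic mE.
  apply: fundamental_lemma1; first exact: (L1_weighted_fubini2 mab mcd hi bE).
  move=> beta tb; have bb := bmeas_smooth1 c d tb.1.
  rewrite -(Rweighted_fubini2 mab mcd hi bE bb) (Rweighted_fubini1 mab mcd hi bE bb).
  rewrite -[RHS](mul0r (fine (mu `[a, b]%classic))) -(Rintegral_cst mu mab 0).
  apply: ae_eq_Rintegral => //.
    apply: measurable_funM; last by case: bE.
    exact: L1_measurable (L1_weighted_fubini1 mab mcd hi bb).
  by apply: aeS (Hb _ tb) => x h1 xab; rewrite h1// mul0r.
have EF (E F : set (measurableTypeR R)) : measurable E -> measurable F ->
    \int[mu2 R]_(z in Q) (h z * (\1_E z.1 * \1_F z.2)) = 0.
  move=> mE mF; have bE := bmeas_indic R `[a, b]%classic mE; have bF := bmeas_indic R `[c, d]%classic mF.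
  rewrite (Rweighted_fubini2 mab mcd hi bE bF).
  rewrite -[RHS](mul0r (fine (mu `[c, d]%classic))) -(Rintegral_cst mu mcd 0).
  apply: ae_eq_Rintegral => //.
    apply: measurable_funM; last by case: bF.
    exact: L1_measurable (L1_weighted_fubini2 mab mcd hi bE).
  by apply: aeS (KE _ mE) => x h1 xab; rewrite h1// mul0r.
pose M2 := (measurableTypeR R * measurableTypeR R)%type.
pose P (S : set M2) := \int[mu2 R]_(z in Q `&` S) h z = 0.
have hQS (S : set M2) : measurable S -> L1 (mu2 R) (Q `&` S) h.
  move=> mS; apply: (L1_subset mQ _ _ hi); last by move=> z [].
  exact: measurableI.
have PG (E F : set (measurableTypeR R)) : measurable E -> measurable F -> P (E `*` F).
  move=> mE mF; rewrite /P -(EF _ _ mE mF) Rintegral_mkcondr.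
  apply: eq_Rintegral => z _; rewrite patchE !indicE.
  rewrite (_ : (z \in E `*` F) = (z.1 \in E) && (z.2 \in F)); last first.
    by apply/idP/andP => [/set_mem[? ?]|[/set_mem ? /set_mem ?]]; [split; exact/mem_set|exact/mem_set].
  by case: (_ \in E); case: (_ \in F); rewrite ?(mulr1, mulr0, mul0r).
have PS (S : set M2) : measurable S -> P S.
  move=> mS; have : <<s [set A `*` B | A in measurable & B in measurable] >> S.
    by rewrite -measurable_prod_measurableType.
  apply: dynkin_induction.
  - exact: measurable_prod_measurableType.
  - move=> _ _ [A mA [B mB <-]] [A' mA' [B' mB' <-]].
    exists (A `&` A'); first exact: measurableI.
    by exists (B `&` B'); [exact: measurableI|rewrite setXI].
  - by rewrite -setXTT; exact: PG.
  - by move=> _ [A mA [B mB <-]]; exact: PG.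
  - move=> S' mS' PS'; rewrite /P.
    have : \int[mu2 R]_(z in Q) h z = 0.
      have := PG setT setT measurableT measurableT.
      by rewrite /P setXTT setIT.
    rewrite -{1}(setIT Q) -(setUv S') setIUr Rintegral_setU.
    + by rewrite PS' add0r.
    + exact: measurableI.
    + by apply: measurableI => //; exact: measurableC.
    + by rewrite -setIUr setUv setIT.
    + by apply/disj_setPS => z [[_ ?] [_ ?]].
  - move=> F mF tF PF; rewrite /P /Rintegral setI_bigcupr integral_bigcup.
    + rewrite eseries0// => i _ _; have := PF i; rewrite /P /Rintegral => PFi.
      by rewrite -[LHS]fineK ?PFi//; apply: integrable_fin_num; [exact: measurableI|exact: hQS].
    + by apply: trivIset_setIl.
    + by move=> k; exact: measurableI.
    + by rewrite -setI_bigcupr; apply: hQS; exact: bigcup_measurable.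
have := @integral_ae_eq _ _ _ (mu2 R) Q mQ (cst 0%E) (EFin \o h) hi.
case.
- exact: measurable_cst.
- move=> E EQ mE; rewrite integral0; have := PS E mE.
  rewrite /P setIidr// /Rintegral => PE.
  rewrite -[LHS]fineK ?PE//; apply: integrable_fin_num => //.
  exact: (L1_subset mQ).
- move=> N [mN N0 hN]; exists N; split => //.
  by apply: subset_trans hN => z /= + h1; apply => Qz; have [] := h1 Qz.
Qed.

End fundamental_lemma.

Lemma continuous_pair (T : topologicalType) (R : realType) (f g : T -> R) :
  continuous f -> continuous g -> continuous (fun t => (f t, g t)).
Proof.
move=> cf cg t B [[B1 B2] [/= n1 n2] sub].
apply: (@filterS2 _ (nbhs t) _ (f @^-1` B1) (g @^-1` B2)); last 2 first.
- exact: cf.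
- exact: cg.
- by move=> s ? ?; exact: sub.
Qed.

Lemma continuous_swap_plane (R : realType) : continuous (fun z : R * R => (z.2, z.1)).
Proof. by apply: continuous_pair => z; [exact: cvg_snd|exact: cvg_fst]. Qed.

Section continuous_measurable_plane.
Variable R : realType.
Local Notation MR := (measurableTypeR R).

(** Relates the product topology to the product sigma-algebra: an open set is the union of the
    countably many squares with rational centre and radius that it contains. *)
Lemma open_measurable_plane (U : set (R * R)) : open U ->
  measurable (U : set (MR * MR)).
Proof.
move=> oU.
pose b (q1 q2 r : rat) : set (MR * MR) :=
  [set z | `|ratr q1 - z.1| < (ratr r : R)] `&` [set z | `|ratr q2 - z.2| < (ratr r : R)].
pose V (q1 q2 r : rat) : set (MR * MR) := if `[< b q1 q2 r `<=` U >] then b q1 q2 r else set0.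
have -> : U = \bigcup_q1 \bigcup_q2 \bigcup_r V q1 q2 r.
  apply/seteqP; split => [z Uz|z [q1 _ [q2 _ [r _]]]]; last first.
    by rewrite /V; case: ifPn => // /asboolP; exact.
  have /nbhs_ballP[e /= e0 eU] : nbhs z U by exact: open_nbhs_nbhs.
  (* With the centre within [e / 4] of [z] and the radius between [e / 4] and [e / 2], the square
     contains [z] and stays within [3 e / 4] of it in each coordinate. *)
  have [q1 /itvP h1] := @rat_in_itvoo R (z.1 - e / 4) (z.1 + e / 4) ltac:(lra).
  have [q2 /itvP h2] := @rat_in_itvoo R (z.2 - e / 4) (z.2 + e / 4) ltac:(lra).
  have [r /itvP h3] := @rat_in_itvoo R (e / 4) (e / 2) ltac:(lra).
  have k1 : z.1 - e / 4 < ratr q1 < z.1 + e / 4 by rewrite !h1.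
  have k2 : z.2 - e / 4 < ratr q2 < z.2 + e / 4 by rewrite !h2.
  have k3 : e / 4 < ratr r < e / 2 by rewrite !h3.
  exists q1 => //; exists q2 => //; exists r => //.
  have bz : b q1 q2 r z by split => /=; rewrite ltr_norml; apply/andP; split; lra.
  rewrite /V; case: asboolP => // -[]; move=> w [/= w1 w2]; apply: eU.
  move: w1 w2; rewrite !ltr_norml => /andP[w1 w1'] /andP[w2 w2'].
  by split; rewrite /ball /= ltr_norml; apply/andP; split; lra.
apply: bigcupT_measurable_rat => q1; apply: bigcupT_measurable_rat => q2.
apply: bigcupT_measurable_rat => r; rewrite /V; case: ifPn => // _.
have mb q : measurable ([set x | `|ratr q - x| < (ratr r : R)] : set MR).
  have := @measurable_ball R (ratr q) (ratr r).
  by rewrite (_ : ball _ _ = [set x : MR | `|ratr q - x| < (ratr r : R)]).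
apply: measurableI.
  rewrite -[X in measurable X]setTI; exact: (@measurable_fst _ _ MR MR measurableT _ (mb q1)).
rewrite -[X in measurable X]setTI; exact: (@measurable_snd _ _ MR MR measurableT _ (mb q2)).
Qed.

Lemma continuous_measurable_plane (phi : R * R -> R) (D : set (MR * MR)) :
  continuous phi -> measurable_fun D phi.
Proof.
move=> /continuousP cphi; apply: measurable_funTS.
apply: (measurability _ (RGenOpens.measurableE R)).
move=> _ [_ [a [b ->] <-]]; rewrite setTI; apply: open_measurable_plane.
exact/cphi/interval_open.
Qed.

End continuous_measurable_plane.

(** * Test functions of two variables *)

Section test_function_theory.
Variable R : realType.
Local Notation mu := (@lebesgue_measure R).
Local Notation MR := (measurableTypeR R).
Implicit Type phi : R * R -> R.

(** Exchange of the coordinates. Statements in [x] are deduced from those in [y] by conjugation with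
    it, on the rectangle with its sides exchanged. *)
Definition sw (T : Type) (f : R * R -> T) : R * R -> T := fun z => f (z.2, z.1).

Lemma swK T (f : R * R -> T) : sw (sw f) = f.
Proof. by apply/funext => -[]. Qed.

Lemma continuous_sw phi : continuous phi -> continuous (sw phi).
Proof.
move=> cphi z; apply: (@continuous_comp _ _ _ (fun z : R * R => (z.2, z.1)) phi); last exact: cphi.
exact: continuous_swap_plane.
Qed.

Lemma smooth_sw phi : smooth phi -> smooth (sw phi).
Proof.
move=> sphi s /=.
have -> : foldr (fun e : bool => if e then (@pdx R) else (@pdy R)) (sw phi) s =
   sw (foldr (fun e : bool => if e then (@pdx R) else (@pdy R)) phi (map negb s)).
  by elim: s => // e s /= ->; case: e.
have [c1 c2] := sphi (map negb s); split; first exact: continuous_sw.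
by move=> x y; have [h1 h2] := c2 y x; split; [exact: h2|exact: h1].
Qed.

Lemma test_function_sw a b c d phi :
  test_function a b c d phi -> test_function c d a b (sw phi).
Proof.
move=> [sphi cphi]; split; first exact: smooth_sw.
move=> z zcl; have : closure [set z | phi z != 0] (z.2, z.1).
  move=> B nB; have nB' : nbhs z ((fun z : R * R => (z.2, z.1)) @^-1` B).
    exact: (@continuous_swap_plane R z B nB).
  by have [w [w1 w2]] := zcl _ nB'; exists (w.2, w.1).
by move=> /cphi[].
Qed.

Lemma smooth_pdy phi : smooth phi -> smooth (pdy phi).
Proof.
move=> sphi s; have := sphi (rcons s false).
by rewrite -cats1 foldr_cat.
Qed.

(** Off the closed support [phi] vanishes on a ball, hence along a vertical segment through its
    centre, and so does the derivative there. *)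
Lemma pdy_support phi :
  [set z | pdy phi z != 0] `<=` closure [set z | phi z != 0].
Proof.
move=> z /= pz; apply: contrapT => nz; move/eqP: pz; apply.
have oC : open (~` closure [set z | phi z != 0]) by exact/closed_openC/closed_closure.
have : nbhs z (~` closure [set z | phi z != 0]) by exact: open_nbhs_nbhs.
move=> /nbhs_ballP[e /= e0 eU]; rewrite /pdy.
have h : is_derive z.2 (1 : R) (cst (0 : R)) 0 by exact: is_derive_cst.
have : is_derive z.2 (1 : R) (fun t => phi (z.1, t)) 0.
  apply: near_eq_is_derive h; near=> t => /=.
  have : ~ closure [set z | phi z != 0] (z.1, t).
    apply: eU; split => /=; first exact: ballxx.
    by near: t; exact: nbhsx_ballx.
  move=> ncl; apply/esym/eqP; apply: contrapT => /negP p0; apply: ncl.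
  exact: subset_closure.
by move=> [_ <-]; rewrite derive1E.
Unshelve. all: by end_near. Qed.

Lemma test_function_pdy a b c d phi :
  test_function a b c d phi -> test_function a b c d (pdy phi).
Proof.
move=> [sphi cphi]; split; first exact: smooth_pdy.
apply: subset_trans cphi; rewrite [X in _ `<=` X](closure_id _).1; last exact: closed_closure.
exact/closure_subset/pdy_support.
Qed.

Lemma pdx_sw phi : pdx phi = sw (pdy (sw phi)).
Proof. by []. Qed.

Lemma test_function_pdx a b c d phi :
  test_function a b c d phi -> test_function a b c d (pdx phi).
Proof.
by move=> t; rewrite pdx_sw; apply/test_function_sw/test_function_pdy/test_function_sw.
Qed.

Lemma test_function_iter a b c d phi i j :
  test_function a b c d phi -> test_function a b c d (iter i (@pdx R) (iter j (@pdy R) phi)).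
Proof.
move=> t; elim: i => [|i ih]; last exact: test_function_pdx.
by elim: j => [//|j ih]; exact: test_function_pdy.
Qed.

Lemma smooth_continuous phi : smooth phi -> continuous phi.
Proof. by move=> /(_ [::])[]. Qed.

Lemma smooth_pdy_is_derive phi (x y : R) : smooth phi ->
  is_derive y 1 (fun t => phi (x, t)) (pdy phi (x, y)).
Proof.
move=> /(_ [::]) /= [_ /(_ x y)[_ h]]; rewrite /pdy /= derive1E.
exact: derivableP.
Qed.

Lemma continuous_section phi x : continuous phi -> continuous (fun y => phi (x, y)).
Proof.
move=> cphi y; apply: (@continuous_comp _ _ _ (fun y : R => (x, y)) phi); last exact: cphi.
by apply: continuous_pair => t; [exact: cvg_cst|exact: cvg_id].
Qed.

Lemma bmeas_continuous a b c d phi : continuous phi ->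
  bmeas (rect a b c d : set (MR * MR)) phi.
Proof.
move=> cphi; split; first exact: continuous_measurable_plane.
have : compact (phi @` rect a b c d).
  apply: continuous_compact; first exact: continuous_subspaceT.
  by apply: compact_setX; exact: segment_compact.
move=> /compact_bounded [M [_ HM]]; exists (M + 1) => x xab.
by apply: (HM (M + 1)); [rewrite ltrDl|exists x].
Qed.

Lemma bmeas_continuous1 c d (f : R -> R) : continuous f ->
  bmeas (`[c, d]%classic : set MR) f.
Proof.
move=> cf; split; first exact: measurable_funTS (continuous_measurable_fun cf).
have : compact (f @` `[c, d]).
  by apply: continuous_compact; [exact: continuous_subspaceT|exact: segment_compact].
move=> /compact_bounded [M [_ HM]]; exists (M + 1) => x xab.
by apply: (HM (M + 1)); [rewrite ltrDl|exists x].
Qed.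

Lemma test_function_out a b c d phi z : test_function a b c d phi ->
  ~ (`]a, b[ `*` `]c, d[)%classic z -> phi z = 0.
Proof.
move=> [_ h] nz; apply/eqP; apply: contrapT => /negP p0; apply: nz; apply: h.
exact: subset_closure.
Qed.

(** A test function vanishes on the side [y = d], so only the lower boundary term remains. *)
Lemma Rintegral_pdy a b c d phi x p : test_function a b c d phi -> p <= d ->
  \int[mu]_(y in `[p, d]) pdy phi (x, y) = - phi (x, p).
Proof.
move=> t; have [sphi _] := t.
have p0 : phi (x, d) = 0.
  by apply: (test_function_out t) => -[_ /=]; rewrite in_itv/= ltxx andbF.
rewrite le_eqVlt => /predU1P[->|pd].
  by rewrite set_itv1 Rintegral_set1 p0 oppr0.
have cv : continuous (fun y => phi (x, y)) by exact/continuous_section/smooth_continuous.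
rewrite /Rintegral (@continuous_FTC2 _ _ (fun y => phi (x, y)) p d pd).
- by rewrite p0 sub0e.
- by apply: continuous_subspaceT; apply: continuous_section; exact/smooth_continuous/smooth_pdy.
- split.
  + by move=> y _; case: (smooth_pdy_is_derive x y sphi).
  + by apply: cvg_at_right_filter; exact: cv.
  + by apply: cvg_at_left_filter; exact: cv.
- by move=> y _; rewrite derive1E; case: (smooth_pdy_is_derive x y sphi).
Qed.

End test_function_theory.

(** * Weak derivatives and primitives *)

Section primitives.
Variable R : realType.
Local Notation mu := (@lebesgue_measure R).
Local Notation MR := (measurableTypeR R).

Lemma L1_snd d1 d2 (T1 : measurableType d1) (T2 : measurableType d2)
    (m1 : {sigma_finite_measure set T1 -> \bar R})
    (m2 : {sigma_finite_measure set T2 -> \bar R}) (A : set T1) (B : set T2)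
    (f : T2 -> R) : measurable A -> measurable B -> (m1 A < +oo)%E ->
  L1 m2 B f -> L1 (m1 \x m2)%E (A `*` B) (fun z => f z.2).
Proof. by move=> mA mB fA fi; exact: (L1_swap mB mA (L1_fst mB mA fA fi)). Qed.

Lemma segment_measure (a b : R) : a <= b -> fine (mu `[a, b]%classic) = b - a.
Proof.
move=> ab; rewrite lebesgue_measure_itv/= lte_fin; case: ltP => //= ba.
by apply/esym/eqP; rewrite subr_eq0 eq_le ab ba.
Qed.

Lemma bmeas_le d (T : measurableType d) (D : set T) (u v : T -> R) :
  measurable_fun setT u -> measurable_fun setT v ->
  bmeas D (fun t => (u t <= v t)%R%:R : R).
Proof.
move=> mU mv.
have mS : measurable [set t | u t <= v t].
  have /(_ measurableT [set true]) := measurable_fun_ler mU mv.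
  by rewrite setTI; apply.
have := bmeas_indic R D mS.
congr bmeas; apply/funext => t; rewrite indicE.
by rewrite (_ : (t \in _) = (u t <= v t))//; apply/idP/idP => [/set_mem//|h]; exact/mem_set.
Qed.

Lemma Rintegral_indic_le a b x (f : R -> R) : a <= x <= b ->
  \int[mu]_(t in `[a, b]) (f t * (t <= x)%R%:R) = \int[mu]_(t in `[a, x]) f t.
Proof.
move=> /andP[ax xb].
rewrite (_ : `[a, x]%classic = `[a, b]%classic `&` [set t | t <= x]); last first.
  by apply/seteqP; split => t /=; rewrite !in_itv/=; lra.
rewrite Rintegral_mkcondr; apply: eq_Rintegral => t _; rewrite patchE.
case: ifPn => [/set_mem /= ->|]; rewrite ?mulr1// => /negP h.
rewrite (_ : (t <= x) = false) ?mulr0//; apply/negP => tx; apply: h.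
exact/mem_set.
Qed.

Lemma Rintegral_indic_ge a b x (f : R -> R) : a <= x <= b ->
  \int[mu]_(t in `[a, b]) (f t * (x <= t)%R%:R) = \int[mu]_(t in `[x, b]) f t.
Proof.
move=> /andP[ax xb].
rewrite (_ : `[x, b]%classic = `[a, b]%classic `&` [set t | x <= t]); last first.
  by apply/seteqP; split => t /=; rewrite !in_itv/=; lra.
rewrite Rintegral_mkcondr; apply: eq_Rintegral => t _; rewrite patchE.
case: ifPn => [/set_mem /= ->|]; rewrite ?mulr1// => /negP h.
rewrite (_ : (x <= t) = false) ?mulr0//; apply/negP => tx; apply: h.
exact/mem_set.
Qed.

(** Fubini over the triangle [t <= x], written as a square with an indicator kernel. When [w] is the
    derivative of a test function this is integration by parts for a primitive of a merely
    integrable function. *)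
Lemma Rintegral_triangle a b (f w : R -> R) : L1 mu `[a, b] f ->
  bmeas (`[a, b]%classic : set MR) w ->
  \int[mu]_(x in `[a, b]) ((\int[mu]_(t in `[a, x]) f t) * w x) =
  \int[mu]_(t in `[a, b]) (f t * \int[mu]_(x in `[t, b]) w x).
Proof.
move=> fi bw; have mab := measurable_segment a b; have fab := segment_lty a b.
have mQ := measurableX mab mab.
pose tr (z : MR * MR) : R := (z.2 <= z.1)%R%:R.
have btr : bmeas (`[a, b] `*` `[a, b] : set (MR * MR)) tr.
  by apply: bmeas_le; [exact: measurable_snd|exact: measurable_fst].
have bk := bmeasM (bmeas_fst _ mab bw) btr.
have ki := L1_bmeas mQ (L1_snd mab mab fab fi) bk.
transitivity (\int[mu]_(x in `[a, b]) \int[mu]_(t in `[a, b]) (f t * (w x * tr (x, t)))).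
  apply: eq_Rintegral => x /set_mem; rewrite /= in_itv/= => axb.
  rewrite -(Rintegral_indic_le f axb) -RintegralZr//.
    by apply: eq_Rintegral => t _; rewrite /tr/= -mulrA [w x * _]mulrC.
  apply: (L1_bmeas mab fi).
  by apply: bmeas_le; [exact: measurable_id|exact: measurable_cst].
rewrite -(Rfubini1 mab mab ki) (Rfubini2 mab mab ki) /=.
apply: eq_Rintegral => t /set_mem; rewrite /= in_itv/= => atb.
rewrite -(Rintegral_indic_ge w atb) -RintegralZl//.
have wi : L1 mu `[a, b] w.
  by case: bw => mw [C wC]; exact: (bounded_L1 mab fab mw wC).
apply: (L1_bmeas mab wi).
by apply: bmeas_le; [exact: measurable_cst|exact: measurable_id].
Qed.

(** The primitive from -oo vanishes to the left of the support of [g], and the condition of zero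
    mean makes it vanish again to the right. *)
Lemma test1_primitive c d (g : R -> R) : test1 c d g ->
  \int[mu]_(y in `[c, d]) g y = 0 -> exists h, test1 c d h /\ derive1 h = g.
Proof.
move=> [sg [p [q [cp qd gpq]]]] g0.
have mcd := measurable_segment c d; have fcd := segment_lty c d.
have gE : g = g \_ `[c, d].
  apply/funext => y; rewrite patchE; case: ifPn => // ncd.
  apply/eqP; apply: contraNT ncd => /gpq/andP[py yq]; apply/mem_set.
  by rewrite /= in_itv/= (le_trans (ltW cp) py) (le_trans yq (ltW qd)).
have gi : L1 mu `[c, d] g.
  have [mg [C gC]] := bmeas_smooth1 c d sg.
  exact: (bounded_L1 mcd fcd mg gC).
have giT : L1 mu setT g by rewrite gE; exact: ((L1_patchP mu g mcd).1 gi).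
have giy y : mu.-integrable `]-oo, y] (EFin \o g).
  exact: (@L1_subset _ _ _ mu _ measurableT _ _ _ _ giT).
pose h (y : R) := \int[mu]_(t in `]-oo, y]) g t.
have dh (y : R) : is_derive y 1 h (g y).
  have [] := @continuous_FTC1 R g -oo%O y (y + 1) ltac:(by rewrite ltrDl) (giy _).
  - by rewrite ltNyr.
  - exact: smooth1_continuous.
  - by move=> d1 d2; apply: DeriveDef; [exact: d1|rewrite -derive1E; exact: d2].
exists h; split; last exact: is_derive_derive1.
split; first by case=> // n; exists g.
exists p, q; split => // y h0.
apply/andP; split; rewrite leNgt; apply: contraNN h0 => hy; apply/eqP.
  rewrite /h -[RHS](mul0r (fine (mu `]-oo, y]))) -(Rintegral_cst mu) //.
  apply: eq_Rintegral => t /set_mem; rewrite /= in_itv/= => ty.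
  apply/eqP; apply: contraTT ty => /gpq/andP[pt _].
  by rewrite -ltNge (lt_le_trans hy pt).
rewrite /h -g0 Rintegral_mkcond [RHS]Rintegral_mkcond -gE.
apply: eq_Rintegral => t _; rewrite patchE; case: ifPn => // nt.
apply/esym/eqP; apply: contraNT nt => /gpq/andP[_ tq]; apply/mem_set.
by rewrite /= in_itv/= (le_trans tq)// ltW.
Qed.

(** If every test function had integral 0, the fundamental lemma would make the constant 1 vanish
    almost everywhere; a test function of nonzero integral is then rescaled. *)
Lemma test1_unit c d : c < d ->
  exists theta, test1 c d theta /\ \int[mu]_(y in `[c, d]) theta y = 1.
Proof.
move=> cd; apply: contrapT => ne.
have mcd := measurable_segment c d; have fcd := segment_lty c d.
have L1t alpha : test1 c d alpha -> L1 mu `[c, d] alpha.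
  move=> ta; have [mg [C gC]] := bmeas_smooth1 c d ta.1.
  exact: (bounded_L1 mcd fcd mg gC).
have h alpha : test1 c d alpha -> \int[mu]_(y in `[c, d]) (1 * alpha y) = 0.
  move=> ta; under eq_Rintegral do rewrite mul1r.
  apply: contrapT => /eqP A0; apply: ne.
  exists (fun y => (\int[mu]_(y in `[c, d]) alpha y)^-1 * alpha y); split.
    case: ta => sa [p [q [cp qd apq]]]; split; first exact: smooth1Z.
    exists p, q; split => // x; rewrite mulf_eq0 negb_or => /andP[_].
    exact: apq.
  by rewrite RintegralZl ?mulVf//; exact: L1t.
have := fundamental_lemma1 (L1_cst mcd fcd 1) h => ae10.
have : \int[mu]_(y in `[c, d]) (1 : R) = \int[mu]_(y in `[c, d]) (0 : R).
  exact: (ae_eq_Rintegral mcd (measurable_cst _) (measurable_cst _) ae10).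
rewrite !(Rintegral_cst mu mcd) mul1r mul0r segment_measure ?ltW//.
by move/eqP; rewrite subr_eq0 gt_eqF.
Qed.

End primitives.

Definition Jx (R : realType) (a : R) (g : R * R -> R) (z : R * R) : R :=
  \int[mu1 R]_(t in `[a, z.1]) g (t, z.2).
Definition Jy (R : realType) (c : R) (g : R * R -> R) (z : R * R) : R :=
  \int[mu1 R]_(t in `[c, z.2]) g (z.1, t).

Section weak_derivatives.
Variables (R : realType) (a b c d : R).
Local Notation mu := (@lebesgue_measure R).
Local Notation MR := (measurableTypeR R).
Local Notation Q := (rect a b c d).
Local Notation WD := (is_weak_derivative a b c d).
Implicit Types f g : R * R -> R.

Let mab := measurable_segment a b.
Let mcd := measurable_segment c d.
Let fab := segment_lty a b.
Let fcd := segment_lty c d.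
Let mQ := measurable_rect a b c d.
Let fQ := rect_lty a b c d.

Lemma L2_L1_rect f : L2 (mu2 R) Q f -> L1 (mu2 R) Q f.
Proof. exact: (L2_L1 mQ fQ). Qed.

Lemma L2_L1_segment p q (f : R -> R) : L2 mu `[p, q] f -> L1 mu `[p, q] f.
Proof. exact: (L2_L1 (measurable_segment p q) (segment_lty p q)). Qed.

Lemma L2_ext1 (n : R -> R) : L2 mu `[a, b] n -> L2 (mu2 R) Q (fun z => n z.1).
Proof. exact: (L2_fst mab mcd fab fcd). Qed.

Lemma L2_ext2 (p : R -> R) : L2 mu `[c, d] p -> L2 (mu2 R) Q (fun z => p z.2).
Proof. exact: (L2_snd mab mcd fab fcd). Qed.

Lemma bmeas_test phi : test_function a b c d phi ->
  bmeas (Q : set (MR * MR)) phi.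
Proof. by move=> [/smooth_continuous cphi _]; exact: bmeas_continuous. Qed.

Lemma L1_mul_test f phi : L2 (mu2 R) Q f -> test_function a b c d phi ->
  L1 (mu2 R) Q (fun z => f z * phi z).
Proof. by move=> f2 t; exact: (L1_bmeas mQ (L2_L1_rect f2) (bmeas_test t)). Qed.

Lemma WD_ae i j f f' g g' : L2 (mu2 R) Q f -> L2 (mu2 R) Q f' ->
  L2 (mu2 R) Q g -> L2 (mu2 R) Q g' ->
  f = f' %[ae mu2 R in Q] -> g = g' %[ae mu2 R in Q] -> WD i j f g -> WD i j f' g'.
Proof.
move=> f2 f'2 g2 g'2 ff' gg' w phi t.
have ti := test_function_iter i j t.
have <- : \int[mu2 R]_(z in Q) (f z * iter i (@pdx R) (iter j (@pdy R) phi) z) =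
    \int[mu2 R]_(z in Q) (f' z * iter i (@pdx R) (iter j (@pdy R) phi) z).
  apply: (ae_eq_Rintegral mQ (L1_measurable (L1_mul_test f2 ti))).
    exact: L1_measurable (L1_mul_test f'2 ti).
  by apply: aeS ff' => z h Qz; rewrite h.
have <- : \int[mu2 R]_(z in Q) (g z * phi z) = \int[mu2 R]_(z in Q) (g' z * phi z).
  apply: (ae_eq_Rintegral mQ (L1_measurable (L1_mul_test g2 t))).
    exact: L1_measurable (L1_mul_test g'2 t).
  by apply: aeS gg' => z h Qz; rewrite h.
exact: w.
Qed.

Lemma WD_D i j f f' g g' : L2 (mu2 R) Q f -> L2 (mu2 R) Q f' ->
  L2 (mu2 R) Q g -> L2 (mu2 R) Q g' ->
  WD i j f g -> WD i j f' g' -> WD i j (fun z => f z + f' z) (fun z => g z + g' z).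
Proof.
move=> f2 f'2 g2 g'2 w w' phi t.
have ti := test_function_iter i j t.
under eq_Rintegral do rewrite mulrDl.
under [in RHS]eq_Rintegral do rewrite mulrDl.
rewrite (RintegralD mQ (L1_mul_test f2 ti) (L1_mul_test f'2 ti)).
rewrite (RintegralD mQ (L1_mul_test g2 t) (L1_mul_test g'2 t)).
by rewrite mulrDr w// w'.
Qed.

Lemma WD_N i j f g : L2 (mu2 R) Q f -> L2 (mu2 R) Q g ->
  WD i j f g -> WD i j (fun z => - f z) (fun z => - g z).
Proof.
move=> f2 g2 w phi t; have ti := test_function_iter i j t.
under eq_Rintegral do rewrite mulNr -mulN1r.
under [in RHS]eq_Rintegral do rewrite mulNr -mulN1r.
rewrite (RintegralZl _ mQ (L1_mul_test f2 ti)) (RintegralZl _ mQ (L1_mul_test g2 t)).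
by rewrite w// mulrCA.
Qed.

(** The test function [pdx phi] is substituted. In the definition of weak derivatives all [pdx]
    stand outside all [pdy], which is why derivatives in [x] are composed at [j = 0] only: mixed
    partial derivatives of test functions never have to be commuted. *)
Lemma WD_comp_x i f g h : WD i 0 f g -> WD 1 0 g h -> WD i.+1 0 f h.
Proof.
move=> fg gh phi t; have tx := test_function_pdx t.
have := fg _ tx; rewrite /= -iterSr => ->.
by have := gh _ t; rewrite /= addn0 expr1 => ->; rewrite !addn0 exprS mulrA [(-1) ^+ i * _]mulrC.
Qed.

Lemma WD_comp_y i j f g h : WD i j f g -> WD 0 1 g h -> WD i j.+1 f h.
Proof.
move=> fg gh phi t; have ty := test_function_pdy t.
have := fg _ ty; rewrite -iterSr => ->.
by have := gh _ t; rewrite /= add0n expr1 => ->; rewrite addnS exprS mulrA [(-1) ^+ (i + j) * _]mulrC.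
Qed.

Lemma sign_inj k (x y : R) : (-1) ^+ k * x = (-1) ^+ k * y -> x = y.
Proof. by move/(congr1 ( *%R ((-1) ^+ k))); rewrite !signrMK. Qed.

Lemma WD_split_x i f g h : WD i 0 f g -> WD i.+1 0 f h -> WD 1 0 g h.
Proof.
move=> fg fh phi t; have tx := test_function_pdx t.
apply: (@sign_inj (i + 0)); have := fg _ tx; rewrite /= -iterSr => <-.
by rewrite -[LHS]/(\int[mu2 R]_(z in Q) (f z * iter i.+1 (@pdx R) (iter 0 (@pdy R) phi) z)) fh// addSn exprS !addn0 mulrA expr1 [(-1)^+i * _]mulrC.
Qed.

Lemma WD_split_y i j f g h : WD i j f g -> WD i j.+1 f h -> WD 0 1 g h.
Proof.
move=> fg fh phi t; have ty := test_function_pdy t.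
apply: (@sign_inj (i + j)); have := fg _ ty; rewrite -iterSr => <-.
by rewrite fh// addnS exprS mulrA add0n expr1 [(-1) ^+ (i + j) * _]mulrC.
Qed.

Lemma WD_id f : WD 0 0 f f.
Proof. by move=> phi t; rewrite /= mul1r. Qed.

(** Written over the fixed segment [[c, d]] against the indicator of [t <= y], the primitive is the
    integral in [t] of a square-integrable function of [((x, y), t)]. *)
Lemma L2_Jy g : L2 (mu2 R) Q g -> L2 (mu2 R) Q (Jy c g).
Proof.
move=> g2; have k2 := L2_mid mab mcd fab fcd mcd fcd g2.
have m3 := measurableX mQ mcd.
have btr : bmeas ((`[a, b] `*` `[c, d]) `*` `[c, d] : set ((MR * MR) * MR))
    (fun z => (z.2 <= z.1.2)%R%:R : R).
  apply: bmeas_le; first exact: measurable_snd.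
  exact: (measurableT_comp measurable_snd measurable_fst).
have := L2_Rintegral (m1 := sfprod mu mu) mQ mcd fQ fcd (L2_bmeas m3 k2 btr).
apply: (eq_L2 mQ) => z [_]; rewrite /= in_itv/= => z2.
by rewrite (Rintegral_indic_le (fun t => g (z.1, t)) z2).
Qed.

(** On almost every vertical section, exchanging the integrations over the triangle leaves the
    integral of [pdy phi] from [t] to [d], which is [- phi (x, t)]. *)
Lemma WD_Jy g : L2 (mu2 R) Q g -> WD 0 1 (Jy c g) g.
Proof.
move=> g2 phi t; have J2 := L2_Jy g2; have ty := test_function_pdy t.
rewrite add0n expr1 mulN1r.
rewrite (Rfubini1 mab mcd (L1_mul_test J2 ty)) (Rfubini1 mab mcd (L1_mul_test g2 t)).
rewrite -[RHS]mulN1r -(RintegralZl _ mab (L1_fubini1 mab mcd (L1_mul_test g2 t))).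
apply: ae_eq_Rintegral => //.
- exact: L1_measurable (L1_fubini1 mab mcd (L1_mul_test J2 ty)).
- exact: L1_measurable (L1Z mab _ (L1_fubini1 mab mcd (L1_mul_test g2 t))).
have := L1_section1 mab mcd (L2_L1_rect g2).
apply: aeS => x gx xab; have {}gx := gx xab.
have cy : continuous (fun y => pdy phi (x, y)).
  by apply: continuous_section; exact: smooth_continuous ty.1.
have cp : continuous (fun y => phi (x, y)).
  by apply: continuous_section; exact: smooth_continuous t.1.
rewrite /Jy/= (Rintegral_triangle gx (bmeas_continuous1 c d cy)).
rewrite -(RintegralZl _ mcd (L1_bmeas mcd gx (bmeas_continuous1 c d cp))).
apply: eq_Rintegral => y /set_mem; rewrite /= in_itv/= => /andP[cy' yd].
by rewrite (Rintegral_pdy x t yd) mulrN mulN1r.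
Qed.

Lemma WD_ext1 (n : R -> R) : L2 mu `[a, b] n -> WD 0 1 (fun z => n z.1) (fun=> 0).
Proof.
move=> n2 phi t; have ty := test_function_pdy t.
under [in RHS]eq_Rintegral do rewrite mul0r.
rewrite (Rintegral_cst _ mQ) mul0r mulr0.
rewrite (Rfubini1 mab mcd (L1_mul_test (L2_ext1 n2) ty)).
rewrite -[RHS](mul0r (fine (mu `[a, b]%classic))) -(Rintegral_cst mu mab 0).
apply: eq_Rintegral => x /set_mem; rewrite /= in_itv/= => xab.
have cy : continuous (fun y => pdy phi (x, y)).
  by apply: continuous_section; exact: smooth_continuous ty.1.
have [mg [C gC]] := bmeas_continuous1 c d cy.
rewrite (RintegralZl _ mcd (bounded_L1 mcd fcd mg gC)).
have [cd|dc] := leP c d; last first.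
  by rewrite set_itv_ge ?Rintegral_set0 ?mulr0// bnd_simp -ltNge.
rewrite (Rintegral_pdy x t cd) (test_function_out t) ?oppr0 ?mulr0//.
by move=> [_]; rewrite /= in_itv/= ltxx.
Qed.

Lemma WD_y_primitive (n : R -> R) g f : L2 mu `[a, b] n -> L2 (mu2 R) Q g ->
  L2 (mu2 R) Q f -> f = (fun z => n z.1 + Jy c g z) %[ae mu2 R in Q] -> WD 0 1 f g.
Proof.
move=> n2 g2 f2 fE; have J2 := L2_Jy g2.
have := WD_D (L2_ext1 n2) J2 (L2_0 _ mQ) g2 (WD_ext1 n2) (WD_Jy g2).
have nJ := L2D mQ (L2_ext1 n2) J2.
apply: WD_ae => //.
- by apply: eq_L2 g2 => // z _; rewrite add0r.
- by apply: aeS fE => z h Qz; rewrite h.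
- by apply: aeW => z _; rewrite add0r.
Qed.

Hypothesis cd : c < d.

(** The function [n] is the average of [h] in [y] against a fixed test function [theta] of integral
    1. For any [beta], the function [beta - (\int beta) theta] has integral 0 and is thus the
    derivative of a test function [eta]; testing the hypothesis with the product of [alpha] and
    [eta] shows that [h - n] is orthogonal to all tensor products. *)
Lemma du_bois_reymond_y h : L2 (mu2 R) Q h -> WD 0 1 h (fun=> 0) ->
  exists2 n, L2 mu `[a, b] n & h = (fun z => n z.1) %[ae mu2 R in Q].
Proof.
move=> h2 w; have hi := L2_L1_rect h2.
have [theta [tt t1]] := test1_unit cd.
have bt := bmeas_smooth1 c d tt.1.
have theta2 : L2 mu `[c, d] theta by case: bt => mt [C tC]; exact: (bounded_L2 mcd fcd mt tC).
pose n x := \int[mu]_(y in `[c, d]) (h (x, y) * theta y).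
have n2 : L2 mu `[a, b] n by exact: (L2_hilbert_schmidt mab mcd fab fcd h2 theta2).
have e2 := L2_ext1 n2; have ei := L2_L1_rect e2.
exists n => //.
suff : (fun z => h z - n z.1) = (fun=> 0) %[ae mu2 R in Q].
  by apply: aeS => z e Qz; apply/eqP; rewrite -subr_eq0; apply/eqP; exact: e.
apply: fundamental_lemma2; first exact: (L2_L1_rect (L2B mQ h2 e2)).
move=> alpha beta ta tb.
have ba := bmeas_smooth1 a b ta.1; have bb := bmeas_smooth1 c d tb.1.
have bi : L1 mu `[c, d] beta by case: bb => mb [C bC]; exact: (bounded_L1 mcd fcd mb bC).
have ti := L2_L1_segment theta2.
set Bt := \int[mu]_(y in `[c, d]) beta y.
have tg : test1 c d (fun y => beta y + (- Bt) * theta y).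
  case: tb => sb [p [q [cp qd bpq]]]; case: tt => st [p' [q' [cp' qd' tpq]]].
  split; first by apply: smooth1D => //; exact: smooth1Z.
  exists (Num.min p p'), (Num.max q q'); split.
  - by rewrite lt_min cp.
  - by rewrite gt_max qd.
  - move=> x; have [bx|/bpq/andP[h1 h3] _] := eqVneq (beta x) 0; last first.
      by rewrite ge_min h1 le_max h3.
    rewrite bx add0r mulf_eq0 negb_or => /andP[_ /tpq/andP[h1 h3]].
    by rewrite ge_min h1 orbT le_max h3 orbT.
have g0 : \int[mu]_(y in `[c, d]) (beta y + (- Bt) * theta y) = 0.
  rewrite (RintegralD mcd bi (L1Z mcd _ ti)) (RintegralZl _ mcd ti) t1 mulr1.
  by rewrite subrr.
have [eta [te eg]] := test1_primitive tg g0.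
have := w _ (test_tensor ta te); rewrite /= pdy_tensor; last by case: te.
rewrite eg.
under [in RHS]eq_Rintegral do rewrite mul0r.
rewrite (Rintegral_cst _ mQ) mul0r mulr0 => hw.
have L1t := L1_mul_test h2.
have hab := L1_bmeas mQ hi (bmeasM (bmeas_fst _ mab ba) (bmeas_snd _ mcd bb)).
have hat := L1_bmeas mQ hi (bmeasM (bmeas_fst _ mab ba) (bmeas_snd _ mcd bt)).
have nab := L1_bmeas mQ ei (bmeasM (bmeas_fst _ mab ba) (bmeas_snd _ mcd bb)).
rewrite -hw; transitivity (\int[mu2 R]_(z in Q) (h z * (alpha z.1 * beta z.2))
    - \int[mu2 R]_(z in Q) (n z.1 * (alpha z.1 * beta z.2))).
  by rewrite -(RintegralB mQ hab nab); apply: eq_Rintegral => z _; rewrite mulrBl.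
transitivity (\int[mu2 R]_(z in Q) (h z * (alpha z.1 * beta z.2))
    - Bt * \int[mu2 R]_(z in Q) (h z * (alpha z.1 * theta z.2))); last first.
  rewrite -(RintegralZl _ mQ hat) -(RintegralB mQ hab (L1Z mQ _ hat)).
  by apply: eq_Rintegral => z _; rewrite /tensor; ring.
congr (_ - _).
rewrite (Rweighted_fubini1 mab mcd ei ba bb) (Rweighted_fubini1 mab mcd hi ba bt).
have ni := L1_bmeas mab (L1_weighted_fubini1 mab mcd hi bt) ba.
rewrite -(RintegralZl _ mab ni); apply: eq_Rintegral => x _.
transitivity (n x * Bt * alpha x).
  by congr (_ * _); exact: (RintegralZl (n x) mcd bi).
by rewrite [n x * Bt]mulrC -mulrA.
Qed.

(** Subtracting [Jy c g] leaves a function whose weak derivative in [y] vanishes. *)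
Lemma y_primitive_of_WD f g : L2 (mu2 R) Q f -> L2 (mu2 R) Q g -> WD 0 1 f g ->
  exists2 n, L2 mu `[a, b] n & f = (fun z => n z.1 + Jy c g z) %[ae mu2 R in Q].
Proof.
move=> f2 g2 w; have J2 := L2_Jy g2.
have : WD 0 1 (fun z => f z - Jy c g z) (fun=> 0).
  have := WD_D f2 (L2N mQ J2) g2 (L2N mQ g2) w (WD_N J2 g2 (WD_Jy g2)).
  apply: WD_ae.
  - exact: (L2B mQ f2 J2).
  - exact: (L2B mQ f2 J2).
  - exact: (L2B mQ g2 g2).
  - exact: L2_0.
  - exact: aeW.
  - by apply: aeW => z _; rewrite subrr.
move=> /(du_bois_reymond_y (L2B mQ f2 J2))[n n2 fn]; exists n => //.
by apply: aeS fn => z h Qz; rewrite -h// subrK.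
Qed.

End weak_derivatives.

(** * Exchange of the two variables *)

Section swap_rectangle.
Variables (R : realType) (a b c d : R).
Local Notation Q := (rect a b c d).
Local Notation Q' := (rect c d a b).
Implicit Types f g : R * R -> R.

Let mab := measurable_segment a b.
Let mcd := measurable_segment c d.
Let fab := segment_lty a b.
Let fcd := segment_lty c d.
Let mQ := measurable_rect a b c d.
Let mQ' := measurable_rect c d a b.

Lemma L1_sw f : L1 (mu2 R) Q f -> L1 (mu2 R) Q' (sw f).
Proof. exact: (L1_swap mab mcd). Qed.

Lemma L2_sw f : L2 (mu2 R) Q f -> L2 (mu2 R) Q' (sw f).
Proof. exact: (L2_swap mab mcd fab fcd). Qed.

Lemma Rintegral_sw f : L1 (mu2 R) Q f ->
  \int[mu2 R]_(z in Q') sw f z = \int[mu2 R]_(z in Q) f z.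
Proof.
by move=> fi; rewrite (Rfubini2 mab mcd fi) (Rfubini1 mcd mab (L1_sw fi)).
Qed.

(** Vanishing almost everywhere is encoded as [\int |f| = 0], which the exchange of variables
    preserves. *)
Lemma ae_sw0 f : L1 (mu2 R) Q f -> f = (fun=> 0) %[ae mu2 R in Q] ->
  sw f = (fun=> 0) %[ae mu2 R in Q'].
Proof.
move=> fi f0; have ni := L1_norm fi.
have : \int[mu2 R]_(z in Q') sw (fun z => `|f z|) z = 0.
  rewrite (Rintegral_sw ni) -[RHS](mul0r (fine (mu2 R Q))) -(Rintegral_cst (mu2 R) mQ 0).
  apply: (ae_eq_Rintegral mQ (L1_measurable ni)) => //.
  by apply: aeS f0 => z h Qz; rewrite h// normr0.
move=> /(Rintegral_eq0_ae mQ' (L1_sw ni)) h.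
by apply: aeS (h (fun z _ => normr_ge0 _)) => z + Qz => /(_ Qz)/normr0_eq0.
Qed.

Lemma ae_sw f g : L1 (mu2 R) Q f -> L1 (mu2 R) Q g -> f = g %[ae mu2 R in Q] ->
  sw f = sw g %[ae mu2 R in Q'].
Proof.
move=> fi gi fg; have := ae_sw0 (L1B mQ fi gi).
have fg0 : (fun z => f z - g z) = (fun=> 0) %[ae mu2 R in Q].
  by apply: aeS fg => z h Qz; rewrite h// subrr.
move=> /(_ fg0); apply: aeS => z h Qz; apply/eqP; rewrite -subr_eq0; apply/eqP.
exact: h.
Qed.

Lemma WD_sw f g : L2 (mu2 R) Q f -> L2 (mu2 R) Q g ->
  is_weak_derivative a b c d 1 0 f g -> is_weak_derivative c d a b 0 1 (sw f) (sw g).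
Proof.
move=> f2 g2 w phi t; have t' := test_function_sw t.
have := w _ t'; rewrite /= pdx_sw swK addn0 add0n.
have L1f := L1_mul_test f2 (test_function_pdx t').
have L1g := L1_mul_test g2 t'.
rewrite -(Rintegral_sw L1g) -(Rintegral_sw L1f).
have -> : sw (fun z => f z * pdx (sw phi) z) = (fun z => sw f z * pdy phi z).
  by rewrite pdx_sw swK; apply/funext => -[].
by have -> : sw (fun z => g z * sw phi z) = (fun z => sw g z * phi z) by apply/funext => -[].
Qed.

Lemma sw_WD f g : L2 (mu2 R) Q f -> L2 (mu2 R) Q g ->
  is_weak_derivative c d a b 0 1 (sw f) (sw g) -> is_weak_derivative a b c d 1 0 f g.
Proof.
move=> f2 g2 w phi t; have t' := test_function_sw t.
have := w _ t'; rewrite /= pdx_sw addn0 add0n.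
have L1f := L1_mul_test f2 (test_function_pdx t).
have L1g := L1_mul_test g2 t.
rewrite pdx_sw in L1f.
rewrite -(Rintegral_sw L1g) -(Rintegral_sw L1f).
by [].
Qed.

End swap_rectangle.

Section weak_derivatives_x.
Variables (R : realType) (a b c d : R).
Local Notation mu := (@lebesgue_measure R).
Local Notation Q := (rect a b c d).
Local Notation WD := (is_weak_derivative a b c d).
Implicit Types f g : R * R -> R.

Let mQ := measurable_rect a b c d.
Let mQ' := measurable_rect c d a b.

Lemma Jx_sw g : Jx a g = sw (Jy a (sw g)).
Proof. by []. Qed.

Lemma L2_Jx g : L2 (mu2 R) Q g -> L2 (mu2 R) Q (Jx a g).
Proof. by move=> g2; rewrite Jx_sw; apply/L2_sw/L2_Jy/L2_sw. Qed.

Lemma WD_x_primitive (p : R -> R) g f : L2 mu `[c, d] p -> L2 (mu2 R) Q g ->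
  L2 (mu2 R) Q f -> f = (fun z => p z.2 + Jx a g z) %[ae mu2 R in Q] -> WD 1 0 f g.
Proof.
move=> p2 g2 f2 fE; apply: sw_WD => //.
apply: (WD_y_primitive p2); [exact: L2_sw|exact: L2_sw|].
have := ae_sw (L2_L1_rect f2) (L2_L1_rect (L2D mQ (L2_ext2 a b p2) (L2_Jx g2))) fE.
exact: id.
Qed.

Lemma x_primitive_of_WD f g : a < b -> L2 (mu2 R) Q f -> L2 (mu2 R) Q g -> WD 1 0 f g ->
  exists2 p, L2 mu `[c, d] p & f = (fun z => p z.2 + Jx a g z) %[ae mu2 R in Q].
Proof.
move=> ab f2 g2 /(WD_sw f2 g2) w.
have [p p2 fp] := y_primitive_of_WD ab (L2_sw f2) (L2_sw g2) w.
exists p => //.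
have J2 : L2 (mu2 R) (rect c d a b) (fun z => p z.1 + Jy a (sw g) z).
  by apply: (L2D mQ'); [exact: L2_ext1|apply/L2_Jy/L2_sw].
by have := ae_sw (L2_L1_rect (L2_sw f2)) (L2_L1_rect J2) fp; rewrite swK.
Qed.

Lemma WD_unique i j f g g' : L2 (mu2 R) Q f -> L2 (mu2 R) Q g -> L2 (mu2 R) Q g' ->
  WD i j f g -> WD i j f g' -> g = g' %[ae mu2 R in Q].
Proof.
move=> f2 g2 g'2 w w'.
suff : (fun z => g z - g' z) = (fun=> 0) %[ae mu2 R in Q].
  by apply: aeS => z e Qz; apply/eqP; rewrite -subr_eq0; apply/eqP; exact: e.
apply: fundamental_lemma2; first exact: (L2_L1_rect (L2B mQ g2 g'2)).
move=> alpha beta ta tb; have t := test_tensor ta tb.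
under eq_Rintegral do rewrite mulrBl.
rewrite (RintegralB mQ (L1_mul_test g2 t) (L1_mul_test g'2 t)).
apply/eqP; rewrite subr_eq0; apply/eqP.
by apply: (@sign_inj _ (i + j)); rewrite -w// -w'.
Qed.

Lemma wderiv0P i j f : has_wderiv a b c d i j f ->
  L2 (mu2 R) Q (wderiv0 a b c d i j f) /\ WD i j f (wderiv0 a b c d i j f).
Proof. by move=> [g gP]; rewrite /wderiv0; case: xgetP => [h _ //|/(_ g)]. Qed.

Lemma wderiv0_ae i j f g : L2 (mu2 R) Q f -> L2 (mu2 R) Q g -> WD i j f g ->
  wderiv0 a b c d i j f = g %[ae mu2 R in Q].
Proof.
move=> f2 g2 w; have [w2 wP] : L2 (mu2 R) Q (wderiv0 a b c d i j f) /\
   WD i j f (wderiv0 a b c d i j f) by apply: wderiv0P; exists g.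
exact: (WD_unique f2 w2 g2 wP w).
Qed.

End weak_derivatives_x.

Section primitive_calculus.
Variables (R : realType) (a b c d : R).
Local Notation mu := (@lebesgue_measure R).
Local Notation MR := (measurableTypeR R).
Local Notation Q := (rect a b c d).
Implicit Types f g : R * R -> R.

Let mab := measurable_segment a b.
Let mcd := measurable_segment c d.
Let mQ := measurable_rect a b c d.

Lemma subset_segment (p q r s : R) : r <= p -> q <= s ->
  (`[p, q] `<=` `[r, s])%classic.
Proof. by move=> rp qs x /=; rewrite !in_itv/=; lra. Qed.

Lemma subset_rect (p q r s : R) : a <= p -> q <= b -> c <= r -> s <= d ->
  rect p q r s `<=` Q.
Proof.
move=> ap qb cr sd z [h1 h2]; split.
  exact: (subset_segment ap qb h1).
exact: (subset_segment cr sd h2).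
Qed.

Lemma L1_subrect f p q r s : a <= p -> q <= b -> c <= r -> s <= d ->
  L1 (mu2 R) Q f -> L1 (mu2 R) (rect p q r s) f.
Proof.
move=> ap qb cr sd; apply: (L1_subset mQ); first exact: measurable_rect.
exact: subset_rect.
Qed.

Lemma L1_subsegment p q r s (f : R -> R) : r <= p -> q <= s ->
  L1 mu `[r, s] f -> L1 mu `[p, q] f.
Proof.
move=> rp qs; apply: (L1_subset (measurable_segment r s)); first exact: measurable_segment.
exact: subset_segment.
Qed.

Lemma Jx_Jy g z : L1 (mu2 R) Q g -> Q z -> Jx a (Jy c g) z = Jy c (Jx a g) z.
Proof.
case: z => x y gi [/=]; rewrite !in_itv/= => /andP[ax xb] /andP[cy yd].
have gi' := L1_subrect (lexx a) xb (lexx c) yd gi.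
rewrite /Jx /Jy /=.
by rewrite -(Rfubini1 (measurable_segment a x) (measurable_segment c y) gi')
  -(Rfubini2 (measurable_segment a x) (measurable_segment c y) gi').
Qed.

Lemma ae_ext1 (P : R -> Prop) : (\forall x \ae mu, `[a, b]%classic x -> P x) ->
  \forall z \ae mu2 R, Q z -> P z.1.
Proof.
move=> [N [mN N0 hN]]; exists (N `*` setT); split.
- exact: measurableX.
- transitivity (mu N * mu (setT : set MR))%E; last by rewrite N0 mul0e.
  exact: product_measure1E.
- by move=> z /= h; split => //; apply: hN => h'; apply: h => -[? ?]; exact: h'.
Qed.

Lemma ae_ext2 (P : R -> Prop) : (\forall y \ae mu, `[c, d]%classic y -> P y) ->
  \forall z \ae mu2 R, Q z -> P z.2.
Proof.
move=> [N [mN N0 hN]]; exists (setT `*` N); split.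
- exact: measurableX.
- transitivity (mu (setT : set MR) * mu N)%E; last by rewrite N0 mule0.
  exact: product_measure1E.
- by move=> z /= h; split => //; apply: hN => h'; apply: h => -[? ?]; exact: h'.
Qed.

(** From [\int |f| = 0], Fubini makes the inner integrals of [|f|] vanish for almost every [x]. *)
Lemma ae_section1 f : L1 (mu2 R) Q f -> f = (fun=> 0) %[ae mu2 R in Q] ->
  \forall x \ae mu, `[a, b]%classic x ->
    (fun y => f (x, y)) = (fun=> 0) %[ae mu in `[c, d]%classic].
Proof.
move=> fi f0; have ni := L1_norm fi.
have i0 : \int[mu2 R]_(z in Q) `|f z| = 0.
  rewrite -[RHS](mul0r (fine (mu2 R Q))) -(Rintegral_cst (mu2 R) mQ 0).
  apply: (ae_eq_Rintegral mQ (L1_measurable ni)) => //.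
  by apply: aeS f0 => z h Qz; rewrite h// normr0.
rewrite (Rfubini1 mab mcd ni) in i0.
have := Rintegral_eq0_ae mab (L1_fubini1 mab mcd ni) _ i0.
move=> /(_ (fun x _ => Rintegral_ge0 _ _)) h.
apply: aeS2 (h _) (L1_section1 mab mcd ni) => // x h1 h2 xab.
have := Rintegral_eq0_ae mcd (h2 xab) (fun y _ => normr_ge0 _) (h1 xab).
by apply: aeS => y h3 ycd; apply/normr0_eq0/h3.
Qed.

Lemma Jy_ae f g : L1 (mu2 R) Q f -> L1 (mu2 R) Q g -> f = g %[ae mu2 R in Q] ->
  Jy c f = Jy c g %[ae mu2 R in Q].
Proof.
move=> fi gi fg.
have fg0 : (fun z => f z - g z) = (fun=> 0) %[ae mu2 R in Q].
  by apply: aeS fg => z h Qz; rewrite h// subrr.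
have := ae_section1 (L1B mQ fi gi) fg0 => h.
(* For almost every [x] the sections agree almost everywhere, so their primitives agree at all [y]
   at once. *)
have P : \forall x \ae mu, `[a, b]%classic x -> forall y, c <= y <= d -> Jy c f (x, y) = Jy c g (x, y).
  apply: aeS2 h (aeS2 _ (L1_section1 mab mcd fi) (L1_section1 mab mcd gi)); last first.
    by move=> x h1 h2; exact: (conj h1 h2).
  move=> x h1 [h2 h3] xab y /andP[cy yd]; rewrite /Jy/=.
  apply: (ae_eq_Rintegral (measurable_segment c y)).
  - exact: L1_measurable (L1_subsegment (lexx c) yd (h2 xab)).
  - exact: L1_measurable (L1_subsegment (lexx c) yd (h3 xab)).
  - apply: aeS (h1 xab) => t e; rewrite /= in_itv/= => /andP[ct ty].
    apply/eqP; rewrite -subr_eq0; apply/eqP; apply: e.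
    by rewrite /= in_itv/= ct (le_trans ty).
apply: aeS (ae_ext1 P) => -[x y] /= e Qz; apply: (e Qz).
by case: Qz => _; rewrite /= in_itv.
Qed.

End primitive_calculus.

Lemma Jx_ae (R : realType) (a b c d : R) (f g : R * R -> R) :
  L1 (mu2 R) (rect a b c d) f -> L1 (mu2 R) (rect a b c d) g ->
  L2 (mu2 R) (rect a b c d) f -> L2 (mu2 R) (rect a b c d) g ->
  f = g %[ae mu2 R in rect a b c d] -> Jx a f = Jx a g %[ae mu2 R in rect a b c d].
Proof.
move=> fi gi f2 g2 fg; have := Jy_ae (L1_sw fi) (L1_sw gi) (ae_sw fi gi fg) => h.
have J2 := L2_Jy (L2_sw f2); have J2' := L2_Jy (L2_sw g2).
exact: (ae_sw (L2_L1_rect J2) (L2_L1_rect J2') h).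
Qed.

Definition prim (R : realType) (p : R) (f : R -> R) (x : R) : R :=
  \int[mu1 R]_(t in `[p, x]) f t.

(** * The spaces H_1 and H_2 *)

(* The functions of H_1 are the [Sq w n r g]: here w is the value at (a, c), n
   and r are the tangential derivatives along the sides y = c and x = a, and g
   is the mixed derivative. *)
Definition Sq (R : realType) (a c w : R) (n r : R -> R) (g : R * R -> R)
    (z : R * R) : R :=
  w + prim a n z.1 + prim c r z.2 + Jx a (Jy c g) z.

Section squares.
Variables (R : realType) (a b c d : R).
Local Notation mu := (@lebesgue_measure R).
Local Notation MR := (measurableTypeR R).
Local Notation Q := (rect a b c d).
Local Notation WD := (is_weak_derivative a b c d).
Implicit Types f g : R * R -> R.
Hypotheses (ab : a < b) (cd : c < d).

Let mab := measurable_segment a b.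
Let mcd := measurable_segment c d.
Let fab := segment_lty a b.
Let fcd := segment_lty c d.
Let mQ := measurable_rect a b c d.

Lemma prim_continuous p q (f : R -> R) : p <= q -> L1 mu `[p, q] f ->
  {within `[p, q], continuous (prim p f)}.
Proof. by move=> pq fi; exact: parameterized_integral_continuous. Qed.

Lemma bmeas_prim p q (f : R -> R) : L1 mu `[p, q] f ->
  bmeas (`[p, q]%classic : set MR) (prim p f).
Proof.
move=> fi; have [pq|qp] := leP p q; last first.
  by rewrite set_itv_ge ?bnd_simp -?ltNge//; split;
    [exact: measurable_fun_set0|exists 0].
split.
  apply: (subspace_continuous_measurable_fun (measurable_itv _)).
  exact: prim_continuous.
have ni := L1_norm fi.
exists (\int[mu]_(t in `[p, q]) `|f t|) => x /=; rewrite in_itv/= => /andP[px xq].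
have fx := L1_subsegment (lexx p) xq fi.
apply: (le_trans (le_normr_Rintegral (measurable_segment p x) fx)).
have := ge0_subset_integral mu (measurable_segment p x) (measurable_segment p q).
move=> /(_ (fun t => `|f t|%:E)) h.
apply: fine_le.
- exact: (integrable_fin_num (measurable_segment p x) (L1_norm fx)).
- exact: (integrable_fin_num (measurable_segment p q) ni).
- apply: h; last exact: subset_segment.
    by have /measurable_EFinP := L1_measurable ni.
  by move=> t _; rewrite lee_fin.
Qed.

Lemma L2_prim p q (f : R -> R) : L1 mu `[p, q] f -> L2 mu `[p, q] (prim p f).
Proof.
move=> /bmeas_prim[mp [C pC]].
exact: (bounded_L2 (measurable_segment p q) (segment_lty p q) mp pC).
Qed.

Lemma prim_ae p q (f g : R -> R) x : L1 mu `[p, q] f -> L1 mu `[p, q] g ->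
  f = g %[ae mu in `[p, q]%classic] -> p <= x <= q -> prim p f x = prim p g x.
Proof.
move=> fi gi fg /andP[px xq]; apply: (ae_eq_Rintegral (measurable_segment p x)).
- exact: L1_measurable (L1_subsegment (lexx p) xq fi).
- exact: L1_measurable (L1_subsegment (lexx p) xq gi).
- apply: aeS fg => t e; rewrite /= in_itv/= => /andP[pt tx].
  by apply: e; rewrite /= in_itv/= pt (le_trans tx).
Qed.

Lemma rect_bounds z : Q z -> a <= z.1 <= b /\ c <= z.2 <= d.
Proof. by move=> [] /=; rewrite !in_itv. Qed.

Lemma Jx_primitive (n : R -> R) g z : L2 mu `[a, b] n -> L2 (mu2 R) Q g -> Q z ->
  Jx a (fun z => n z.1 + Jy c g z) z = prim a n z.1 + Jx a (Jy c g) z.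
Proof.
case: z => x y n2 g2 /rect_bounds[/=] /andP[ax xb] /andP[cy yd].
have gi := L1_subrect (lexx a) xb (lexx c) yd (L2_L1_rect g2).
have ni := L1_subsegment (lexx a) xb (L2_L1_segment n2).
have max := measurable_segment a x.
by rewrite /Jx/= (RintegralD max ni (L1_fubini1 max (measurable_segment c y) gi)).
Qed.

Lemma Jy_primitive (r : R -> R) g z : L2 mu `[c, d] r -> L2 (mu2 R) Q g -> Q z ->
  Jy c (fun z => r z.2 + Jx a g z) z = prim c r z.2 + Jx a (Jy c g) z.
Proof.
case: z => x y r2 g2 Qz; have /= [/andP[ax xb] /andP[cy yd]] := rect_bounds Qz.
rewrite (Jx_Jy (L2_L1_rect g2) Qz).
have gi := L1_subrect (lexx a) xb (lexx c) yd (L2_L1_rect g2).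
have ri := L1_subsegment (lexx c) yd (L2_L1_segment r2).
have mcy := measurable_segment c y.
by rewrite /Jy/= (RintegralD mcy ri (L1_fubini2 (measurable_segment a x) mcy gi)).
Qed.

(** The four terms regrouped as a function of [y] plus an [x]-primitive. The same sum is a function
    of [x] plus a [y]-primitive in [Sq_y], and these two readings give both first derivatives. *)
Lemma Sq_x w n r g z : L2 mu `[a, b] n -> L2 (mu2 R) Q g -> Q z ->
  Sq a c w n r g z = (w + prim c r z.2) + Jx a (fun z => n z.1 + Jy c g z) z.
Proof. by move=> n2 g2 Qz; rewrite Jx_primitive// /Sq; ring. Qed.

Lemma Sq_y w n r g z : L2 mu `[c, d] r -> L2 (mu2 R) Q g -> Q z ->
  Sq a c w n r g z = (w + prim a n z.1) + Jy c (fun z => r z.2 + Jx a g z) z.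
Proof. by move=> r2 g2 Qz; rewrite Jy_primitive// /Sq; ring. Qed.

Lemma L2_shift p q w (f : R -> R) : L2 mu `[p, q] f ->
  L2 mu `[p, q] (fun x => w + f x).
Proof.
move=> f2; apply: (L2D (measurable_segment p q)) => //.
exact: (L2_cst (measurable_segment p q) (segment_lty p q)).
Qed.

Lemma L2_prim_shift p q w (f : R -> R) : L2 mu `[p, q] f ->
  L2 mu `[p, q] (fun x => w + prim p f x).
Proof. by move=> f2; apply: L2_shift; exact/L2_prim/L2_L1_segment. Qed.

Lemma L2_y_primitive n g : L2 mu `[a, b] n -> L2 (mu2 R) Q g ->
  L2 (mu2 R) Q (fun z => n z.1 + Jy c g z).
Proof. by move=> n2 g2; apply: (L2D mQ); [exact: L2_ext1|exact: L2_Jy]. Qed.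

Lemma L2_x_primitive r g : L2 mu `[c, d] r -> L2 (mu2 R) Q g ->
  L2 (mu2 R) Q (fun z => r z.2 + Jx a g z).
Proof. by move=> n2 g2; apply: (L2D mQ); [exact: L2_ext2|exact: L2_Jx]. Qed.

Lemma L2_Sq w n r g : L2 mu `[a, b] n -> L2 mu `[c, d] r -> L2 (mu2 R) Q g ->
  L2 (mu2 R) Q (Sq a c w n r g).
Proof.
move=> n2 r2 g2.
apply: (eq_L2 mQ _ (L2_x_primitive (L2_prim_shift w r2) (L2_y_primitive n2 g2))).
by move=> z Qz; rewrite Sq_x.
Qed.

Lemma WD_Sq_x w n r g : L2 mu `[a, b] n -> L2 mu `[c, d] r -> L2 (mu2 R) Q g ->
  WD 1 0 (Sq a c w n r g) (fun z => n z.1 + Jy c g z).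
Proof.
move=> n2 r2 g2; apply: (WD_x_primitive (L2_prim_shift w r2)).
- exact: L2_y_primitive.
- exact: L2_Sq.
- by apply: aeW => z Qz; exact: Sq_x.
Qed.

Lemma WD_Sq_y w n r g : L2 mu `[a, b] n -> L2 mu `[c, d] r -> L2 (mu2 R) Q g ->
  WD 0 1 (Sq a c w n r g) (fun z => r z.2 + Jx a g z).
Proof.
move=> n2 r2 g2; apply: (WD_y_primitive (L2_prim_shift w n2)).
- exact: L2_x_primitive.
- exact: L2_Sq.
- by apply: aeW => z Qz; exact: Sq_y.
Qed.

(** Differentiation in [y] under the integral in [x]: by Fubini the [x]-primitive of a [y]-primitive
    is again a [y]-primitive. *)
Lemma WD_Jx n g f : L2 mu `[a, b] n -> L2 (mu2 R) Q g ->
  (forall z, Q z -> f z = n z.1 + Jy c g z) -> WD 0 1 (Jx a f) (Jx a g).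
Proof.
move=> n2 g2 fE.
have JfE z : Q z -> Jx a f z = prim a n z.1 + Jy c (Jx a g) z.
  move=> Qz; rewrite -(Jx_Jy (L2_L1_rect g2) Qz) -Jx_primitive//.
  apply: eq_Rintegral => t /set_mem; rewrite /= in_itv/= => /andP[at_ tz].
  have [/andP[ax xb] cyd] := rect_bounds Qz.
  by rewrite fE//; split; rewrite /= in_itv//= at_ (le_trans tz).
apply: (WD_y_primitive (L2_prim (L2_L1_segment n2)) (L2_Jx g2)).
- apply: L2_Jx; apply: (eq_L2 mQ _ (L2_y_primitive n2 g2)).
  by move=> z Qz; rewrite fE.
- exact: aeW.
Qed.

(** The entry [(i, j)] is reached by [i] steps in [x] along [j = 0] and then [j] steps in [y], the
    order that [WD_comp_x] and [WD_comp_y] allow. *)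
Lemma WD_grid k (e : nat -> nat -> R * R -> R) :
  (forall i, (i < k)%N -> WD 1 0 (e i 0%N) (e i.+1 0%N)) ->
  (forall i j, (i <= k)%N -> (j < k)%N -> WD 0 1 (e i j) (e i j.+1)) ->
  forall i j, (i <= k)%N -> (j <= k)%N -> WD i j (e 0%N 0%N) (e i j).
Proof.
move=> ex ey i j ik; elim: j => [_|j ih jk].
  elim: i ik => [_|i ih ik]; first exact: WD_id.
  exact: (WD_comp_x (ih (ltnW ik)) (ex _ ik)).
exact: (WD_comp_y (ih (ltnW jk)) (ey _ _ ik jk)).
Qed.

(* Averaging in x turns a weak derivative in y of a function of y alone into a
   function of y alone. *)
Lemma y_part_primitive m f0 f1 g0 g1 : L2 mu `[c, d] m ->
  L2 (mu2 R) Q f0 -> L2 (mu2 R) Q f1 -> L2 (mu2 R) Q g0 -> L2 (mu2 R) Q g1 ->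
  WD 0 1 f0 f1 -> WD 0 1 g0 g1 ->
  f0 = (fun z => m z.2 + g0 z) %[ae mu2 R in Q] ->
  exists w r, [/\ L2 mu `[c, d] r,
    m = (fun y => w + prim c r y) %[ae mu in `[c, d]%classic] &
    f1 = (fun z => r z.2 + g1 z) %[ae mu2 R in Q]].
Proof.
move=> m2 f02 f12 g02 g12 wf wg fE.
have me := L2_ext2 a b m2.
pose rho z := f1 z - g1 z.
have rho2 : L2 (mu2 R) Q rho by exact: L2B.
have wm : WD 0 1 (fun z => m z.2) rho.
  have := WD_D f02 (L2N mQ g02) f12 (L2N mQ g12) wf (WD_N g02 g12 wg).
  apply: WD_ae => //.
  - exact: L2B.
  - by apply: aeS fE => z h Qz; rewrite h// addrK.
  - exact: aeW.
have [n n2 mE] := y_primitive_of_WD cd me rho2 wm.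
have ba0 : b - a != 0 by rewrite subr_eq0 gt_eqF.
pose r y := (b - a)^-1 * \int[mu]_(x in `[a, b]) rho (x, y).
have I2 : L2 mu `[c, d] (fun y => \int[mu]_(x in `[a, b]) rho (x, y)).
  exact: (L2_Rintegral mcd mab fcd fab (L2_sw rho2)).
have r2 : L2 mu `[c, d] r by exact: L2Z.
pose w := (b - a)^-1 * \int[mu]_(x in `[a, b]) n x.
exists w, r.
have mr : m = (fun y => w + prim c r y) %[ae mu in `[c, d]%classic].
  have B2 := L2_y_primitive n2 rho2.
  have dif : (fun z => m z.2 - (n z.1 + Jy c rho z)) = (fun=> 0) %[ae mu2 R in Q].
    by apply: aeS mE => z h Qz; rewrite h// subrr.
  have di := L2_L1_rect (L2B mQ me B2).
  have := ae_section1 (L1_sw di) (ae_sw0 di dif).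
  apply: aeS => y h ycd; have {}h := h ycd.
  have /andP[cy yd] : c <= y <= d by move: ycd; rewrite /= in_itv.
  have ri := L1_subrect (lexx a) (lexx b) (lexx c) yd (L2_L1_rect rho2).
  have mcy := measurable_segment c y.
  have ni := L2_L1_segment n2.
  have Ji := L1_fubini1 mab mcy ri.
  have Bi := L1D mab ni Ji.
  have : \int[mu]_(x in `[a, b]) m y = \int[mu]_(x in `[a, b]) (n x + Jy c rho (x, y)).
    apply: (ae_eq_Rintegral mab (measurable_cst _) (L1_measurable Bi)).
    apply: aeS h => x h xab; apply/eqP; rewrite -subr_eq0; apply/eqP; exact: h.
  rewrite (Rintegral_cst mu mab) (RintegralD mab ni Ji) segment_measure ?ltW// => E.
  have -> : prim c r y = (b - a)^-1 * \int[mu]_(x in `[a, b]) Jy c rho (x, y).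
    rewrite /prim /r (RintegralZl _ mcy (L1_fubini2 mab mcy ri)).
    by rewrite -(Rfubini2 mab mcy ri) (Rfubini1 mab mcy ri).
  by rewrite /w -mulrDr -E mulrC mulfK.
split => //.
(* Both [rho] and [r] are now weak derivatives in [y] of the same function [m], so uniqueness makes
   [rho] independent of [x]. *)
have wr : WD 0 1 (fun z => m z.2) (fun z => r z.2).
  apply: (@WD_y_primitive _ _ _ _ _ (fun=> w)) => //.
  - exact: (L2_cst mab fab).
  - exact: L2_ext2.
  - exact: (@ae_ext2 R a b c d (fun y => m y = w + prim c r y) mr).
have := WD_unique me rho2 (L2_ext2 a b r2) wm wr.
by apply: aeS => z h Qz; rewrite -h// /rho subrK.
Qed.

End squares.

(* Data determining a function of H_2: its derivatives d_x^i d_y^j, i, j < 2, at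
   the corner (a, c), the traces of d_x^2 d_y^j on y = c and of d_x^i d_y^2 on
   x = a, and d_x^2 d_y^2. *)
Record jet2 (R : realType) := Jet2 {
  j00 : R; j10 : R; j01 : R; j11 : R;
  j20 : R -> R; j21 : R -> R; j02 : R -> R; j12 : R -> R;
  j22 : R * R -> R }.

(** * The grid of derivatives of a function of H_2 *)

Section grid2.
Variables (R : realType) (a b c d : R).
Local Notation mu := (@lebesgue_measure R).
Local Notation Q := (rect a b c d).
Local Notation WD := (is_weak_derivative a b c d).
Hypotheses (ab : a < b) (cd : c < d).

Let mcd := measurable_segment c d.
Let mQ := measurable_rect a b c d.

Definition L2jet (J : jet2 R) : Prop :=
  [/\ L2 mu `[a, b] (j20 J), L2 mu `[a, b] (j21 J),
      L2 mu `[c, d] (j02 J), L2 mu `[c, d] (j12 J) & L2 (mu2 R) Q (j22 J)].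

Lemma Jy_eq f g z : (forall z, Q z -> f z = g z) -> Q z -> Jy c f z = Jy c g z.
Proof.
move=> fg Qz; have [axb /andP[cz zd]] := rect_bounds Qz.
apply: eq_Rintegral => t /set_mem; rewrite /= in_itv/= => /andP[ct tz].
by apply: fg; split; rewrite /= in_itv//= ct (le_trans tz).
Qed.

Lemma Jx_eq f g z : (forall z, Q z -> f z = g z) -> Q z -> Jx a f z = Jx a g z.
Proof.
move=> fg Qz; have [/andP[az zb] cyd] := rect_bounds Qz.
apply: eq_Rintegral => t /set_mem; rewrite /= in_itv/= => /andP[at_ tz].
by apply: fg; split; rewrite /= in_itv//= at_ (le_trans tz).
Qed.

Lemma WD_eq i j f g g' : L2 (mu2 R) Q f -> L2 (mu2 R) Q g ->
  (forall z, Q z -> g z = g' z) -> WD i j f g -> WD i j f g'.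
Proof.
move=> f2 g2 gg'; apply: WD_ae => //; first exact: (eq_L2 mQ gg').
  exact: aeW.
by apply: aeW => z Qz; exact: gg'.
Qed.

Section grid.
Variable J : jet2 R.

(** [eij] stands for the derivative [d_x^i d_y^j], and [nij], [pij] for its traces on [y = c] and on
    [x = a]. For [i, j < 2] the function [eij] is the square whose data are its value at the corner,
    the tangential derivatives along the two sides, and the mixed derivative, that is the entry with
    both indices increased by 1. *)
Let n11 x := j11 J + prim a (j21 J) x.
Let n10 x := j10 J + prim a (j20 J) x.
Let p11 y := j11 J + prim c (j12 J) y.
Let p01 y := j01 J + prim c (j02 J) y.
Let e21 z := j21 J z.1 + Jy c (j22 J) z.
Let e20 z := j20 J z.1 + Jy c e21 z.
Let e12 z := j12 J z.2 + Jx a (j22 J) z.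
Let e02 z := j02 J z.2 + Jx a e12 z.
Let e11 := Sq a c (j11 J) (j21 J) (j12 J) (j22 J).
Let e10 := Sq a c (j10 J) (j20 J) p11 e21.
Let e01 := Sq a c (j01 J) n11 (j02 J) e12.
Let e00 := Sq a c (j00 J) n10 p01 e11.

Definition grid2 (i j : nat) : R * R -> R :=
  match i, j with
  | 0, 0 => e00 | 0, 1 => e01 | 0, _ => e02
  | 1, 0 => e10 | 1, 1 => e11 | 1, _ => e12
  | _, 0 => e20 | _, 1 => e21 | _, _ => j22 J
  end%N.

Hypothesis J2 : L2jet J.

Lemma L2_grid2 i j : L2 (mu2 R) Q (grid2 i j).
Proof.
case: J2 => h20 h21 h02 h12 h22.
have e212 : L2 (mu2 R) Q e21 by exact: L2_y_primitive.
have e122 : L2 (mu2 R) Q e12 by exact: L2_x_primitive.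
have e112 : L2 (mu2 R) Q e11 by exact: L2_Sq.
have p012 := L2_prim_shift (j01 J) h02; have n102 := L2_prim_shift (j10 J) h20.
have p112 := L2_prim_shift (j11 J) h12; have n112 := L2_prim_shift (j11 J) h21.
case: i => [|[|i]]; case: j => [|[|j]].
- exact: (L2_Sq _ n102 p012 e112).
- exact: (L2_Sq _ n112 h02 e122).
- exact: (L2_x_primitive h02 e122).
- exact: (L2_Sq _ h20 p112 e212).
- exact: e112.
- exact: e122.
- exact: (L2_y_primitive h20 e212).
- exact: e212.
- exact: h22.
Qed.

Lemma grid2_e11x z : Q z -> e11 z = p11 z.2 + Jx a e21 z.
Proof. by case: J2 => h20 h21 h02 h12 h22; exact: (Sq_x _ _ h21 h22). Qed.

Lemma grid2_e11y z : Q z -> e11 z = n11 z.1 + Jy c e12 z.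
Proof. by case: J2 => h20 h21 h02 h12 h22; exact: (Sq_y _ _ h12 h22). Qed.

Lemma grid2_e10x z : Q z -> e10 z = (j10 J + prim c p11 z.2) + Jx a e20 z.
Proof.
case: J2 => h20 h21 h02 h12 h22.
exact: (Sq_x _ _ h20 (L2_y_primitive h21 h22)).
Qed.

(** [Sq] presents the derivative in [y] as [p11 + Jx e21]; this is [e11] because a square may be
    integrated in either order. *)
Lemma grid2_e10y z : Q z -> e10 z = n10 z.1 + Jy c e11 z.
Proof.
case: J2 => h20 h21 h02 h12 h22 Qz.
rewrite /e10 (Sq_y _ _ (L2_prim_shift _ h12) (L2_y_primitive h21 h22) Qz).
by congr (_ + _); apply: Jy_eq Qz => w Qw; rewrite grid2_e11x.
Qed.

Lemma grid2_e01x z : Q z -> e01 z = p01 z.2 + Jx a e11 z.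
Proof.
case: J2 => h20 h21 h02 h12 h22 Qz.
rewrite /e01 (Sq_x _ _ (L2_prim_shift _ h21) (L2_x_primitive h12 h22) Qz).
by congr (_ + _); apply: Jx_eq Qz => w Qw; rewrite grid2_e11y.
Qed.

Lemma WD_grid2 i j : (i <= 2)%N -> (j <= 2)%N -> WD i j (grid2 0 0) (grid2 i j).
Proof.
case: J2 => h20 h21 h02 h12 h22.
have e212 : L2 (mu2 R) Q e21 := L2_grid2 2 1.
have e122 : L2 (mu2 R) Q e12 := L2_grid2 1 2.
have e112 : L2 (mu2 R) Q e11 := L2_grid2 1 1.
have e102 : L2 (mu2 R) Q e10 := L2_grid2 1 0.
have e012 : L2 (mu2 R) Q e01 := L2_grid2 0 1.
have e002 : L2 (mu2 R) Q e00 := L2_grid2 0 0.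
have e202 : L2 (mu2 R) Q e20 := L2_grid2 2 0.
have n102 : L2 mu `[a, b] n10 by exact: L2_prim_shift.
have n112 : L2 mu `[a, b] n11 by exact: L2_prim_shift.
have p112 : L2 mu `[c, d] p11 by exact: L2_prim_shift.
have p012 : L2 mu `[c, d] p01 by exact: L2_prim_shift.
apply: WD_grid => [[|[|//]]|[|[|[|//]]] [|[|//]]] _.
- apply: (WD_eq e002 _ _ (WD_Sq_x _ n102 p012 e112)); first exact: (L2_y_primitive n102 e112).
  by move=> z Qz; rewrite /= (grid2_e10y Qz).
- exact: (WD_Sq_x _ h20 p112 e212).
- move=> _; apply: (WD_eq e002 _ _ (WD_Sq_y _ n102 p012 e112)); first exact: (L2_x_primitive p012 e112).
  by move=> z Qz; rewrite /= (grid2_e01x Qz).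
- by move=> _; exact: (WD_Sq_y _ n112 h02 e122).
- move=> _; apply: (WD_eq e102 _ _ (WD_Sq_y _ h20 p112 e212)); first exact: (L2_x_primitive p112 e212).
  by move=> z Qz; rewrite /= (grid2_e11x Qz).
- by move=> _; exact: (WD_Sq_y _ h21 h12 h22).
- by move=> _; apply: (WD_y_primitive h20 e212 e202); exact: aeW.
- by move=> _; apply: (WD_y_primitive h21 h22 e212); exact: aeW.
Qed.

End grid.

(** The weak derivative [d_x d_y f] makes [d_x f] a primitive in [y]. In [f = m(y) + Jx (d_x f)] the
    function [m] is a priori only in L2; the existence of [d_y f], through [y_part_primitive], makes
    it a primitive. *)
Lemma in_H1_representation f : L2 (mu2 R) Q f ->
  (forall i j, (maxn i j <= 1)%N -> has_wderiv a b c d i j f) ->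
  exists w n r, [/\ L2 mu `[a, b] n, L2 mu `[c, d] r &
    f = Sq a c w n r (wderiv0 a b c d 1 1 f) %[ae mu2 R in Q]].
Proof.
move=> f2 Hf; pose g i j := wderiv0 a b c d i j f.
have gP i j : (maxn i j <= 1)%N -> L2 (mu2 R) Q (g i j) /\ WD i j f (g i j).
  by move=> h; exact: wderiv0P (Hf i j h).
have [g102 g10] := gP 1%N 0%N isT; have [g012 g01] := gP 0%N 1%N isT.
have [g112 g11] := gP 1%N 1%N isT.
have w10 : WD 0 1 (g 1 0)%N (g 1 1)%N by exact: WD_split_y g10 g11.
have [n n2 g10E] := y_primitive_of_WD cd g102 g112 w10.
have [m m2 fE] := x_primitive_of_WD ab f2 g102 g10.
have e2 := L2_y_primitive n2 g112.
have JE := Jx_ae (L2_L1_rect g102) (L2_L1_rect e2) g102 e2 g10E.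
have fE' : f = (fun z => m z.2 + Jx a (fun z => n z.1 + Jy c (g 1 1)%N z) z) %[ae mu2 R in Q].
  by apply: aeS2 fE JE => z h1 h2 Qz; rewrite (h1 Qz) (h2 Qz).
have wJ := WD_Jx n2 g112 (fun z _ => erefl).
have [w [r [r2 mE _]]] := y_part_primitive ab cd m2 f2 g012 (L2_Jx e2) (L2_Jx g112) g01 wJ fE'.
exists w, n, r; split => //.
have := @ae_ext2 R a b c d (fun y => m y = w + prim c r y) mE.
by apply: aeS2 fE' => z h1 h2 Qz; rewrite (Sq_x _ _ n2 g112 Qz) -(h2 Qz) (h1 Qz).
Qed.

(** The derivatives are treated in decreasing order [i] in [x]. At [i = 2] they are primitives in
    [y]. At [i = 1] and [i = 0] integration in [x] leaves a function of [y] alone, which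
    [y_part_primitive] differentiates twice; each use yields one constant and one function of the
    jet. *)
Lemma in_H2_representation f : L2 (mu2 R) Q f ->
  (forall i j, (maxn i j <= 2)%N -> has_wderiv a b c d i j f) ->
  exists2 J, L2jet J & j22 J = wderiv0 a b c d 2 2 f /\
    f = grid2 J 0 0 %[ae mu2 R in Q].
Proof.
move=> f2 Hf; pose g i j := wderiv0 a b c d i j f.
have gP i j : (maxn i j <= 2)%N -> L2 (mu2 R) Q (g i j) /\ WD i j f (g i j).
  by move=> h; exact: wderiv0P (Hf i j h).
have [g102 g10] := gP 1%N 0%N isT; have [g012 g01] := gP 0%N 1%N isT.
have [g112 g11] := gP 1%N 1%N isT; have [g202 g20] := gP 2%N 0%N isT.
have [g212 g21] := gP 2%N 1%N isT; have [g222 g22] := gP 2%N 2%N isT.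
have [g022 g02] := gP 0%N 2%N isT; have [g122 g12] := gP 1%N 2%N isT.
have w20 := WD_split_y g20 g21; have w21 := WD_split_y g21 g22.
have w10 := WD_split_y g10 g11; have w11 := WD_split_y g11 g12.
have w01 := WD_split_y g01 g02.
have x10 := WD_split_x g10 g20.
have [h21 h212 g21E] := y_primitive_of_WD cd g212 g222 w21.
have [h20 h202 g20E] := y_primitive_of_WD cd g202 g212 w20.
pose e21 z := h21 z.1 + Jy c (g 2 2)%N z.
have e212 : L2 (mu2 R) Q e21 by exact: L2_y_primitive.
pose e20 z := h20 z.1 + Jy c e21 z.
have e202 : L2 (mu2 R) Q e20 by exact: L2_y_primitive.
have g20E' : (g 2 0)%N = e20 %[ae mu2 R in Q].
  have := Jy_ae (L2_L1_rect g212) (L2_L1_rect e212) g21E.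
  by apply: aeS2 g20E => z h1 h2 Qz; rewrite (h1 Qz) (h2 Qz).
have [m1 m12 g10E] := x_primitive_of_WD ab g102 g202 x10.
have g10E' : (g 1 0)%N = (fun z => m1 z.2 + Jx a e20 z) %[ae mu2 R in Q].
  have := Jx_ae (L2_L1_rect g202) (L2_L1_rect e202) g202 e202 g20E'.
  by apply: aeS2 g10E => z h1 h2 Qz; rewrite (h1 Qz) (h2 Qz).
have wJ20 : WD 0 1 (Jx a e20) (Jx a e21) := WD_Jx h202 e212 (fun z _ => erefl).
have wJ21 : WD 0 1 (Jx a e21) (Jx a (g 2 2)%N) := WD_Jx h212 g222 (fun z _ => erefl).
have [h10 [r1 [r12 m1E g11E]]] :=
  y_part_primitive ab cd m12 g102 g112 (L2_Jx e202) (L2_Jx e212) w10 wJ20 g10E'.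
have [h11 [h12 [h122 r1E g12E]]] :=
  y_part_primitive ab cd r12 g112 g122 (L2_Jx e212) (L2_Jx g222) w11 wJ21 g11E.
have [m0 m02 fE] := x_primitive_of_WD ab f2 g102 g10.
(* A provisional jet holding the data found so far. The entries with [i = 0] are set to 0; the grid
   functions with [i >= 1] do not involve them. *)
pose J0 := Jet2 0 h10 0 h11 h20 h21 (fun=> 0) h12 (g 2 2)%N.
have J02 : L2jet J0 by split => //; exact: (L2_0 mu mcd).
pose p11 y := h11 + prim c h12 y.
have p112 : L2 mu `[c, d] p11 by exact: L2_prim_shift.
have g10G : (g 1 0)%N = grid2 J0 1 0 %[ae mu2 R in Q].
  have := @ae_ext2 R a b c d (fun y => m1 y = h10 + prim c r1 y) m1E.
  apply: aeS2 g10E' => z k1 k2 Qz; rewrite (k1 Qz) (k2 Qz) [RHS](grid2_e10x J02 Qz).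
  congr (_ + _ + _).
  exact: (prim_ae (L2_L1_segment r12) (L2_L1_segment p112) r1E (rect_bounds Qz).2).
have G2 i j := L2_grid2 J02 i j.
have fE' : f = (fun z => m0 z.2 + Jx a (grid2 J0 1 0) z) %[ae mu2 R in Q].
  have := Jx_ae (L2_L1_rect g102) (L2_L1_rect (G2 1 0)%N) g102 (G2 1 0)%N g10G.
  by apply: aeS2 fE => z h1 h2 Qz; rewrite (h1 Qz) (h2 Qz).
have n102 : L2 mu `[a, b] (fun x => h10 + prim a h20 x) by exact: L2_prim_shift.
have n112 : L2 mu `[a, b] (fun x => h11 + prim a h21 x) by exact: L2_prim_shift.
have wJ10 := WD_Jx n102 (G2 1 1)%N (grid2_e10y J02).
have wJ11 := WD_Jx n112 (G2 1 2)%N (grid2_e11y J02).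
have [h00 [r0 [r02 m0E g01E]]] :=
  y_part_primitive ab cd m02 f2 g012 (L2_Jx (G2 1 0)%N) (L2_Jx (G2 1 1)%N) g01 wJ10 fE'.
have [h01 [h02 [h022 r0E g02E]]] :=
  y_part_primitive ab cd r02 g012 g022 (L2_Jx (G2 1 1)%N) (L2_Jx (G2 1 2)%N) w01 wJ11 g01E.
pose J := Jet2 h00 h10 h01 h11 h20 h21 h02 h12 (g 2 2)%N.
have J2 : L2jet J by split.
exists J; first exact: J2.
split; first by [].

pose p01 y := h01 + prim c h02 y.
have p012 : L2 mu `[c, d] p01 by exact: L2_prim_shift.
have := @ae_ext2 R a b c d (fun y => m0 y = h00 + prim c r0 y) m0E.
apply: aeS2 fE' => z k1 k2 Qz; rewrite (k1 Qz) (k2 Qz).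
rewrite [RHS](Sq_x _ _ n102 (G2 1 1)%N Qz); congr (_ + _ + _).
  exact: (prim_ae (L2_L1_segment r02) (L2_L1_segment p012) r0E (rect_bounds Qz).2).
by apply: Jx_eq Qz => w Qw; exact: (grid2_e10y J02 Qw).
Qed.

End grid2.

(** * Hölder estimates for primitives and limits at 0 *)

Section generic.
Context (R : realType).
Local Notation mu := (@lebesgue_measure R).

(** [g] is replaced by the maximum of [f] and [g], which equals [g] almost everywhere and dominates
    [f] everywhere. *)
Lemma le_Rintegral_ae d (T : measurableType d) (m : {measure set T -> \bar R})
    (D : set T) (f g : T -> R) : measurable D -> L1 m D f -> L1 m D g ->
  {ae m, forall x, D x -> f x <= g x} ->
  \int[m]_(x in D) f x <= \int[m]_(x in D) g x.
Proof.
move=> mD fi gi fg.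
have mh : measurable_fun D (fun x => Num.max (f x) (g x)).
  exact: measurable_maxr (L1_measurable fi) (L1_measurable gi).
have hi : L1 m D (fun x => Num.max (f x) (g x)).
  apply: (L1_le mD mh (L1D mD (L1_norm fi) (L1_norm gi))) => x _.
  by case: (leP (f x) (g x)) => _; rewrite ?lerDl ?lerDr.
have -> : \int[m]_(x in D) g x = \int[m]_(x in D) Num.max (f x) (g x).
  apply: (ae_eq_Rintegral mD (L1_measurable gi) mh).
  by apply: filterS fg => x h Dx; case: (leP (f x) (g x)) (h Dx) => //; case: ltgtP.
by apply: le_Rintegral => // x _; rewrite le_max lexx.
Qed.

Lemma cvg0_le (F G : R -> R) : (\forall e \near 0^'+, 0 <= F e <= G e) ->
  G @ 0^'+ --> (0 : R) -> F @ 0^'+ --> (0 : R).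
Proof. by move=> FG G0; apply: (squeeze_cvgr FG) => //; exact: cvg_cst. Qed.

Lemma cvg0_linear (k : R) : (fun e : R => k * e) @ 0^'+ --> (0 : R).
Proof.
rewrite -{2}(mulr0 k); apply: cvgM; first exact: cvg_cst.
by apply: cvg_within_filter; exact: cvg_id.
Qed.

Lemma le0_cvg0 (k : R) (F : R -> R) : (\forall e \near 0^'+, k <= F e) ->
  F @ 0^'+ --> (0 : R) -> k <= 0.
Proof.
move=> kF F0; rewrite leNgt; apply/negP => k0.
have kF' : \forall e \near 0^'+, k <= F e /\ F e < k.
  by near=> e; split; [near: e; exact: kF|near: e; exact: (cvgr_lt _ F0 _ k0)].
by case: (@filter_ex _ _ (at_right_proper_filter 0) _ kF') => e [h1 h2]; move: (le_lt_trans h1 h2); rewrite ltxx.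
Unshelve. all: by end_near. Qed.

Lemma cvg0_twice (F G : R -> R) : F @ 0^'+ --> (0 : R) -> G @ 0^'+ --> (0 : R) ->
  (fun e => 2 * F e + 2 * G e) @ 0^'+ --> (0 : R).
Proof.
move=> F0 G0.
have h : (fun e => 2 * F e + 2 * G e) @ 0^'+ --> (2 * 0 + 2 * 0 : R).
  by apply: cvgD; apply: cvgM => //; exact: cvg_cst.
by rewrite !mulr0 addr0 in h.
Qed.

(** At an end of [[c, d]] only half of the neighbourhood of [y0] remains, hence a length between [e]
    and [2 * e]. The upper bound serves the existence of traces, the lower one their uniqueness. *)
Lemma near_segment (c d y0 e : R) : c <= y0 <= d -> 0 < e ->
  exists p q, [/\ c <= p, q <= d, e <= d - c -> e <= q - p,
    0 <= q - p <= 2 * e &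
    forall y, (c <= y <= d) && (`|y - y0| <= e) = (p <= y <= q)].
Proof.
move=> /andP[cy yd] e0; exists (Num.max c (y0 - e)), (Num.min d (y0 + e)).
split.
- by rewrite le_max lexx.
- by rewrite ge_min lexx.
- by case: (leP c (y0 - e)); case: (leP d (y0 + e)); lra.
- by case: (leP c (y0 - e)); case: (leP d (y0 + e)) => h1 h2; apply/andP; split; lra.
- move=> y; rewrite ler_distl ge_max le_min.
  by case: (c <= y); case: (y <= d); case: (y0 - e <= y); case: (y <= y0 + e).
Qed.

Lemma primB (p q x y : R) (f : R -> R) : L1 mu `[p, q] f ->
  p <= x -> x <= y -> y <= q ->
  prim p f y - prim p f x = \int[mu]_(t in `[x, y]) f t.
Proof.
move=> fi px xy yq; have fy := L1_subsegment (lexx p) yq fi.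
have fxy := L1_subsegment px yq fi.
rewrite /prim Rintegral_itvB ?bnd_simp//.
rewrite Rintegral_itv_obnd_cbnd//.
apply: (L1_subset (measurable_segment x y)) fxy => //; exact: subset_itv_oc_cc.
Qed.

(** Cauchy-Schwarz on the segment between [x] and [y]: the primitive of a square-integrable function
    is Hölder continuous of exponent 1/2. All existence results for traces rest on this. *)
Lemma prim_holder (p q x y : R) (f : R -> R) : L2 mu `[p, q] f ->
  p <= x <= q -> p <= y <= q ->
  (prim p f y - prim p f x) ^+ 2 <= `|y - x| * \int[mu]_(t in `[p, q]) f t ^+ 2.
Proof.
move=> f2; wlog xy : x y / x <= y.
  move=> wl; have [/wl//|yx px py] := leP x y.
  by rewrite -sqrrN opprB distrC; apply: wl => //; exact: ltW.
move=> /andP[px xq] /andP[py yq]; rewrite (primB (L2_L1_segment f2) px xy yq).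
have mxy := measurable_segment x y; have mpq := measurable_segment p q.
have sub := subset_segment px yq.
have f2' := L2_subset mpq mxy sub f2.
apply: (le_trans (sqr_Rintegral_le mxy (segment_lty x y) f2')).
rewrite (segment_measure xy) ger0_norm ?subr_ge0//.
apply: ler_wpM2l; first by rewrite subr_ge0.
have fi := L2_sqr f2.
apply: fine_le.
- exact: (integrable_fin_num mxy (L2_sqr f2')).
- exact: (integrable_fin_num mpq fi).
- apply: (ge0_subset_integral mu mxy mpq) => //.
    by have /measurable_EFinP := L1_measurable fi.
  by move=> t _; rewrite lee_fin sqr_ge0.
Qed.

End generic.

(** * Traces *)

Section traces.
Variables (R : realType) (a b c d : R).
Local Notation mu := (@lebesgue_measure R).
Local Notation Q := (rect a b c d).
Implicit Types f g : R * R -> R.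
Hypotheses (ab : a < b) (cd : c < d).

Let mab := measurable_segment a b.
Let mcd := measurable_segment c d.
Let fab := segment_lty a b.
Let mQ := measurable_rect a b c d.
Let fQ := rect_lty a b c d.

Lemma strip_rect y0 e : c <= y0 <= d -> 0 < e ->
  exists p q, [/\ rect a b c d `&` [set z | `|z.2 - y0| <= e] = rect a b p q,
    c <= p, q <= d, e <= d - c -> e <= q - p & 0 <= q - p <= 2 * e].
Proof.
move=> y0cd e0; have [p [q [cp qd epq pq h]]] := near_segment y0cd e0.
exists p, q; split => //; apply/seteqP; split => -[x y] /=; rewrite /rect/= !in_itv/= -h.
  by move=> [[? ->] ->].
by move=> [? /andP[? ?]].
Qed.

Lemma square_rect x0 y0 e : a <= x0 <= b -> c <= y0 <= d -> 0 < e ->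
  exists p q r s, [/\ rect a b c d `&`
      [set z | `|z.1 - x0| <= e /\ `|z.2 - y0| <= e] = rect p q r s,
    [/\ a <= p, q <= b, c <= r & s <= d], e <= b - a -> e <= q - p,
    e <= d - c -> e <= s - r & 0 <= q - p <= 2 * e /\ 0 <= s - r <= 2 * e].
Proof.
move=> x0ab y0cd e0.
have [p [q [ap qb epq pq h]]] := near_segment x0ab e0.
have [r [s [cr sd ers rs k]]] := near_segment y0cd e0.
exists p, q, r, s; split => //; apply/seteqP; split => -[x y] /=; rewrite /rect/= !in_itv/= -h -k.
  by move=> [[-> ->] [-> ->]].
by move=> [/andP[? ?] /andP[? ?]].
Qed.

Lemma Rintegral_rect_fst (p q r s : R) (G : R -> R) : r <= s -> L1 mu `[p, q] G ->
  L1 (mu2 R) (rect p q r s) (fun z => G z.1) /\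
  \int[mu2 R]_(z in rect p q r s) G z.1 = (s - r) * \int[mu]_(x in `[p, q]) G x.
Proof.
move=> rs Gi; have mpq := measurable_segment p q; have mrs := measurable_segment r s.
have i1 := L1_fst (m1 := mu) (m2 := mu) mpq mrs (segment_lty r s) Gi.
split => //; rewrite (Rfubini1 mpq mrs i1)/=.
rewrite -(RintegralZl _ mpq Gi); apply: eq_Rintegral => x _.
by rewrite (Rintegral_cst mu mrs) (segment_measure rs) mulrC.
Qed.

Lemma Rintegral_rect_cst (p q r s k : R) : p <= q -> r <= s ->
  \int[mu2 R]_(z in rect p q r s) k = (q - p) * (s - r) * k.
Proof.
move=> pq rs; have mpq := measurable_segment p q.
have [_] := Rintegral_rect_fst rs (L1_cst (mu := mu) mpq (segment_lty p q) k).
by move=> ->; rewrite (Rintegral_cst mu mpq) (segment_measure pq); ring.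
Qed.

(** On almost every section [prim_holder] gives [(f - h)^2 <= |y - y0| G(x)]. Over a strip of width
    at most [2 e] this integrates to at most [2 e^2 \int G], and division by [e] leaves
    [2 e \int G]. *)
Lemma is_trace_y_primitive y0 f n g : c <= y0 <= d -> L2 (mu2 R) Q f ->
  L2 mu `[a, b] n -> L2 (mu2 R) Q g ->
  f = (fun z => n z.1 + Jy c g z) %[ae mu2 R in Q] ->
  is_trace_y a b c d y0 f (fun x => n x + Jy c g (x, y0)).
Proof.
move=> y0cd f2 n2 g2 fE; have /andP[cy0 y0d] := y0cd.
pose h x := n x + Jy c g (x, y0).
have h2 : L2 mu `[a, b] h.
  apply: (L2D mab n2).
  have my0 := measurable_segment c y0.
  apply: (L2_Rintegral (m1 := mu) (m2 := mu) mab my0 fab (segment_lty c y0)).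
  exact: (L2_subset mQ (measurable_rect a b c y0) (subset_rect (lexx a) (lexx b) (lexx c) y0d)).
split; first exact: h2.
have D2 : L2 (mu2 R) Q (fun z => f z - h z.1) by exact: (L2B mQ f2 (L2_ext1 c d h2)).
pose G x := \int[mu]_(y in `[c, d]) g (x, y) ^+ 2.
have Gi : L1 mu `[a, b] G := L1_fubini1 mab mcd (L2_sqr g2).
have bound : {ae mu2 R, forall z, Q z -> (f z - h z.1) ^+ 2 <= `|z.2 - y0| * G z.1}.
  have s1 := @ae_ext1 R a b c d (fun x => L2 mu `[c, d] (fun y => g (x, y)))
    (L2_section1 mab mcd g2).
  apply: aeS2 fE s1 => -[x y] e1 e2 Qz; have [_ /= ycd] := rect_bounds Qz.
  rewrite (e1 Qz) /h/= opprD addrACA subrr add0r.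
  exact: (prim_holder (e2 Qz) y0cd ycd).
apply: (cvg0_le _ (cvg0_linear (2 * \int[mu]_(x in `[a, b]) G x))).
near=> e.
have e0 : 0 < e by near: e; exact: nbhs_right_gt.
have [p [q [SE cp qd _ /andP[pq0 pq2]]]] := strip_rect y0cd e0.
have pq : p <= q by rewrite -subr_ge0.
have sub := subset_rect (lexx a) (lexx b) cp qd.
have mS := measurable_rect a b p q.
have Di := L1_subset mQ mS sub (L2_sqr D2).
have [Gi2 Gint] := Rintegral_rect_fst pq (L1Z mab e Gi).
apply/andP; split.
  rewrite mulr_ge0 ?invr_ge0 ?(ltW e0)//.
  by apply: Rintegral_ge0 => z _; exact: sqr_ge0.
rewrite ler_pdivrMl// SE.
apply: (@le_trans _ _ ((q - p) * \int[mu]_(x in `[a, b]) (e * G x))).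
  rewrite -Gint; apply: (le_Rintegral_ae mS Di Gi2).
  apply: aeS bound => z h1 Sz; apply: (le_trans (h1 (sub _ Sz))).
  apply: ler_wpM2r; first by apply: Rintegral_ge0 => t _; exact: sqr_ge0.
  by move: Sz; rewrite -SE => -[].
rewrite (RintegralZl _ mab Gi).
have G0 : 0 <= \int[mu]_(x in `[a, b]) G x.
  by apply: Rintegral_ge0 => x _; apply: Rintegral_ge0 => y _; exact: sqr_ge0.
set I := \int[mu]_(x in `[a, b]) G x.
have -> : e * (2 * I * e) = 2 * e * (e * I) by ring.
by apply: ler_wpM2r => //; rewrite mulr_ge0// ltW.
Unshelve. all: by end_near. Qed.

(** [(h - h')^2 <= 2 (f - h)^2 + 2 (f - h')^2]. Integrated over a strip of width at least [e], this
    bounds [\int (h - h')^2] by twice the sum of two means that tend to 0. *)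
Lemma trace_y_unique y0 f h h' : c <= y0 <= d -> L2 (mu2 R) Q f ->
  is_trace_y a b c d y0 f h -> is_trace_y a b c d y0 f h' ->
  h = h' %[ae mu in `[a, b]%classic].
Proof.
move=> y0cd f2 [h2 ch] [h'2 ch'].
have hh2 := L2B mab h2 h'2; have hhi := L2_sqr hh2.
have D2 := L2B mQ f2 (L2_ext1 c d h2); have D'2 := L2B mQ f2 (L2_ext1 c d h'2).
set k := \int[mu]_(x in `[a, b]) (h x - h' x) ^+ 2.
have k0 : k <= 0.
  apply: (le0_cvg0 _ (cvg0_twice ch ch')); near=> e.
  have e0 : 0 < e by near: e; exact: nbhs_right_gt.
  have ecd : e <= d - c by near: e; apply: nbhs_right_le; rewrite subr_gt0.
  have [p [q [SE cp qd /(_ ecd) epq /andP[pq0 pq2]]]] := strip_rect y0cd e0.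
  have pq : p <= q by rewrite -subr_ge0.
  have sub := subset_rect (lexx a) (lexx b) cp qd.
  have mS := measurable_rect a b p q.
  have Di := L1Z mS 2 (L1_subset mQ mS sub (L2_sqr D2)).
  have D'i := L1Z mS 2 (L1_subset mQ mS sub (L2_sqr D'2)).
  have [ki kint] := Rintegral_rect_fst pq hhi.
  rewrite /= SE mulrCA (mulrCA 2) -mulrDr ler_pdivlMl//.
  apply: (@le_trans _ _ ((q - p) * k)).
    by apply: ler_wpM2r => //; apply: Rintegral_ge0 => x _; exact: sqr_ge0.
  rewrite -kint -(RintegralZl _ mS (L1_subset mQ mS sub (L2_sqr D2))).
  rewrite -(RintegralZl _ mS (L1_subset mQ mS sub (L2_sqr D'2))).
  rewrite -(RintegralD mS Di D'i); apply: (le_Rintegral mS ki (L1D mS Di D'i)) => z _.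
  rewrite -mulrDr -subr_ge0.
  have -> : 2 * ((f z - h z.1) ^+ 2 + (f z - h' z.1) ^+ 2) - (h z.1 - h' z.1) ^+ 2 =
    ((f z - h z.1) + (f z - h' z.1)) ^+ 2 by ring.
  exact: sqr_ge0.
have k00 : k = 0.
  by apply/eqP; rewrite eq_le k0; apply: Rintegral_ge0 => x _; exact: sqr_ge0.
have := Rintegral_eq0_ae mab hhi (fun x _ => sqr_ge0 _) k00.
apply: aeS => x h0 xab; apply/eqP; rewrite -subr_eq0 -sqrf_eq0; apply/eqP; exact: h0.
Unshelve. all: by end_near. Qed.

Lemma trace_xy_unique x0 y0 f v v' : Q (x0, y0) -> L2 (mu2 R) Q f ->
  is_trace_xy a b c d x0 y0 f v -> is_trace_xy a b c d x0 y0 f v' -> v = v'.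
Proof.
move=> /rect_bounds[/= x0ab y0cd] f2 ch ch'.
have D2 := L2B mQ f2 (L2_cst mQ fQ v); have D'2 := L2B mQ f2 (L2_cst mQ fQ v').
set k := (v - v') ^+ 2.
have k0 : k <= 0.
  apply: (le0_cvg0 _ (cvg0_twice ch ch')); near=> e.
  have e0 : 0 < e by near: e; exact: nbhs_right_gt.
  have ecd : e <= d - c by near: e; apply: nbhs_right_le; rewrite subr_gt0.
  have eab : e <= b - a by near: e; apply: nbhs_right_le; rewrite subr_gt0.
  have [p [q [r [s [SE [ap qb cr sd] /(_ eab) epq /(_ ecd) ers]]]]] := square_rect x0ab y0cd e0.
  move=> [/andP[pq0 pq2] /andP[rs0 rs2]].
  have pq : p <= q by rewrite -subr_ge0.
  have rs : r <= s by rewrite -subr_ge0.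
  have sub := subset_rect ap qb cr sd.
  have mS := measurable_rect p q r s.
  have Di := L1Z mS 2 (L1_subset mQ mS sub (L2_sqr D2)).
  have D'i := L1Z mS 2 (L1_subset mQ mS sub (L2_sqr D'2)).
  rewrite /= SE mulrCA (mulrCA 2) -mulrDr ler_pdivlMl ?exprn_gt0//.
  apply: (@le_trans _ _ ((q - p) * (s - r) * k)).
    apply: ler_wpM2r; first exact: sqr_ge0.
    by rewrite expr2; apply: ler_pM => //; exact: ltW.
  rewrite -(Rintegral_rect_cst k pq rs) -(RintegralZl _ mS (L1_subset mQ mS sub (L2_sqr D2))).
  rewrite -(RintegralZl _ mS (L1_subset mQ mS sub (L2_sqr D'2))).
  rewrite -(RintegralD mS Di D'i).
  apply: (le_Rintegral mS (L1_cst mS (rect_lty p q r s) k) (L1D mS Di D'i)) => z _.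
  rewrite -mulrDr -subr_ge0.
  have -> : 2 * ((f z - v) ^+ 2 + (f z - v') ^+ 2) - k =
    ((f z - v) + (f z - v')) ^+ 2 by rewrite /k; ring.
  exact: sqr_ge0.
apply/eqP; rewrite -subr_eq0 -sqrf_eq0 eq_le k0; exact: sqr_ge0.
Unshelve. all: by end_near. Qed.

(** The bound is uniform in [y], so the Hölder constant it yields for [Jx a (Jy c g)] in the
    variable [x] does not depend on [y]. *)
Lemma Jy_sqr_bound y g : c <= y <= d -> L2 (mu2 R) Q g ->
  L2 mu `[a, b] (fun x => Jy c g (x, y)) /\
  \int[mu]_(x in `[a, b]) Jy c g (x, y) ^+ 2 <=
    (d - c) * \int[mu2 R]_(z in Q) g z ^+ 2.
Proof.
move=> ycd g2; have /andP[cy yd] := ycd.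
have my := measurable_segment c y.
have J2 : L2 mu `[a, b] (fun x => Jy c g (x, y)).
  apply: (L2_Rintegral (m1 := mu) (m2 := mu) mab my fab (segment_lty c y)).
  exact: (L2_subset mQ (measurable_rect a b c y) (subset_rect (lexx a) (lexx b) (lexx c) yd)).
split => //; have g2i := L2_sqr g2.
rewrite (Rfubini1 mab mcd g2i) -(RintegralZl _ mab (L1_fubini1 mab mcd g2i)).
apply: (le_Rintegral_ae mab (L2_sqr J2) (L1Z mab _ (L1_fubini1 mab mcd g2i))).
apply: aeS (L2_section1 mab mcd g2) => x gx xab.
have cc : c <= c <= d by rewrite lexx ltW.
have := prim_holder (gx xab) cc ycd.
have -> : prim c (fun y => g (x, y)) c = 0.
  by rewrite /prim set_itv1 Rintegral_set1.
rewrite subr0 => h; apply: (le_trans h); apply: ler_wpM2r.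
  by apply: Rintegral_ge0 => t _; exact: sqr_ge0.
by rewrite ger0_norm ?subr_ge0// lerB.
Qed.

End traces.

(** * Corner traces *)

Section corners.
Variables (R : realType) (a b c d : R).
Local Notation mu := (@lebesgue_measure R).
Local Notation Q := (rect a b c d).
Implicit Types f g : R * R -> R.
Hypotheses (ab : a < b) (cd : c < d).

Let mQ := measurable_rect a b c d.
Let fQ := rect_lty a b c d.

(** The increment from [(x', y')] to [(x, y)] passes through [(x', y)]; each one-dimensional piece
    is the increment of a primitive and is bounded by [prim_holder]. *)
Lemma Sq_holder w n r g : L2 mu `[a, b] n -> L2 mu `[c, d] r ->
  L2 (mu2 R) Q g -> exists M, forall (z z' : R * R) (e : R), Q z -> Q z' ->
  `|z.1 - z'.1| <= e -> `|z.2 - z'.2| <= e ->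
  (Sq a c w n r g z - Sq a c w n r g z') ^+ 2 <= M * e.
Proof.
move=> n2 r2 g2.
set N := \int[mu]_(x in `[a, b]) n x ^+ 2.
set P := \int[mu]_(y in `[c, d]) r y ^+ 2.
set K := \int[mu2 R]_(z in Q) g z ^+ 2.
(* The factor 4 bounds the square of a sum of four increments; the last two terms come from
   [Jy_sqr_bound] in either variable. *)
exists (4 * (N + P + (d - c) * K + (b - a) * K)) => -[x y] [x' y'] e Qz Qz' /= xe ye.
have [/= xab ycd] := rect_bounds Qz; have [/= x'ab y'cd] := rect_bounds Qz'.
have Qz'' : Q (x', y) by split; rewrite /= in_itv.
have [Ji Jb] := Jy_sqr_bound cd ycd g2.
have [J'i J'b] := Jy_sqr_bound ab x'ab (L2_sw g2).
have hN := prim_holder n2 x'ab xab; have hP := prim_holder r2 y'cd ycd.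
have h1 := prim_holder Ji x'ab xab; have h2 := prim_holder J'i y'cd ycd.
(* The order of integration is exchanged so that the increment in [y] is that of a [y]-primitive. *)
have JE1 : Jx a (Jy c g) (x', y) = prim c (fun t => Jy a (sw g) (t, x')) y.
  by rewrite (Jx_Jy (L2_L1_rect g2) Qz'').
have JE2 : Jx a (Jy c g) (x', y') = prim c (fun t => Jy a (sw g) (t, x')) y'.
  by rewrite (Jx_Jy (L2_L1_rect g2) Qz').
have -> : Sq a c w n r g (x, y) - Sq a c w n r g (x', y') =
  (prim a n x - prim a n x') + (prim c r y - prim c r y') +
  (prim a (fun t => Jy c g (t, y)) x - prim a (fun t => Jy c g (t, y)) x') +
  (prim c (fun t => Jy a (sw g) (t, x')) y - prim c (fun t => Jy a (sw g) (t, x')) y').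
  have alg (k A A' C C' D D' D'' : R) : k + A + C + D - (k + A' + C' + D'') =
    (A - A') + (C - C') + (D - D') + (D' - D'') by ring.
  by rewrite -JE1 -JE2; exact: alg.
rewrite (Rintegral_sw (L2_sqr g2)) -/K in J'b.
set A := prim a n x - _ in hN *; set C := prim c r y - _ in hP *.
set D := prim a _ x - _ in h1 *; set E := prim c _ y - _ in h2 *.
have e0 : 0 <= e by exact: le_trans xe.
have bound (u v I I' : R) : 0 <= I -> I <= I' -> `|u| <= e -> v ^+ 2 <= `|u| * I -> v ^+ 2 <= I' * e.
  move=> I0 II' ue vu; apply: (le_trans vu); rewrite mulrC; exact: ler_pM.
have int0 p q (h : R -> R) : 0 <= \int[mu]_(t in `[p, q]) h t ^+ 2.
  by apply: Rintegral_ge0 => t _; exact: sqr_ge0.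
have {}hN := bound _ _ _ _ (int0 _ _ _) (lexx _) xe hN.
have {}hP := bound _ _ _ _ (int0 _ _ _) (lexx _) ye hP.
have {}h1 := bound _ _ _ _ (int0 _ _ _) Jb xe h1.
have {}h2 := bound _ _ _ _ (int0 _ _ _) J'b ye h2.
apply: (@le_trans _ _ (4 * (A ^+ 2 + C ^+ 2 + D ^+ 2 + E ^+ 2))).
  rewrite -subr_ge0.
  have -> : 4 * (A ^+ 2 + C ^+ 2 + D ^+ 2 + E ^+ 2) - (A + C + D + E) ^+ 2 =
    (A - C) ^+ 2 + (A - D) ^+ 2 + (A - E) ^+ 2 + (C - D) ^+ 2 + (C - E) ^+ 2 + (D - E) ^+ 2.
    by ring.
  by rewrite !addr_ge0 ?sqr_ge0.
rewrite -mulrA ler_pM2l; last by [].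
rewrite (mulrDl _ _ e) (mulrDl _ _ e) (mulrDl N P e).
exact: (lerD (lerD (lerD hN hP) h1) h2).
Qed.

Lemma is_trace_xy_Sq x0 y0 f w n r g : Q (x0, y0) -> L2 (mu2 R) Q f ->
  L2 mu `[a, b] n -> L2 mu `[c, d] r -> L2 (mu2 R) Q g ->
  f = Sq a c w n r g %[ae mu2 R in Q] ->
  is_trace_xy a b c d x0 y0 f (Sq a c w n r g (x0, y0)).
Proof.
move=> Q0 f2 n2 r2 g2 fE; have [M HM] := Sq_holder w n2 r2 g2.
have [/= x0ab y0cd] := rect_bounds Q0.
set v := Sq _ _ _ _ _ _ _.
have D2 := L2B mQ f2 (L2_cst mQ fQ v).
(* The small square has area at most [(2 * e)^2] and the integrand is at most [M * e]. *)
apply: (cvg0_le _ (cvg0_linear (4 * M))); near=> e.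
have e0 : 0 < e by near: e; exact: nbhs_right_gt.
have [p [q [r' [s [SE [ap qb cr sd] _ _]]]]] := square_rect x0ab y0cd e0.
move=> [/andP[pq0 pq2] /andP[rs0 rs2]].
have pq : p <= q by rewrite -subr_ge0.
have rs : r' <= s by rewrite -subr_ge0.
have sub := subset_rect ap qb cr sd.
have mS := measurable_rect p q r' s.
have Di := L1_subset mQ mS sub (L2_sqr D2).
apply/andP; split.
  rewrite mulr_ge0 ?invr_ge0 ?exprn_ge0 ?(ltW e0)//.
  by apply: Rintegral_ge0 => z _; exact: sqr_ge0.
have Me0 : 0 <= M * e.
  apply: (le_trans (sqr_ge0 _) (HM _ _ e Q0 Q0 _ _)); by rewrite subrr normr0 ltW.
rewrite ler_pdivrMl ?exprn_gt0// SE.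
apply: (@le_trans _ _ ((q - p) * (s - r') * (M * e))).
  rewrite -(Rintegral_rect_cst _ pq rs).
  apply: (le_Rintegral_ae mS Di (L1_cst mS (rect_lty p q r' s) _)).
  apply: aeS fE => z h Sz; rewrite (h (sub _ Sz)).
  by move: (Sz); rewrite -SE => -[Qz [/= h1 h2]]; exact: HM.
have -> : e ^+ 2 * (4 * M * e) = 2 * e * (2 * e) * (M * e) by ring.
by apply: ler_wpM2r => //; exact: ler_pM.
Unshelve. all: by end_near. Qed.

Lemma is_trace_x_sw x0 f h : a <= x0 <= b -> L2 (mu2 R) Q f ->
  is_trace_x a b c d x0 f h <-> is_trace_y c d a b x0 (sw f) h.
Proof.
move=> x0ab f2.
have E e : L2 mu `[c, d] h -> 0 < e ->
    \int[mu2 R]_(z in rect a b c d `&` [set z | `|z.1 - x0| <= e]) (f z - h z.2) ^+ 2 =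
    \int[mu2 R]_(z in rect c d a b `&` [set z | `|z.2 - x0| <= e]) (sw f z - h z.1) ^+ 2.
  move=> h2 e0; have [p [q [SE ap qb _ _]]] := strip_rect c d x0ab e0.
  have -> : rect a b c d `&` [set z | `|z.1 - x0| <= e] = rect p q c d.
    apply/seteqP; split=> -[x y].
      move=> [[/= h1 h2'] h3]; have : rect c d p q (y, x) by rewrite -SE.
      by move=> [].
    move=> [h1 h2']; have : rect c d p q (y, x) by [].
    by rewrite -SE => -[[]].
  rewrite SE.
  have D2 := L2B mQ f2 (L2_ext2 a b h2).
  rewrite -(Rintegral_sw (L1_subset mQ (measurable_rect p q c d) _ (L2_sqr D2)))//.
  exact: subset_rect.
split=> -[h2 ch]; split => //.
  apply: (cvg0_le _ ch); near=> e.
  have e0 : 0 < e by near: e; exact: nbhs_right_gt.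
  rewrite -(E _ h2 e0) lexx andbT mulr_ge0 ?invr_ge0 ?(ltW e0)//.
  by apply: Rintegral_ge0 => z _; exact: sqr_ge0.
apply: (cvg0_le _ ch); near=> e.
have e0 : 0 < e by near: e; exact: nbhs_right_gt.
rewrite -(E _ h2 e0) lexx andbT mulr_ge0 ?invr_ge0 ?(ltW e0)//.
by apply: Rintegral_ge0 => z _; exact: sqr_ge0.
Unshelve. all: by end_near. Qed.

Lemma xget_trace_y y0 f n g : c <= y0 <= d -> L2 (mu2 R) Q f ->
  L2 mu `[a, b] n -> L2 (mu2 R) Q g ->
  f = (fun z => n z.1 + Jy c g z) %[ae mu2 R in Q] ->
  let h := xget (fun=> 0) (is_trace_y a b c d y0 f) in
  L2 mu `[a, b] h /\
  h = (fun x => n x + Jy c g (x, y0)) %[ae mu in `[a, b]%classic].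
Proof.
move=> y0cd f2 n2 g2 fE /=.
have tr := is_trace_y_primitive y0cd f2 n2 g2 fE.
have tr' := xgetI (fun=> 0) tr; split; first by case: tr'.
exact: (trace_y_unique cd y0cd f2 tr' tr).
Qed.

Lemma xget_trace_x x0 f n g : a <= x0 <= b -> L2 (mu2 R) Q f ->
  L2 mu `[c, d] n -> L2 (mu2 R) Q g ->
  f = (fun z => n z.2 + Jx a g z) %[ae mu2 R in Q] ->
  let h := xget (fun=> 0) (is_trace_x a b c d x0 f) in
  L2 mu `[c, d] h /\
  h = (fun y => n y + Jx a g (x0, y)) %[ae mu in `[c, d]%classic].
Proof.
move=> x0ab f2 n2 g2 fE /=.
have fE' : sw f = (fun z => n z.1 + Jy a (sw g) z) %[ae mu2 R in rect c d a b].
  exact: (ae_sw (L2_L1_rect f2) (L2_L1_rect (L2_x_primitive n2 g2)) fE).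
have tr := is_trace_y_primitive x0ab (L2_sw f2) n2 (L2_sw g2) fE'.
have trx := (is_trace_x_sw _ x0ab f2).2 tr.
have tr' := xgetI (fun=> 0) trx; split; first by case: tr'.
exact: (trace_y_unique ab x0ab (L2_sw f2) ((is_trace_x_sw _ x0ab f2).1 tr') tr).
Qed.

Lemma xget_trace_xy x0 y0 f w n r g : Q (x0, y0) -> L2 (mu2 R) Q f ->
  L2 mu `[a, b] n -> L2 mu `[c, d] r -> L2 (mu2 R) Q g ->
  f = Sq a c w n r g %[ae mu2 R in Q] ->
  xget 0 (is_trace_xy a b c d x0 y0 f) = Sq a c w n r g (x0, y0).
Proof.
move=> Q0 f2 n2 r2 g2 fE; have tr := is_trace_xy_Sq Q0 f2 n2 r2 g2 fE.
exact: (trace_xy_unique ab cd Q0 f2 (xgetI 0 tr) tr).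
Qed.

End corners.

(** * Integrals of matrix-valued functions *)

Section matrix_integrals.
Context d (T : measurableType d) (R : realType).

Definition L1mx (mu : {measure set T -> \bar R}) p q (D : set T)
    (F : T -> 'M[R]_(p, q)) := forall i j, L1 mu D (fun t => F t i j).

Definition bmeasmx p q (D : set T) (F : T -> 'M[R]_(p, q)) :=
  forall i j, bmeas D (fun t => F t i j).

Lemma mulmx_entry p q r (F : T -> 'M[R]_(p, q)) (G : T -> 'M[R]_(q, r)) i j :
  (fun t => (F t *m G t) i j) = (fun t => \sum_k F t i k * G t k j).
Proof. by apply/funext => t; rewrite mxE. Qed.

Lemma addmx_entry p q (F G : T -> 'M[R]_(p, q)) i j :
  (fun t => (F t + G t) i j) = (fun t => F t i j + G t i j).
Proof. by apply/funext => t; rewrite mxE. Qed.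

Lemma bmeasmx_cst p q (D : set T) (C : 'M[R]_(p, q)) : bmeasmx D (fun=> C).
Proof. by move=> i j; exact: bmeas_cst. Qed.

Lemma bmeasmxD p q (D : set T) (F G : T -> 'M[R]_(p, q)) :
  bmeasmx D F -> bmeasmx D G -> bmeasmx D (fun t => F t + G t).
Proof. by move=> bF bG i j; rewrite addmx_entry; exact: bmeasD. Qed.

Lemma bmeasmxM p q r (D : set T) (F : T -> 'M[R]_(p, q)) (G : T -> 'M[R]_(q, r)) :
  bmeasmx D F -> bmeasmx D G -> bmeasmx D (fun t => F t *m G t).
Proof.
by move=> bF bG i j; rewrite mulmx_entry; apply: bmeas_sum => k; exact: bmeasM.
Qed.

Lemma bmeas_comp d' (T' : measurableType d') (D : set T) (E : set T')
    (phi : T -> T') (f : T' -> R) : measurable D -> measurable E ->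
  measurable_fun setT phi -> phi @` D `<=` E -> bmeas E f ->
  bmeas D (fun t => f (phi t)).
Proof.
move=> mD mE mphi sub [mf [C fC]]; split; last first.
  by exists C => x Dx; apply: fC; apply: sub; exists x.
by apply: (measurable_comp mE sub mf); exact: measurable_funS mphi.
Qed.

Variable mu : {measure set T -> \bar R}.
Variable D : set T.
Hypothesis mD : measurable D.

Lemma L1mxD p q (F G : T -> 'M[R]_(p, q)) : L1mx mu D F -> L1mx mu D G ->
  L1mx mu D (fun t => F t + G t).
Proof. by move=> F1 G1 i j; rewrite addmx_entry; exact: (L1D mD). Qed.

Lemma L2mxD p q (F G : T -> 'M[R]_(p, q)) : L2mx mu D F -> L2mx mu D G ->
  L2mx mu D (fun t => F t + G t).
Proof. by move=> F1 G1 i j; rewrite addmx_entry; exact: (L2D mD). Qed.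

Lemma L2mxN p q (F : T -> 'M[R]_(p, q)) : L2mx mu D F -> L2mx mu D (fun t => - F t).
Proof.
move=> F2 i j; have -> : (fun t => (- F t) i j) = (fun t => - F t i j).
  by apply/funext => t; rewrite mxE.
exact: (L2N mD).
Qed.

Lemma L2mx0 p q : L2mx mu D (fun=> 0 : 'M[R]_(p, q)).
Proof.
move=> i j; have -> : (fun t : T => (0 : 'M[R]_(p, q)) i j) = (fun=> 0).
  by apply/funext => t; rewrite mxE.
exact: (L2_0 mu mD).
Qed.

Lemma L2mx_mul p q r (F : T -> 'M[R]_(p, q)) (G : T -> 'M[R]_(q, r)) :
  L2mx mu D F -> L2mx mu D G -> L1mx mu D (fun t => F t *m G t).
Proof.
move=> F2 G2 i j; rewrite mulmx_entry; apply: (L1_sum mD) => k _.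
exact: (L2_mul mD (F2 i k) (G2 k j)).
Qed.

Lemma L2mx_bmeasl p q r (F : T -> 'M[R]_(p, q)) (G : T -> 'M[R]_(q, r)) :
  bmeasmx D F -> L2mx mu D G -> L2mx mu D (fun t => F t *m G t).
Proof.
move=> bF G2 i j; rewrite mulmx_entry; apply: (L2_sum mD) => k.
have -> : (fun t => F t i k * G t k j) = (fun t => G t k j * F t i k).
  by apply/funext => t; rewrite mulrC.
exact: (L2_bmeas mD (G2 k j) (bF i k)).
Qed.

Lemma L2mx_bmeasr p q r (F : T -> 'M[R]_(p, q)) (G : T -> 'M[R]_(q, r)) :
  L2mx mu D F -> bmeasmx D G -> L2mx mu D (fun t => F t *m G t).
Proof.
move=> F2 bG i j; rewrite mulmx_entry; apply: (L2_sum mD) => k.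
exact: (L2_bmeas mD (F2 i k) (bG k j)).
Qed.

Lemma L1mx_bmeasl p q r (F : T -> 'M[R]_(p, q)) (G : T -> 'M[R]_(q, r)) :
  bmeasmx D F -> L1mx mu D G -> L1mx mu D (fun t => F t *m G t).
Proof.
move=> bF G2 i j; rewrite mulmx_entry; apply: (L1_sum mD) => k _.
have -> : (fun t => F t i k * G t k j) = (fun t => G t k j * F t i k).
  by apply/funext => t; rewrite mulrC.
exact: (L1_bmeas mD (G2 k j) (bF i k)).
Qed.

Lemma L1mx_subset (E : set T) p q (F : T -> 'M[R]_(p, q)) : measurable E -> E `<=` D ->
  L1mx mu D F -> L1mx mu E F.
Proof. by move=> mE ED F1 i j; exact: (L1_subset mD mE ED (F1 i j)). Qed.

Lemma L2mx_subset (E : set T) p q (F : T -> 'M[R]_(p, q)) : measurable E -> E `<=` D ->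
  L2mx mu D F -> L2mx mu E F.
Proof. by move=> mE ED F1 i j; exact: (L2_subset mD mE ED (F1 i j)). Qed.

Lemma L2mx_L1mx p q (F : T -> 'M[R]_(p, q)) : (mu D < +oo)%E ->
  L2mx mu D F -> L1mx mu D F.
Proof. by move=> fD F2 i j; exact: (L2_L1 mD fD (F2 i j)). Qed.

Lemma bmeasmx_L2mx p q (F : T -> 'M[R]_(p, q)) : (mu D < +oo)%E ->
  bmeasmx D F -> L2mx mu D F.
Proof. by move=> fD bF i j; have [mf [C fC]] := bF i j; exact: (bounded_L2 mD fD mf fC). Qed.

Lemma eq_mxint p q (F G : T -> 'M[R]_(p, q)) : (forall t, D t -> F t = G t) ->
  mxint mu D F = mxint mu D G.
Proof.
by move=> FG; apply/matrixP => i j; rewrite !mxE; apply: eq_Rintegral => t /set_mem/FG ->.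
Qed.

Lemma mxint_ae p q (F G : T -> 'M[R]_(p, q)) :
  (forall i j, measurable_fun D (fun t => F t i j)) ->
  (forall i j, measurable_fun D (fun t => G t i j)) ->
  F = G %[ae mu in D] -> mxint mu D F = mxint mu D G.
Proof.
move=> mF mG FG; apply/matrixP => i j; rewrite !mxE.
apply: (ae_eq_Rintegral mD (mF i j) (mG i j)).
by apply: aeS FG => t h Dt; rewrite h.
Qed.

Lemma mxintD p q (F G : T -> 'M[R]_(p, q)) : L1mx mu D F -> L1mx mu D G ->
  mxint mu D (fun t => F t + G t) = mxint mu D F + mxint mu D G.
Proof.
move=> F1 G1; apply/matrixP => i j; rewrite !mxE addmx_entry.
exact: (RintegralD mD (F1 i j) (G1 i j)).
Qed.

Lemma mxint0 p q : mxint mu D (fun=> 0 : 'M[R]_(p, q)) = 0.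
Proof.
by apply/matrixP => i j; rewrite !mxE (Rintegral_cst mu mD) mul0r.
Qed.

Lemma mxint_mulmxl p q r (C : 'M[R]_(p, q)) (F : T -> 'M[R]_(q, r)) : L1mx mu D F ->
  mxint mu D (fun t => C *m F t) = C *m mxint mu D F.
Proof.
move=> F1; apply/matrixP => i j; rewrite !mxE (mulmx_entry (fun=> C)).
rewrite (Rintegral_sum mD); last by move=> k; exact: (L1Z mD _ (F1 k j)).
by apply: eq_bigr => k _; rewrite mxE (RintegralZl _ mD (F1 k j)).
Qed.

Lemma mxint_mulmxr p q r (F : T -> 'M[R]_(p, q)) (C : 'M[R]_(q, r)) : L1mx mu D F ->
  mxint mu D (fun t => F t *m C) = mxint mu D F *m C.
Proof.
move=> F1; apply/matrixP => i j; rewrite !mxE (mulmx_entry F (fun=> C)).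
rewrite (Rintegral_sum mD); last first.
  by move=> k; apply: (eq_L1 mD _ (L1Z mD (C k j) (F1 i k))) => t _; rewrite mulrC.
by apply: eq_bigr => k _; rewrite mxE (RintegralZr _ mD (F1 i k)).
Qed.

Lemma mxintN p q (F : T -> 'M[R]_(p, q)) : L1mx mu D F ->
  mxint mu D (fun t => - F t) = - mxint mu D F.
Proof.
move=> F1; rewrite -[RHS]mul1mx mulmxN -mulNmx -(mxint_mulmxl _ F1).
by apply: eq_mxint => t _; rewrite mulNmx mul1mx.
Qed.

End matrix_integrals.

Lemma ae_forall2 d (T : measurableType d) (R : realType)
    (mu : {measure set T -> \bar R}) (I J : finType) (P : I -> J -> T -> Prop) :
  (forall i j, \forall t \ae mu, P i j t) ->
  \forall t \ae mu, forall i j, P i j t.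
Proof.
by move=> h; apply: filter_forall => i; apply: filter_forall => j; exact: h.
Qed.

(** * Fubini for matrix-valued functions *)

Section matrix_fubini.
Context d1 d2 (T1 : measurableType d1) (T2 : measurableType d2) (R : realType).
Variables (m1 : {sigma_finite_measure set T1 -> \bar R})
          (m2 : {sigma_finite_measure set T2 -> \bar R}).
Variables (A : set T1) (B : set T2).
Hypotheses (mA : measurable A) (mB : measurable B).

Lemma L1mx_section1 p q (F : T1 * T2 -> 'M[R]_(p, q)) :
  L1mx (m1 \x m2)%E (A `*` B) F ->
  {ae m1, forall x, A x -> L1mx m2 B (fun y => F (x, y))}.
Proof.
move=> F1; have := ae_forall2 (fun i j => L1_section1 mA mB (F1 i j)).
by apply: aeS => x h Ax i j; exact: h.
Qed.

Lemma L1mx_section2 p q (F : T1 * T2 -> 'M[R]_(p, q)) :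
  L1mx (m1 \x m2)%E (A `*` B) F ->
  {ae m2, forall y, B y -> L1mx m1 A (fun x => F (x, y))}.
Proof.
move=> F1; have := ae_forall2 (fun i j => L1_section2 mA mB (F1 i j)).
by apply: aeS => y h By i j; exact: h.
Qed.

Lemma L2mx_section1 p q (F : T1 * T2 -> 'M[R]_(p, q)) :
  L2mx (m1 \x m2)%E (A `*` B) F ->
  {ae m1, forall x, A x -> L2mx m2 B (fun y => F (x, y))}.
Proof.
move=> F1; have := ae_forall2 (fun i j => L2_section1 mA mB (F1 i j)).
by apply: aeS => x h Ax i j; exact: h.
Qed.

Lemma mxint_entry1 p q (F : T1 * T2 -> 'M[R]_(p, q)) i j :
  (fun x => (mxint m2 B (fun y => F (x, y))) i j) =
  (fun x => \int[m2]_(y in B) F (x, y) i j).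
Proof. by apply/funext => x; rewrite mxE. Qed.

Lemma mxint_entry2 p q (F : T1 * T2 -> 'M[R]_(p, q)) i j :
  (fun y => (mxint m1 A (fun x => F (x, y))) i j) =
  (fun y => \int[m1]_(x in A) F (x, y) i j).
Proof. by apply/funext => y; rewrite mxE. Qed.

Lemma L1mx_fubini1 p q (F : T1 * T2 -> 'M[R]_(p, q)) :
  L1mx (m1 \x m2)%E (A `*` B) F ->
  L1mx m1 A (fun x => mxint m2 B (fun y => F (x, y))).
Proof. by move=> F1 i j; rewrite mxint_entry1; exact: (L1_fubini1 mA mB (F1 i j)). Qed.

Lemma L1mx_fubini2 p q (F : T1 * T2 -> 'M[R]_(p, q)) :
  L1mx (m1 \x m2)%E (A `*` B) F ->
  L1mx m2 B (fun y => mxint m1 A (fun x => F (x, y))).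
Proof. by move=> F1 i j; rewrite mxint_entry2; exact: (L1_fubini2 mA mB (F1 i j)). Qed.

Lemma mxint_fubini1 p q (F : T1 * T2 -> 'M[R]_(p, q)) :
  L1mx (m1 \x m2)%E (A `*` B) F ->
  mxint m1 A (fun x => mxint m2 B (fun y => F (x, y))) = mxint (m1 \x m2)%E (A `*` B) F.
Proof.
move=> F1; apply/matrixP => i j; rewrite !mxE mxint_entry1.
by rewrite (Rfubini1 mA mB (F1 i j)).
Qed.

Lemma mxint_fubini2 p q (F : T1 * T2 -> 'M[R]_(p, q)) :
  L1mx (m1 \x m2)%E (A `*` B) F ->
  mxint m2 B (fun y => mxint m1 A (fun x => F (x, y))) = mxint (m1 \x m2)%E (A `*` B) F.
Proof.
move=> F1; apply/matrixP => i j; rewrite !mxE mxint_entry2.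
by rewrite (Rfubini2 mA mB (F1 i j)).
Qed.

Section pull.
Variables (p q r : nat) (f : T1 -> 'M[R]_(p, q)) (w : T1 * T2 -> 'M[R]_(q, r)).
Hypothesis mf : forall i j, measurable_fun A (fun x => f x i j).
Hypothesis w1 : L1mx (m1 \x m2)%E (A `*` B) w.
Hypothesis fw1 : L1mx (m1 \x m2)%E (A `*` B) (fun z => f z.1 *m w z).

Let pull_ae : {ae m1, forall x, A x ->
  mxint m2 B (fun y => f x *m w (x, y)) = f x *m mxint m2 B (fun y => w (x, y))}.
Proof.
by apply: aeS (L1mx_section1 w1) => x h Ax; exact: (mxint_mulmxl mB _ (h Ax)).
Qed.

Let measurable_pull i j :
  measurable_fun A (fun x => (f x *m mxint m2 B (fun y => w (x, y))) i j).
Proof.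
rewrite mulmx_entry; apply: measurable_sum => k.
apply: measurable_funM; first exact: mf.
exact: (L1_measurable (L1mx_fubini1 w1 k j)).
Qed.

(** The factor [f x] leaves the inner integral only where the section of [w] is integrable, that is
    for almost every [x]. As [f] may be unbounded, integrability is inherited from the product [fw1]
    and not from [w1]. *)
Lemma L1mx_pull : L1mx m1 A (fun x => f x *m mxint m2 B (fun y => w (x, y))).
Proof.
move=> i j; apply: (ae_eq_L1 mA (measurable_pull i j) _ (L1mx_fubini1 fw1 i j)).
by apply: aeS pull_ae => x h Ax; rewrite h.
Qed.

Lemma mxint_pull : mxint m1 A (fun x => f x *m mxint m2 B (fun y => w (x, y))) =
  mxint (m1 \x m2)%E (A `*` B) (fun z => f z.1 *m w z).
Proof.
rewrite -(mxint_fubini1 fw1); apply: (mxint_ae mA measurable_pull).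
  by move=> i j; exact: (L1_measurable (L1mx_fubini1 fw1 i j)).
by apply: aeS pull_ae => x h Ax; rewrite h.
Qed.

End pull.

(** Fubini as used for composing kernels: the integration over the intermediate variable [x] acts on
    the kernel alone, before the argument [u] is integrated. *)
Lemma mxint_push p q r (k : T1 * T2 -> 'M[R]_(p, q)) (u : T2 -> 'M[R]_(q, r)) :
  (forall i j, measurable_fun B (fun y => u y i j)) ->
  L1mx (m1 \x m2)%E (A `*` B) k ->
  L1mx (m1 \x m2)%E (A `*` B) (fun z => k z *m u z.2) ->
  mxint m2 B (fun y => mxint m1 A (fun x => k (x, y)) *m u y) =
  mxint (m1 \x m2)%E (A `*` B) (fun z => k z *m u z.2).
Proof.
move=> mu k1 ku1; rewrite -(mxint_fubini2 ku1).
apply: (mxint_ae mB).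
- move=> i j; rewrite mulmx_entry; apply: measurable_sum => l.
  apply: measurable_funM; last exact: mu.
  exact: (L1_measurable (L1mx_fubini2 k1 i l)).
- by move=> i j; exact: (L1_measurable (L1mx_fubini2 ku1 i j)).
apply: aeS (L1mx_section2 k1) => y h By.
by rewrite -(mxint_mulmxr mA _ (h By)).
Qed.

Hypotheses (fA : (m1 A < +oo)%E) (fB : (m2 B < +oo)%E).

Lemma L2mx_fst p q (F : T1 -> 'M[R]_(p, q)) : L2mx m1 A F ->
  L2mx (m1 \x m2)%E (A `*` B) (fun z => F z.1).
Proof. by move=> F2 i j; exact: (L2_fst mA mB fA fB (F2 i j)). Qed.

Lemma L2mx_snd p q (F : T2 -> 'M[R]_(p, q)) : L2mx m2 B F ->
  L2mx (m1 \x m2)%E (A `*` B) (fun z => F z.2).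
Proof. by move=> F2 i j; exact: (L2_snd mA mB fA fB (F2 i j)). Qed.

Lemma L2mx_swap p q (F : T1 * T2 -> 'M[R]_(p, q)) : L2mx (m1 \x m2)%E (A `*` B) F ->
  L2mx (m2 \x m1)%E (B `*` A) (fun z => F (z.2, z.1)).
Proof. by move=> F2 i j; exact: (L2_swap mA mB fA fB (F2 i j)). Qed.

Lemma L2mx_int p q (F : T1 * T2 -> 'M[R]_(p, q)) : L2mx (m1 \x m2)%E (A `*` B) F ->
  L2mx m1 A (fun x => mxint m2 B (fun y => F (x, y))).
Proof. by move=> F2 i j; rewrite mxint_entry1; exact: (L2_Rintegral mA mB fA fB (F2 i j)). Qed.

End matrix_fubini.

(** * Composition of integral operators *)

(* The kernels of an operator from L_2 of the rectangle to R^m0 x L_2 x L_2, in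
   the order of arguments used for the parameters F and G. *)
Record bikernel (R : realType) (m0 m1 m2 n : nat) := BiKernel {
  k0 : R -> R -> 'M[R]_(m0, n);
  k1_0 : R -> R -> 'M[R]_(m1, n);
  k1_1 : R -> R -> R -> 'M[R]_(m1, n);
  k2_0 : R -> R -> 'M[R]_(m2, n);
  k2_1 : R -> R -> R -> 'M[R]_(m2, n) }.

(** Exchange of the variables at the level of kernels, as [ptr] is for parameters; statements about
    the [y]-component become statements about the [x]-component. *)
Definition ktr (R : realType) m0 m1 m2 n (k : bikernel R m0 m1 m2 n) :
    bikernel R m0 m2 m1 n :=
  BiKernel (fun y x => k0 k x y) (fun y x => k2_0 k x y) (fun y x v => k2_1 k x y v)
    (fun y x => k1_0 k x y) (fun y x t => k1_1 k x y t).

Definition ptr (R : realType) m0 m1 m2 p0 p1 p2 (A : PI011 R m0 m1 m2 p0 p1 p2) :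
    PI011 R m0 m2 m1 p0 p2 p1 :=
  MkPI011 (P00 A) (P02 A) (P01 A) (P20 A) (P22_0 A) (P22_1 A) (fun y x => P21 A x y)
    (P10 A) (fun y x => P12 A x y) (P11_0 A) (P11_1 A).

Lemma aeS3 d (T : measurableType d) (R : realType) (mu : {measure set T -> \bar R})
    (P1 P2 P3 S : T -> Prop) : (forall x, P1 x -> P2 x -> P3 x -> S x) ->
  (\forall x \ae mu, P1 x) -> (\forall x \ae mu, P2 x) ->
  (\forall x \ae mu, P3 x) -> \forall x \ae mu, S x.
Proof. by move=> PS; apply: filterS3. Qed.

Section kernels.
Variable R : realType.
Local Notation mu := (@lebesgue_measure R).
Local Notation MR := (measurableTypeR R).
Implicit Types a b c d : R.

(** A point [(x, (t, y))] consists of the variable [x] of the result and the point [(t, y)] at which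
    the argument is taken. Kernels take these in the order [x y t], hence the permuted projections
    in the statements below. *)
Definition trip p q a b c d : set (R * (R * R)) := `[p, q] `*` rect a b c d.

Definition mu3 : {measure set (MR * (MR * MR)) -> \bar R} := (mu \x sfprod mu mu)%E.

Definition act0 a b c d m0 m1 m2 n (k : bikernel R m0 m1 m2 n) (u : R * R -> 'cV[R]_n) :=
  mxint (mu2 R) (rect a b c d) (fun z => k0 k z.1 z.2 *m u z).

Definition act1 a b c d m0 m1 m2 n (k : bikernel R m0 m1 m2 n) (u : R * R -> 'cV[R]_n)
    (x : R) :=
  \mint_(y in `[c, d]) (k1_0 k x y *m u (x, y)) +
  mxint (mu2 R) (rect a b c d) (fun z => k1_1 k x z.2 z.1 *m u z).

Definition act a b c d m0 m1 m2 n (k : bikernel R m0 m1 m2 n) (u : R * R -> 'cV[R]_n) :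
    rl2 R m0 m1 m2 :=
  (act0 a b c d k u, act1 a b c d k u, act1 c d a b (ktr k) (sw u)).

(** The half in question is the pair of kernels producing the function of [x]; the other half is
    obtained from [ktr k] on the exchanged rectangle. *)
Definition half_bmeas a b c d m0 m1 m2 n (k : bikernel R m0 m1 m2 n) :=
  bmeasmx (rect a b c d) (fun z => k1_0 k z.1 z.2) /\
  bmeasmx (trip a b a b c d) (fun w => k1_1 k w.1 w.2.2 w.2.1).

Definition half_L2 a b c d m0 m1 m2 n (k : bikernel R m0 m1 m2 n) :=
  L2mx (mu2 R) (rect a b c d) (fun z => k1_0 k z.1 z.2) /\
  L2mx mu3 (trip a b a b c d) (fun w => k1_1 k w.1 w.2.2 w.2.1).

Definition bmeas_kernel a b c d m0 m1 m2 n (k : bikernel R m0 m1 m2 n) :=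
  [/\ bmeasmx (rect a b c d) (fun z => k0 k z.1 z.2), half_bmeas a b c d k &
      half_bmeas c d a b (ktr k)].

(** Kernels of [P[A]] composed with [act k]. The terms are arranged so that for [A = Eh] and the
    kernels F they are literally the parameters G, and for [A = B] and the kernels H they reduce to
    F. *)
Definition picomp a b c d m0 m1 m2 p0 p1 p2 n (A : PI011 R m0 m1 m2 p0 p1 p2)
    (k : bikernel R m0 m1 m2 n) : bikernel R p0 p1 p2 n :=
  BiKernel
    (fun x y => P00 A *m k0 k x y + P01 A x *m k1_0 k x y
       + \mint_(t in `[a, b]) (P01 A t *m k1_1 k t y x)
       + P02 A y *m k2_0 k x y
       + \mint_(v in `[c, d]) (P02 A v *m k2_1 k x v y))
    (fun x y => P11_0 A x *m k1_0 k x y)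
    (fun x y t => P10 A x *m k0 k t y + P11_0 A x *m k1_1 k x y t
       + P11_1 A x t *m k1_0 k t y
       + \mint_(e in `[a, b]) (P11_1 A x e *m k1_1 k e y t)
       + P12 A x y *m k2_0 k t y
       + \mint_(v in `[c, d]) (P12 A x v *m k2_1 k t v y))
    (fun x y => P22_0 A y *m k2_0 k x y)
    (fun x y v => P20 A y *m k0 k x v + P22_0 A y *m k2_1 k x y v
       + P22_1 A y v *m k2_0 k x v
       + \mint_(m in `[c, d]) (P22_1 A y m *m k2_1 k x m v)
       + P21 A x y *m k1_0 k x v
       + \mint_(t in `[a, b]) (P21 A t y *m k1_1 k t v x)).

Lemma measurable_trip p q a b c d : measurable (trip p q a b c d : set (MR * (MR * MR))).
Proof. exact: (measurableX (measurable_segment p q) (measurable_rect a b c d)). Qed.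

Lemma measurable_swap : measurable_fun setT (fun z : MR * MR => (z.2, z.1)).
Proof. by apply: measurable_fun_pair. Qed.

Lemma measurable_swap2 :
  measurable_fun setT (fun w : MR * (MR * MR) => (w.1, (w.2.2, w.2.1))).
Proof.
apply: measurable_fun_pair => //; apply: measurable_fun_pair.
  exact: (measurableT_comp measurable_snd measurable_snd).
exact: (measurableT_comp measurable_fst measurable_snd).
Qed.

Lemma square_integrable_ptr a b c d m0 m1 m2 p0 p1 p2 (A : PI011 R m0 m1 m2 p0 p1 p2) :
  square_integrable_parameters a b c d A ->
  square_integrable_parameters c d a b (ptr A).
Proof.
move=> [[h1 h2 h3 h4] [h5 h6 h7 h8] [h9 h10]]; split; [by split|by split|split].
  exact: (L2mx_swap (measurable_segment a b) (measurable_segment c d)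
    (segment_lty a b) (segment_lty c d) h10).
exact: (L2mx_swap (measurable_segment a b) (measurable_segment c d)
  (segment_lty a b) (segment_lty c d) h9).
Qed.

Lemma bmeas_kernel_tr a b c d m0 m1 m2 n (k : bikernel R m0 m1 m2 n) :
  bmeas_kernel a b c d k -> bmeas_kernel c d a b (ktr k).
Proof.
move=> [b0 b1 b2]; split => // i j.
apply: (bmeas_comp (measurable_rect c d a b) (measurable_rect a b c d) measurable_swap _ (b0 i j)).
by move=> _ [[x y] [h1 h2] <-].
Qed.

(** [P] is extended to the variables [((x, z), e)], multiplied there by the bounded [F] and
    integrated in [e], which keeps square integrability because all the sets have finite measure. *)
Lemma L2mx_hilbert_schmidt (p q : R) a b c d m n l (P : R -> R -> 'M[R]_(m, n))
    (F : R -> R * R -> 'M[R]_(n, l)) (r s : R) :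
  L2mx (mu2 R) (`[p, q] `*` `[r, s]) (fun z => P z.1 z.2) ->
  bmeasmx (trip r s a b c d) (fun w => F w.1 w.2) ->
  L2mx mu3 (trip p q a b c d)
    (fun w => \mint_(e in `[r, s]) (P w.1 e *m F e w.2)).
Proof.
move=> P2 bF; have mpq := measurable_segment p q; have mrs := measurable_segment r s.
have mQ := measurable_rect a b c d; have fQ := rect_lty a b c d.
have ft := finite_measureX (m1 := mu) (m2 := sfprod mu mu) mpq mQ (segment_lty p q) fQ.
apply: (L2mx_int (m1 := sfprod mu (sfprod mu mu)) (m2 := mu) (measurable_trip p q a b c d)
  mrs ft (segment_lty r s) (F := fun z => P z.1.1 z.2 *m F z.2 z.1.2)).
have mT : measurable (trip p q a b c d `*` `[r, s] : set ((MR * (MR * MR)) * MR)).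
  exact: (measurableX (measurable_trip p q a b c d) mrs).
apply: (L2mx_bmeasr (mu := (sfprod mu (sfprod mu mu) \x mu)%E) mT) => i j.
  exact: (L2_mid (m1 := mu) (m2 := mu) (m3 := sfprod mu mu) mpq mrs
    (segment_lty p q) (segment_lty r s) mQ fQ (P2 i j)).
apply: (bmeas_comp (phi := fun z : (MR * (MR * MR)) * MR => (z.2, z.1.2)) mT
  (measurable_trip r s a b c d) _ _ (bF i j)).
  apply: measurable_fun_pair => //.
  exact: (measurableT_comp measurable_snd measurable_fst).
by move=> _ [[[x w] e] [[/= h1 h2] h3] <-].
Qed.

Section composition.
Variables (a b c d : R).
Local Notation Q := (rect a b c d).

Let mab := measurable_segment a b.
Let mcd := measurable_segment c d.
Let fab := segment_lty a b.
Let fcd := segment_lty c d.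
Let mQ := measurable_rect a b c d.
Let fQ := rect_lty a b c d.
Let mT := measurable_trip a b a b c d.
Let fT : (mu3 (trip a b a b c d) < +oo)%E :=
  finite_measureX (m1 := mu) (m2 := sfprod mu mu) mab mQ fab fQ.

Lemma L2mx_snd3 m n (u : R * R -> 'M[R]_(m, n)) : L2mx (mu2 R) Q u ->
  L2mx mu3 (trip a b a b c d) (fun w => u w.2).
Proof. exact: (L2mx_snd (m1 := mu) (m2 := sfprod mu mu) mab mQ fab fQ). Qed.

Lemma L2mx_fst3 m n (f : R -> 'M[R]_(m, n)) : L2mx mu `[a, b] f ->
  L2mx mu3 (trip a b a b c d) (fun w => f w.1).
Proof. exact: (L2mx_fst (m1 := mu) (m2 := sfprod mu mu) mab mQ fab fQ). Qed.

(* The outer variable may range over a subsegment: x is also a limit of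
   integration in the parameters T. *)
Lemma row_act1_subsegment p q m0 m1 m2 n (k : bikernel R m0 m1 m2 n) m
    (q1 : R -> 'M[R]_(m, m1)) u :
  (forall i j, measurable_fun (`[p, q]%classic : set MR) (fun x => q1 x i j)) ->
  L2mx (mu2 R) Q u -> L2mx (mu2 R) (rect p q c d) u ->
  L2mx (mu2 R) (rect p q c d) (fun z => k1_0 k z.1 z.2) ->
  L2mx (mu2 R) (rect p q c d) (fun z => q1 z.1 *m k1_0 k z.1 z.2) ->
  L2mx mu3 (trip p q a b c d) (fun w => k1_1 k w.1 w.2.2 w.2.1) ->
  L2mx mu3 (trip p q a b c d) (fun w => q1 w.1 *m k1_1 k w.1 w.2.2 w.2.1) ->
  \mint_(x in `[p, q]) (q1 x *m act1 a b c d k u x) =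
  mxint (mu2 R) (rect p q c d) (fun z => (q1 z.1 *m k1_0 k z.1 z.2) *m u z) +
  mxint (mu2 R) Q (fun z => \mint_(t in `[p, q]) (q1 t *m k1_1 k t z.2 z.1) *m u z).
Proof.
move=> q1m u2 u2' k02 qk02 k12 qk12.
have mpq := measurable_segment p q; have mS := measurable_rect p q c d.
have mS3 := measurable_trip p q a b c d.
have fS3 := finite_measureX (m1 := mu) (m2 := sfprod mu mu) mpq mQ (segment_lty p q) fQ.
have u3 : L2mx mu3 (trip p q a b c d) (fun w => u w.2).
  exact: (L2mx_snd (m1 := mu) (m2 := sfprod mu mu) mpq mQ (segment_lty p q) fQ u2).
have um i j : measurable_fun Q (fun z => u z i j) by case: (u2 i j).
have ku1 := L2mx_mul mS k02 u2'; have k1u1 := L2mx_mul mS3 k12 u3.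
have qku1 : L1mx (mu2 R) (rect p q c d) (fun z => q1 z.1 *m (k1_0 k z.1 z.2 *m u z)).
  by move=> i j; apply: (eq_L1 mS _ (L2mx_mul mS qk02 u2' i j)) => z _; rewrite mulmxA.
have qk1u1 : L1mx mu3 (trip p q a b c d)
    (fun w => q1 w.1 *m (k1_1 k w.1 w.2.2 w.2.1 *m u w.2)).
  by move=> i j; apply: (eq_L1 mS3 _ (L2mx_mul mS3 qk12 u3 i j)) => z _; rewrite mulmxA.
transitivity (mxint mu `[p, q] (fun x =>
    q1 x *m \mint_(y in `[c, d]) (k1_0 k x y *m u (x, y)) +
    q1 x *m mxint (mu2 R) Q (fun z => k1_1 k x z.2 z.1 *m u z))).
  by apply: eq_mxint => x _; rewrite -mulmxDr.
rewrite (mxintD mpq (L1mx_pull (m1 := mu) (m2 := mu) mpq mcd q1m ku1 qku1)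
  (L1mx_pull (m1 := mu) (m2 := sfprod mu mu) mpq mQ q1m k1u1 qk1u1)).
congr (_ + _).
  rewrite (mxint_pull (m1 := mu) (m2 := mu) mpq mcd q1m ku1 qku1).
  by apply: eq_mxint => z _; rewrite mulmxA.
rewrite (mxint_pull (m1 := mu) (m2 := sfprod mu mu) mpq mQ q1m k1u1 qk1u1).
transitivity (mxint mu3 (trip p q a b c d)
  (fun w => (q1 w.1 *m k1_1 k w.1 w.2.2 w.2.1) *m u w.2)).
  by apply: eq_mxint => z _; rewrite mulmxA.
exact: (esym (mxint_push (m1 := mu) (m2 := sfprod mu mu) mpq mQ um
  (L2mx_L1mx mS3 fS3 qk12) (L2mx_mul mS3 qk12 u3))).
Qed.

Section half.
Variables (m0 m1 m2 n : nat) (k : bikernel R m0 m1 m2 n).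
Hypothesis bk : half_bmeas a b c d k.

Lemma L2mx_act1 u : L2mx (mu2 R) Q u -> L2mx mu `[a, b] (act1 a b c d k u).
Proof.
move=> u2; case: bk => b0 b1; apply: (L2mxD mab).
  exact: (L2mx_int mab mcd fab fcd (L2mx_bmeasl mQ b0 u2)).
exact: (L2mx_int (m1 := mu) (m2 := sfprod mu mu) mab mQ fab fQ
  (L2mx_bmeasl mT b1 (L2mx_snd3 u2))).
Qed.

Variables (m : nat) (q1 : R -> 'M[R]_(m, m1)).
Hypothesis q12 : L2mx mu `[a, b] q1.

Lemma L2mx_row_local :
  L2mx (mu2 R) Q (fun z => q1 z.1 *m k1_0 k z.1 z.2).
Proof.
case: bk => b0 _; apply: (L2mx_bmeasr mQ _ b0).
exact: (L2mx_fst (m1 := mu) (m2 := mu) mab mcd fab fcd q12).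
Qed.

Lemma L2mx_row_integral :
  L2mx (mu2 R) Q (fun z => \mint_(t in `[a, b]) (q1 t *m k1_1 k t z.2 z.1)).
Proof.
case: bk => _ b1.
have h := L2mx_bmeasr mT (L2mx_fst3 q12) b1.
have h' := L2mx_swap (m1 := mu) (m2 := sfprod mu mu) mab mQ fab fQ h.
exact: (L2mx_int (m1 := sfprod mu mu) (m2 := mu) mQ mab fQ fab h').
Qed.

Lemma row_act1 u : L2mx (mu2 R) Q u ->
  \mint_(x in `[a, b]) (q1 x *m act1 a b c d k u x) =
  mxint (mu2 R) Q (fun z => (q1 z.1 *m k1_0 k z.1 z.2 +
    \mint_(t in `[a, b]) (q1 t *m k1_1 k t z.2 z.1)) *m u z).
Proof.
move=> u2; case: (bk) => b0 b1.
have q1m i j : measurable_fun (`[a, b]%classic : set MR) (fun x => q1 x i j) by case: (q12 i j).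
rewrite (row_act1_subsegment q1m u2 u2 (bmeasmx_L2mx mQ fQ b0) L2mx_row_local
  (bmeasmx_L2mx mT fT b1) (L2mx_bmeasr mT (L2mx_fst3 q12) b1)).
have loc := L2mx_mul mQ L2mx_row_local u2.
have int := L2mx_mul mQ L2mx_row_integral u2.
rewrite -(mxintD mQ loc int); apply: eq_mxint => z _; by rewrite -mulmxDl.
Qed.

End half.

Lemma mxint_sw m n (F : R * R -> 'M[R]_(m, n)) : L1mx (mu2 R) Q F ->
  mxint (mu2 R) (rect c d a b) (sw F) = mxint (mu2 R) Q F.
Proof.
move=> F1; apply/matrixP => i j; rewrite !mxE; exact: (Rintegral_sw (F1 i j)).
Qed.

Lemma L2mx_sw m n (F : R * R -> 'M[R]_(m, n)) : L2mx (mu2 R) Q F ->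
  L2mx (mu2 R) (rect c d a b) (sw F).
Proof. by move=> F2 i j; exact: (L2_sw (F2 i j)). Qed.

Lemma bmeas_section e1 e2 (T1 : measurableType e1) (T2 : measurableType e2)
    (A : set T1) (B : set T2) (f : T1 * T2 -> R) x : measurable A -> measurable B ->
  A x -> bmeas (A `*` B) f -> bmeas B (fun y => f (x, y)).
Proof.
move=> mA mB Ax [mf [C fC]]; split; first exact: (L1_section mA mB Ax mf).
by exists C => y By; exact: fC.
Qed.

End composition.

(** Kernel of a row that acts on [act k] by integration only. The first row of [picomp] has this
    form; so does the row for [x] at a fixed [x], apart from the multiplication by [P11_0]. *)
Definition rowk a b c d m m0 m1 m2 n (q0 : 'M[R]_(m, m0)) (q1 : R -> 'M[R]_(m, m1))
    (q2 : R -> 'M[R]_(m, m2)) (k : bikernel R m0 m1 m2 n) x y :=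
  q0 *m k0 k x y + q1 x *m k1_0 k x y + \mint_(t in `[a, b]) (q1 t *m k1_1 k t y x)
  + q2 y *m k2_0 k x y + \mint_(v in `[c, d]) (q2 v *m k2_1 k x v y).

Section rows.
Variables (a b c d : R).
Local Notation Q := (rect a b c d).

Let mab := measurable_segment a b.
Let mcd := measurable_segment c d.
Let fab := segment_lty a b.
Let fcd := segment_lty c d.
Let mQ := measurable_rect a b c d.
Let fQ := rect_lty a b c d.
Let mT := measurable_trip a b a b c d.

Variables (m0 m1 m2 n : nat) (k : bikernel R m0 m1 m2 n).
Hypothesis bk : bmeas_kernel a b c d k.

Let b0 : bmeasmx Q (fun z => k0 k z.1 z.2). Proof. by case: bk. Qed.
Let b1 : half_bmeas a b c d k. Proof. by case: bk. Qed.
Let b2 : half_bmeas c d a b (ktr k). Proof. by case: bk. Qed.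

Section row.
Variables (m : nat) (q0 : 'M[R]_(m, m0)) (q1 : R -> 'M[R]_(m, m1)).
Variable q2 : R -> 'M[R]_(m, m2).
Hypotheses (q12 : L2mx mu `[a, b] q1) (q22 : L2mx mu `[c, d] q2).

Let r0 : L2mx (mu2 R) Q (fun z => q0 *m k0 k z.1 z.2).
Proof.
exact: (L2mx_bmeasl mQ (bmeasmx_cst Q q0) (bmeasmx_L2mx mQ fQ b0)).
Qed.
Let r1 := L2mx_row_local b1 q12.
Let r2 := L2mx_row_integral b1 q12.
Let r3 : L2mx (mu2 R) Q (fun z => q2 z.2 *m k2_0 k z.1 z.2).
Proof. exact: (L2mx_sw (L2mx_row_local b2 q22)). Qed.
Let r4 : L2mx (mu2 R) Q (fun z => \mint_(v in `[c, d]) (q2 v *m k2_1 k z.1 v z.2)).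
Proof. exact: (L2mx_sw (L2mx_row_integral b2 q22)). Qed.

Lemma L2mx_rowk : L2mx (mu2 R) Q (fun z => rowk a b c d q0 q1 q2 k z.1 z.2).
Proof.
exact: (L2mxD mQ (L2mxD mQ (L2mxD mQ (L2mxD mQ r0 r1) r2) r3) r4).
Qed.

Lemma row_act u : L2mx (mu2 R) Q u ->
  q0 *m act0 a b c d k u + \mint_(x in `[a, b]) (q1 x *m act1 a b c d k u x)
    + \mint_(y in `[c, d]) (q2 y *m act1 c d a b (ktr k) (sw u) y) =
  mxint (mu2 R) Q (fun z => rowk a b c d q0 q1 q2 k z.1 z.2 *m u z).
Proof.
move=> u2.
rewrite /act0 -(mxint_mulmxl mQ); last first.
  exact: (L2mx_L1mx mQ fQ (L2mx_bmeasl mQ b0 u2)).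
rewrite (row_act1 b1 q12 u2) (row_act1 b2 q22 (L2mx_sw u2)).
have h34 := L2mx_mul mQ (L2mxD mQ r3 r4) u2.
have h12 := L2mx_mul mQ (L2mxD mQ r1 r2) u2.
have h0 := L2mx_mul mQ r0 u2.
transitivity (mxint (mu2 R) Q (fun z => (q0 *m k0 k z.1 z.2) *m u z) +
  mxint (mu2 R) Q (fun z => (q1 z.1 *m k1_0 k z.1 z.2 +
    \mint_(t in `[a, b]) (q1 t *m k1_1 k t z.2 z.1)) *m u z) +
  mxint (mu2 R) Q (fun z => (q2 z.2 *m k2_0 k z.1 z.2 +
    \mint_(v in `[c, d]) (q2 v *m k2_1 k z.1 v z.2)) *m u z)).
  congr (_ + _ + _); first by apply: eq_mxint => z _; rewrite mulmxA.
  exact: (mxint_sw h34).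
rewrite -(mxintD mQ h0 h12) -(mxintD mQ (L1mxD mQ h0 h12) h34).
by apply: eq_mxint => z _; rewrite -!mulmxDl /rowk !addrA.
Qed.

End row.

Section comp.
Variables (p0 p1 p2 : nat) (A : PI011 R m0 m1 m2 p0 p1 p2).
Hypothesis A2 : square_integrable_parameters a b c d A.

Lemma picomp_k1_1 x y t : k1_1 (picomp a b c d A k) x y t =
  rowk a b c d (P10 A x) (P11_1 A x) (P12 A x) k t y + P11_0 A x *m k1_1 k x y t.
Proof.
rewrite /rowk [RHS]addrC !addrA; do 4 congr (_ + _); exact: addrC.
Qed.

Lemma picomp_row1_at u x : `[a, b]%classic x -> L2mx (mu2 R) Q u ->
  L2mx mu `[c, d] (fun y => u (x, y)) ->
  L2mx mu `[a, b] (P11_1 A x) -> L2mx mu `[c, d] (P12 A x) ->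
  (pi011 a b c d A (act a b c d k u)).1.2 x = act1 a b c d (picomp a b c d A k) u x.
Proof.
move=> xab u2 ux q1x q2x; case: (b1) => bl bi.
have bl' : bmeasmx `[c, d] (fun y => k1_0 k x y).
  by move=> i j; exact: (bmeas_section mab mcd xab (bl i j)).
have bi' : bmeasmx Q (fun z => k1_1 k x z.2 z.1).
  by move=> i j; exact: (bmeas_section mab mQ xab (bi i j)).
have l1 := L2mx_L1mx mcd fcd (L2mx_bmeasl mcd bl' ux).
have i1 := L2mx_L1mx mQ fQ (L2mx_bmeasl mQ bi' u2).
have L := mxint_mulmxl mcd (P11_0 A x) l1.
have I := mxint_mulmxl mQ (P11_0 A x) i1.
have ru := row_act (P10 A x) q1x q2x u2.
have ku : L1mx (mu2 R) Q (fun z => P11_0 A x *m (k1_1 k x z.2 z.1 *m u z)).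
  exact: (L1mx_bmeasl mQ (bmeasmx_cst Q _) i1).
have rk := L2mx_mul mQ (L2mx_rowk (P10 A x) q1x q2x) u2.
rewrite /act1/=.
have -> : mxint (mu2 R) Q (fun z => k1_1 (picomp a b c d A k) x z.2 z.1 *m u z) =
    mxint (mu2 R) Q (fun z => rowk a b c d (P10 A x) (P11_1 A x) (P12 A x) k z.1 z.2 *m u z
      + P11_0 A x *m (k1_1 k x z.2 z.1 *m u z)).
  by apply: eq_mxint => z _; rewrite picomp_k1_1 mulmxDl mulmxA.
rewrite (mxintD mQ rk ku) -ru I.
have -> : \mint_(y in `[c, d]) (P11_0 A x *m k1_0 k x y *m u (x, y)) =
    \mint_(y in `[c, d]) (P11_0 A x *m (k1_0 k x y *m u (x, y))).
  by apply: eq_mxint => y _; rewrite mulmxA.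
rewrite L /act1/= mulmxDr.
have alg (s1 s2 s3 s4 s5 : 'cV[R]_p1) : s1 + (s2 + s3) + s4 + s5 = s2 + (s1 + s4 + s5 + s3).
  by apply/matrixP => i j; rewrite !mxE; ring.
exact: alg.
Qed.

Lemma picomp_row1 u : L2mx (mu2 R) Q u ->
  (pi011 a b c d A (act a b c d k u)).1.2 =
    act1 a b c d (picomp a b c d A k) u %[ae mu in `[a, b]%classic].
Proof.
move=> u2; case: A2 => -[_ _ _ _] [_ _ q1 _] [q2 _].
have := L2mx_section1 mab mcd q2; have := L2mx_section1 mab mab q1.
have := L2mx_section1 mab mcd u2.
apply: aeS3 => x ux q1x q2x xab.
exact: (picomp_row1_at xab u2 (ux xab) (q1x xab) (q2x xab)).
Qed.

(** Every term is a parameter of [A], square integrable in at most two variables, times a bounded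
    kernel, possibly integrated once; what has to be done is to extend each factor to the three
    variables of [trip]. *)
Lemma half_L2_picomp : half_L2 a b c d (picomp a b c d A k).
Proof.
case: A2 => -[_ _ q10 _] [q110 _ q1 _] [q2 _]; case: (b1) => bl bi; case: (b2) => bl' bi'.
split; first exact: (L2mx_row_local b1 q110).
have m21 : measurable_fun setT (fun w : MR * (MR * MR) => (w.2.2, w.2.1)).
  exact: (measurableT_comp measurable_swap measurable_snd).
have c0 : bmeasmx (trip a b a b c d) (fun w => k0 k w.2.1 w.2.2).
  move=> i j; apply: (bmeas_comp mT mQ measurable_snd _ (b0 i j)).
  by move=> _ [w [_ ?] <-].
have c1 : bmeasmx (trip a b a b c d) (fun w => k1_0 k w.2.1 w.2.2).
  move=> i j; apply: (bmeas_comp mT mQ measurable_snd _ (bl i j)).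
  by move=> _ [w [_ ?] <-].
have c2 : bmeasmx (trip a b a b c d) (fun w => k2_0 k w.2.1 w.2.2).
  move=> i j; apply: (bmeas_comp mT (measurable_rect c d a b) m21 _ (bl' i j)).
  by move=> _ [w [_ [? ?]] <-].
have c21 : bmeasmx (trip c d a b c d) (fun w => k2_1 k w.2.1 w.1 w.2.2).
  move=> i j; apply: (bmeas_comp (measurable_trip c d a b c d)
    (measurable_trip c d c d a b) measurable_swap2 _ (bi' i j)).
  by move=> _ [w [? [? ?]] <-].
have c11 : bmeasmx (trip a b a b c d) (fun w => k1_1 k w.1 w.2.2 w.2.1) := bi.
have t1 := L2mx_bmeasr mT (L2mx_fst3 c d q10) c0.
have t2 := L2mx_bmeasr mT (L2mx_fst3 c d q110) bi.
(* [P11_1] does not involve [y]: it is extended to [((x, t), y)] and reassociated. In [t5] the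
   variable [t] is inserted instead, by [L2_mid]. *)
have t3 : L2mx mu3 (trip a b a b c d) (fun w => P11_1 A w.1 w.2.1 *m k1_0 k w.2.1 w.2.2).
  apply: (L2mx_bmeasr mT _ c1) => i j.
  have faa := finite_measureX mab mab fab fab.
  have h := L2_fst (m1 := sfprod mu mu) (m2 := mu) (measurable_rect a b a b) mcd faa fcd (q1 i j).
  exact: (L2_assoc mab mab fab fab mcd fcd h).
have t4 := L2mx_hilbert_schmidt q1 (F := fun e z => k1_1 k e z.2 z.1) bi.
have t5 : L2mx mu3 (trip a b a b c d) (fun w => P12 A w.1 w.2.2 *m k2_0 k w.2.1 w.2.2).
  apply: (L2mx_bmeasr mT _ c2) => i j.
  have h := L2_mid mab mcd fab fcd mab fab (q2 i j).
  exact: (L2_assoc mab mab fab fab mcd fcd h).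
have t6 := L2mx_hilbert_schmidt q2 (F := fun v z => k2_1 k z.1 v z.2) c21.
exact: (L2mxD mT (L2mxD mT (L2mxD mT (L2mxD mT (L2mxD mT t1 t2) t3) t4) t5) t6).
Qed.

End comp.
End rows.

Section full_composition.
Variables (a b c d : R) (m0 m1 m2 p0 p1 p2 n : nat).
Variables (A : PI011 R m0 m1 m2 p0 p1 p2) (k : bikernel R m0 m1 m2 n).
Hypothesis A2 : square_integrable_parameters a b c d A.
Hypothesis bk : bmeas_kernel a b c d k.
Local Notation Q := (rect a b c d).

Lemma act0_tr u : L2mx (mu2 R) Q u -> act0 c d a b (ktr k) (sw u) = act0 a b c d k u.
Proof.
move=> u2; case: bk => b0 _ _; have mQ := measurable_rect a b c d.
exact: (mxint_sw (L2mx_L1mx mQ (rect_lty a b c d) (L2mx_bmeasl mQ b0 u2))).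
Qed.

Lemma picomp_act u : L2mx (mu2 R) Q u ->
  rl2_eq a b c d (pi011 a b c d A (act a b c d k u)) (act a b c d (picomp a b c d A k) u).
Proof.
move=> u2; case: (A2) => -[q01 q02 _ _] _ _; split.
- exact: (row_act bk (P00 A) q01 q02 u2).
- exact: picomp_row1.
(* The row for [y] is the row for [x] of the transposed operator, up to the order of its four
   terms. *)
have := picomp_row1 (bmeas_kernel_tr bk) (square_integrable_ptr A2) (L2mx_sw u2).
apply: aeS => y h ycd; rewrite -[RHS](h ycd)/= (act0_tr u2) swK.
have alg (s1 s2 s3 s4 : 'cV[R]_p2) : s1 + s2 + s3 + s4 = s1 + s3 + s4 + s2.
  by apply/matrixP => i j; rewrite !mxE; ring.
exact: alg.
Qed.

Lemma L2mx_picomp_k0 : L2mx (mu2 R) Q (fun z => k0 (picomp a b c d A k) z.1 z.2).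
Proof. by case: (A2) => -[q01 q02 _ _] _ _; exact: (L2mx_rowk bk _ q01 q02). Qed.

Lemma half_L2_picomp_tr : half_L2 c d a b (ktr (picomp a b c d A k)).
Proof. exact: (half_L2_picomp (bmeas_kernel_tr bk) (square_integrable_ptr A2)). Qed.

Lemma in_rl2_act u : L2mx (mu2 R) Q u -> in_rl2 a b c d (act a b c d k u).
Proof.
move=> u2; case: bk => _ b1 b2; split; first exact: (L2mx_act1 b1 u2).
exact: (L2mx_act1 b2 (L2mx_sw u2)).
Qed.

Lemma pi011_ae v w : in_rl2 a b c d v -> in_rl2 a b c d w -> rl2_eq a b c d v w ->
  rl2_eq a b c d (pi011 a b c d A v) (pi011 a b c d A w).
Proof.
case: v w => [[v0 v1] v2] [[w0 w1] w2] [/= hv1 hv2] [/= hw1 hw2] [/= e0 e1 e2].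
have mab := measurable_segment a b; have mcd := measurable_segment c d.
case: A2 => -[q01 q02 q10 q20] [_ _ q11 q22] [q12 q21].
have int1 m (P : R -> 'M[R]_(m, m1)) : L2mx mu `[a, b] P ->
    \mint_(x in `[a, b]) (P x *m v1 x) = \mint_(x in `[a, b]) (P x *m w1 x).
  move=> P2; apply: (mxint_ae mab).
  - by move=> i j; exact: (L1_measurable (L2mx_mul mab P2 hv1 i j)).
  - by move=> i j; exact: (L1_measurable (L2mx_mul mab P2 hw1 i j)).
  - by apply: aeS e1 => x h xab; rewrite (h xab).
have int2 m (P : R -> 'M[R]_(m, m2)) : L2mx mu `[c, d] P ->
    \mint_(x in `[c, d]) (P x *m v2 x) = \mint_(x in `[c, d]) (P x *m w2 x).
  move=> P2; apply: (mxint_ae mcd).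
  - by move=> i j; exact: (L1_measurable (L2mx_mul mcd P2 hv2 i j)).
  - by move=> i j; exact: (L1_measurable (L2mx_mul mcd P2 hw2 i j)).
  - by apply: aeS e2 => x h xab; rewrite (h xab).
split => /=.
- by rewrite e0 (int1 _ _ q01) (int2 _ _ q02).
- have := L2mx_section1 mab mcd q12; have := L2mx_section1 mab mab q11.
  apply: aeS3 e1 => x h1 h2 h3 xab.
  by rewrite e0 (h1 xab) (int1 _ _ (h2 xab)) (int2 _ _ (h3 xab)).
have q21' := L2mx_swap mab mcd (segment_lty a b) (segment_lty c d) q21.
have := L2mx_section1 mcd mab q21'; have := L2mx_section1 mcd mcd q22.
apply: aeS3 e2 => x h1 h2 h3 xcd.
by rewrite e0 (h1 xcd) (int2 _ _ (h2 xcd)) (int1 _ _ (h3 xcd)).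
Qed.

End full_composition.

Section rl2_theory.
Variables (a b c d : R) (m0 m1 m2 : nat).
Implicit Types v w : rl2 R m0 m1 m2.

Definition rl2_opp v : rl2 R m0 m1 m2 := (- v.1.1, fun x => - v.1.2 x, fun y => - v.2 y).

Lemma rl2_eq_sym v w : rl2_eq a b c d v w -> rl2_eq a b c d w v.
Proof.
case=> h1 h2 h3; split; first by rewrite h1.
  by apply: aeS h2 => x h hx; rewrite h.
by apply: aeS h3 => x h hx; rewrite h.
Qed.

Lemma rl2_eq_trans v w t : rl2_eq a b c d v w -> rl2_eq a b c d w t ->
  rl2_eq a b c d v t.
Proof.
case=> h1 h2 h3 [h1' h2' h3']; split; first by rewrite h1.
  by apply: aeS2 h2 h2' => x h h' hx; rewrite h// h'.
by apply: aeS2 h3 h3' => x h h' hx; rewrite h// h'.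
Qed.

End rl2_theory.
End kernels.

(** * Integrals over the four quadrants at a point *)

Section splitting.
Variable R : realType.
Local Notation mu := (@lebesgue_measure R).

Lemma mxintB d (T : measurableType d) (m : {measure set T -> \bar R}) (D : set T)
    p q (F G : T -> 'M[R]_(p, q)) : measurable D -> L1mx m D F -> L1mx m D G ->
  mxint m D (fun t => F t - G t) = mxint m D F - mxint m D G.
Proof.
move=> mD F1 G1; rewrite -(mxintN mD G1).
by apply: (mxintD mD F1 (G := fun t => - G t)) => i j; apply: (eq_L1 mD _ (L1N mD (G1 i j))) => t _; rewrite mxE.
Qed.

Lemma L1mxB d (T : measurableType d) (m : {measure set T -> \bar R}) (D : set T)
    p q (F G : T -> 'M[R]_(p, q)) : measurable D -> L1mx m D F -> L1mx m D G ->
  L1mx m D (fun t => F t - G t).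
Proof.
move=> mD F1 G1 i j; apply: (eq_L1 mD _ (L1B mD (F1 i j) (G1 i j))) => t _.
by rewrite !mxE.
Qed.

Lemma mxint_segment_split p m q k l (F : R -> 'M[R]_(k, l)) : p <= m -> m <= q ->
  L1mx mu `[p, q] F ->
  \mint_(t in `[p, q]) F t = \mint_(t in `[p, m]) F t + \mint_(t in `[m, q]) F t.
Proof.
move=> pm mq F1; apply/matrixP => i j; rewrite !mxE.
by rewrite -(primB (F1 i j) pm mq (lexx q)) addrC subrK.
Qed.

Lemma mxint_rect_split1 p m q r s k l (F : R * R -> 'M[R]_(k, l)) : p <= m -> m <= q ->
  L1mx (mu2 R) (rect p q r s) F ->
  mxint (mu2 R) (rect p q r s) F =
    mxint (mu2 R) (rect p m r s) F + mxint (mu2 R) (rect m q r s) F.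
Proof.
move=> pm mq F1; have mpq := measurable_segment p q; have mrs := measurable_segment r s.
have mQ := measurable_rect p q r s.
have F1l := L1mx_subset mQ (measurable_rect p m r s) (subset_rect (lexx p) mq (lexx r) (lexx s)) F1.
have F1r := L1mx_subset mQ (measurable_rect m q r s) (subset_rect pm (lexx q) (lexx r) (lexx s)) F1.
rewrite -(mxint_fubini1 mpq mrs F1) -(mxint_fubini1 (measurable_segment p m) mrs F1l).
rewrite -(mxint_fubini1 (measurable_segment m q) mrs F1r).
exact: (mxint_segment_split pm mq (L1mx_fubini1 mpq mrs F1)).
Qed.

Lemma mxint_rect_split2 p q r m s k l (F : R * R -> 'M[R]_(k, l)) : r <= m -> m <= s ->
  L1mx (mu2 R) (rect p q r s) F ->
  mxint (mu2 R) (rect p q r s) F =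
    mxint (mu2 R) (rect p q r m) F + mxint (mu2 R) (rect p q m s) F.
Proof.
move=> rm ms F1; have mpq := measurable_segment p q; have mrs := measurable_segment r s.
have mQ := measurable_rect p q r s.
have F1l := L1mx_subset mQ (measurable_rect p q r m) (subset_rect (lexx p) (lexx q) (lexx r) ms) F1.
have F1r := L1mx_subset mQ (measurable_rect p q m s) (subset_rect (lexx p) (lexx q) rm (lexx s)) F1.
rewrite -(mxint_fubini2 mpq mrs F1) -(mxint_fubini2 mpq (measurable_segment r m) F1l).
rewrite -(mxint_fubini2 mpq (measurable_segment m s) F1r).
exact: (mxint_segment_split rm ms (L1mx_fubini2 mpq mrs F1)).
Qed.

Lemma mxintD3 d (T : measurableType d) (m : {measure set T -> \bar R}) (D : set T)
    p q (F G H : T -> 'M[R]_(p, q)) : measurable D ->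
  L1mx m D F -> L1mx m D G -> L1mx m D H ->
  mxint m D (fun t => F t + G t + H t) = mxint m D F + mxint m D G + mxint m D H.
Proof. by move=> mD F1 G1 H1; rewrite (mxintD mD (L1mxD mD F1 G1) H1) (mxintD mD F1 G1). Qed.

(** The quadrants at [(x, y)] are reassembled: [N] lives on the lower left one, [P] on the strip
    [t <= x], [P'] on the strip [v <= y] and [W] on the whole rectangle. The four kernels of T
    differ by exactly these contributions. *)
Lemma mxint_quadrants a b c d x y k l (N P P' W : R * R -> 'M[R]_(k, l)) :
  a <= x <= b -> c <= y <= d -> L1mx (mu2 R) (rect a b c d) N ->
  L1mx (mu2 R) (rect a b c d) P -> L1mx (mu2 R) (rect a b c d) P' ->
  L1mx (mu2 R) (rect a b c d) W ->
  \mint_(t in `[a, x]) \mint_(v in `[c, y]) (N (t, v) - (P (t, v) + P' (t, v) + W (t, v)))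
  + \mint_(t in `[x, b]) \mint_(v in `[c, y]) (- (P' (t, v) + W (t, v)))
  + \mint_(t in `[a, x]) \mint_(v in `[y, d]) (- (P (t, v) + W (t, v)))
  + \mint_(t in `[x, b]) \mint_(v in `[y, d]) (- W (t, v)) =
  mxint (mu2 R) (rect a x c y) N - (mxint (mu2 R) (rect a x c d) P
    + mxint (mu2 R) (rect a b c y) P' + mxint (mu2 R) (rect a b c d) W).
Proof.
move=> /andP[ax xb] /andP[cy yd] N1 P1 P'1 W1.
have mQ := measurable_rect a b c d.
have sub p q r s F : a <= p -> q <= b -> c <= r -> s <= d ->
    L1mx (mu2 R) (rect a b c d) F -> L1mx (mu2 R) (rect p q r s) (F : R * R -> 'M[R]_(k, l)).
  move=> ap qb cr sd; apply: (L1mx_subset mQ (measurable_rect p q r s)).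
  exact: subset_rect.
have L1N' p q r s (F : R * R -> 'M[R]_(k, l)) : L1mx (mu2 R) (rect p q r s) F ->
    L1mx (mu2 R) (rect p q r s) (fun z => - F z).
  move=> F1 i j; apply: (eq_L1 (measurable_rect p q r s) _
    (L1N (measurable_rect p q r s) (F1 i j))) => z _; by rewrite mxE.
have i22 : \mint_(t in `[x, b]) \mint_(v in `[y, d]) (- W (t, v)) =
    - mxint (mu2 R) (rect x b y d) W.
  have W1' := sub x b y d W ax (lexx b) cy (lexx d) W1.
  rewrite -(mxintN (measurable_rect x b y d) W1').
  exact: (mxint_fubini1 (measurable_segment x b) (measurable_segment y d) (L1N' _ _ _ _ _ W1')).
have i12 : \mint_(t in `[a, x]) \mint_(v in `[y, d]) (- (P (t, v) + W (t, v))) =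
    - (mxint (mu2 R) (rect a x y d) P + mxint (mu2 R) (rect a x y d) W).
  have mS := measurable_rect a x y d.
  have W1' := sub a x y d W (lexx a) xb cy (lexx d) W1.
  have P1' := sub a x y d P (lexx a) xb cy (lexx d) P1.
  rewrite -(mxintD mS P1' W1') -(mxintN mS (L1mxD mS P1' W1')).
  exact: (mxint_fubini1 (measurable_segment a x) (measurable_segment y d)
    (L1N' _ _ _ _ _ (L1mxD mS P1' W1'))).
have i21 : \mint_(t in `[x, b]) \mint_(v in `[c, y]) (- (P' (t, v) + W (t, v))) =
    - (mxint (mu2 R) (rect x b c y) P' + mxint (mu2 R) (rect x b c y) W).
  have mS := measurable_rect x b c y.
  have W1' := sub x b c y W ax (lexx b) (lexx c) yd W1.
  have P1' := sub x b c y P' ax (lexx b) (lexx c) yd P'1.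
  rewrite -(mxintD mS P1' W1') -(mxintN mS (L1mxD mS P1' W1')).
  exact: (mxint_fubini1 (measurable_segment x b) (measurable_segment c y)
    (L1N' _ _ _ _ _ (L1mxD mS P1' W1'))).
have i11 : \mint_(t in `[a, x]) \mint_(v in `[c, y])
      (N (t, v) - (P (t, v) + P' (t, v) + W (t, v))) =
    mxint (mu2 R) (rect a x c y) N - (mxint (mu2 R) (rect a x c y) P
      + mxint (mu2 R) (rect a x c y) P' + mxint (mu2 R) (rect a x c y) W).
  have mS := measurable_rect a x c y.
  have W1' := sub a x c y W (lexx a) xb (lexx c) yd W1.
  have P1' := sub a x c y P (lexx a) xb (lexx c) yd P1.
  have P'1' := sub a x c y P' (lexx a) xb (lexx c) yd P'1.
  have N1' := sub a x c y N (lexx a) xb (lexx c) yd N1.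
  have PPW := L1mxD mS (L1mxD mS P1' P'1') W1'.
  rewrite -(mxintD3 mS P1' P'1' W1') -(mxintB mS N1' PPW).
  exact: (mxint_fubini1 (measurable_segment a x) (measurable_segment c y)
    (L1mxB mS N1' PPW)).
rewrite i11 i12 i21 i22.
rewrite (mxint_rect_split1 ax xb W1).
rewrite (mxint_rect_split2 cy yd (sub a x c d W (lexx a) xb (lexx c) (lexx d) W1)).
rewrite (mxint_rect_split2 cy yd (sub x b c d W ax (lexx b) (lexx c) (lexx d) W1)).
rewrite (mxint_rect_split2 cy yd (sub a x c d P (lexx a) xb (lexx c) (lexx d) P1)).
rewrite (mxint_rect_split1 ax xb (sub a b c y P' (lexx a) (lexx b) (lexx c) yd P'1)).
have alg (n p1 p2 p1' p2' w1 w2 w3 w4 : 'M[R]_(k, l)) :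
    n - (p1 + p1' + w1) - (p2' + w3) - (p2 + w2) - w4 =
    n - (p1 + p2 + (p1' + p2') + (w1 + w2 + (w3 + w4))).
  by apply/matrixP => i j; rewrite !mxE; ring.
exact: alg.
Qed.

End splitting.

(** * The integral part of T at a fixed point, for arbitrary kernels *)

Section kernel_step.
Variables (R : realType) (a b c d x y : R) (m0 m1 m2 n l : nat).
Local Notation mu := (@lebesgue_measure R).
Local Notation MR := (measurableTypeR R).
Local Notation Q := (rect a b c d).
Hypotheses (xab : a <= x <= b) (ycd : c <= y <= d).
Variable k : bikernel R m0 m1 m2 n.
Variables (K30 : 'M[R]_(l, m0)) (K31 : R -> 'M[R]_(l, m1)) (K32 : R -> 'M[R]_(l, m2)).
Variable K33 : R -> R -> 'M[R]_(l, n).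
Hypothesis k02 : L2mx (mu2 R) Q (fun z => k0 k z.1 z.2).
Hypotheses (h1 : half_L2 a b c d k) (h2 : half_L2 c d a b (ktr k)).
Hypotheses (bK31 : bmeasmx (`[a, b]%classic : set MR) K31)
  (bK32 : bmeasmx (`[c, d]%classic : set MR) K32)
  (bK33 : bmeasmx (Q : set (MR * MR)) (fun z => K33 z.1 z.2)).
Variable u : R * R -> 'cV[R]_n.
Hypothesis u2 : L2mx (mu2 R) Q u.

Let ax : a <= x. Proof. by case/andP: xab. Qed.
Let xb : x <= b. Proof. by case/andP: xab. Qed.
Let cy : c <= y. Proof. by case/andP: ycd. Qed.
Let yd : y <= d. Proof. by case/andP: ycd. Qed.
Let mQ := measurable_rect a b c d.
Let fQ := rect_lty a b c d.

(** [S1] and [S2] are, up to sign, the two integral terms of [T22], and [S22], [S12], [S21], [S11]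
    have the form of [T22], [T12], [T21], [T11] at a fixed [(x, y)], with arbitrary kernels [k] in
    place of G. *)
Let S1 z := \mint_(e in `[a, x]) (K31 e *m k1_1 k e z.2 z.1).
Let S2 z := \mint_(e in `[c, y]) (K32 e *m k2_1 k z.1 e z.2).
Let S22 t v := - (K30 *m k0 k t v)
  - \mint_(e in `[a, x]) (K31 e *m k1_1 k e v t)
  - \mint_(e in `[c, y]) (K32 e *m k2_1 k t e v).
Let S12 t v := - (K31 t *m k1_0 k t v) + S22 t v.
Let S21 t v := - (K32 v *m k2_0 k t v) + S22 t v.
Let S11 t v := K33 t v + S21 t v + S12 t v - S22 t v.

(* The x-half for an arbitrary rectangle; the y-half is its transpose. *)
Lemma half_step p q r s t m1' m2' (k' : bikernel R m0 m1' m2' n) (K : R -> 'M[R]_(l, m1'))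
    (u' : R * R -> 'cV[R]_n) : p <= t -> t <= q ->
  half_L2 p q r s k' -> bmeasmx (`[p, q]%classic : set MR) K ->
  L2mx (mu2 R) (rect p q r s) u' ->
  [/\ L1mx (mu2 R) (rect p q r s) (fun z => (K z.1 *m k1_0 k' z.1 z.2) *m u' z),
      L1mx (mu2 R) (rect p q r s)
        (fun z => \mint_(e in `[p, t]) (K e *m k1_1 k' e z.2 z.1) *m u' z) &
      \mint_(e in `[p, t]) (K e *m act1 p q r s k' u' e) =
      mxint (mu2 R) (rect p t r s) (fun z => (K z.1 *m k1_0 k' z.1 z.2) *m u' z) +
      mxint (mu2 R) (rect p q r s)
        (fun z => \mint_(e in `[p, t]) (K e *m k1_1 k' e z.2 z.1) *m u' z)].
Proof.
move=> pt tq [l0 l1] bK u'2.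
have mpt := measurable_segment p t; have mpq := measurable_segment p q.
have mrs := measurable_segment r s; have mR := measurable_rect p q r s.
have fR := rect_lty p q r s; have mS := measurable_rect p t r s.
have mS3 := measurable_trip p t p q r s; have mT := measurable_trip p q p q r s.
have subR := subset_rect (lexx p) tq (lexx r) (lexx s).
have bK' : bmeasmx (rect p q r s) (fun z : MR * MR => K z.1).
  by move=> i j; exact: (bmeas_fst _ mpq (bK i j)).
have bK3 : bmeasmx (trip p q p q r s) (fun w : MR * (MR * MR) => K w.1).
  by move=> i j; exact: (bmeas_fst _ mpq (bK i j)).
have qk0 := L2mx_bmeasl mR bK' l0; have qk1 := L2mx_bmeasl mT bK3 l1.
have sub3 : trip p t p q r s `<=` trip p q p q r s.
  by move=> [e z] [h h']; split => //; exact: (subset_segment (lexx p) tq).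
have qk1' := L2mx_subset mT mS3 sub3 qk1.
have Km i j : measurable_fun (`[p, t]%classic : set MR) (fun e => K e i j).
  case: (bK i j) => + _; apply: measurable_funS => //; exact: (subset_segment (lexx p) tq).
have S1l : L2mx (mu2 R) (rect p q r s) (fun z => \mint_(e in `[p, t]) (K e *m k1_1 k' e z.2 z.1)).
  have h := L2mx_swap (m1 := mu) (m2 := sfprod mu mu) mpt mR (segment_lty p t) fR qk1'.
  exact: (L2mx_int (m1 := sfprod mu mu) (m2 := mu) mR mpt fR (segment_lty p t) h).
split; [exact: (L2mx_mul mR qk0 u'2)|exact: (L2mx_mul mR S1l u'2)|].
exact: (row_act1_subsegment Km u'2 (L2mx_subset mR mS subR u'2)
  (L2mx_subset mR mS subR l0) (L2mx_subset mR mS subR qk0)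
  (L2mx_subset mT mS3 sub3 l1) qk1').
Qed.

(** Read backwards: composing the integrals of [K31] and [K32] with the components of [act k u]
    gives a part local in one variable, integrated over a strip, and a part with kernel [S1] or
    [S2], integrated over the whole rectangle. Sorting the contributions by quadrant produces the
    four kernels. *)
Lemma kernel_step :
  \mint_(t in `[a, x]) \mint_(v in `[c, y]) (S11 t v *m u (t, v))
  + \mint_(t in `[x, b]) \mint_(v in `[c, y]) (S21 t v *m u (t, v))
  + \mint_(t in `[a, x]) \mint_(v in `[y, d]) (S12 t v *m u (t, v))
  + \mint_(t in `[x, b]) \mint_(v in `[y, d]) (S22 t v *m u (t, v)) =
  mxint (mu2 R) (rect a x c y) (fun z => K33 z.1 z.2 *m u z)
  - (K30 *m act0 a b c d k u
     + \mint_(e in `[a, x]) (K31 e *m act1 a b c d k u e)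
     + \mint_(e in `[c, y]) (K32 e *m act1 c d a b (ktr k) (sw u) e)).
Proof.
have [P1 V1 E1] := half_step ax xb h1 bK31 u2.
have [P2 V2 E2] := half_step cy yd h2 bK32 (L2mx_sw u2).
pose N z := K33 z.1 z.2 *m u z.
pose P z := (K31 z.1 *m k1_0 k z.1 z.2) *m u z.
pose P' z := (K32 z.2 *m k2_0 k z.1 z.2) *m u z.
pose V0 z := (K30 *m k0 k z.1 z.2) *m u z.
have P'1 : L1mx (mu2 R) Q P'.
  by move=> i j; apply: (eq_L1 mQ _ (L1_sw (P2 i j))) => -[s t] _.
have V'1 : L1mx (mu2 R) Q (fun z => S2 z *m u z).
  by move=> i j; apply: (eq_L1 mQ _ (L1_sw (V2 i j))) => -[s t] _.
have N1 : L1mx (mu2 R) Q N := L2mx_L1mx mQ fQ (L2mx_bmeasl mQ bK33 u2).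
have V01 : L1mx (mu2 R) Q V0 := L2mx_mul mQ (L2mx_bmeasl mQ (bmeasmx_cst Q K30) k02) u2.
have {V1} V11 : L1mx (mu2 R) Q (fun z => S1 z *m u z) := V1.
have E0 : K30 *m act0 a b c d k u = mxint (mu2 R) Q V0.
  rewrite -(mxint_mulmxl mQ _ (L2mx_mul mQ k02 u2)).
  by apply: eq_mxint => z _; rewrite mulmxA.
have {}E1 : \mint_(e in `[a, x]) (K31 e *m act1 a b c d k u e) =
    mxint (mu2 R) (rect a x c d) P + mxint (mu2 R) Q (fun z => S1 z *m u z) := E1.
have {}E2 : \mint_(e in `[c, y]) (K32 e *m act1 c d a b (ktr k) (sw u) e) =
    mxint (mu2 R) (rect a b c y) P' + mxint (mu2 R) Q (fun z => S2 z *m u z).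
  rewrite E2; congr (_ + _); last exact: (mxint_sw V'1).
  apply: (mxint_sw (F := P')); apply: (L1mx_subset mQ (measurable_rect a b c y) _ P'1).
  exact: (subset_rect (lexx a) (lexx b) (lexx c) yd).
pose W z := V0 z + S1 z *m u z + S2 z *m u z.
have W1 : L1mx (mu2 R) Q W := L1mxD mQ (L1mxD mQ V01 V11) V'1.
have S22E t v : S22 t v *m u (t, v) = - W (t, v).
  by rewrite /S22 /W /V0 !mulmxDl !mulNmx !opprD.
rewrite E0 E1 E2.
transitivity (mxint (mu2 R) (rect a x c y) N - (mxint (mu2 R) (rect a x c d) P
    + mxint (mu2 R) (rect a b c y) P' + mxint (mu2 R) Q W)); last first.
  rewrite /W (mxintD3 mQ V01 V11 V'1); congr (_ - _).
  have alg (s1 s2 s3 s4 s5 : 'cV[R]_l) :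
      s1 + s2 + (s3 + s4 + s5) = s3 + (s1 + s4) + (s2 + s5).
    by apply/matrixP => i j; rewrite !mxE; ring.
  exact: alg.
have S21E t v : S21 t v *m u (t, v) = - (P' (t, v) + W (t, v)).
  by rewrite /S21 mulmxDl S22E mulNmx -opprD.
have S12E t v : S12 t v *m u (t, v) = - (P (t, v) + W (t, v)).
  by rewrite /S12 mulmxDl S22E mulNmx -opprD.
have S11E t v : S11 t v *m u (t, v) = N (t, v) - (P (t, v) + P' (t, v) + W (t, v)).
  have alg (s1 s2 s3 w : 'cV[R]_l) : s1 - (s2 + w) - (s3 + w) - - w =
      s1 - (s3 + s2 + w).
    by apply/matrixP => i j; rewrite !mxE; ring.
  by rewrite /S11 mulmxBl mulmxDl mulmxDl S21E S12E S22E; exact: alg.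
have i11 : \mint_(t in `[a, x]) \mint_(v in `[c, y]) (S11 t v *m u (t, v)) =
    \mint_(t in `[a, x]) \mint_(v in `[c, y]) (N (t, v) - (P (t, v) + P' (t, v) + W (t, v))).
  by apply: eq_mxint => t _; apply: eq_mxint => v _; exact: S11E.
have i21 : \mint_(t in `[x, b]) \mint_(v in `[c, y]) (S21 t v *m u (t, v)) =
    \mint_(t in `[x, b]) \mint_(v in `[c, y]) (- (P' (t, v) + W (t, v))).
  by apply: eq_mxint => t _; apply: eq_mxint => v _; exact: S21E.
have i12 : \mint_(t in `[a, x]) \mint_(v in `[y, d]) (S12 t v *m u (t, v)) =
    \mint_(t in `[a, x]) \mint_(v in `[y, d]) (- (P (t, v) + W (t, v))).
  by apply: eq_mxint => t _; apply: eq_mxint => v _; exact: S12E.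
have i22 : \mint_(t in `[x, b]) \mint_(v in `[y, d]) (S22 t v *m u (t, v)) =
    \mint_(t in `[x, b]) \mint_(v in `[y, d]) (- W (t, v)).
  by apply: eq_mxint => t _; apply: eq_mxint => v _; exact: S22E.
rewrite i11 i21 i12 i22; exact: (mxint_quadrants xab ycd N1 P1 P'1 W1).
Qed.

End kernel_step.

(** * The operator T as an expansion *)

Section evaluation.
Variables (R : realType) (a b c d : R).
Local Notation mu := (@lebesgue_measure R).
Local Notation MR := (measurableTypeR R).
Local Notation Q := (rect a b c d).
Implicit Types f g : R * R -> R.

Lemma bmeas_id p q : bmeas (`[p, q]%classic : set MR) (fun t : MR => t : R).
Proof.
split; first exact: measurable_id.
exists (Num.max `|p| `|q|) => t; rewrite /= in_itv/= => /andP[pt tq].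
by rewrite le_max; have [t0|t0] := leP 0 t;
  [rewrite (ger0_norm t0) (le_trans tq (ler_norm q)) orbT
  |rewrite (ltr0_norm t0) -normrN (le_trans _ (ler_norm (- p)))// lerN2].
Qed.

Lemma bmeas_distance p q (w : R) : bmeas (`[p, q]%classic : set MR) (fun t : MR => w - t).
Proof.
have -> : (fun t : MR => w - t) = (fun t => w + (- 1) * t).
  by apply/funext => t; rewrite mulN1r.
apply: bmeasD; first exact: bmeas_cst.
by apply: bmeasM; [exact: bmeas_cst|exact: bmeas_id].
Qed.

(** Cauchy's formula for repeated integration, the origin of the factors [x - theta] and [y - nu] in
    the matrices K. *)
Lemma Rintegral_prim p x (f : R -> R) : L1 mu `[p, x] f ->
  \int[mu]_(t in `[p, x]) prim p f t = \int[mu]_(t in `[p, x]) (f t * (x - t)).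
Proof.
move=> fi; have := Rintegral_triangle fi (bmeas_cst _ 1); rewrite /prim.
under eq_Rintegral do rewrite mulr1.
move=> ->; apply: eq_Rintegral => t /set_mem; rewrite /= in_itv/= => /andP[pt tx].
by rewrite (Rintegral_cst mu (measurable_segment t x)) mul1r (segment_measure tx).
Qed.

Lemma Rintegral_prim_shift p x w (f : R -> R) : p <= x -> L1 mu `[p, x] f ->
  \int[mu]_(t in `[p, x]) (w + prim p f t) =
  (x - p) * w + \int[mu]_(t in `[p, x]) (f t * (x - t)).
Proof.
move=> px fi; have mpx := measurable_segment p x; have fpx := segment_lty p x.
have pi : L1 mu `[p, x] (prim p f).
  by have [mp [C pC]] := bmeas_prim fi; exact: (bounded_L1 mpx fpx mp pC).
rewrite (RintegralD mpx (L1_cst mpx fpx w) pi) (Rintegral_prim fi).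
by rewrite (Rintegral_cst mu mpx) (segment_measure px) mulrC.
Qed.

Section point.
Variables x y : R.
Hypothesis Qz : Q (x, y).
Local Notation Qxy := (rect a x c y).

Let xb : x <= b. Proof. by have [/andP[]] := rect_bounds Qz. Qed.
Let cy : c <= y. Proof. by have [_ /andP[]] := rect_bounds Qz. Qed.
Let yd : y <= d. Proof. by have [_ /andP[]] := rect_bounds Qz. Qed.
Let max := measurable_segment a x.
Let mcy := measurable_segment c y.

Lemma L1_lower_rect g : L2 (mu2 R) Q g -> L1 (mu2 R) Qxy g.
Proof. by move=> g2; exact: (L1_subrect (lexx a) xb (lexx c) yd (L2_L1_rect g2)). Qed.

Lemma Jx_Jy_double g : L2 (mu2 R) Q g ->
  Jx a (Jy c g) (x, y) = \int[mu2 R]_(z in Qxy) g z.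
Proof. by move=> g2; rewrite (Rfubini1 max mcy (L1_lower_rect g2)). Qed.

Lemma Jx_Jy_y_primitive n g : L2 mu `[a, b] n -> L2 (mu2 R) Q g ->
  Jx a (Jy c (fun z => n z.1 + Jy c g z)) (x, y) =
  (y - c) * prim a n x + \int[mu2 R]_(z in Qxy) (g z * (y - z.2)).
Proof.
move=> n2 g2; have gi := L1_lower_rect g2.
have ni : L1 mu `[a, x] n := L1_subsegment (lexx a) xb (L2_L1_segment n2).
have e2 := L2_y_primitive n2 g2.
have Ji := L1_fubini1 max mcy (L1_lower_rect e2).
have bv := bmeas_distance c y y.
have bv2 : bmeas (Qxy : set (MR * MR)) (fun z : MR * MR => y - z.2).
  exact: (bmeas_snd _ mcy bv).
have mQxy := measurable_rect a x c y.
have gvi : L1 (mu2 R) Qxy (fun z => g z * (y - z.2)) := L1_bmeas mQxy gi bv2.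
have Ki := L1_fubini1 max mcy gvi.
have nyi := L1Z max (y - c) ni.
rewrite (Rfubini1 max mcy gvi) /prim -(RintegralZl _ max ni) -(RintegralD max nyi Ki).
apply: (ae_eq_Rintegral max (L1_measurable Ji) (L1_measurable (L1D max nyi Ki))).
apply: aeS (L1_section1 max mcy gi) => s h sx.
exact: (Rintegral_prim_shift (n s) cy (h sx)).
Qed.

End point.

End evaluation.

Section evaluation2.
Variables (R : realType) (a b c d x y : R).
Local Notation mu := (@lebesgue_measure R).
Local Notation MR := (measurableTypeR R).
Local Notation Q := (rect a b c d).
Local Notation Qxy := (rect a x c y).
Implicit Types f g : R * R -> R.
Hypothesis Qz : Q (x, y).

Let ax : a <= x. Proof. by have [/andP[]] := rect_bounds Qz. Qed.
Let xb : x <= b. Proof. by have [/andP[]] := rect_bounds Qz. Qed.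
Let yd : y <= d. Proof. by have [_ /andP[]] := rect_bounds Qz. Qed.
Let max := measurable_segment a x.
Let mcy := measurable_segment c y.
Let fax := segment_lty a x.
Let mQxy := measurable_rect a x c y.

Lemma Jx_Jy_x_primitive r g : L2 mu `[c, d] r -> L2 (mu2 R) Q g ->
  Jx a (Jy c (fun z => r z.2 + Jx a g z)) (x, y) =
  (x - a) * prim c r y + \int[mu2 R]_(z in Qxy) (g z * (x - z.1)).
Proof.
move=> r2 g2; have e2 := L2_x_primitive r2 g2.
rewrite (Jx_Jy (L2_L1_rect e2) Qz).
have Qz' : rect c d a b (y, x) by case: Qz.
have := Jx_Jy_y_primitive Qz' r2 (L2_sw g2).
have bu2 : bmeas (Qxy : set (MR * MR)) (fun z : MR * MR => x - z.1).
  exact: (bmeas_fst _ max (bmeas_distance a x x)).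
have gvi := L1_bmeas mQxy (L1_lower_rect Qz g2) bu2.
by rewrite -(Rintegral_sw gvi).
Qed.

(** Repeated integration in each variable. The four weights are the last column of the last block
    row of [K30], [K31], [K32] and [K33], since the square in question is the mixed derivative
    [d_x d_y] of a function of H_2. *)
Lemma Jx_Jy_Sq w n r g : L2 mu `[a, b] n -> L2 mu `[c, d] r -> L2 (mu2 R) Q g ->
  Jx a (Jy c (Sq a c w n r g)) (x, y) =
  (y - c) * (x - a) * w + (y - c) * \int[mu]_(t in `[a, x]) (n t * (x - t))
  + (x - a) * \int[mu]_(t in `[c, y]) (r t * (y - t))
  + \int[mu2 R]_(z in Qxy) (g z * ((x - z.1) * (y - z.2))).
Proof.
move=> n2 r2 g2; have e2 := L2_x_primitive r2 g2.
have n'2 := L2_prim_shift w n2.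
have SE : Jx a (Jy c (Sq a c w n r g)) (x, y) =
    Jx a (Jy c (fun z => (w + prim a n z.1) + Jy c (fun z => r z.2 + Jx a g z) z)) (x, y).
  by apply: Jx_eq Qz => z Qz'; apply: Jy_eq Qz' => {}z Qz'; exact: (Sq_y _ _ r2 g2 Qz').
rewrite SE (Jx_Jy_y_primitive Qz n'2 e2).
have ni : L1 mu `[a, x] n := L1_subsegment (lexx a) xb (L2_L1_segment n2).
have ri : L1 mu `[c, y] r := L1_subsegment (lexx c) yd (L2_L1_segment r2).
rewrite {1}/prim (Rintegral_prim_shift w ax ni).
have gi := L1_lower_rect Qz g2.
have bu := bmeas_distance a x x; have bv := bmeas_distance c y y.
have bv2 : bmeas (Qxy : set (MR * MR)) (fun z : MR * MR => y - z.2).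
  exact: (bmeas_snd _ mcy bv).
have ei := L1_bmeas mQxy (L1_lower_rect Qz e2) bv2.
have K : \int[mu2 R]_(z in Qxy) ((r z.2 + Jx a g z) * (y - z.2)) =
    (x - a) * \int[mu]_(t in `[c, y]) (r t * (y - t)) +
    \int[mu2 R]_(z in Qxy) (g z * ((x - z.1) * (y - z.2))).
  rewrite (Rfubini2 max mcy ei) (Rweighted_fubini2 max mcy gi bu bv).
  have rvi : L1 mu `[c, y] (fun t => r t * (y - t)) := L1_bmeas mcy ri bv.
  have Ki := L1_bmeas mcy (L1_weighted_fubini2 max mcy gi bu) bv.
  have rvi' := L1Z mcy (x - a) rvi.
  rewrite -(RintegralZl _ mcy rvi) -(RintegralD mcy rvi' Ki).
  apply: (ae_eq_Rintegral mcy (L1_measurable (L1_fubini2 max mcy ei))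
    (L1_measurable (L1D mcy rvi' Ki))).
  apply: aeS (L1_section2 max mcy gi) => t h tcy; have {}h := h tcy.
  have pi : L1 mu `[a, x] (fun s => r t + prim a (fun s => g (s, t)) s).
    apply: (L1D max (L1_cst max fax _)).
    by have [mp [C pC]] := bmeas_prim h; exact: (bounded_L1 max fax mp pC).
  transitivity ((\int[mu]_(s in `[a, x]) (r t + prim a (fun s => g (s, t)) s)) * (y - t)).
    by rewrite -(RintegralZr _ max pi); apply: eq_Rintegral => s _.
  rewrite (Rintegral_prim_shift (r t) ax h) mulrDl; congr (_ + _).
  by rewrite mulrA.
by rewrite K; ring.
Qed.

End evaluation2.

(** * Bounded block matrices and polynomial entries *)

Section bounded_matrices.
Context d (T : measurableType d) (R : realType).
Variable D : set T.

Lemma bmeasmx_col p1 p2 q (F : T -> 'M[R]_(p1, q)) (G : T -> 'M[R]_(p2, q)) :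
  bmeasmx D F -> bmeasmx D G -> bmeasmx D (fun t => col_mx (F t) (G t)).
Proof.
move=> bF bG i j; case: (split_ordP i) => k ->.
  have -> : (fun t => col_mx (F t) (G t) (lshift p2 k) j) = (fun t => F t k j).
    by apply/funext => t; rewrite col_mxEu.
  exact: bF.
have -> : (fun t => col_mx (F t) (G t) (rshift p1 k) j) = (fun t => G t k j).
  by apply/funext => t; rewrite col_mxEd.
exact: bG.
Qed.

Lemma bmeasmx_row p q1 q2 (F : T -> 'M[R]_(p, q1)) (G : T -> 'M[R]_(p, q2)) :
  bmeasmx D F -> bmeasmx D G -> bmeasmx D (fun t => row_mx (F t) (G t)).
Proof.
move=> bF bG i j; case: (split_ordP j) => k ->.
  have -> : (fun t => row_mx (F t) (G t) i (lshift q2 k)) = (fun t => F t i k).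
    by apply/funext => t; rewrite row_mxEl.
  exact: bF.
have -> : (fun t => row_mx (F t) (G t) i (rshift q1 k)) = (fun t => G t i k).
  by apply/funext => t; rewrite row_mxEr.
exact: bG.
Qed.

Lemma bmeasmxZ p q (f : T -> R) (F : T -> 'M[R]_(p, q)) :
  bmeas D f -> bmeasmx D F -> bmeasmx D (fun t => f t *: F t).
Proof.
move=> bf bF i j; have -> : (fun t => (f t *: F t) i j) = (fun t => f t * F t i j).
  by apply/funext => t; rewrite mxE.
exact: bmeasM.
Qed.

Lemma bmeasmx_scalar n (f : T -> R) : bmeas D f ->
  bmeasmx D (fun t => (f t)%:M : 'M[R]_n).
Proof.
move=> bf; have -> : (fun t => (f t)%:M : 'M[R]_n) = (fun t => f t *: 1%:M).
  by apply/funext => t; rewrite scalemx1.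
by apply: bmeasmxZ => //; exact: bmeasmx_cst.
Qed.

Lemma bmeas_shift (w : R) (f : T -> R) : bmeas D f -> bmeas D (fun t => w - f t).
Proof.
move=> bf; have -> : (fun t => w - f t) = (fun t => w + (- 1) * f t).
  by apply/funext => t; rewrite mulN1r.
apply: bmeasD; first exact: bmeas_cst.
by apply: bmeasM => //; exact: bmeas_cst.
Qed.

Lemma bmeas_exp (f : T -> R) k : bmeas D f -> bmeas D (fun t => f t ^+ k).
Proof.
move=> bf; elim: k => [|k ih]; first exact: bmeas_cst.
have -> : (fun t => f t ^+ k.+1) = (fun t => f t * f t ^+ k).
  by apply/funext => t; rewrite exprS.
exact: bmeasM.
Qed.

Lemma bmeas_poly (P : {poly R}) (f : T -> R) : bmeas D f -> bmeas D (fun t => P.[f t]).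
Proof.
move=> bf; have -> : (fun t => P.[f t]) = (fun t => \sum_(i < size P) P`_i * f t ^+ i).
  by apply/funext => t; rewrite horner_coef.
by apply: bmeas_sum => i; apply: bmeasM; [exact: bmeas_cst|exact: bmeas_exp].
Qed.

Lemma bmeas_poly2 (P : {poly {poly R}}) (f g : T -> R) : bmeas D f -> bmeas D g ->
  bmeas D (fun t => P.[f t, g t]).
Proof.
move=> bf bg.
have -> : (fun t => P.[f t, g t]) =
    (fun t => \sum_(i < size P) (P`_i).[g t] * f t ^+ i).
  apply/funext => t; rewrite (horner_coef P) horner_sum; apply: eq_bigr => i _.
  by rewrite hornerM horner_exp hornerC.
by apply: bmeas_sum => i; apply: bmeasM; [exact: bmeas_poly|exact: bmeas_exp].
Qed.

Lemma bmeasmx_polymx1 p q (M : R -> 'M[R]_(p, q)) (f : T -> R) : polymx1 M ->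
  bmeas D f -> bmeasmx D (fun t => M (f t)).
Proof.
move=> [P MP] bf i j; have -> : (fun t => M (f t) i j) = (fun t => (P i j).[f t]).
  by apply/funext => t; rewrite MP mxE.
exact: bmeas_poly.
Qed.

Lemma bmeasmx_polymx2 p q (M : R -> R -> 'M[R]_(p, q)) (f g : T -> R) : polymx2 M ->
  bmeas D f -> bmeas D g -> bmeasmx D (fun t => M (f t) (g t)).
Proof.
move=> [P MP] bf bg i j.
have -> : (fun t => M (f t) (g t) i j) = (fun t => (P i j).[f t, g t]).
  by apply/funext => t; rewrite MP mxE.
exact: bmeas_poly2.
Qed.

End bounded_matrices.

Ltac bmeasmx_blocks := repeat first
  [ exact: bmeasmx_cst | assumption | apply: bmeasmx_col | apply: bmeasmx_row
  | apply: bmeasmxZ | apply: bmeasmx_scalar | apply: bmeasM | exact: bmeas_cst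
  | apply: bmeas_shift ].

(** * The kernels H, F and G, and the expansion of T *)

Section parameters.
Variables (R : realType) (a b c d : R) (n0 n1 n2 : nat).
Local Notation mu := (@lebesgue_measure R).
Local Notation MR := (measurableTypeR R).
Local Notation Q := (rect a b c d).
Variable B : PI011 R (bf0 n1 n2) (bf1 n1 n2) (bf1 n1 n2)
                     (bc0 n1 n2) (bc1 n1 n2) (bc1 n1 n2).
Hypothesis hB : polynomial_parameters B.

Let mab := measurable_segment a b.
Let mcd := measurable_segment c d.
Let fab := segment_lty a b.
Let fcd := segment_lty c d.

Lemma bmeas_rect1 p q r s : bmeas (rect p q r s : set (MR * MR)) (fun z : MR * MR => z.1 : R).
Proof. exact: (bmeas_fst _ (measurable_segment p q) (bmeas_id p q)). Qed.

Lemma bmeas_rect2 p q r s : bmeas (rect p q r s : set (MR * MR)) (fun z : MR * MR => z.2 : R).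
Proof. exact: (bmeas_snd _ (measurable_segment r s) (bmeas_id r s)). Qed.

Section trip.
Variables p q r s t v : R.
Local Notation T := (trip p q r s t v : set (MR * (MR * MR))).

Lemma bmeas_trip0 : bmeas T (fun w : MR * (MR * MR) => w.1 : R).
Proof. exact: (bmeas_fst _ (measurable_segment p q) (bmeas_id p q)). Qed.

Lemma bmeas_trip1 : bmeas T (fun w : MR * (MR * MR) => w.2.1 : R).
Proof. exact: (bmeas_snd _ (measurable_rect r s t v) (bmeas_rect1 r s t v)). Qed.

Lemma bmeas_trip2 : bmeas T (fun w : MR * (MR * MR) => w.2.2 : R).
Proof. exact: (bmeas_snd _ (measurable_rect r s t v) (bmeas_rect2 r s t v)). Qed.

End trip.

Lemma square_integrable_polynomial : square_integrable_parameters a b c d B.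
Proof.
case: hB => -[h1 h2 h3 h4] [h5 h6 h7 h8] [h9 h10]; split; split.
- exact: (bmeasmx_L2mx mab fab (bmeasmx_polymx1 h1 (bmeas_id a b))).
- exact: (bmeasmx_L2mx mcd fcd (bmeasmx_polymx1 h2 (bmeas_id c d))).
- exact: (bmeasmx_L2mx mab fab (bmeasmx_polymx1 h3 (bmeas_id a b))).
- exact: (bmeasmx_L2mx mcd fcd (bmeasmx_polymx1 h4 (bmeas_id c d))).
- exact: (bmeasmx_L2mx mab fab (bmeasmx_polymx1 h5 (bmeas_id a b))).
- exact: (bmeasmx_L2mx mcd fcd (bmeasmx_polymx1 h6 (bmeas_id c d))).
- exact: (bmeasmx_L2mx (measurable_rect a b a b) (rect_lty a b a b)
    (bmeasmx_polymx2 h7 (bmeas_rect1 _ _ _ _) (bmeas_rect2 _ _ _ _))).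
- exact: (bmeasmx_L2mx (measurable_rect c d c d) (rect_lty c d c d)
    (bmeasmx_polymx2 h8 (bmeas_rect1 _ _ _ _) (bmeas_rect2 _ _ _ _))).
- exact: (bmeasmx_L2mx (measurable_rect a b c d) (rect_lty a b c d)
    (bmeasmx_polymx2 h9 (bmeas_rect1 _ _ _ _) (bmeas_rect2 _ _ _ _))).
- exact: (bmeasmx_L2mx (measurable_rect a b c d) (rect_lty a b c d)
    (bmeasmx_polymx2 h10 (bmeas_rect1 _ _ _ _) (bmeas_rect2 _ _ _ _))).
Qed.

Lemma bmeasmx_H03 e (T : measurableType e) (D : set T) (f g : T -> R) :
  bmeas D f -> bmeas D g -> bmeasmx D (fun t => H03 b d n0 n1 n2 (f t) (g t)).
Proof.
by move=> bf bg; rewrite /H03 /col5 /col4 /col3 /col2 /row3; bmeasmx_blocks.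
Qed.

Lemma bmeasmx_H13 e (T : measurableType e) (D : set T) (g : T -> R) :
  bmeas D g -> bmeasmx D (fun t => H13 d n0 n1 n2 (g t)).
Proof. by move=> bg; rewrite /H13 /col3 /col2 /row3; bmeasmx_blocks. Qed.

Lemma bmeasmx_H23 e (T : measurableType e) (D : set T) (g : T -> R) :
  bmeas D g -> bmeasmx D (fun t => H23 b n0 n1 n2 (g t)).
Proof. by move=> bg; rewrite /H23 /col3 /col2 /row3; bmeasmx_blocks. Qed.

(** The contribution of the highest derivatives to the boundary values. On a side it is an integral
    along the transversal through the given point, hence the two zero kernels. *)
Definition kerH : bikernel R (bf0 n1 n2) (bf1 n1 n2) (bf1 n1 n2) (nst n0 n1 n2) :=
  BiKernel (fun x y => H03 b d n0 n1 n2 x y) (fun _ y => H13 d n0 n1 n2 y)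
    (fun _ _ _ => 0) (fun x _ => H23 b n0 n1 n2 x) (fun _ _ _ => 0).

Definition kerF := BiKernel (fun x y => F0 b d n0 B x y) (fun x y => F1_0 d n0 B x y)
  (fun x y t => F1_1 b d n0 B x y t) (fun x y => F2_0 b n0 B x y)
  (fun x y v => F2_1 b d n0 B x y v).

Lemma bmeas_kerH : bmeas_kernel a b c d kerH.
Proof.
split.
- by apply: bmeasmx_H03; [exact: bmeas_rect1|exact: bmeas_rect2].
- split; last exact: bmeasmx_cst.
  by apply: bmeasmx_H13; exact: bmeas_rect2.
- split; last exact: bmeasmx_cst.
  by apply: bmeasmx_H23; exact: bmeas_rect2.
Qed.

Lemma picomp_kerH : picomp a b c d B kerH = kerF.
Proof.
have z1 p q r s m (P : R -> 'M[R]_(p, q)) :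
    \mint_(t in `[r, s]) (P t *m (0 : 'M[R]_(q, m))) = 0.
  rewrite -[RHS](mxint0 mu (measurable_segment r s)).
  by apply: eq_mxint => t _; rewrite mulmx0.
rewrite /picomp /kerF; congr BiKernel.
- by apply/funext => x; apply/funext => y; rewrite /= !z1 !addr0.
- apply/funext => x; apply/funext => y; apply/funext => t.
  by rewrite /= !z1 !addr0 mulmx0 addr0.
- apply/funext => x; apply/funext => y; apply/funext => v.
  by rewrite /= !z1 !addr0 mulmx0 addr0.
Qed.

(** Polynomials are bounded on the rectangle; this makes F an admissible inner factor for the merely
    square-integrable [Eh]. *)
Lemma bmeas_kerF : bmeas_kernel a b c d kerF.
Proof.
case: hB => -[h1 h2 h3 h4] [h5 h6 h7 h8] [h9 h10].
split.
- rewrite /=/F0; apply: bmeasmxD; [apply: bmeasmxD|]; apply: bmeasmxM.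
  + exact: bmeasmx_cst.
  + by apply: bmeasmx_H03; [exact: bmeas_rect1|exact: bmeas_rect2].
  + exact: (bmeasmx_polymx1 h1 (bmeas_rect1 _ _ _ _)).
  + exact: (bmeasmx_H13 (bmeas_rect2 _ _ _ _)).
  + exact: (bmeasmx_polymx1 h2 (bmeas_rect2 _ _ _ _)).
  + exact: (bmeasmx_H23 (bmeas_rect1 _ _ _ _)).
- split.
    apply: bmeasmxM; first exact: (bmeasmx_polymx1 h5 (bmeas_rect1 _ _ _ _)).
    exact: (bmeasmx_H13 (bmeas_rect2 _ _ _ _)).
  rewrite /=/F1_1; apply: bmeasmxD; [apply: bmeasmxD|]; apply: bmeasmxM.
  + by apply: (bmeasmx_polymx1 h3); exact: bmeas_trip0.
  + by apply: bmeasmx_H03; [exact: bmeas_trip1|exact: bmeas_trip2].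
  + by apply: (bmeasmx_polymx2 h7); [exact: bmeas_trip0|exact: bmeas_trip1].
  + by apply: bmeasmx_H13; exact: bmeas_trip2.
  + by apply: (bmeasmx_polymx2 h9); [exact: bmeas_trip0|exact: bmeas_trip2].
  + by apply: bmeasmx_H23; exact: bmeas_trip1.
- split.
    apply: bmeasmxM; first exact: (bmeasmx_polymx1 h6 (bmeas_rect1 _ _ _ _)).
    exact: (bmeasmx_H23 (bmeas_rect2 _ _ _ _)).
  rewrite /=/F2_1; apply: bmeasmxD; [apply: bmeasmxD|]; apply: bmeasmxM.
  + by apply: (bmeasmx_polymx1 h4); exact: bmeas_trip0.
  + by apply: bmeasmx_H03; [exact: bmeas_trip2|exact: bmeas_trip1].
  + by apply: (bmeasmx_polymx2 h8); [exact: bmeas_trip0|exact: bmeas_trip1].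
  + by apply: bmeasmx_H23; exact: bmeas_trip2.
  + by apply: (bmeasmx_polymx2 h10); [exact: bmeas_trip2|exact: bmeas_trip0].
  + by apply: bmeasmx_H13; exact: bmeas_trip1.
Qed.

Section inverse.
Variable Eh : PI011 R (bc0 n1 n2) (bc1 n1 n2) (bc1 n1 n2)
                      (bc0 n1 n2) (bc1 n1 n2) (bc1 n1 n2).
Hypothesis hwp : well_posed_with_inverse a b c d B Eh.
Local Notation state := (R * R -> 'cV[R]_(nst n0 n1 n2)).
Implicit Type u : state.

Let Eh2 : square_integrable_parameters a b c d Eh. Proof. by case: hwp. Qed.

Definition kerG := picomp a b c d Eh kerF.

(** The kernels alone do not give this: the local part of G contains the factor [P11_0 Eh], and a
    product of two square-integrable functions of [x] is only integrable. Square integrability comes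
    from [P[Eh]] preserving L2, applied to [P[F] u], and is transferred along the almost everywhere
    equality of [picomp_act]. *)
Lemma in_rl2_kerG u : L2mx (mu2 R) Q u -> in_rl2 a b c d (act a b c d kerG u).
Proof.
move=> u2; have [e0 e1 e2] := picomp_act Eh2 bmeas_kerF u2.
case: hwp => _ [_ Eh_rl2 _ _].
have [/= h1 h2] := Eh_rl2 _ (in_rl2_act bmeas_kerF u2).
(* From the kernels only integrability in [x] is extracted, which provides the measurability that
   the transfer requires. *)
have meas p q r s m0 m1 m2 (k : bikernel R m0 m1 m2 (nst n0 n1 n2)) (u' : state) :
    L2mx (mu2 R) (rect p q r s) u' -> half_L2 p q r s k ->
    L1mx mu `[p, q] (act1 p q r s k u').
  move=> u'2 [l0 l1]; have mpq := measurable_segment p q.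
  have mR := measurable_rect p q r s; have mT := measurable_trip p q p q r s.
  apply: (L1mxD mpq).
    exact: (L1mx_fubini1 mpq (measurable_segment r s) (L2mx_mul mR l0 u'2)).
  have h : L1mx (mu \x sfprod mu mu)%E (trip p q p q r s)
      (fun w => k1_1 k w.1 w.2.2 w.2.1 *m u' w.2).
    exact: (L2mx_mul mT l1 (L2mx_snd3 u'2)).
  exact: (L1mx_fubini1 (m1 := mu) (m2 := sfprod mu mu) mpq mR h).
split=> i j.
  have m1 := meas a b c d _ _ _ kerG u u2 (half_L2_picomp bmeas_kerF Eh2).
  apply: (ae_eq_L2 mab (L1_measurable (m1 i j)) _ (h1 i j)).
  by apply: aeS e1 => x h xab; exact: (congr1 (fun M : 'cV[R]_(bc1 n1 n2) => M i j) (h xab)).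
have m2 := meas c d a b _ _ _ (ktr kerG) (sw u) (L2mx_sw u2)
  (half_L2_picomp_tr Eh2 bmeas_kerF).
apply: (ae_eq_L2 mcd (L1_measurable (m2 i j)) _ (h2 i j)).
by apply: aeS e2 => x h xab; exact: (congr1 (fun M : 'cV[R]_(bc1 n1 n2) => M i j) (h xab)).
Qed.

Lemma bmeasmx_K31 x y p q : bmeasmx (`[p, q]%classic : set MR) (fun t => K31 c n0 n1 n2 x y t).
Proof.
have bt := bmeas_id p q.
by rewrite /K31 /col3 /col2 /row3; bmeasmx_blocks.
Qed.

Lemma bmeasmx_K32 x y p q : bmeasmx (`[p, q]%classic : set MR) (fun t => K32 a n0 n1 n2 x y t).
Proof.
have bt := bmeas_id p q.
by rewrite /K32 /col3 /col2 /row3; bmeasmx_blocks.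
Qed.

Lemma bmeasmx_K33 x y p q r s : bmeasmx (rect p q r s : set (MR * MR))
  (fun z => K33 n0 n1 n2 x y z.1 z.2).
Proof.
have b1 := bmeas_rect1 p q r s; have b2 := bmeas_rect2 p q r s.
by rewrite /K33 /col3 /col2 /row3; bmeasmx_blocks.
Qed.

(* The function with core boundary data v and right-hand side u. *)
Definition expansion (v : rl2 R (bc0 n1 n2) (bc1 n1 n2) (bc1 n1 n2)) u : state :=
  fun z => T00 R n0 n1 n2 *m u z + (mxint (mu2 R) (rect a z.1 c z.2)
      (fun w => K33 n0 n1 n2 z.1 z.2 w.1 w.2 *m u w)
    + (K30 a c n0 n1 n2 z.1 z.2 *m v.1.1
    + \mint_(t in `[a, z.1]) (K31 c n0 n1 n2 z.1 z.2 t *m v.1.2 t)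
    + \mint_(t in `[c, z.2]) (K32 a n0 n1 n2 z.1 z.2 t *m v.2 t))).

(** [P[G] u] enters under integrals only, so the equality holds at every point of the rectangle
    although [P[G] u] is determined almost everywhere. *)
Lemma Top_expansion u z : L2mx (mu2 R) Q u -> Q z ->
  Top a b c d B Eh u z = expansion (rl2_opp (act a b c d kerG u)) u z.
Proof.
case: z => x y u2 Qz; have [/= xab ycd] := rect_bounds Qz.
have G0 := L2mx_picomp_k0 Eh2 bmeas_kerF.
have G1 := half_L2_picomp bmeas_kerF Eh2; have G2 := half_L2_picomp_tr Eh2 bmeas_kerF.
have E := kernel_step xab ycd (K30 a c n0 n1 n2 x y) G0 G1 G2
  (bmeasmx_K31 x y a b) (bmeasmx_K32 x y c d) (bmeasmx_K33 x y a b c d) u2.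
have /andP[ax xb] := xab; have /andP[cy yd] := ycd.
have alg (s0 s1 s2 s3 s4 : 'cV[R]_(nst n0 n1 n2)) :
    s0 + s1 + s2 + s3 + s4 = s0 + (s1 + s2 + s3 + s4).
  by apply/matrixP => i j; rewrite !mxE; ring.
apply: (etrans (alg _ _ _ _ _)); rewrite /expansion; congr (_ + _).
apply: (etrans E); congr (_ + _).
have [g1 g2] := in_rl2_kerG u2.
have K31g : L1mx mu `[a, x] (fun t => K31 c n0 n1 n2 x y t *m act1 a b c d kerG u t).
  apply: (L1mx_bmeasl (measurable_segment a x) (bmeasmx_K31 x y a x)).
  apply: (L2mx_L1mx (measurable_segment a x) (segment_lty a x)).
  exact: (L2mx_subset mab (measurable_segment a x) (subset_segment (lexx a) xb) g1).
have K32g : L1mx mu `[c, y] (fun t => K32 a n0 n1 n2 x y t *m act1 c d a b (ktr kerG) (sw u) t).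
  apply: (L1mx_bmeasl (measurable_segment c y) (bmeasmx_K32 x y c y)).
  apply: (L2mx_L1mx (measurable_segment c y) (segment_lty c y)).
  exact: (L2mx_subset mcd (measurable_segment c y) (subset_segment (lexx c) yd) g2).
rewrite /= !opprD mulmxN; congr (_ + _ + _).
  rewrite -(mxintN (measurable_segment a x) K31g).
  by apply: eq_mxint => t _; rewrite mulmxN.
rewrite -(mxintN (measurable_segment c y) K32g).
by apply: eq_mxint => t _; rewrite mulmxN.
Qed.

End inverse.
End parameters.

(** * Values of the grid functions *)

Section grid_values.
Variables (R : realType) (a b c d : R).
Local Notation mu := (@lebesgue_measure R).
Local Notation Q := (rect a b c d).
Variable J : jet2 R.
Hypothesis J2 : L2jet a b c d J.

Lemma Rintegral_segment1 p (f : R -> R) : \int[mu]_(t in `[p, p]) f t = 0.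
Proof. by rewrite set_itv1 Rintegral_set1. Qed.

Lemma Sq_corner w n r g : Sq a c w n r g (a, c) = w.
Proof. by rewrite /Sq /prim /Jx /= !Rintegral_segment1 !addr0. Qed.

Lemma Sq_bottom w n r g x : Sq a c w n r g (x, c) = w + prim a n x.
Proof.
have JE : Jx a (Jy c g) (x, c) = 0.
  have -> : Jy c g = fun z => \int[mu]_(t in `[c, z.2]) g (z.1, t) by [].
  rewrite /Jx /=; under eq_Rintegral do rewrite Rintegral_segment1.
  by rewrite (Rintegral_cst mu (measurable_segment a x)) mul0r.
by rewrite /Sq JE /prim /= Rintegral_segment1 !addr0.
Qed.

Lemma Sq_left w n r g y : Sq a c w n r g (a, y) = w + prim c r y.
Proof. by rewrite /Sq /prim /Jx /= !Rintegral_segment1 !addr0. Qed.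

Section point.
Variables x y : R.
Hypothesis Qz : Q (x, y).
Local Notation Qxy := (rect a x c y).

Let ax : a <= x. Proof. by have [/andP[]] := rect_bounds Qz. Qed.
Let xb : x <= b. Proof. by have [/andP[]] := rect_bounds Qz. Qed.
Let cy : c <= y. Proof. by have [_ /andP[]] := rect_bounds Qz. Qed.
Let yd : y <= d. Proof. by have [_ /andP[]] := rect_bounds Qz. Qed.

Let lowx f : L2 mu `[a, b] f -> L1 mu `[a, x] f.
Proof. by move=> f2; exact: (L1_subsegment (lexx a) xb (L2_L1_segment f2)). Qed.
Let lowy f : L2 mu `[c, d] f -> L1 mu `[c, y] f.
Proof. by move=> f2; exact: (L1_subsegment (lexx c) yd (L2_L1_segment f2)). Qed.

Lemma grid2_11 : grid2 a c J 1 1 (x, y) =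
  j11 J + \int[mu]_(t in `[a, x]) j21 J t + \int[mu]_(t in `[c, y]) j12 J t
  + \int[mu2 R]_(z in Qxy) j22 J z.
Proof. by case: J2 => h20 h21 h02 h12 h22; rewrite /= /Sq (Jx_Jy_double Qz h22). Qed.

Lemma grid2_10 : grid2 a c J 1 0 (x, y) =
  j10 J + \int[mu]_(t in `[a, x]) j20 J t
  + ((y - c) * j11 J + \int[mu]_(t in `[c, y]) (j12 J t * (y - t)))
  + ((y - c) * \int[mu]_(t in `[a, x]) j21 J t
     + \int[mu2 R]_(z in Qxy) (j22 J z * (y - z.2))).
Proof.
case: J2 => h20 h21 h02 h12 h22.
rewrite /= /Sq (Jx_Jy_y_primitive Qz h21 h22); congr (_ + _ + _).
exact: (Rintegral_prim_shift _ cy (lowy h12)).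
Qed.

Lemma grid2_01 : grid2 a c J 0 1 (x, y) =
  j01 J + ((x - a) * j11 J + \int[mu]_(t in `[a, x]) (j21 J t * (x - t)))
  + \int[mu]_(t in `[c, y]) j02 J t
  + ((x - a) * \int[mu]_(t in `[c, y]) j12 J t
     + \int[mu2 R]_(z in Qxy) (j22 J z * (x - z.1))).
Proof.
case: J2 => h20 h21 h02 h12 h22.
rewrite /= /Sq (Jx_Jy_x_primitive Qz h12 h22); congr (_ + _ + _ + _).
exact: (Rintegral_prim_shift _ ax (lowx h21)).
Qed.

Lemma grid2_00 : grid2 a c J 0 0 (x, y) =
  j00 J + ((x - a) * j10 J + \int[mu]_(t in `[a, x]) (j20 J t * (x - t)))
  + ((y - c) * j01 J + \int[mu]_(t in `[c, y]) (j02 J t * (y - t)))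
  + ((y - c) * (x - a) * j11 J
     + (y - c) * \int[mu]_(t in `[a, x]) (j21 J t * (x - t))
     + (x - a) * \int[mu]_(t in `[c, y]) (j12 J t * (y - t))
     + \int[mu2 R]_(z in Qxy) (j22 J z * ((x - z.1) * (y - z.2)))).
Proof.
case: J2 => h20 h21 h02 h12 h22.
rewrite [LHS]/= {1}/Sq (Jx_Jy_Sq Qz _ h21 h12 h22).
congr (_ + _ + _ + _).
  exact: (Rintegral_prim_shift _ ax (lowx h20)).
exact: (Rintegral_prim_shift _ cy (lowy h02)).
Qed.

End point.

End grid_values.

(** * Componentwise action of the matrices K and of [T00] *)

Section K_matrices.
Variables (R : realType) (a b c d : R) (n0 n1 n2 : nat).
Local Notation mu := (@lebesgue_measure R).
Local Notation Q := (rect a b c d).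

Definition i1 (l : 'I_n1) : 'I_(nst n0 n1 n2) := rshift n0 (lshift n2 l).
Definition i2 (l : 'I_n2) : 'I_(nst n0 n1 n2) := rshift n0 (rshift n1 l).

Local Notation "w '.[5,1]' l" := (w (lshift _ l) 0) (at level 9, l at level 8).
Local Notation "w '.[5,2]' l" := (w (rshift _ (lshift _ l)) 0) (at level 9, l at level 8).
Local Notation "w '.[5,3]' l" := (w (rshift _ (rshift _ (lshift _ l))) 0) (at level 9, l at level 8).
Local Notation "w '.[5,4]' l" := (w (rshift _ (rshift _ (rshift _ (lshift _ l)))) 0)
  (at level 9, l at level 8).
Local Notation "w '.[5,5]' l" := (w (rshift _ (rshift _ (rshift _ (rshift _ l)))) 0)
  (at level 9, l at level 8).

Lemma K30_1 x y (w : 'cV[R]_(bc0 n1 n2)) l :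
  (K30 a c n0 n1 n2 x y *m w) (i1 l) 0 = w.[5,1] l.
Proof.
rewrite -[w in LHS]vsubmxK /K30 /col3 /col2 /row5 /row3 /i1.
rewrite !mul_col_mx !col_mxEd col_mxEu mul_row_col mul1mx.
by rewrite !(row_mx0, mul0mx, addr0) mxE.
Qed.

Lemma K30_2 x y (w : 'cV[R]_(bc0 n1 n2)) l :
  (K30 a c n0 n1 n2 x y *m w) (i2 l) 0 =
  w.[5,2] l + (x - a) * w.[5,3] l + (y - c) * w.[5,4] l
  + ((y - c) * (x - a)) * w.[5,5] l.
Proof.
rewrite -[w in LHS]vsubmxK -[dsubmx w in LHS]vsubmxK.
rewrite -[dsubmx (dsubmx w) in LHS]vsubmxK -[dsubmx (dsubmx (dsubmx w)) in LHS]vsubmxK.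
rewrite /K30 /col3 /col2 /row5 /row3 /i2.
rewrite !mul_col_mx !col_mxEd !mul_row_col !mul_scalar_mx mul0mx add0r.
by rewrite !mxE mul1r !addrA.
Qed.

Lemma K31_1 x y t (w : 'cV[R]_(bc1 n1 n2)) l :
  (K31 c n0 n1 n2 x y t *m w) (i1 l) 0 = w (lshift _ l) 0.
Proof.
rewrite -[w in LHS]vsubmxK /K31 /col3 /col2 /row3 /i1.
rewrite !mul_col_mx !col_mxEd col_mxEu mul_row_col mul1mx.
by rewrite !(row_mx0, mul0mx, addr0) mxE.
Qed.

Lemma K31_2 x y t (w : 'cV[R]_(bc1 n1 n2)) l :
  (K31 c n0 n1 n2 x y t *m w) (i2 l) 0 =
  (x - t) * w (rshift _ (lshift _ l)) 0 + ((y - c) * (x - t)) * w (rshift _ (rshift _ l)) 0.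
Proof.
rewrite -[w in LHS]vsubmxK -[dsubmx w in LHS]vsubmxK.
rewrite /K31 /col3 /col2 /row3 /i2.
rewrite !mul_col_mx !col_mxEd !mul_row_col !mul_scalar_mx mul0mx add0r.
by rewrite !mxE.
Qed.

Lemma K32_1 x y t (w : 'cV[R]_(bc1 n1 n2)) l :
  (K32 a n0 n1 n2 x y t *m w) (i1 l) 0 = w (lshift _ l) 0.
Proof.
rewrite -[w in LHS]vsubmxK /K32 /col3 /col2 /row3 /i1.
rewrite !mul_col_mx !col_mxEd col_mxEu mul_row_col mul1mx.
by rewrite !(row_mx0, mul0mx, addr0) mxE.
Qed.

Lemma K32_2 x y t (w : 'cV[R]_(bc1 n1 n2)) l :
  (K32 a n0 n1 n2 x y t *m w) (i2 l) 0 =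
  (y - t) * w (rshift _ (lshift _ l)) 0 + ((x - a) * (y - t)) * w (rshift _ (rshift _ l)) 0.
Proof.
rewrite -[w in LHS]vsubmxK -[dsubmx w in LHS]vsubmxK.
rewrite /K32 /col3 /col2 /row3 /i2.
rewrite !mul_col_mx !col_mxEd !mul_row_col !mul_scalar_mx mul0mx add0r.
by rewrite !mxE.
Qed.

Lemma K33_1 x y s t (w : 'cV[R]_(nst n0 n1 n2)) l :
  (K33 n0 n1 n2 x y s t *m w) (i1 l) 0 = w (i1 l) 0.
Proof.
rewrite -[w in LHS]vsubmxK -[dsubmx w in LHS]vsubmxK.
rewrite /K33 /col3 /col2 /row3 /i1.
rewrite !mul_col_mx !col_mxEd col_mxEu !mul_row_col mul1mx !mul0mx add0r addr0.
by rewrite !mxE.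
Qed.

Lemma K33_2 x y s t (w : 'cV[R]_(nst n0 n1 n2)) l :
  (K33 n0 n1 n2 x y s t *m w) (i2 l) 0 = ((x - s) * (y - t)) * w (i2 l) 0.
Proof.
rewrite -[w in LHS]vsubmxK -[dsubmx w in LHS]vsubmxK.
rewrite /K33 /col3 /col2 /row3 /i2.
rewrite !mul_col_mx !col_mxEd !mul_row_col !mul_scalar_mx !mul0mx !add0r.
by rewrite !mxE.
Qed.

Lemma T00_1 (w : 'cV[R]_(nst n0 n1 n2)) l : (T00 R n0 n1 n2 *m w) (i1 l) 0 = 0.
Proof.
rewrite /T00 /col3 /col2 /row3 /i1 !mul_col_mx !col_mxEd col_mxEu.
by rewrite !row_mx0 mul0mx mxE.
Qed.

Lemma T00_2 (w : 'cV[R]_(nst n0 n1 n2)) l : (T00 R n0 n1 n2 *m w) (i2 l) 0 = 0.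
Proof.
rewrite /T00 /col3 /col2 /row3 /i2 !mul_col_mx !col_mxEd.
by rewrite !row_mx0 mul0mx mxE.
Qed.

Lemma T00_0 (w : 'cV[R]_(nst n0 n1 n2)) l :
  (T00 R n0 n1 n2 *m w) (lshift _ l) 0 = w (lshift _ l) 0.
Proof.
rewrite -[w in LHS]vsubmxK /T00 /col3 /col2 /row3 !mul_col_mx col_mxEu.
by rewrite !row_mx0 mul_row_col mul1mx mul0mx addr0 mxE.
Qed.

Lemma K30_0 x y (w : 'cV[R]_(bc0 n1 n2)) l :
  (K30 a c n0 n1 n2 x y *m w) (lshift _ l) 0 = 0.
Proof.
rewrite /K30 /col3 /col2 /row5 /row3 !mul_col_mx col_mxEu.
by rewrite !row_mx0 mul0mx mxE.
Qed.

Lemma K31_0 x y t (w : 'cV[R]_(bc1 n1 n2)) l :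
  (K31 c n0 n1 n2 x y t *m w) (lshift _ l) 0 = 0.
Proof.
rewrite /K31 /col3 /col2 /row3 !mul_col_mx col_mxEu.
by rewrite !row_mx0 mul0mx mxE.
Qed.

Lemma K32_0 x y t (w : 'cV[R]_(bc1 n1 n2)) l :
  (K32 a n0 n1 n2 x y t *m w) (lshift _ l) 0 = 0.
Proof.
rewrite /K32 /col3 /col2 /row3 !mul_col_mx col_mxEu.
by rewrite !row_mx0 mul0mx mxE.
Qed.

Lemma K33_0 x y s t (w : 'cV[R]_(nst n0 n1 n2)) l :
  (K33 n0 n1 n2 x y s t *m w) (lshift _ l) 0 = 0.
Proof.
rewrite /K33 /col3 /col2 /row3 !mul_col_mx col_mxEu.
by rewrite !row_mx0 mul0mx mxE.
Qed.

Lemma addmxE p q (A B : 'M[R]_(p, q)) i j : (A + B) i j = A i j + B i j.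
Proof. by rewrite mxE. Qed.

Lemma mxintE e (T : measurableType e) (m : {measure set T -> \bar R}) (D : set T)
    p q (F : T -> 'M[R]_(p, q)) i j :
  (mxint m D F) i j = \int[m]_(t in D) F t i j.
Proof. by rewrite mxE. Qed.

Section expansion.
Variables (v : rl2 R (bc0 n1 n2) (bc1 n1 n2) (bc1 n1 n2)).
Variable u : R * R -> 'cV[R]_(nst n0 n1 n2).
Hypotheses (v2 : in_rl2 a b c d v) (u2 : L2mx (mu2 R) Q u).

(** The blocks of [v] follow the columns of H: at the corner [u1, u2, d_x u2, d_y u2, d_x d_y u2];
    on [y = c] the functions [d_x u1, d_x^2 u2, d_x^2 d_y u2]; on [x = a] the functions
    [d_y u1, d_y^2 u2, d_x d_y^2 u2]. The state [u] holds the highest mixed derivatives. *)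
Definition core_square (l : 'I_n1) : R * R -> R :=
  Sq a c (v.1.1.[5,1] l) (fun t => v.1.2 t (lshift _ l) 0)
    (fun t => v.2 t (lshift _ l) 0) (fun z => u z (i1 l) 0).

Definition core_jet (l : 'I_n2) : jet2 R :=
  Jet2 (v.1.1.[5,2] l) (v.1.1.[5,3] l) (v.1.1.[5,4] l) (v.1.1.[5,5] l)
    (fun t => v.1.2 t (rshift _ (lshift _ l)) 0)
    (fun t => v.1.2 t (rshift _ (rshift _ l)) 0)
    (fun t => v.2 t (rshift _ (lshift _ l)) 0)
    (fun t => v.2 t (rshift _ (rshift _ l)) 0)
    (fun z => u z (i2 l) 0).

Lemma L2jet_core l : L2jet a b c d (core_jet l).
Proof.
by case: v2 => h1 h2; split; [exact: h1|exact: h1|exact: h2|exact: h2|exact: u2].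
Qed.

Lemma expansion_0 z l : expansion a c v u z (lshift _ l) 0 = u z (lshift _ l) 0.
Proof.
have z1 e (T : measurableType e) (m : {measure set T -> \bar R}) (D : set T)
    (mD : measurable D) : \int[m]_(t in D) (0 : R) = 0.
  by rewrite (Rintegral_cst m mD) mul0r.
rewrite /expansion !(addmxE, mxintE) T00_0 K30_0.
under eq_Rintegral do rewrite K33_0.
under [X in _ + (_ + (_ + X + _))]eq_Rintegral do rewrite K31_0.
under [X in _ + (_ + (_ + _ + X))]eq_Rintegral do rewrite K32_0.
rewrite (z1 _ _ _ _ (measurable_rect _ _ _ _)).
by rewrite !(z1 _ _ _ _ (measurable_segment _ _)) !addr0.
Qed.

Lemma expansion_1 z l : Q z -> expansion a c v u z (i1 l) 0 = core_square l z.
Proof.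
case: z => x y Qz; rewrite /expansion !(addmxE, mxintE) T00_1 K30_1.
under eq_Rintegral do rewrite K33_1.
under [X in _ + (_ + (_ + X + _))]eq_Rintegral do rewrite K31_1.
under [X in _ + (_ + (_ + _ + X))]eq_Rintegral do rewrite K32_1.
by rewrite add0r addrC /core_square /Sq (Jx_Jy_double Qz (u2 _ _)).
Qed.

(** The last block rows of [K30] to [K33] hold the coefficients of [grid2_00], which is Taylor's
    formula of degree 1 in each variable with integral remainders. *)
Lemma expansion_2 z l : Q z ->
  expansion a c v u z (i2 l) 0 = grid2 a c (core_jet l) 0 0 z.
Proof.
case: z => x y Qz; have [/= /andP[ax xb] /andP[cy yd]] := rect_bounds Qz.
rewrite [RHS](grid2_00 (L2jet_core l) Qz) /expansion !(addmxE, mxintE) T00_2 K30_2.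
case: v2 => h1 h2.
have lin p q (f g : R -> R) w : L1 mu `[p, q] f -> L1 mu `[p, q] g ->
    \int[mu]_(t in `[p, q]) ((q - t) * f t + (w * (q - t)) * g t) =
    \int[mu]_(t in `[p, q]) (f t * (q - t)) + w * \int[mu]_(t in `[p, q]) (g t * (q - t)).
  move=> f1 g1; have mpq := measurable_segment p q.
  have bq := bmeas_distance p q q.
  have fi := L1_bmeas mpq f1 bq; have gi := L1_bmeas mpq g1 bq.
  rewrite -(RintegralZl _ mpq gi) -(RintegralD mpq fi (L1Z mpq w gi)).
  by apply: eq_Rintegral => t _; ring.
have -> : \int[mu2 R]_(w in rect a x c y) (K33 n0 n1 n2 x y w.1 w.2 *m u w) (i2 l) 0 =
    \int[mu2 R]_(w in rect a x c y) (u w (i2 l) 0 * ((x - w.1) * (y - w.2))).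
  by apply: eq_Rintegral => w _; rewrite K33_2 mulrC.
have lowx f : L2 mu `[a, b] f -> L1 mu `[a, x] f.
  by move=> f2; exact: (L1_subsegment (lexx a) xb (L2_L1_segment f2)).
have lowy f : L2 mu `[c, d] f -> L1 mu `[c, y] f.
  by move=> f2; exact: (L1_subsegment (lexx c) yd (L2_L1_segment f2)).
under [X in _ + (_ + (_ + X + _))]eq_Rintegral do rewrite K31_2.
under [X in _ + (_ + (_ + _ + X))]eq_Rintegral do rewrite K32_2.
rewrite (lin _ _ _ _ _ (lowx _ (h1 _ _)) (lowx _ (h1 _ _))).
rewrite (lin _ _ _ _ _ (lowy _ (h2 _ _)) (lowy _ (h2 _ _))) /=.
ring.
Qed.

End expansion.
End K_matrices.

(** * Boundary values of an expansion *)

Section derivatives.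
Variables (R : realType) (a b c d : R).
Local Notation mu := (@lebesgue_measure R).
Local Notation Q := (rect a b c d).
Local Notation WD := (is_weak_derivative a b c d).

Lemma wderiv0_of_WD i j f g h : L2 (mu2 R) Q f -> L2 (mu2 R) Q g -> L2 (mu2 R) Q h ->
  f = g %[ae mu2 R in Q] -> WD i j g h ->
  [/\ has_wderiv a b c d i j f, L2 (mu2 R) Q (wderiv0 a b c d i j f) &
      wderiv0 a b c d i j f = h %[ae mu2 R in Q]].
Proof.
move=> f2 g2 h2 fg gh.
have gf : g = f %[ae mu2 R in Q] by apply: aeS fg => z e Qz; rewrite (e Qz).
have fh : WD i j f h by apply: (WD_ae g2 f2 h2 h2 gf _ gh); exact: aeW.
have hf : has_wderiv a b c d i j f by exists h.
split => //; first by case: (wderiv0P hf).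
exact: wderiv0_ae.
Qed.

Section square.
Variables (w : R) (n r : R -> R) (g f : R * R -> R).
Hypotheses (n2 : L2 mu `[a, b] n) (r2 : L2 mu `[c, d] r) (g2 : L2 (mu2 R) Q g).
Hypotheses (f2 : L2 (mu2 R) Q f) (fE : f = Sq a c w n r g %[ae mu2 R in Q]).

Lemma wderiv0_Sq_x : [/\ has_wderiv a b c d 1 0 f, L2 (mu2 R) Q (wderiv0 a b c d 1 0 f) &
  wderiv0 a b c d 1 0 f = (fun z => n z.1 + Jy c g z) %[ae mu2 R in Q]].
Proof.
exact: (wderiv0_of_WD f2 (L2_Sq w n2 r2 g2) (L2_y_primitive n2 g2) fE (WD_Sq_x w n2 r2 g2)).
Qed.

Lemma wderiv0_Sq_y : [/\ has_wderiv a b c d 0 1 f, L2 (mu2 R) Q (wderiv0 a b c d 0 1 f) &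
  wderiv0 a b c d 0 1 f = (fun z => r z.2 + Jx a g z) %[ae mu2 R in Q]].
Proof.
exact: (wderiv0_of_WD f2 (L2_Sq w n2 r2 g2) (L2_x_primitive r2 g2) fE (WD_Sq_y w n2 r2 g2)).
Qed.

Lemma wderiv0_Sq_xy : [/\ has_wderiv a b c d 1 1 f, L2 (mu2 R) Q (wderiv0 a b c d 1 1 f) &
  wderiv0 a b c d 1 1 f = g %[ae mu2 R in Q]].
Proof.
apply: (wderiv0_of_WD f2 (L2_Sq w n2 r2 g2) g2 fE).
apply: (WD_comp_y (WD_Sq_x w n2 r2 g2)).
by apply: (WD_y_primitive n2 g2 (L2_y_primitive n2 g2)); exact: aeW.
Qed.

Lemma wderiv0_Sq i j : (maxn i j <= 1)%N -> has_wderiv a b c d i j f.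
Proof.
have [h10 _ _] := wderiv0_Sq_x; have [h01 _ _] := wderiv0_Sq_y.
have [h11 _ _] := wderiv0_Sq_xy.
rewrite geq_max => /andP[].
case: i => [|[|//]]; case: j => [|[|//]] _ _; [|exact: h01|exact: h10|exact: h11].
by exists f; split; [exact: f2|exact: WD_id].
Qed.

End square.

Lemma wderiv0_grid2 (J : jet2 R) f i j : L2jet a b c d J -> L2 (mu2 R) Q f ->
  f = grid2 a c J 0 0 %[ae mu2 R in Q] -> (i <= 2)%N -> (j <= 2)%N ->
  [/\ has_wderiv a b c d i j f, L2 (mu2 R) Q (wderiv0 a b c d i j f) &
      wderiv0 a b c d i j f = grid2 a c J i j %[ae mu2 R in Q]].
Proof.
move=> J2 f2 fE ij jj.
exact: (wderiv0_of_WD f2 (L2_grid2 J2 0 0) (L2_grid2 J2 i j) fE (WD_grid2 J2 ij jj)).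
Qed.

End derivatives.

(** * Block products with the matrices H *)

Section H_matrices.
Variables (R : realType) (a b c d : R) (n0 n1 n2 : nat).

Lemma row3_mul p q1 q2 q3 (A1 : 'M[R]_(p, q1)) (A2 : 'M[R]_(p, q2))
    (A3 : 'M[R]_(p, q3)) (w1 : 'cV[R]_q1) (w2 : 'cV[R]_q2) (w3 : 'cV[R]_q3) :
  row3 A1 A2 A3 *m col3 w1 w2 w3 = A1 *m w1 + (A2 *m w2 + A3 *m w3).
Proof. by rewrite /row3 /col3 /col2 !mul_row_col. Qed.

Lemma row5_mul p q1 q2 q3 q4 q5 (A1 : 'M[R]_(p, q1)) (A2 : 'M[R]_(p, q2))
    (A3 : 'M[R]_(p, q3)) (A4 : 'M[R]_(p, q4)) (A5 : 'M[R]_(p, q5))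
    (w1 : 'cV[R]_q1) (w2 : 'cV[R]_q2) (w3 : 'cV[R]_q3) (w4 : 'cV[R]_q4) (w5 : 'cV[R]_q5) :
  row5 A1 A2 A3 A4 A5 *m col5 w1 w2 w3 w4 w5 =
  A1 *m w1 + (A2 *m w2 + (A3 *m w3 + (A4 *m w4 + A5 *m w5))).
Proof. by rewrite /row5 /row3 /col5 /col4 /col3 /col2 !mul_row_col. Qed.

Lemma col3_mul p1 p2 p3 q r (A1 : 'M[R]_(p1, q)) (A2 : 'M[R]_(p2, q))
    (A3 : 'M[R]_(p3, q)) (w : 'M[R]_(q, r)) :
  col3 A1 A2 A3 *m w = col3 (A1 *m w) (A2 *m w) (A3 *m w).
Proof. by rewrite /col3 /col2 !mul_col_mx. Qed.

Lemma col5_mul p1 p2 p3 p4 p5 q r (A1 : 'M[R]_(p1, q)) (A2 : 'M[R]_(p2, q))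
    (A3 : 'M[R]_(p3, q)) (A4 : 'M[R]_(p4, q)) (A5 : 'M[R]_(p5, q)) (w : 'M[R]_(q, r)) :
  col5 A1 A2 A3 A4 A5 *m w =
  col5 (A1 *m w) (A2 *m w) (A3 *m w) (A4 *m w) (A5 *m w).
Proof. by rewrite /col5 /col4 /col3 /col2 !mul_col_mx. Qed.

Lemma kron4_mul n (k1 k2 k3 k4 : R) (w : 'cV[R]_n) :
  kron4 n k1 k2 k3 k4 *m w = col4 (k1 *: w) (k2 *: w) (k3 *: w) (k4 *: w).
Proof. by rewrite /kron4 /col4 /col3 /col2 !mul_col_mx !mul_scalar_mx. Qed.

Lemma kron2_mul n (k1 k2 : R) (w : 'cV[R]_n) :
  kron2 n k1 k2 *m w = col2 (k1 *: w) (k2 *: w).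
Proof. by rewrite /kron2 /col2 !mul_col_mx !mul_scalar_mx. Qed.

Lemma scale_col4 n k (w1 w2 w3 w4 : 'cV[R]_n) :
  k *: col4 w1 w2 w3 w4 = col4 (k *: w1) (k *: w2) (k *: w3) (k *: w4).
Proof. by rewrite /col4 /col3 /col2 !scale_col_mx. Qed.

Lemma add_col4 n (w1 w2 w3 w4 v1 v2 v3 v4 : 'cV[R]_n) :
  col4 w1 w2 w3 w4 + col4 v1 v2 v3 v4 = col4 (w1 + v1) (w2 + v2) (w3 + v3) (w4 + v4).
Proof. by rewrite /col4 /col3 /col2 !add_col_mx. Qed.

Lemma scale_col2 n k (w1 w2 : 'cV[R]_n) : k *: col2 w1 w2 = col2 (k *: w1) (k *: w2).
Proof. by rewrite /col2 !scale_col_mx. Qed.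

Lemma add_col2 n (w1 w2 v1 v2 : 'cV[R]_n) :
  col2 w1 w2 + col2 v1 v2 = col2 (w1 + v1) (w2 + v2).
Proof. by rewrite /col2 !add_col_mx. Qed.

Lemma H00_mul (w1 : 'cV[R]_n1) (w2 w3 w4 w5 : 'cV[R]_n2) :
  H00 a b c d n1 n2 *m col5 w1 w2 w3 w4 w5 = col5
    (col4 w1 w1 w1 w1)
    (col4 w2 (w2 + (b - a) *: w3) (w2 + (d - c) *: w4)
      (w2 + (b - a) *: w3 + (d - c) *: w4 + ((d - c) * (b - a)) *: w5))
    (col4 w3 w3 (w3 + (d - c) *: w5) (w3 + (d - c) *: w5))
    (col4 w4 (w4 + (b - a) *: w5) w4 (w4 + (b - a) *: w5))
    (col4 w5 w5 w5 w5).
Proof.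
rewrite /H00 col5_mul; congr col5; rewrite row5_mul !mul0mx ?add0r ?addr0;
  by rewrite !kron4_mul ?add_col4 !scale1r ?scale0r ?add0r ?addr0 ?addrA.
Qed.

Lemma H01_mul x (w1 : 'cV[R]_n1) (w2 w3 : 'cV[R]_n2) :
  H01 b c d n1 n2 x *m col3 w1 w2 w3 = col5
    (col4 0 w1 0 w1)
    (col4 0 ((b - x) *: w2) 0 ((b - x) *: w2 + ((b - x) * (d - c)) *: w3))
    (col4 0 w2 0 (w2 + (d - c) *: w3))
    (col4 0 ((b - x) *: w3) 0 ((b - x) *: w3))
    (col4 0 w3 0 w3).
Proof.
rewrite /H01 col5_mul !row3_mul !mul0mx !(add0r, addr0) -!scalemxAl.
rewrite !kron4_mul !scale_col4 !add_col4.
by rewrite !scale1r !scale0r !scaler0 !(add0r, addr0) !scalerA.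
Qed.

Lemma H02_mul y (w1 : 'cV[R]_n1) (w2 w3 : 'cV[R]_n2) :
  H02 a b d n1 n2 y *m col3 w1 w2 w3 = col5
    (col4 0 0 w1 w1)
    (col4 0 0 ((d - y) *: w2) ((d - y) *: w2 + ((d - y) * (b - a)) *: w3))
    (col4 0 0 ((d - y) *: w3) ((d - y) *: w3))
    (col4 0 0 w2 (w2 + (b - a) *: w3))
    (col4 0 0 w3 w3).
Proof.
rewrite /H02 col5_mul !row3_mul !mul0mx !(add0r, addr0) -!scalemxAl.
rewrite !kron4_mul !scale_col4 !add_col4.
by rewrite !scale1r !scale0r !scaler0 !(add0r, addr0) !scalerA.
Qed.

Lemma H03_mul x y (u0 : 'cV[R]_n0) (u1 : 'cV[R]_n1) (u2 : 'cV[R]_n2) :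
  H03 b d n0 n1 n2 x y *m col3 u0 u1 u2 = col5
    (col4 0 0 0 u1) (col4 0 0 0 (((d - y) * (b - x)) *: u2))
    (col4 0 0 0 ((d - y) *: u2)) (col4 0 0 0 ((b - x) *: u2)) (col4 0 0 0 u2).
Proof.
rewrite /H03 col5_mul !row3_mul !mul0mx !(add0r, addr0) -!scalemxAl.
rewrite !kron4_mul !scale_col4.
by rewrite !scale1r !scale0r !scaler0.
Qed.

Lemma H11_mul (w1 : 'cV[R]_n1) (w2 w3 : 'cV[R]_n2) :
  H11 c d n1 n2 *m col3 w1 w2 w3 =
    col3 (col2 w1 w1) (col2 w2 (w2 + (d - c) *: w3)) (col2 w3 w3).
Proof.
rewrite /H11 col3_mul !row3_mul !mul0mx !(add0r, addr0) -!scalemxAl.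
by rewrite !kron2_mul !scale_col2 !add_col2 !scale1r !scale0r !scaler0 !(add0r, addr0).
Qed.

Lemma H22_mul (w1 : 'cV[R]_n1) (w2 w3 : 'cV[R]_n2) :
  H22 a b n1 n2 *m col3 w1 w2 w3 =
    col3 (col2 w1 w1) (col2 w2 (w2 + (b - a) *: w3)) (col2 w3 w3).
Proof.
rewrite /H22 col3_mul !row3_mul !mul0mx !(add0r, addr0) -!scalemxAl.
by rewrite !kron2_mul !scale_col2 !add_col2 !scale1r !scale0r !scaler0 !(add0r, addr0).
Qed.

Lemma H13_mul y (u0 : 'cV[R]_n0) (u1 : 'cV[R]_n1) (u2 : 'cV[R]_n2) :
  H13 d n0 n1 n2 y *m col3 u0 u1 u2 =
    col3 (col2 0 u1) (col2 0 ((d - y) *: u2)) (col2 0 u2).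
Proof.
rewrite /H13 col3_mul !row3_mul !mul0mx !(add0r, addr0) -!scalemxAl.
by rewrite !kron2_mul !scale_col2 !scale1r !scale0r !scaler0.
Qed.

Lemma H23_mul x (u0 : 'cV[R]_n0) (u1 : 'cV[R]_n1) (u2 : 'cV[R]_n2) :
  H23 b n0 n1 n2 x *m col3 u0 u1 u2 =
    col3 (col2 0 u1) (col2 0 ((b - x) *: u2)) (col2 0 u2).
Proof.
rewrite /H23 col3_mul !row3_mul !mul0mx !(add0r, addr0) -!scalemxAl.
by rewrite !kron2_mul !scale_col2 !scale1r !scale0r !scaler0.
Qed.

End H_matrices.

Lemma col3_sub (R : realType) p1 p2 p3 (w : 'cV[R]_(p1 + (p2 + p3))) :
  w = col3 (usubmx w) (usubmx (dsubmx w)) (dsubmx (dsubmx w)).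
Proof. by rewrite /col3 /col2 !vsubmxK. Qed.

Lemma col5_sub (R : realType) p1 p2 p3 p4 p5 (w : 'cV[R]_(p1 + (p2 + (p3 + (p4 + p5))))) :
  w = col5 (usubmx w) (usubmx (dsubmx w)) (usubmx (dsubmx (dsubmx w)))
    (usubmx (dsubmx (dsubmx (dsubmx w)))) (dsubmx (dsubmx (dsubmx (dsubmx w)))).
Proof. by rewrite /col5 /col4 /col3 /col2 !vsubmxK. Qed.

Section grid_corners.
Variables (R : realType) (a b c d : R).
Local Notation mu := (@lebesgue_measure R).
Hypotheses (ab : a < b) (cd : c < d).
Variable J : jet2 R.
Hypothesis J2 : L2jet a b c d J.

Let h20 : L1 mu `[a, b] (j20 J). Proof. by case: J2 => h _ _ _ _; exact: L2_L1_segment. Qed.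
Let h21 : L1 mu `[a, b] (j21 J). Proof. by case: J2 => _ h _ _ _; exact: L2_L1_segment. Qed.
Let h02 : L1 mu `[c, d] (j02 J). Proof. by case: J2 => _ _ h _ _; exact: L2_L1_segment. Qed.
Let h12 : L1 mu `[c, d] (j12 J). Proof. by case: J2 => _ _ _ h _; exact: L2_L1_segment. Qed.

Lemma grid2_10_left : grid2 a c J 1 0 (a, d) =
  j10 J + ((d - c) * j11 J + \int[mu]_(t in `[c, d]) (j12 J t * (d - t))).
Proof. by rewrite /= Sq_left /prim (Rintegral_prim_shift _ (ltW cd) h12). Qed.

Lemma grid2_01_bottom : grid2 a c J 0 1 (b, c) =
  j01 J + ((b - a) * j11 J + \int[mu]_(t in `[a, b]) (j21 J t * (b - t))).
Proof. by rewrite /= Sq_bottom /prim (Rintegral_prim_shift _ (ltW ab) h21). Qed.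

Lemma grid2_00_bottom : grid2 a c J 0 0 (b, c) =
  j00 J + ((b - a) * j10 J + \int[mu]_(t in `[a, b]) (j20 J t * (b - t))).
Proof. by rewrite /= Sq_bottom /prim (Rintegral_prim_shift _ (ltW ab) h20). Qed.

Lemma grid2_00_left : grid2 a c J 0 0 (a, d) =
  j00 J + ((d - c) * j01 J + \int[mu]_(t in `[c, d]) (j02 J t * (d - t))).
Proof. by rewrite /= Sq_left /prim (Rintegral_prim_shift _ (ltW cd) h02). Qed.

End grid_corners.

Definition rl2_add (R : realType) (m0 m1 m2 : nat) (v w : rl2 R m0 m1 m2) :
    rl2 R m0 m1 m2 :=
  (v.1.1 + w.1.1, fun x => v.1.2 x + w.1.2 x, fun y => v.2 y + w.2 y).

Lemma ae_forall e (T : measurableType e) (R : realType) (m : {measure set T -> \bar R})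
    (I : finType) (P : I -> T -> Prop) :
  (forall i, \forall t \ae m, P i t) -> \forall t \ae m, forall i, P i t.
Proof.
move=> h; have := ae_forall2 (fun (i : I) (_ : unit) => h i).
by apply: aeS => t Pt i; exact: Pt i tt.
Qed.

Lemma L2mx_col_mx e (T : measurableType e) (R : realType) (m : {measure set T -> \bar R})
    (D : set T) p1 p2 (A1 : T -> 'cV[R]_p1) (A2 : T -> 'cV[R]_p2) :
  L2mx m D A1 -> L2mx m D A2 -> L2mx m D (fun t => col_mx (A1 t) (A2 t)).
Proof.
move=> h1 h2 i j; case: (split_ordP i) => l ->.
- by under eq_fun do rewrite col_mxEu; exact: h1.
- by under eq_fun do rewrite col_mxEd; exact: h2.
Qed.

(** * Traces of a function given by its expansion *)

Section boundary.
Variables (R : realType) (a b c d : R) (n0 n1 n2 : nat).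
Local Notation mu := (@lebesgue_measure R).
Local Notation Q := (rect a b c d).
Hypotheses (ab : a < b) (cd : c < d).
Variables (u U : R * R -> 'cV[R]_(nst n0 n1 n2)).
Variable v : rl2 R (bc0 n1 n2) (bc1 n1 n2) (bc1 n1 n2).
Hypotheses (v2 : in_rl2 a b c d v) (U2 : L2mx (mu2 R) Q U).
Hypothesis u1L2 : forall l, L2 (mu2 R) Q (fun z => comp1 u z l 0).
Hypothesis u2L2 : forall l, L2 (mu2 R) Q (fun z => comp2 u z l 0).
Hypothesis u1E : forall l,
  (fun z => comp1 u z l 0) = core_square a c v U l %[ae mu2 R in Q].
Hypothesis u2E : forall l,
  (fun z => comp2 u z l 0) = grid2 a c (core_jet v U l) 0 0 %[ae mu2 R in Q].

Let mab := measurable_segment a b.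
Let mcd := measurable_segment c d.
Let mQ := measurable_rect a b c d.
Let J l := core_jet v U l.
Let J2 l : L2jet a b c d (J l) := L2jet_core v2 U2 l.

Let v12 i : L2 mu `[a, b] (fun t => v.1.2 t i 0). Proof. by case: v2. Qed.
Let v22 i : L2 mu `[c, d] (fun t => v.2 t i 0). Proof. by case: v2. Qed.
Let v11 i := L2_L1_segment (v12 i).
Let v21 i := L2_L1_segment (v22 i).

Let Qac : Q (a, c). Proof. by split; rewrite /= in_itv/= lexx ltW. Qed.
Let Qbc : Q (b, c). Proof. by split; rewrite /= in_itv/= lexx ltW. Qed.
Let Qad : Q (a, d). Proof. by split; rewrite /= in_itv/= lexx ltW. Qed.
Let Qbd : Q (b, d). Proof. by split; rewrite /= in_itv/= lexx ltW. Qed.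

Lemma wderivE i j n (f : R * R -> 'cV[R]_n) l :
  (fun z => wderiv a b c d i j f z l 0) = wderiv0 a b c d i j (fun z => f z l 0).
Proof. by apply/funext => z; rewrite mxE. Qed.

Lemma trace_xyE x0 y0 n (f : R * R -> 'cV[R]_n) l w p r g : Q (x0, y0) ->
  L2 (mu2 R) Q (fun z => f z l 0) -> L2 mu `[a, b] p -> L2 mu `[c, d] r ->
  L2 (mu2 R) Q g -> (fun z => f z l 0) = Sq a c w p r g %[ae mu2 R in Q] ->
  trace_xy a b c d x0 y0 f l 0 = Sq a c w p r g (x0, y0).
Proof.
by move=> Q0 f2 p2 r2 g2 fE; rewrite mxE; exact: (xget_trace_xy ab cd Q0 f2 p2 r2 g2 fE).
Qed.

Lemma trace_square x0 y0 l : Q (x0, y0) ->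
  trace_xy a b c d x0 y0 (comp1 u) l 0 = core_square a c v U l (x0, y0).
Proof.
move=> Q0; exact: (trace_xyE Q0 (u1L2 l) (v12 _) (v22 _) (U2 _ _) (u1E l)).
Qed.

(** The grid functions with [i, j <= 1] are those defined as squares, to which the formula for
    corner traces applies. *)
Lemma trace_grid x0 y0 i j n (f : R * R -> 'cV[R]_n) l l' : Q (x0, y0) ->
  (i <= 1)%N -> (j <= 1)%N -> L2 (mu2 R) Q (fun z => f z l' 0) ->
  (fun z => f z l' 0) = grid2 a c (J l) i j %[ae mu2 R in Q] ->
  trace_xy a b c d x0 y0 f l' 0 = grid2 a c (J l) i j (x0, y0).
Proof.
move=> Q0; have [h20 h21 h02 h12 h22] := J2 l.
have e21 := L2_grid2 (J2 l) 2 1; have e12 := L2_grid2 (J2 l) 1 2.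
have e11 := L2_grid2 (J2 l) 1 1.
have p11 := L2_prim_shift (j11 (J l)) h12; have p01 := L2_prim_shift (j01 (J l)) h02.
have n10 := L2_prim_shift (j10 (J l)) h20; have n11 := L2_prim_shift (j11 (J l)) h21.
case: i => [|[|//]]; case: j => [|[|//]] _ _ f2 fE.
- exact: (trace_xyE Q0 f2 n10 p01 e11 fE).
- exact: (trace_xyE Q0 f2 n11 h02 e12 fE).
- exact: (trace_xyE Q0 f2 h20 p11 e21 fE).
- exact: (trace_xyE Q0 f2 h21 h12 h22 fE).
Qed.

Lemma trace_wderiv x0 y0 i j l : Q (x0, y0) -> (i <= 1)%N -> (j <= 1)%N ->
  trace_xy a b c d x0 y0 (wderiv a b c d i j (comp2 u)) l 0 = grid2 a c (J l) i j (x0, y0).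
Proof.
move=> Q0 i1 j1.
have [_ f2 fE] := wderiv0_grid2 (J2 l) (u2L2 l) (u2E l) (leqW i1) (leqW j1).
rewrite -(wderivE i j (comp2 u) l) in f2 fE.
exact: (trace_grid (i := i) (j := j) Q0 i1 j1 f2 fE).
Qed.

Lemma trace_u2 x0 y0 l : Q (x0, y0) ->
  trace_xy a b c d x0 y0 (comp2 u) l 0 = grid2 a c (J l) 0 0 (x0, y0).
Proof. by move=> Q0; exact: (trace_grid (l := l) (i := 0%N) (j := 0%N) Q0 isT isT (u2L2 l) (u2E l)). Qed.

Lemma Rintegral_distance_comb p q (f g : R -> R) k : L1 mu `[p, q] f -> L1 mu `[p, q] g ->
  \int[mu]_(t in `[p, q]) ((q - t) * f t + ((q - t) * k) * g t) =
  \int[mu]_(t in `[p, q]) (f t * (q - t)) + k * \int[mu]_(t in `[p, q]) (g t * (q - t)).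
Proof.
move=> f1 g1; have mpq := measurable_segment p q; have bq := bmeas_distance p q q.
have fi := L1_bmeas mpq f1 bq; have gi := L1_bmeas mpq g1 bq.
rewrite -(RintegralZl _ mpq gi) -(RintegralD mpq fi (L1Z mpq k gi)).
by apply: eq_Rintegral => t _; ring.
Qed.

Lemma Rintegral_comb p q (f g : R -> R) k : L1 mu `[p, q] f -> L1 mu `[p, q] g ->
  \int[mu]_(t in `[p, q]) (f t + k * g t) =
  \int[mu]_(t in `[p, q]) f t + k * \int[mu]_(t in `[p, q]) g t.
Proof.
move=> f1 g1; have mpq := measurable_segment p q.
by rewrite -(RintegralZl _ mpq g1) -(RintegralD mpq f1 (L1Z mpq k g1)).
Qed.

Section columns.
Variables (p q : R) (F : R -> 'cV[R]_(bc1 n1 n2)).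
Hypothesis F1 : forall i, L1 mu `[p, q] (fun t => F t i 0).

Lemma mint_w1 l : (\mint_(t in `[p, q]) usubmx (F t)) l 0 =
  \int[mu]_(t in `[p, q]) F t (lshift (n2 + n2) l) 0.
Proof. by rewrite mxintE; apply: eq_Rintegral => t _; rewrite mxE. Qed.

Lemma mint_w2 l : (\mint_(t in `[p, q]) usubmx (dsubmx (F t))) l 0 =
  \int[mu]_(t in `[p, q]) F t (rshift n1 (lshift n2 l)) 0.
Proof. by rewrite mxintE; apply: eq_Rintegral => t _; rewrite !mxE. Qed.

Lemma mint_w3 l : (\mint_(t in `[p, q]) dsubmx (dsubmx (F t))) l 0 =
  \int[mu]_(t in `[p, q]) F t (rshift n1 (rshift n2 l)) 0.
Proof. by rewrite mxintE; apply: eq_Rintegral => t _; rewrite !mxE. Qed.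

Lemma mint_w2_shift l : (\mint_(t in `[p, q]) ((q - t) *: usubmx (dsubmx (F t)))) l 0 =
  \int[mu]_(t in `[p, q]) (F t (rshift n1 (lshift n2 l)) 0 * (q - t)).
Proof. by rewrite mxintE; apply: eq_Rintegral => t _; rewrite !mxE mulrC. Qed.

Lemma mint_w3_shift l : (\mint_(t in `[p, q]) ((q - t) *: dsubmx (dsubmx (F t)))) l 0 =
  \int[mu]_(t in `[p, q]) (F t (rshift n1 (rshift n2 l)) 0 * (q - t)).
Proof. by rewrite mxintE; apply: eq_Rintegral => t _; rewrite !mxE mulrC. Qed.

Lemma mint_w23 k l :
  (\mint_(t in `[p, q]) (usubmx (dsubmx (F t)) + k *: dsubmx (dsubmx (F t)))) l 0 =
  \int[mu]_(t in `[p, q]) F t (rshift n1 (lshift n2 l)) 0 + k * \int[mu]_(t in `[p, q]) F t (rshift n1 (rshift n2 l)) 0.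
Proof.
rewrite mxintE -(Rintegral_comb k (F1 _) (F1 _)).
by apply: eq_Rintegral => t _; rewrite !mxE.
Qed.

Lemma mint_w23_shift k l :
  (\mint_(t in `[p, q]) ((q - t) *: usubmx (dsubmx (F t))
     + ((q - t) * k) *: dsubmx (dsubmx (F t)))) l 0 =
  \int[mu]_(t in `[p, q]) (F t (rshift n1 (lshift n2 l)) 0 * (q - t))
  + k * \int[mu]_(t in `[p, q]) (F t (rshift n1 (rshift n2 l)) 0 * (q - t)).
Proof.
rewrite mxintE -(Rintegral_distance_comb k (F1 _) (F1 _)).
by apply: eq_Rintegral => t _; rewrite !mxE.
Qed.

End columns.

Lemma col_mx_congr p1 p2 (A1 B1 : 'cV[R]_p1) (A2 B2 : 'cV[R]_p2) :
  A1 = B1 -> A2 = B2 -> col_mx A1 A2 = col_mx B1 B2.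
Proof. by move=> -> ->. Qed.

Lemma mxint_col e (T : measurableType e) (m : {measure set T -> \bar R}) D p1 p2
    (A1 : T -> 'cV[R]_p1) (A2 : T -> 'cV[R]_p2) :
  mxint m D (fun t => col_mx (A1 t) (A2 t)) = col_mx (mxint m D A1) (mxint m D A2).
Proof.
apply/matrixP => i j; rewrite mxintE.
case: (split_ordP i) => l ->; rewrite ?col_mxEu ?col_mxEd mxintE;
  by apply: eq_Rintegral => t _; rewrite ?col_mxEu ?col_mxEd.
Qed.

Let U1 l : (mxint (mu2 R) Q (fun z => usubmx (dsubmx (U z)))) l 0 =
  \int[mu2 R]_(z in Q) U z (@i1 n0 n1 n2 l) 0.
Proof. by rewrite mxintE; apply: eq_Rintegral => z _; rewrite !mxE. Qed.
Let V00 l : (mxint (mu2 R) Q (fun z => dsubmx (dsubmx (U z)))) l 0 =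
  \int[mu2 R]_(z in Q) U z (@i2 n0 n1 n2 l) 0.
Proof. by rewrite mxintE; apply: eq_Rintegral => z _; rewrite !mxE. Qed.
Let V01 l : (mxint (mu2 R) Q (fun z => (d - z.2) *: dsubmx (dsubmx (U z)))) l 0 =
  \int[mu2 R]_(z in Q) (U z (@i2 n0 n1 n2 l) 0 * (d - z.2)).
Proof. by rewrite mxintE; apply: eq_Rintegral => z _; rewrite !mxE mulrC. Qed.
Let V10 l : (mxint (mu2 R) Q (fun z => (b - z.1) *: dsubmx (dsubmx (U z)))) l 0 =
  \int[mu2 R]_(z in Q) (U z (@i2 n0 n1 n2 l) 0 * (b - z.1)).
Proof. by rewrite mxintE; apply: eq_Rintegral => z _; rewrite !mxE mulrC. Qed.
Let V11 l :
  (mxint (mu2 R) Q (fun z => ((d - z.2) * (b - z.1)) *: dsubmx (dsubmx (U z)))) l 0 =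
  \int[mu2 R]_(z in Q) (U z (@i2 n0 n1 n2 l) 0 * ((b - z.1) * (d - z.2))).
Proof. by rewrite mxintE; apply: eq_Rintegral => z _; rewrite !mxE; ring. Qed.

Lemma Lambda_corners : (Lambda_bf a b c d u).1.1 =
  (H1op a b c d v).1.1 + act0 a b c d (kerH b d n0 n1 n2) U.
Proof.
have E0 := etrans (congr1 (mulmx (H00 a b c d n1 n2)) (col5_sub v.1.1)) (H00_mul a b c d _ _ _ _ _).
have E1 t := etrans (congr1 (mulmx (H01 b c d n1 n2 t)) (col3_sub (v.1.2 t))) (H01_mul b c d t _ _ _).
have E2 t := etrans (congr1 (mulmx (H02 a b d n1 n2 t)) (col3_sub (v.2 t))) (H02_mul a b d t _ _ _).
have E3 (z : R * R) := etrans (congr1 (mulmx (H03 b d n0 n1 n2 z.1 z.2)) (col3_sub (U z)))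
  (H03_mul b d z.1 z.2 _ _ _).
have -> : (H1op a b c d v).1.1 = H00 a b c d n1 n2 *m v.1.1
  + \mint_(t in `[a, b]) (H01 b c d n1 n2 t *m v.1.2 t)
  + \mint_(t in `[c, d]) (H02 a b d n1 n2 t *m v.2 t).
  by case: (v) => -[].
have I1 : \mint_(t in `[a, b]) (H01 b c d n1 n2 t *m v.1.2 t) = _ :=
  congr1 (@mxint _ _ R mu _ _ `[a, b]) (funext E1).
have I2 : \mint_(t in `[c, d]) (H02 a b d n1 n2 t *m v.2 t) = _ :=
  congr1 (@mxint _ _ R mu _ _ `[c, d]) (funext E2).
have I3 : mxint (mu2 R) Q (fun z => H03 b d n0 n1 n2 z.1 z.2 *m U z) = _ :=
  congr1 (@mxint _ _ R (mu2 R) _ _ Q) (funext E3).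
rewrite /act0 [k0 _]/= E0 I1 I2 I3 {I1 I2 I3 E0 E1 E2 E3}.
rewrite /Lambda_bf /Lambda1 /col5 /col4 /col3 /col2 !mxint_col !add_col_mx.
rewrite !(mxint0 _ mab) !(mxint0 _ mcd) !(mxint0 _ mQ).
have S_bd l : core_square a c v U l (b, d) = v.1.1 (lshift _ l) 0
    + \int[mu]_(t in `[a, b]) v.1.2 t (lshift (n2 + n2) l) 0
    + \int[mu]_(t in `[c, d]) v.2 t (lshift (n2 + n2) l) 0
    + \int[mu2 R]_(z in Q) U z (@i1 n0 n1 n2 l) 0.
  by rewrite /core_square /Sq (Jx_Jy_double Qbd (U2 _ _)).
have grid_corner i j l : (i <= 1)%N -> (j <= 1)%N -> grid2 a c (J l) i j (a, c) =
    match i, j with 0%N, 0%N => j00 (J l) | 0%N, _ => j01 (J l)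
    | _, 0%N => j10 (J l) | _, _ => j11 (J l) end.
  by case: i => [|[|//]]; case: j => [|[|//]] _ _; exact: Sq_corner.
(* Twenty scalar identities remain: the five functions in the first block of [Lambda_bf], each at
   the corners [(a, c)], [(b, c)], [(a, d)], [(b, d)] in this order. At [(b, d)] the integral of [U]
   over the whole rectangle appears. *)
do !apply: col_mx_congr; apply/matrixP => l j; rewrite {j}ord1 !addmxE.
- by rewrite (trace_square _ Qac) [LHS]Sq_corner !mxE !addr0.
- by rewrite (trace_square _ Qbc) [LHS]Sq_bottom (mint_w1 _ _ v.1.2) !mxE !addr0.
- by rewrite (trace_square _ Qad) [LHS]Sq_left (mint_w1 _ _ v.2) !mxE !addr0.
- by rewrite (trace_square _ Qbd) S_bd (mint_w1 _ _ v.1.2) (mint_w1 _ _ v.2) U1 !mxE.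
- rewrite (trace_u2 _ Qac) [LHS](grid_corner 0%N 0%N l isT isT) !mxE ?addr0 /J /prim /=; ring.
- rewrite (trace_u2 _ Qbc) [LHS](grid2_00_bottom ab (J2 l)) (mint_w2_shift _ _ v.1.2) !mxE ?addr0 /J /prim /=; ring.
- rewrite (trace_u2 _ Qad) [LHS](grid2_00_left cd (J2 l)) (mint_w2_shift _ _ v.2) !mxE ?addr0 /J /prim /=; ring.
- rewrite (trace_u2 _ Qbd) [LHS](grid2_00 (J2 l) Qbd) (mint_w23_shift v11) (mint_w23_shift v21) V11 !mxE ?addr0 /J /prim /=; ring.
- rewrite (trace_wderiv (i := 1%N) (j := 0%N) l Qac isT isT) [LHS](grid_corner 1%N 0%N l isT isT) !mxE ?addr0 /J /prim /=; ring.
- rewrite (trace_wderiv (i := 1%N) (j := 0%N) l Qbc isT isT) [LHS]Sq_bottom (mint_w2 _ _ v.1.2) !mxE ?addr0 /J /prim /=; ring.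
- rewrite (trace_wderiv (i := 1%N) (j := 0%N) l Qad isT isT) [LHS](grid2_10_left cd (J2 l)) (mint_w3_shift _ _ v.2) !mxE ?addr0 /J /prim /=; ring.
- rewrite (trace_wderiv (i := 1%N) (j := 0%N) l Qbd isT isT) [LHS](grid2_10 (J2 l) Qbd) (mint_w23 v11) (mint_w3_shift _ _ v.2) V01 !mxE ?addr0 /J /prim /=; ring.
- rewrite (trace_wderiv (i := 0%N) (j := 1%N) l Qac isT isT) [LHS](grid_corner 0%N 1%N l isT isT) !mxE ?addr0 /J /prim /=; ring.
- rewrite (trace_wderiv (i := 0%N) (j := 1%N) l Qbc isT isT) [LHS](grid2_01_bottom ab (J2 l)) (mint_w3_shift _ _ v.1.2) !mxE ?addr0 /J /prim /=; ring.
- rewrite (trace_wderiv (i := 0%N) (j := 1%N) l Qad isT isT) [LHS]Sq_left (mint_w2 _ _ v.2) !mxE ?addr0 /J /prim /=; ring.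
- rewrite (trace_wderiv (i := 0%N) (j := 1%N) l Qbd isT isT) [LHS](grid2_01 (J2 l) Qbd) (mint_w3_shift _ _ v.1.2) (mint_w23 v21) V10 !mxE ?addr0 /J /prim /=; ring.
- rewrite (trace_wderiv (i := 1%N) (j := 1%N) l Qac isT isT) [LHS](grid_corner 1%N 1%N l isT isT) !mxE ?addr0 /J /prim /=; ring.
- rewrite (trace_wderiv (i := 1%N) (j := 1%N) l Qbc isT isT) [LHS]Sq_bottom (mint_w3 _ _ v.1.2) !mxE ?addr0 /J /prim /=; ring.
- rewrite (trace_wderiv (i := 1%N) (j := 1%N) l Qad isT isT) [LHS]Sq_left (mint_w3 _ _ v.2) !mxE ?addr0 /J /prim /=; ring.
- rewrite (trace_wderiv (i := 1%N) (j := 1%N) l Qbd isT isT) [LHS](grid2_11 (J2 l) Qbd) (mint_w3 _ _ v.1.2) (mint_w3 _ _ v.2) V00 !mxE ?addr0 /J /prim /=; ring.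
Qed.

Lemma trace_y_value y0 n (f : R * R -> 'cV[R]_n) l h g : c <= y0 <= d ->
  L2 (mu2 R) Q (fun z => f z l 0) -> L2 mu `[a, b] h -> L2 (mu2 R) Q g ->
  (fun z => f z l 0) = (fun z => h z.1 + Jy c g z) %[ae mu2 R in Q] ->
  \forall x \ae mu, `[a, b]%classic x ->
    trace_y a b c d y0 f x l 0 = h x + Jy c g (x, y0).
Proof.
move=> y0cd f2 h2 g2 fE; have [_ e] := xget_trace_y cd y0cd f2 h2 g2 fE.
by apply: aeS e => x ex abx; rewrite mxE (ex abx).
Qed.

Lemma trace_x_value x0 n (f : R * R -> 'cV[R]_n) l h g : a <= x0 <= b ->
  L2 (mu2 R) Q (fun z => f z l 0) -> L2 mu `[c, d] h -> L2 (mu2 R) Q g ->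
  (fun z => f z l 0) = (fun z => h z.2 + Jx a g z) %[ae mu2 R in Q] ->
  \forall y \ae mu, `[c, d]%classic y ->
    trace_x a b c d x0 f y l 0 = h y + Jx a g (x0, y).
Proof.
move=> x0ab f2 h2 g2 fE; have [_ e] := xget_trace_x ab x0ab f2 h2 g2 fE.
by apply: aeS e => y ey cdy; rewrite mxE (ey cdy).
Qed.

Lemma L2_trace_y y0 n (f : R * R -> 'cV[R]_n) l h g : c <= y0 <= d ->
  L2 (mu2 R) Q (fun z => f z l 0) -> L2 mu `[a, b] h -> L2 (mu2 R) Q g ->
  (fun z => f z l 0) = (fun z => h z.1 + Jy c g z) %[ae mu2 R in Q] ->
  L2 mu `[a, b] (fun x => trace_y a b c d y0 f x l 0).
Proof.
move=> y0cd f2 h2 g2 fE; have [] := xget_trace_y cd y0cd f2 h2 g2 fE.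
by under [X in _ -> _ -> L2 _ _ X]eq_fun do rewrite mxE.
Qed.

Lemma L2_trace_x x0 n (f : R * R -> 'cV[R]_n) l h g : a <= x0 <= b ->
  L2 (mu2 R) Q (fun z => f z l 0) -> L2 mu `[c, d] h -> L2 (mu2 R) Q g ->
  (fun z => f z l 0) = (fun z => h z.2 + Jx a g z) %[ae mu2 R in Q] ->
  L2 mu `[c, d] (fun y => trace_x a b c d x0 f y l 0).
Proof.
move=> x0ab f2 h2 g2 fE; have [] := xget_trace_x ab x0ab f2 h2 g2 fE.
by under [X in _ -> _ -> L2 _ _ X]eq_fun do rewrite mxE.
Qed.

Let cin : c <= c <= d. Proof. by rewrite lexx ltW. Qed.
Let din : c <= d <= d. Proof. by rewrite lexx ltW. Qed.
Let ain : a <= a <= b. Proof. by rewrite lexx ltW. Qed.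
Let bin : a <= b <= b. Proof. by rewrite lexx ltW. Qed.

Let Jy_bottom g x : Jy c g (x, c) = 0.
Proof. exact: Rintegral_segment1. Qed.

Let Jx_left g y : Jx a g (a, y) = 0.
Proof. exact: Rintegral_segment1. Qed.

(** Each function concerned has the form [n(x) + Jy c g]. On [y = c] only [n] is left. On [y = d]
    the integral extends across the rectangle, and for [d_x^2 u2] repeated integration turns it into
    the weights [d - c] of [H11] and [d - t] of [H13]. *)
Lemma Lambda_bottom_top : \forall x \ae mu, `[a, b]%classic x ->
  (Lambda_bf a b c d u).1.2 x =
  (H1op a b c d v).1.2 x + act1 a b c d (kerH b d n0 n1 n2) U x.
Proof.
have A (l : 'I_n1) : \forall x \ae mu, `[a, b]%classic x ->
    trace_y a b c d c (wderiv a b c d 1 0 (comp1 u)) x l 0 = v.1.2 x (lshift _ l) 0 /\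
    trace_y a b c d d (wderiv a b c d 1 0 (comp1 u)) x l 0 = v.1.2 x (lshift _ l) 0
      + \int[mu]_(t in `[c, d]) U (x, t) (@i1 n0 n1 n2 l) 0.
  have [_ f2 fE] := wderiv0_Sq_x (v12 _) (v22 _) (U2 _ _) (u1L2 l) (u1E l).
  rewrite -(wderivE 1 0 (comp1 u) l) in f2 fE.
  apply: aeS2 (trace_y_value cin f2 (v12 _) (U2 _ _) fE)
    (trace_y_value din f2 (v12 _) (U2 _ _) fE) => x ec ed abx.
  split; last exact: (ed abx).
  exact: (etrans (ec abx) (etrans (congr1 (+%R _) (Jy_bottom _ _)) (addr0 _))).
have A2 (l : 'I_n2) : \forall x \ae mu, `[a, b]%classic x ->
    [/\ trace_y a b c d c (wderiv a b c d 2 0 (comp2 u)) x l 0 = j20 (J l) x,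
     trace_y a b c d d (wderiv a b c d 2 0 (comp2 u)) x l 0 = j20 (J l) x
      + ((d - c) * j21 (J l) x + \int[mu]_(t in `[c, d]) (j22 (J l) (x, t) * (d - t))),
     trace_y a b c d c (wderiv a b c d 2 1 (comp2 u)) x l 0 = j21 (J l) x &
     trace_y a b c d d (wderiv a b c d 2 1 (comp2 u)) x l 0 = j21 (J l) x
      + \int[mu]_(t in `[c, d]) j22 (J l) (x, t)].
  have [h20 h21 _ _ h22] := J2 l.
  have e21 := L2_grid2 (J2 l) 2 1.
  have [_ f2 fE] := wderiv0_grid2 (i := 2) (j := 0) (J2 l) (u2L2 l) (u2E l) isT isT.
  have [_ g2 gE] := wderiv0_grid2 (i := 2) (j := 1) (J2 l) (u2L2 l) (u2E l) isT isT.
  rewrite -(wderivE 2 0 (comp2 u) l) in f2 fE.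
  rewrite -(wderivE 2 1 (comp2 u) l) in g2 gE.
  have sec := L1_section1 mab mcd (L2_L1_rect h22).
  have T0 := aeS2 (fun x p q => conj p q) (trace_y_value cin f2 h20 e21 fE)
    (trace_y_value din f2 h20 e21 fE).
  have T1 := aeS2 (fun x p q => conj p q) (trace_y_value cin g2 h21 h22 gE)
    (trace_y_value din g2 h21 h22 gE).
  apply: aeS3 T0 T1 sec => x [ec ed] [gc gd] s abx.
  split; [|rewrite (ed abx)| |exact: (gd abx)].
  - exact: (etrans (ec abx) (etrans (congr1 (+%R _) (Jy_bottom _ _)) (addr0 _))).
  - have -> : Jy c (grid2 a c (J l) 2 1) (x, d) = \int[mu]_(t in `[c, d])
        (j21 (J l) x + prim c (fun s => j22 (J l) (x, s)) t) by [].
    by rewrite (Rintegral_prim_shift _ (ltW cd) (s abx)).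
  - exact: (etrans (gc abx) (etrans (congr1 (+%R _) (Jy_bottom _ _)) (addr0 _))).
have {}A := ae_forall A; have {}A2 := ae_forall A2.
apply: aeS2 A A2 => x Ax A2x abx.
have E1 := etrans (congr1 (mulmx (H11 c d n1 n2)) (col3_sub (v.1.2 x))) (H11_mul c d _ _ _).
have E2 t := etrans (congr1 (mulmx (H13 d n0 n1 n2 t)) (col3_sub (U (x, t))))
  (H13_mul d t _ _ _).
have I2 : \mint_(t in `[c, d]) (H13 d n0 n1 n2 t *m U (x, t)) = _ :=
  congr1 (@mxint _ _ R mu _ _ `[c, d]) (funext E2).
have I3 : mxint (mu2 R) Q (fun z => (0 : 'M[R]_(bf1 n1 n2, _)) *m U z) = 0.
  by rewrite -[RHS](mxint0 (mu2 R) mQ); apply: eq_mxint => z _; rewrite mul0mx.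
have -> : (H1op a b c d v).1.2 x = H11 c d n1 n2 *m v.1.2 x by case: (v) => -[].
rewrite /act1 [k1_0 _]/= [k1_1 _]/= E1 I2 I3 {I2 I3 E1 E2}.
rewrite /Lambda_bf /Lambda2 /col3 /col2 !mxint_col addr0 !add_col_mx !(mxint0 _ mcd).
do !apply: col_mx_congr; apply/matrixP => l j; rewrite {j}ord1.
- by rewrite addmxE (Ax l abx).1 !mxE addr0.
- rewrite (Ax l abx).2 !mxE; congr (_ + _).
  by apply: eq_Rintegral => t _; rewrite !mxE.
- by have [e _ _ _] := A2x l abx; rewrite [LHS]e addmxE 3!mxE addr0.
- have [_ e _ _] := A2x l abx; rewrite [LHS]e !addmxE 5!mxE mxintE addrA; congr (_ + _).
  by apply: eq_Rintegral => t _; rewrite 3!mxE mulrC.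
- by have [_ _ e _] := A2x l abx; rewrite [LHS]e addmxE 3!mxE addr0.
- have [_ _ _ e] := A2x l abx; rewrite [LHS]e addmxE 2!mxE mxintE; congr (_ + _).
  by apply: eq_Rintegral => t _; rewrite 2!mxE.
Qed.

Lemma Lambda_left_right : \forall y \ae mu, `[c, d]%classic y ->
  (Lambda_bf a b c d u).2 y =
  (H1op a b c d v).2 y + act1 c d a b (ktr (kerH b d n0 n1 n2)) (sw U) y.
Proof.
have A (l : 'I_n1) : \forall y \ae mu, `[c, d]%classic y ->
    trace_x a b c d a (wderiv a b c d 0 1 (comp1 u)) y l 0 = v.2 y (lshift _ l) 0 /\
    trace_x a b c d b (wderiv a b c d 0 1 (comp1 u)) y l 0 = v.2 y (lshift _ l) 0
      + \int[mu]_(t in `[a, b]) U (t, y) (@i1 n0 n1 n2 l) 0.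
  have [_ f2 fE] := wderiv0_Sq_y (v12 _) (v22 _) (U2 _ _) (u1L2 l) (u1E l).
  rewrite -(wderivE 0 1 (comp1 u) l) in f2 fE.
  apply: aeS2 (trace_x_value ain f2 (v22 _) (U2 _ _) fE)
    (trace_x_value bin f2 (v22 _) (U2 _ _) fE) => y ea eb cdy.
  split; last exact: (eb cdy).
  exact: (etrans (ea cdy) (etrans (congr1 (+%R _) (Jx_left _ _)) (addr0 _))).
have A2 (l : 'I_n2) : \forall y \ae mu, `[c, d]%classic y ->
    [/\ trace_x a b c d a (wderiv a b c d 0 2 (comp2 u)) y l 0 = j02 (J l) y,
     trace_x a b c d b (wderiv a b c d 0 2 (comp2 u)) y l 0 = j02 (J l) y
      + ((b - a) * j12 (J l) y + \int[mu]_(t in `[a, b]) (j22 (J l) (t, y) * (b - t))),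
     trace_x a b c d a (wderiv a b c d 1 2 (comp2 u)) y l 0 = j12 (J l) y &
     trace_x a b c d b (wderiv a b c d 1 2 (comp2 u)) y l 0 = j12 (J l) y
      + \int[mu]_(t in `[a, b]) j22 (J l) (t, y)].
  have [_ _ h02 h12 h22] := J2 l.
  have e12 := L2_grid2 (J2 l) 1 2.
  have [_ f2 fE] := wderiv0_grid2 (i := 0) (j := 2) (J2 l) (u2L2 l) (u2E l) isT isT.
  have [_ g2 gE] := wderiv0_grid2 (i := 1) (j := 2) (J2 l) (u2L2 l) (u2E l) isT isT.
  rewrite -(wderivE 0 2 (comp2 u) l) in f2 fE.
  rewrite -(wderivE 1 2 (comp2 u) l) in g2 gE.
  have sec := L1_section2 mab mcd (L2_L1_rect h22).
  have T0 := aeS2 (fun x p q => conj p q) (trace_x_value ain f2 h02 e12 fE)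
    (trace_x_value bin f2 h02 e12 fE).
  have T1 := aeS2 (fun x p q => conj p q) (trace_x_value ain g2 h12 h22 gE)
    (trace_x_value bin g2 h12 h22 gE).
  apply: aeS3 T0 T1 sec => y [ea eb] [ga gb] s cdy.
  split; [|rewrite (eb cdy)| |exact: (gb cdy)].
  - exact: (etrans (ea cdy) (etrans (congr1 (+%R _) (Jx_left _ _)) (addr0 _))).
  - have -> : Jx a (grid2 a c (J l) 1 2) (b, y) = \int[mu]_(t in `[a, b])
        (j12 (J l) y + prim a (fun s => j22 (J l) (s, y)) t) by [].
    by rewrite (Rintegral_prim_shift _ (ltW ab) (s cdy)).
  - exact: (etrans (ga cdy) (etrans (congr1 (+%R _) (Jx_left _ _)) (addr0 _))).
have {}A := ae_forall A; have {}A2 := ae_forall A2.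
apply: aeS2 A A2 => y Ay A2y cdy.
have E1 := etrans (congr1 (mulmx (H22 a b n1 n2)) (col3_sub (v.2 y))) (H22_mul a b _ _ _).
have E2 t := etrans (congr1 (mulmx (H23 b n0 n1 n2 t)) (col3_sub (U (t, y))))
  (H23_mul b t _ _ _).
have I2 : \mint_(t in `[a, b]) (H23 b n0 n1 n2 t *m sw U (y, t)) = _ :=
  congr1 (@mxint _ _ R mu _ _ `[a, b]) (funext E2).
have mQ' := measurable_rect c d a b.
have I3 : mxint (mu2 R) (rect c d a b)
    (fun z => (0 : 'M[R]_(bf1 n1 n2, _)) *m sw U z) = 0.
  by rewrite -[RHS](mxint0 (mu2 R) mQ'); apply: eq_mxint => z _; rewrite mul0mx.
have -> : (H1op a b c d v).2 y = H22 a b n1 n2 *m v.2 y by case: (v) => -[].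
rewrite /act1 [k1_0 _]/= [k1_1 _]/= E1 I2 I3 {I2 I3 E1 E2}.
rewrite /Lambda_bf /Lambda3 /col3 /col2 !mxint_col addr0 !add_col_mx !(mxint0 _ mab).
do !apply: col_mx_congr; apply/matrixP => l j; rewrite {j}ord1.
- by rewrite addmxE (Ay l cdy).1 !mxE addr0.
- rewrite addmxE (Ay l cdy).2 !mxE; congr (_ + _).
  by apply: eq_Rintegral => t _; rewrite !mxE.
- by have [e _ _ _] := A2y l cdy; rewrite [LHS]e addmxE 3!mxE addr0.
- have [_ e _ _] := A2y l cdy; rewrite [LHS]e !addmxE 5!mxE mxintE addrA; congr (_ + _).
  by apply: eq_Rintegral => t _; rewrite 3!mxE mulrC.
- by have [_ _ e _] := A2y l cdy; rewrite [LHS]e addmxE 3!mxE addr0.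
- have [_ _ _ e] := A2y l cdy; rewrite [LHS]e addmxE 2!mxE mxintE; congr (_ + _).
  by apply: eq_Rintegral => t _; rewrite 2!mxE.
Qed.

(** Square integrability is part of the definition of a side trace; it passes to the function chosen
    by [xget] once some trace is known to exist. *)
Lemma in_rl2_Lambda_bf : in_rl2 a b c d (Lambda_bf a b c d u).
Proof.
have Ay (y0 : R) (l : 'I_n1) : c <= y0 <= d ->
    L2 mu `[a, b] (fun x => trace_y a b c d y0 (wderiv a b c d 1 0 (comp1 u)) x l 0).
  have [_ f2 fE] := wderiv0_Sq_x (v12 _) (v22 _) (U2 _ _) (u1L2 l) (u1E l).
  rewrite -(wderivE 1 0 (comp1 u) l) in f2 fE.
  by move=> y0cd; exact: (L2_trace_y y0cd f2 (v12 _) (U2 _ _) fE).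
have Ax (x0 : R) (l : 'I_n1) : a <= x0 <= b ->
    L2 mu `[c, d] (fun y => trace_x a b c d x0 (wderiv a b c d 0 1 (comp1 u)) y l 0).
  have [_ f2 fE] := wderiv0_Sq_y (v12 _) (v22 _) (U2 _ _) (u1L2 l) (u1E l).
  rewrite -(wderivE 0 1 (comp1 u) l) in f2 fE.
  by move=> x0ab; exact: (L2_trace_x x0ab f2 (v22 _) (U2 _ _) fE).
have By (y0 : R) (l : 'I_n2) : c <= y0 <= d ->
    L2 mu `[a, b] (fun x => trace_y a b c d y0 (wderiv a b c d 2 0 (comp2 u)) x l 0) /\
    L2 mu `[a, b] (fun x => trace_y a b c d y0 (wderiv a b c d 2 1 (comp2 u)) x l 0).
  have [h20 h21 _ _ h22] := J2 l; have e21 := L2_grid2 (J2 l) 2 1.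
  have [_ f2 fE] := wderiv0_grid2 (i := 2) (j := 0) (J2 l) (u2L2 l) (u2E l) isT isT.
  have [_ g2 gE] := wderiv0_grid2 (i := 2) (j := 1) (J2 l) (u2L2 l) (u2E l) isT isT.
  rewrite -(wderivE 2 0 (comp2 u) l) in f2 fE.
  rewrite -(wderivE 2 1 (comp2 u) l) in g2 gE.
  move=> y0cd; split; first exact: (L2_trace_y y0cd f2 h20 e21 fE).
  exact: (L2_trace_y y0cd g2 h21 h22 gE).
have Bx (x0 : R) (l : 'I_n2) : a <= x0 <= b ->
    L2 mu `[c, d] (fun y => trace_x a b c d x0 (wderiv a b c d 0 2 (comp2 u)) y l 0) /\
    L2 mu `[c, d] (fun y => trace_x a b c d x0 (wderiv a b c d 1 2 (comp2 u)) y l 0).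
  have [_ _ h02 h12 h22] := J2 l; have e12 := L2_grid2 (J2 l) 1 2.
  have [_ f2 fE] := wderiv0_grid2 (i := 0) (j := 2) (J2 l) (u2L2 l) (u2E l) isT isT.
  have [_ g2 gE] := wderiv0_grid2 (i := 1) (j := 2) (J2 l) (u2L2 l) (u2E l) isT isT.
  rewrite -(wderivE 0 2 (comp2 u) l) in f2 fE.
  rewrite -(wderivE 1 2 (comp2 u) l) in g2 gE.
  move=> x0ab; split; first exact: (L2_trace_x x0ab f2 h02 e12 fE).
  exact: (L2_trace_x x0ab g2 h12 h22 gE).
rewrite /in_rl2 /Lambda_bf /Lambda2 /Lambda3 /col3 /col2.
split; do !apply: L2mx_col_mx; move=> l j; rewrite {j}ord1.
- exact: Ay cin.
- exact: Ay din.
- exact: (By c l cin).1.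
- exact: (By d l din).1.
- exact: (By c l cin).2.
- exact: (By d l din).2.
- exact: Ax ain.
- exact: Ax bin.
- exact: (Bx a l ain).1.
- exact: (Bx b l bin).1.
- exact: (Bx a l ain).2.
- exact: (Bx b l bin).2.
Qed.

Lemma Lambda_bf_decomposition : rl2_eq a b c d (Lambda_bf a b c d u)
  (rl2_add (H1op a b c d v) (act a b c d (kerH b d n0 n1 n2) U)).
Proof.
split; first by rewrite Lambda_corners [RHS]/=.
- by apply: aeS Lambda_bottom_top => x e abx; rewrite (e abx) [RHS]/=.
- by apply: aeS Lambda_left_right => y e cdy; rewrite (e cdy) [RHS]/=.
Qed.

End boundary.

(** * The boundary value problem *)

Section rl2_addition.
Variables (R : realType) (a b c d : R) (m0 m1 m2 : nat).
Local Notation mu := (@lebesgue_measure R).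
Implicit Types v w : rl2 R m0 m1 m2.
Let mab := measurable_segment a b.
Let mcd := measurable_segment c d.

Lemma in_rl2_add v w : in_rl2 a b c d v -> in_rl2 a b c d w -> in_rl2 a b c d (rl2_add v w).
Proof.
move=> [v1 v2] [w1 w2]; split; first exact: (L2mxD mab v1 w1).
exact: (L2mxD mcd v2 w2).
Qed.

Lemma rl2_eq_add v w v' w' : rl2_eq a b c d v v' -> rl2_eq a b c d w w' ->
  rl2_eq a b c d (rl2_add v w) (rl2_add v' w').
Proof.
case=> e0 e1 e2 [f0 f1 f2]; split; first by rewrite /= e0 f0.
- by apply: aeS2 e1 f1 => x ex fx abx; rewrite /= (ex abx) (fx abx).
- by apply: aeS2 e2 f2 => x ex fx abx; rewrite /= (ex abx) (fx abx).
Qed.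

Lemma rl2_add_eq0 v w : rl2_eq a b c d (rl2_add v w) (rl2_zero R m0 m1 m2) ->
  rl2_eq a b c d v (rl2_opp w).
Proof.
case=> e0 e1 e2; split; first by apply/eqP; rewrite /= -addr_eq0; exact/eqP.
- apply: aeS e1 => x ex abx; apply/eqP; rewrite /= -addr_eq0; apply/eqP; exact: ex abx.
- apply: aeS e2 => x ex abx; apply/eqP; rewrite /= -addr_eq0; apply/eqP; exact: ex abx.
Qed.

Lemma in_rl2_opp v : in_rl2 a b c d v -> in_rl2 a b c d (rl2_opp v).
Proof. by move=> [v1 v2]; split; [exact: (L2mxN mab v1)|exact: (L2mxN mcd v2)]. Qed.

Lemma rl2_eq_refl v : rl2_eq a b c d v v.
Proof. by split => //; exact: aeW. Qed.

Variables (p0 p1 p2 : nat) (A : PI011 R m0 m1 m2 p0 p1 p2).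
Hypothesis A2 : square_integrable_parameters a b c d A.

(** Additivity holds almost everywhere only: the integrals defining a row split at those [x] where
    the sections of the kernels are square integrable, and likewise in [y]. *)
Lemma pi011_add v w : in_rl2 a b c d v -> in_rl2 a b c d w ->
  rl2_eq a b c d (pi011 a b c d A (rl2_add v w))
    (rl2_add (pi011 a b c d A v) (pi011 a b c d A w)).
Proof.
case: v w => [[v0 v1] v2] [[w0 w1] w2] [/= hv1 hv2] [/= hw1 hw2].
case: A2 => -[q01 q02 q10 q20] [_ _ q11 q22] [q12 q21].
have int1 m (P : R -> 'M[R]_(m, m1)) : L2mx mu `[a, b] P ->
    \mint_(x in `[a, b]) (P x *m (v1 x + w1 x)) =
    \mint_(x in `[a, b]) (P x *m v1 x) + \mint_(x in `[a, b]) (P x *m w1 x).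
  move=> P2; rewrite -(mxintD mab (L2mx_mul mab P2 hv1) (L2mx_mul mab P2 hw1)).
  by apply: eq_mxint => x _; rewrite mulmxDr.
have int2 m (P : R -> 'M[R]_(m, m2)) : L2mx mu `[c, d] P ->
    \mint_(x in `[c, d]) (P x *m (v2 x + w2 x)) =
    \mint_(x in `[c, d]) (P x *m v2 x) + \mint_(x in `[c, d]) (P x *m w2 x).
  move=> P2; rewrite -(mxintD mcd (L2mx_mul mcd P2 hv2) (L2mx_mul mcd P2 hw2)).
  by apply: eq_mxint => x _; rewrite mulmxDr.
have alg3 m (s1 s2 s3 t1 t2 t3 : 'cV[R]_m) :
    (s1 + t1) + (s2 + t2) + (s3 + t3) = (s1 + s2 + s3) + (t1 + t2 + t3).
  by apply/matrixP => i j; rewrite !mxE; ring.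
have alg4 m (s1 s2 s3 s4 t1 t2 t3 t4 : 'cV[R]_m) :
    (s1 + t1) + (s2 + t2) + (s3 + t3) + (s4 + t4) =
    (s1 + s2 + s3 + s4) + (t1 + t2 + t3 + t4).
  by apply/matrixP => i j; rewrite !mxE; ring.
split => /=.
- by rewrite mulmxDr (int1 _ _ q01) (int2 _ _ q02); exact: alg3.
- have := L2mx_section1 mab mcd q12; have := L2mx_section1 mab mab q11.
  apply: aeS2 => x h2 h3 xab.
  by rewrite !mulmxDr (int1 _ _ (h2 xab)) (int2 _ _ (h3 xab)); exact: alg4.
have q21' := L2mx_swap mab mcd (segment_lty a b) (segment_lty c d) q21.
have := L2mx_section1 mcd mab q21'; have := L2mx_section1 mcd mcd q22.
apply: aeS2 => x h2 h3 xcd.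
by rewrite !mulmxDr (int2 _ _ (h2 xcd)) (int1 _ _ (h3 xcd)); exact: alg4.
Qed.

Lemma pi011_zero : pi011 a b c d A (rl2_zero R m0 m1 m2) = rl2_zero R p0 p1 p2.
Proof.
have z e (T : measurableType e) (m : {measure set T -> \bar R}) (D : set T) p q r
    (F : T -> 'M[R]_(p, q)) : measurable D ->
    mxint m D (fun t => F t *m (0 : 'M[R]_(q, r))) = 0.
  by move=> mD; rewrite -[RHS](mxint0 m mD); apply: eq_mxint => t _; rewrite mulmx0.
rewrite /pi011 /rl2_zero; congr (_, _, _).
- by rewrite mulmx0 (z _ _ _ _ _ _ _ _ mab) (z _ _ _ _ _ _ _ _ mcd) !addr0.
- by apply/funext => x; rewrite !mulmx0 (z _ _ _ _ _ _ _ _ mab) (z _ _ _ _ _ _ _ _ mcd) !addr0.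
- by apply/funext => x; rewrite !mulmx0 (z _ _ _ _ _ _ _ _ mab) (z _ _ _ _ _ _ _ _ mcd) !addr0.
Qed.

Lemma in_rl2_zero : in_rl2 a b c d (rl2_zero R m0 m1 m2).
Proof. by split; [exact: (L2mx0 mu mab)|exact: (L2mx0 mu mcd)]. Qed.

End rl2_addition.

Lemma in_rl2_H1op (R : realType) (a b c d : R) (n1 n2 : nat)
    (v : rl2 R (bc0 n1 n2) (bc1 n1 n2) (bc1 n1 n2)) :
  in_rl2 a b c d v -> in_rl2 a b c d (H1op a b c d v).
Proof.
case: v => -[v0 v1] v2 [/= h1 h2]; split => /=.
- exact: (L2mx_bmeasl (measurable_segment a b) (bmeasmx_cst _ _) h1).
- exact: (L2mx_bmeasl (measurable_segment c d) (bmeasmx_cst _ _) h2).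
Qed.

Section expansion_ae.
Variables (R : realType) (a b c d : R) (n0 n1 n2 : nat).
Local Notation mu := (@lebesgue_measure R).
Local Notation Q := (rect a b c d).

(** The functions in the core data occur only under integrals, so changing them on null sets alters
    the expansion at no point. *)
Lemma expansion_ae (v w : rl2 R (bc0 n1 n2) (bc1 n1 n2) (bc1 n1 n2))
    (u : R * R -> 'cV[R]_(nst n0 n1 n2)) z :
  in_rl2 a b c d v -> in_rl2 a b c d w -> rl2_eq a b c d v w -> Q z ->
  expansion a c v u z = expansion a c w u z.
Proof.
case: z => x y [v1 v2] [w1 w2] [e0 e1 e2] Qz.
have /andP[ax xb] := (rect_bounds Qz).1; have /andP[cy yd] := (rect_bounds Qz).2.
have max := measurable_segment a x; have mcy := measurable_segment c y.
have int p q r (F G : R -> 'cV[R]_r) x' k (K : R -> 'M[R]_(k, r)) :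
    x' <= q -> bmeasmx (`[p, x']%classic : set (measurableTypeR R)) K ->
    L2mx mu `[p, q] F -> L2mx mu `[p, q] G -> F = G %[ae mu in `[p, q]%classic] ->
    \mint_(t in `[p, x']) (K t *m F t) = \mint_(t in `[p, x']) (K t *m G t).
  move=> xq bK F2 G2 FG; have mpx := measurable_segment p x'.
  have mpq := measurable_segment p q.
  have sub := subset_segment (lexx p) xq.
  have F2' := L2mx_bmeasl mpx bK (L2mx_subset mpq mpx sub F2).
  have G2' := L2mx_bmeasl mpx bK (L2mx_subset mpq mpx sub G2).
  apply: (mxint_ae mpx).
  - by move=> i j; case: (F2' i j).
  - by move=> i j; case: (G2' i j).
  - by apply: aeS FG => t e pxt; rewrite (e (sub _ pxt)).
rewrite /expansion e0.
rewrite (int _ _ _ _ _ _ _ _ xb (bmeasmx_K31 c x y a x) v1 w1 e1).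
by rewrite (int _ _ _ _ _ _ _ _ yd (bmeasmx_K32 a x y c y) v2 w2 e2).
Qed.

End expansion_ae.

Section inverse.
Variables (R : realType) (a b c d : R) (n0 n1 n2 : nat).
Hypotheses (ab : a < b) (cd : c < d).
Local Notation mu := (@lebesgue_measure R).
Local Notation Q := (rect a b c d).
Variables (B : PI011 R (bf0 n1 n2) (bf1 n1 n2) (bf1 n1 n2)
                       (bc0 n1 n2) (bc1 n1 n2) (bc1 n1 n2))
          (Eh : PI011 R (bc0 n1 n2) (bc1 n1 n2) (bc1 n1 n2)
                        (bc0 n1 n2) (bc1 n1 n2) (bc1 n1 n2)).
Hypotheses (hB : polynomial_parameters B) (hwp : well_posed_with_inverse a b c d B Eh).
Local Notation state := (R * R -> 'cV[R]_(nst n0 n1 n2)).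
Local Notation core := (rl2 R (bc0 n1 n2) (bc1 n1 n2) (bc1 n1 n2)).

Lemma core_values_unique (L : rl2 R (bf0 n1 n2) (bf1 n1 n2) (bf1 n1 n2)) (v : core)
    (U : state) :
  in_rl2 a b c d L -> in_rl2 a b c d v -> L2mx (mu2 R) Q U ->
  rl2_eq a b c d L (rl2_add (H1op a b c d v) (act a b c d (kerH b d n0 n1 n2) U)) ->
  rl2_eq a b c d (pi011 a b c d B L) (rl2_zero R _ _ _) ->
  rl2_eq a b c d v (rl2_opp (act a b c d (kerG a b c d n0 B Eh) U)).
Proof.
move=> L2 v2 U2 LE BL0; have [Eh2 [BH2 _ EBH _]] := hwp.
have B2 := square_integrable_polynomial a b c d hB.
have Hv2 := in_rl2_H1op v2.
have bH := bmeas_kerH a b c d n0 n1 n2; have bF := bmeas_kerF a b c d n0 hB.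
have HU2 := in_rl2_act bH U2; have FU2 := in_rl2_act bF U2.
have BU := picomp_act B2 bH U2; rewrite picomp_kerH in BU.
have BLE : rl2_eq a b c d (rl2_add (pi011 a b c d B (H1op a b c d v))
    (act a b c d (kerF b d n0 B) U)) (rl2_zero R _ _ _).
  apply: rl2_eq_trans BL0.
  apply: rl2_eq_trans (rl2_eq_sym (pi011_ae B2 L2 (in_rl2_add Hv2 HU2) LE)).
  apply: rl2_eq_sym; apply: (rl2_eq_trans (pi011_add B2 Hv2 HU2)).
  exact: (rl2_eq_add (rl2_eq_refl _ _ _ _ _) BU).
have := pi011_ae Eh2 (in_rl2_add (BH2 _ v2) FU2) (in_rl2_zero _ _ _ _ _ _ _) BLE.
rewrite pi011_zero => E0; apply: rl2_add_eq0; apply: rl2_eq_trans E0.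
apply: rl2_eq_sym; apply: (rl2_eq_trans (pi011_add Eh2 (BH2 _ v2) FU2)).
exact: (rl2_eq_add (EBH _ v2) (picomp_act Eh2 bF U2)).
Qed.

Lemma state_eq (x y : 'cV[R]_(nst n0 n1 n2)) :
  (forall l, x (lshift _ l) 0 = y (lshift _ l) 0) ->
  (forall l, x (@i1 n0 n1 n2 l) 0 = y (@i1 n0 n1 n2 l) 0) ->
  (forall l, x (@i2 n0 n1 n2 l) 0 = y (@i2 n0 n1 n2 l) 0) -> x = y.
Proof.
move=> e0 e1 e2; apply/matrixP => i j; rewrite ord1.
case: (split_ordP i) => k ->; first exact: e0.
by case: (split_ordP k) => l ->; [exact: e1|exact: e2].
Qed.

(** The representations of H_1 and H_2 functions are scalar; the data chosen for each component are
    stacked in the block order of H_1. *)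
Lemma core_values_exist (u : state) : in_L2H1H2 a b c d u ->
  exists v : core, [/\ in_rl2 a b c d v,
    forall l, (fun z => comp1 u z l 0) = core_square a c v (Dop a b c d u) l
      %[ae mu2 R in Q] &
    forall l, (fun z => comp2 u z l 0) = grid2 a c (core_jet v (Dop a b c d u) l) 0 0
      %[ae mu2 R in Q]].
Proof.
move=> [u0 [u1 u1d] [u2 u2d]].
have /choice[s sP] (l : 'I_n1) : exists s : R * (R -> R) * (R -> R),
    [/\ L2 mu `[a, b] s.1.2, L2 mu `[c, d] s.2 & (fun z => comp1 u z l 0) =
      Sq a c s.1.1 s.1.2 s.2 (wderiv0 a b c d 1 1 (fun z => comp1 u z l 0))
      %[ae mu2 R in Q]].
  have [w [n [r h]]] := in_H1_representation ab cd (u1 l 0) (fun i j ij => u1d i j ij l).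
  by exists (w, n, r).
have /choice[J JP] (l : 'I_n2) : exists J, [/\ L2jet a b c d J,
    j22 J = wderiv0 a b c d 2 2 (fun z => comp2 u z l 0) &
    (fun z => comp2 u z l 0) = grid2 a c J 0 0 %[ae mu2 R in Q]].
  have [J J2 [e h]] := in_H2_representation ab cd (u2 l 0) (fun i j ij => u2d i j ij l).
  by exists J.
pose v : core := (col5 (\col_l (s l).1.1) (\col_l j00 (J l)) (\col_l j10 (J l))
    (\col_l j01 (J l)) (\col_l j11 (J l)),
  fun x => col3 (\col_l (s l).1.2 x) (\col_l j20 (J l) x) (\col_l j21 (J l) x),
  fun y => col3 (\col_l (s l).2 y) (\col_l j02 (J l) y) (\col_l j12 (J l) y)).
have col p (F : 'I_p -> R -> R) D : (forall l, L2 mu D (F l)) ->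
    L2mx mu D (fun t => \col_l F l t).
  by move=> h i j; under eq_fun do rewrite mxE; exact: h.
have squareE l : core_square a c v (Dop a b c d u) l =
    Sq a c (s l).1.1 (s l).1.2 (s l).2 (wderiv0 a b c d 1 1 (fun z => comp1 u z l 0)).
  rewrite /core_square; congr (Sq a c _ _ _ _).
  - by rewrite /v /= /col5 col_mxEu mxE.
  - by apply/funext => t; rewrite /v /= /col3 col_mxEu mxE.
  - by apply/funext => t; rewrite /v /= /col3 col_mxEu mxE.
  - by apply/funext => z; rewrite /Dop /col3 /col2 /i1 col_mxEd col_mxEu mxE.
have jetE l : core_jet v (Dop a b c d u) l = J l.
  have [_ e _] := JP l.
  transitivity (Jet2 (j00 (J l)) (j10 (J l)) (j01 (J l)) (j11 (J l)) (j20 (J l)) (j21 (J l))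
    (j02 (J l)) (j12 (J l)) (j22 (J l))); last by case: (J l).
  rewrite /core_jet; congr Jet2.
  - by rewrite /v /= /col5 /col4 /col3 /col2 col_mxEd col_mxEu mxE.
  - by rewrite /v /= /col5 /col4 /col3 /col2 !col_mxEd col_mxEu mxE.
  - by rewrite /v /= /col5 /col4 /col3 /col2 !col_mxEd col_mxEu mxE.
  - by rewrite /v /= /col5 /col4 /col3 /col2 !col_mxEd mxE.
  - by apply/funext => t; rewrite /v /= /col3 /col2 col_mxEd col_mxEu mxE.
  - by apply/funext => t; rewrite /v /= /col3 /col2 !col_mxEd mxE.
  - by apply/funext => t; rewrite /v /= /col3 /col2 col_mxEd col_mxEu mxE.
  - by apply/funext => t; rewrite /v /= /col3 /col2 !col_mxEd mxE.
  - by rewrite e; apply/funext => z; rewrite /Dop /col3 /col2 /i2 !col_mxEd mxE.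
exists v; split.
- split; apply: L2mx_col_mx; [|apply: L2mx_col_mx| |apply: L2mx_col_mx]; apply: col => l.
  + by case: (sP l).
  + by case: (JP l) => -[].
  + by case: (JP l) => -[].
  + by case: (sP l).
  + by case: (JP l) => -[].
  + by case: (JP l) => -[].
- by move=> l; rewrite squareE; case: (sP l).
- by move=> l; rewrite jetE; case: (JP l).
Qed.

Lemma in_L2_Dop (u : state) : in_L2H1H2 a b c d u -> L2mx (mu2 R) Q (Dop a b c d u).
Proof.
move=> [u0 [u1 u1d] [u2 u2d]]; rewrite /Dop /col3 /col2.
apply: L2mx_col_mx; first exact: u0.
apply: L2mx_col_mx => l j; rewrite {j}ord1 wderivE.
- by case: (wderiv0P (u1d 1%N 1%N isT l)).
- by case: (wderiv0P (u2d 2 2 isT l)).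
Qed.

Lemma Top_Dop (u : state) : in_X a b c d B u ->
  u = Top a b c d B Eh (Dop a b c d u) %[ae mu2 R in Q].
Proof.
move=> [uD BL0]; have U2 := in_L2_Dop uD.
have [v [v2 u1E u2E]] := core_values_exist uD.
have [_ [u1 _] [u2 _]] := uD.
have u1L l := u1 l 0; have u2L l := u2 l 0.
have LE := Lambda_bf_decomposition ab cd v2 U2 u1L u2L u1E u2E.
have L2 := in_rl2_Lambda_bf ab cd v2 U2 u1L u2L u1E u2E.
have vE := core_values_unique L2 v2 U2 LE BL0.
have g2 := in_rl2_opp (in_rl2_kerG hB hwp U2).
(* The only null set arises from representing [u] by its expansion; the remaining equalities hold at
   every point. *)
apply: aeS2 (ae_forall u1E) (ae_forall u2E) => z e1 e2 Qz.
rewrite (Top_expansion hB hwp U2 Qz) -(expansion_ae _ v2 g2 vE Qz).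
apply: state_eq => l.
- by rewrite expansion_0 /Dop /col3 col_mxEu /comp0 mxE.
- by rewrite (expansion_1 _ U2 _ Qz) -(e1 l Qz) /comp1 !mxE.
- by rewrite (expansion_2 v2 U2 _ Qz) -(e2 l Qz) /comp2 !mxE.
Qed.

Lemma Dop_Top (uh : state) : in_L2 a b c d uh ->
  in_L2H1H2 a b c d (Top a b c d B Eh uh) /\
  uh = Dop a b c d (Top a b c d B Eh uh) %[ae mu2 R in Q].
Proof.
move=> U2; set u := Top a b c d B Eh uh.
pose v := rl2_opp (act a b c d (kerG a b c d n0 B Eh) uh).
have v2 : in_rl2 a b c d v := in_rl2_opp (in_rl2_kerG hB hwp U2).
have mQ := measurable_rect a b c d.
(* With equality at every point, the square integrability of [u] is that of squares and grid
   functions. *)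
have uE z : Q z -> u z = expansion a c v uh z by exact: (Top_expansion hB hwp U2).
have u0E z l : Q z -> comp0 u z l 0 = uh z (lshift _ l) 0.
  by move=> Qz; rewrite /comp0 mxE (uE z Qz) expansion_0.
have u1E z l : Q z -> comp1 u z l 0 = core_square a c v uh l z.
  by move=> Qz; rewrite /comp1 2!mxE (uE z Qz); exact: expansion_1.
have u2E z l : Q z -> comp2 u z l 0 = grid2 a c (core_jet v uh l) 0 0 z.
  by move=> Qz; rewrite /comp2 2!mxE (uE z Qz); exact: (expansion_2 v2 U2 l Qz).
have J2 l := L2jet_core v2 U2 l.
have vL l : L2 mu `[a, b] (fun t => v.1.2 t (lshift (n2 + n2) l) 0) by case: v2.
have wL l : L2 mu `[c, d] (fun t => v.2 t (lshift (n2 + n2) l) 0) by case: v2.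
have u0L l : L2 (mu2 R) Q (fun z => comp0 u z l 0).
  by apply: (eq_L2 mQ _ (U2 (lshift _ l) 0)) => z Qz; rewrite (u0E z l Qz).
have u1L l : L2 (mu2 R) Q (fun z => comp1 u z l 0).
  have sL : L2 (mu2 R) Q (core_square a c v uh l) := L2_Sq _ (vL l) (wL l) (U2 _ _).
  by apply: (eq_L2 mQ _ sL) => z Qz; exact: (esym (u1E z l Qz)).
have u2L l : L2 (mu2 R) Q (fun z => comp2 u z l 0).
  by apply: (eq_L2 mQ _ (L2_grid2 (J2 l) 0 0)) => z Qz; exact: (esym (u2E z l Qz)).
have u1A l : (fun z => comp1 u z l 0) = core_square a c v uh l %[ae mu2 R in Q].
  by apply: aeW => z Qz; exact: u1E.
have u2A l : (fun z => comp2 u z l 0) = grid2 a c (core_jet v uh l) 0 0 %[ae mu2 R in Q].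
  by apply: aeW => z Qz; exact: u2E.
split.
  split; first by move=> l j; rewrite ord1; exact: u0L.
  - split; first by move=> l j; rewrite ord1; exact: u1L.
    by move=> i j ij l; exact: (wderiv0_Sq (vL l) (wL l) (U2 _ _) (u1L l) (u1A l) ij).
  - split; first by move=> l j; rewrite ord1; exact: u2L.
    move=> i j; rewrite geq_max => /andP[i_le j_le] l.
    by case: (wderiv0_grid2 (J2 l) (u2L l) (u2A l) i_le j_le).
have D1 l : wderiv0 a b c d 1 1 (fun z => comp1 u z l 0) =
    (fun z => uh z (@i1 n0 n1 n2 l) 0) %[ae mu2 R in Q].
  by case: (wderiv0_Sq_xy (vL l) (wL l) (U2 _ _) (u1L l) (u1A l)).
have D2 l : wderiv0 a b c d 2 2 (fun z => comp2 u z l 0) =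
    (fun z => uh z (@i2 n0 n1 n2 l) 0) %[ae mu2 R in Q].
  by case: (wderiv0_grid2 (i := 2) (j := 2) (J2 l) (u2L l) (u2A l) isT isT).
apply: aeS2 (ae_forall D1) (ae_forall D2) => z e1 e2 Qz; apply: state_eq => l.
- by rewrite -(u0E z l Qz) /Dop /col3 col_mxEu.
- by rewrite -(e1 l Qz) /Dop /col3 /col2 /i1 col_mxEd col_mxEu mxE.
- by rewrite -(e2 l Qz) /Dop /col3 /col2 /i2 !col_mxEd mxE.
Qed.

End inverse.

Theorem theorem13 (R : realType) (a b c d : R) (n0 n1 n2 : nat)
  (hab : a < b) (hcd : c < d)
  (B : PI011 R (bf0 n1 n2) (bf1 n1 n2) (bf1 n1 n2)
               (bc0 n1 n2) (bc1 n1 n2) (bc1 n1 n2))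
  (Eh : PI011 R (bc0 n1 n2) (bc1 n1 n2) (bc1 n1 n2)
                (bc0 n1 n2) (bc1 n1 n2) (bc1 n1 n2))
  (hB : polynomial_parameters B)
  (hwp : well_posed_with_inverse a b c d B Eh) :
  (forall u : R * R -> 'cV[R]_(nst n0 n1 n2),
     in_X a b c d B u ->
     u = Top a b c d B Eh (Dop a b c d u) %[ae mu2 R in rect a b c d]) /\
  (forall uh : R * R -> 'cV[R]_(nst n0 n1 n2),
     in_L2 a b c d uh ->
     in_L2H1H2 a b c d (Top a b c d B Eh uh) /\
     uh = Dop a b c d (Top a b c d B Eh uh) %[ae mu2 R in rect a b c d]).
Proof. by split=> [u uX|uh uhL]; [exact: Top_Dop|exact: Dop_Top]. Qed.
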